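(* Let $E=\mathbf R^n\times(\mathbf R^n)^*$, let $m_2,m_3$ be order functions on $E$ and let $m_1$ be an order function on $E\times E^*$. Let $\widehat\Gamma\subset E\times E^*$ be a lattice such that $q^{-1}(\widehat\Gamma)=\Gamma\times\Gamma$, where $\Gamma\subset E$ is a lattice. Let $B_1\subset\ell^\infty(\widehat\Gamma)$ and $B_2,B_3\subset\ell^\infty(\Gamma)$ be admissible Banach spaces, and put $\widetilde m_1=m_1\circ q$, $\widetilde B_1=B_1\circ q=\{u\circ q:u\in B_1\}\subset\ell^\infty(\Gamma\times\Gamma)$. Assume that whenever $k_1\in\widetilde m_1\widetilde B_1$ and $k_2\in m_2B_2$, the sum $$k_3(\alpha)=\sum_{\beta\in\Gamma}k_1(\alpha,\beta)k_2(\beta)$$ converges absolutely for every $\alpha\in\Gamma$, that $k_3\in m_3B_3$, and that $\|k_3/m_3\|_{B_3}\le C\|k_1/\widetilde m_1\|_{\widetilde B_1}\|k_2/m_2\|_{B_2}$ with $C$ independent of $k_1,k_2$. Then, if $a_1\in\widetilde S(m_1,B_1)$ and $u\in\widetilde S(m_2,B_2)$, the distribution $v=a_1^w(u)$ is well-defined in $\widetilde S(m_3,B_3)$, in the sense that $$e^{-\Phi(x)}Tv(x)=\int_{\mathbf C^n}K^{\rm eff}_{a_1^w}(x,y)\,e^{-\Phi(y)}Tu(y)\,L(dy)$$ converges absolutely for every $x\in\mathbf C^n$ and $$\frac1{m_3}\big((e^{-\Phi}Tv)\circ\pi\circ\kappa_T\big)\in[B_3].$$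
   Context: Order functions and lattices: an order function on a finite dimensional real vector space $V$ is $m:V\to]0,\infty[$ with $m(\rho)\le C_0\langle\rho-\mu\rangle^{N_0}m(\mu)$ for some $C_0>0,N_0\ge1$ and all $\rho,\mu\in V$, $\langle\rho\rangle=(1+|\rho|^2)^{1/2}$. A lattice in $V$ is the set of integer combinations of a basis. Admissible Banach space on a lattice $\Gamma$: a Banach space $B$ of functions $u:\Gamma\to\mathbf C$ such that (i) for $u\in B$, $\gamma\in\Gamma$, the translate $\tau_\gamma u(\alpha)=u(\alpha-\gamma)$ is in $B$ and $\|\tau_\gamma u\|_B=\|u\|_B$; (ii) $\delta_\gamma\in B$ for every $\gamma\in\Gamma$, where $\delta_\gamma(\alpha)=\delta_{\gamma,\alpha}$; (iii) there is $C$ such that if $u\in B$ and $|v(\gamma)|\le|u(\gamma)|$ for all $\gamma$, then $v\in B$ and $\|v\|_B\le C\|u\|_B$. Then automatically $\ell^1(\Gamma)\subset B\subset\ell^\infty(\Gamma)$. $k\in mB$ means $k/m\in B$. The space $[B]$: for $\Gamma\subset V$ a lattice and $0\le\chi\in C_0^\infty(V)$ with $\sum_{\gamma\in\Gamma}\tau_\gamma\chi>0$, $[B]$ is the set of locally bounded measurable $u:V\to\mathbf C$ such that $|u(x)|\le\sum_{\gamma\in\Gamma}v(\gamma)\chi(x-\gamma)$ for some $v\in B$. $J:E^*\to E$ maps a linear form $\ell$ to its Hamilton field $(\ell'_\xi,-\ell'_x)$ (coordinates $(x,\xi)$ on $E$); $q:E\times E\to E\times E^*$, $q(x,y)=(\frac{x+y}2,J^{-1}(y-x))$.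 The transported space $B_1\circ q$ carries the norm transported from $B_1$. Weyl quantization: $b^wu(x)=(2\pi)^{-k}\iint e^{i(x-y)\cdot\theta}b(\frac{x+y}2,\theta)u(y)\,dy\,d\theta$ for symbols $b$ on $W\times W^*$, $\dim W=k$. Symbol spaces: for a finite dimensional real vector space $F$, an order function $m$ on $F\times F^*$, a lattice $\Lambda\subset F\times F^*$, an admissible $B\subset\ell^\infty(\Lambda)$ and $\chi\in\mathcal S(F\times F^* )$ with $\sum_{\gamma\in\Lambda}\chi_\gamma=1$, $\chi_\gamma(\rho)=\chi(\rho-\gamma)$, a distribution $a\in\mathcal S'(F)$ is in $\widetilde S(m,B)$ iff $\gamma\mapsto\frac1{m(\gamma)}\|\chi_\gamma^wa\|_{L^2(F)}$ belongs to $B$. Here $\widetilde S(m_1,B_1)\subset\mathcal S'(E)$ (with $F=E$), while $\widetilde S(m_j,B_j)\subset\mathcal S'(\mathbf R^n)$ for $j=2,3$ (with $F=\mathbf R^n$). Bargmann transform: $Tu(x)=c\int_{\mathbf R^n}e^{i\phi(x,y)}u(y)\,dy$, $x\in\mathbf C^n$, with $\phi$ a holomorphic quadratic form on $\mathbf C^n\times\mathbf C^n$, $\det\phi''_{xy}\ne0$, $\mathrm{Im}\,\phi''_{yy}>0$, and $c>0$ such that $T:L^2(\mathbf R^n)\to H_\Phi(\mathbf C^n)=\mathrm{Hol}(\mathbf C^n)\cap L^2(e^{-2\Phi}L(dx))$ is unitary, $\Phi(x)=\sup_{y\in\mathbf R^n}-\mathrm{Im}\,\phi(x,y)$, $L$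 = Lebesgue measure; $T$ extends to $\mathcal S'(\mathbf R^n)$. With $\kappa_T:(y,-\phi'_y(x,y))\mapsto(x,\phi'_x(x,y))$ one has $\kappa_T(E)=\Lambda_\Phi=\{(x,\frac2i\partial_x\Phi(x)):x\in\mathbf C^n\}$; $\pi:\Lambda_\Phi\ni(x,\xi)\mapsto x\in\mathbf C^n$ is the natural projection. A distribution $u\in\mathcal S'(\mathbf R^n)$ is in $\widetilde S(m_j,B_j)$, $j=2,3$, iff $\frac1{m_j}((e^{-\Phi}Tu)\circ\pi\circ\kappa_T)\in[B_j]$. Effective kernel of $a^w$, $a\in\mathcal S'(E)$: if $K_{a^w}\in\mathcal S'(\mathbf R^n\times\mathbf R^n)$ is the distribution kernel of $a^w$, set $K(x,\overline y)=c^2\iint e^{i(\phi(x,t)-\overline{\phi(y,s)})}K_{a^w}(t,s)\,dt\,ds$ and $K^{\rm eff}_{a^w}(x,y)=e^{-\Phi(x)}K(x,\overline y)e^{-\Phi(y)}$, $x,y\in\mathbf C^n$.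
   Formalization: Order functions need not be measurable while [B_3] consists of measurable functions, so the membership in [B_3] is asserted for measurable m_3; for arbitrary m_3 only local boundedness and the majorization defining [B_3] are asserted. *)

(* Defs.v *)
From HB Require Import structures.
From mathcomp Require Import all_boot all_order all_algebra.
From mathcomp Require Import complex.
From mathcomp Require Import all_classical all_reals all_analysis.

Set Implicit Arguments.
Unset Strict Implicit.
Unset Printing Implicit Defensive.

Import Order.TTheory GRing.Theory Num.Theory.
Import numFieldNormedType.Exports.
Import ComplexField.Normc.

Local Open Scope classical_set_scope.
Local Open Scope complex_scope.
Local Open Scope ring_scope.

(* Conventions. R^N is ['rV[R]_N]; a product R^a x R^b is ['rV[R]_(a + b)], its
   elements being [row_mx x y]. The dual of R^N is identified with R^N through
   the coordinates, so that a linear form l acts by x |-> [dotmx l x]. *)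

Section LebesgueMeasure.
Variable R : realType.

Local Notation tupR N := (N.-tuple (measurableTypeR R)).

Definition cons_tup N (p : measurableTypeR R * tupR N) : tupR N.+1 :=
  [tuple of p.1 :: p.2].

Lemma measurable_cons_tup N : measurable_fun setT (@cons_tup N).
Proof. by apply: measurable_cons; [exact: measurable_fst|exact: measurable_snd]. Qed.

Section step.
Variables (N : nat) (mu : {sigma_finite_measure set (tupR N) -> \bar R}).

Definition leb_step : set (tupR N.+1) -> \bar R :=
  pushforward (@lebesgue_measure R \x mu)%E (@cons_tup N).

Let leb_step0 : leb_step set0 = 0%E.
Proof. by rewrite /leb_step /pushforward preimage_set0 measure0. Qed.

Let mpre A : measurable A -> measurable (@cons_tup N @^-1` A).
Proof. by move=> mA; rewrite -[X in measurable X]setTI; exact: measurable_cons_tup. Qed.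

Let leb_step_ge0 A : (0 <= leb_step A)%E.
Proof. by apply: integral_ge0 => // *. Qed.

Let leb_step_sigma_additive : semi_sigma_additive leb_step.
Proof.
move=> F mF tF mUF; rewrite /leb_step /pushforward preimage_bigcup.
apply: measure_semi_sigma_additive.
- by move=> n; exact: mpre.
- apply/trivIsetP => /= i j _ _ ij; rewrite -preimage_setI.
  by move/trivIsetP : tF => /(_ _ _ _ _ ij) ->//; rewrite preimage_set0.
- by rewrite -preimage_bigcup; exact: mpre.
Qed.

HB.instance Definition _ := isMeasure.Build _ _ _ leb_step
  leb_step0 leb_step_ge0 leb_step_sigma_additive.

Let leb_step_sigma_finite : sigma_finite setT leb_step.
Proof.
have /sigma_finiteP[A [TA ndA Aoo]] := sigma_finiteT (@lebesgue_measure R).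
have /sigma_finiteP[B [TB ndB Boo]] := sigma_finiteT mu.
pose g (t : tupR N.+1) : measurableTypeR R * tupR N :=
  (tnth t ord0, [tuple of behead t]).
have mg : measurable_fun setT g.
  apply/measurable_fun_pairP; split; [exact: measurable_tnth|exact: measurable_behead].
exists (fun i => g @^-1` (A i `*` B i)).
  apply/seteqP; split => // t _; have [k _ Ak] : (\bigcup_i A i) (g t).1 by rewrite -TA.
  have [l _ Bl] : (\bigcup_i B i) (g t).2 by rewrite -TB.
  exists (maxn k l) => //; split.
  - by move: Ak; exact/subsetPset/ndA/leq_maxl.
  - by move: Bl; exact/subsetPset/ndB/leq_maxr.
move=> i; have [mA Ai] := Aoo i; have [mB Bi] := Boo i; split.
  by rewrite -[X in measurable X]setTI; apply: mg => //; exact: measurableX.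
rewrite /leb_step /pushforward -comp_preimage.
rewrite (_ : g \o _ = idfun).
  by rewrite preimage_id product_measure1E// lte_mul_pinfty// ge0_fin_numE.
by apply/funext => -[x t] /=; rewrite /g /cons_tup /=; congr (_, _); apply/val_inj.
Qed.

HB.instance Definition _ :=
  Measure_isSigmaFinite.Build _ _ _ leb_step leb_step_sigma_finite.

End step.

Fixpoint lebn (N : nat) : {sigma_finite_measure set (tupR N) -> \bar R} :=
  match N with
  | 0 => @dirac _ (tupR 0) [tuple] R
  | N'.+1 => leb_step (lebn N')
  end.

Definition row_of_tup N (t : tupR N) : 'rV[R]_N := \row_i tnth t i.

End LebesgueMeasure.

Section Analysis.
Variable R : realType.
Local Notation C := R[i].

Definition cexp (z : C) : C :=
  (expR (complex.Re z))%:C * (cos (complex.Im z) +i* sin (complex.Im z)).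

Definition cplx_vec N (x : 'rV[R]_N) : 'rV[C]_N := map_mx (real_complex R) x.

(* [to_Cn] identifies R^n x R^n with C^n, (a, b) |-> a + ib; the measure L(dx) on
   C^n is the image of [lebn R (n + n)]. *)
Definition to_Cn n (z : 'rV[R]_(n + n)) : 'rV[C]_n :=
  \row_i (z 0 (lshift n i) +i* z 0 (rshift n i)).

Definition dotmx (K : pzSemiRingType) N (x y : 'rV[K]_N) : K :=
  \sum_(i < N) x 0 i * y 0 i.

(* <x> = (1 + |x|^2)^(1/2) for the Euclidean norm; the library's norm on ['rV_N]
   is the sup norm. *)
Definition jbr N (x : 'rV[R]_N) : R := Num.sqrt (1 + dotmx x x).

Definition cmeasurable N (f : 'rV[R]_N -> C) : Prop :=
  measurable_fun setT (fun t => complex.Re (f (row_of_tup t)) : R) /\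
  measurable_fun setT (fun t => complex.Im (f (row_of_tup t)) : R).

Definition cintegrable N (f : 'rV[R]_N -> C) : Prop :=
  (lebn R N).-integrable setT (fun t => (complex.Re (f (row_of_tup t)))%:E) /\
  (lebn R N).-integrable setT (fun t => (complex.Im (f (row_of_tup t)))%:E).

Definition cintegral N (f : 'rV[R]_N -> C) : C :=
  (\int[lebn R N]_t complex.Re (f (row_of_tup t))) +i*
  (\int[lebn R N]_t complex.Im (f (row_of_tup t))).

Definition L2sq N (f : 'rV[R]_N -> C) : \bar R :=
  (\int[lebn R N]_t (normc (f (row_of_tup t)) ^+ 2)%:E)%E.

Definition L2norm N (f : 'rV[R]_N -> C) : R := Num.sqrt (fine (L2sq f)).

Definition inL2 N (f : 'rV[R]_N -> C) : Prop :=
  cmeasurable f /\ (L2sq f < +oo)%E.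

Definition csummable (T : choiceType) (D : set T) (f : T -> C) : Prop :=
  summable D (fun x => (normc (f x))%:E).

Definition rsum (T : choiceType) (D : set T) (f : T -> R) : R :=
  fine (\esum_(x in D) ((f^\+)%R x)%:E) - fine (\esum_(x in D) ((f^\-)%R x)%:E).

Definition csum (T : choiceType) (D : set T) (f : T -> C) : C :=
  rsum D (fun x => complex.Re (f x)) +i* rsum D (fun x => complex.Im (f x)).

(* The partial derivatives along the word [s]. *)
Definition pderiv N (s : seq 'I_N) (f : 'rV[R]_N -> R) : 'rV[R]_N -> R :=
  foldr (fun i (g : 'rV[R]_N -> R) => 'D_(delta_mx 0 i) g) f s.

Definition smooth N (f : 'rV[R]_N -> R) : Prop :=
  forall s : seq 'I_N, continuous (pderiv s f) /\
    forall x i, derivable (pderiv s f) x (delta_mx 0 i).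

Definition csmooth N (f : 'rV[R]_N -> C) : Prop :=
  smooth (fun x => complex.Re (f x)) /\ smooth (fun x => complex.Im (f x)).

Definition cpderiv N (s : seq 'I_N) (f : 'rV[R]_N -> C) (x : 'rV[R]_N) : C :=
  pderiv s (fun x => complex.Re (f x)) x +i* pderiv s (fun x => complex.Im (f x)) x.

Definition schwartz N (f : 'rV[R]_N -> C) : Prop :=
  csmooth f /\ forall (k : nat) s, exists M : R,
    forall x, jbr x ^+ k * normc (cpderiv s f x) <= M.

Definition schwartz_norm N (k : nat) (f : 'rV[R]_N -> C) : R :=
  sup [set r | exists (s : seq 'I_N) (x : 'rV[R]_N),
    (size s <= k)%N /\ r = jbr x ^+ k * normc (cpderiv s f x)].

(* A distribution is a functional on all functions, of which only the values on
   Schwartz functions matter. *)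
Definition tempered N (u : ('rV[R]_N -> C) -> C) : Prop :=
  (forall (a : C) f g, schwartz f -> schwartz g ->
     u (fun x => a * f x + g x) = a * u f + u g) /\
  (exists (k : nat) (M : R), forall f, schwartz f ->
     normc (u f) <= M * schwartz_norm k f).

End Analysis.

Section Lattices.
Variable R : realType.
Local Notation C := R[i].

Definition order_function N (m : 'rV[R]_N -> R) : Prop :=
  (forall x, 0 < m x) /\
  exists C0 N0 : R, [/\ 0 < C0, 1 <= N0 &
    forall x y, m x <= C0 * jbr (x - y) `^ N0 * m y].

Definition lattice N (G : set 'rV[R]_N) : Prop :=
  exists2 b : 'M[R]_N, b \in unitmx &
    G = [set map_mx intr z *m b | z in [set: 'rV[int]_N]].

(* A complex Banach space of functions on T: an abstract Banach space with an
   injective linear realization of its elements as functions. *)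
Record banach_fun_space (T : Type) := BanachFunSpace {
  bfs_sort :> completeNormedModType C;
  bfs_fun : bfs_sort -> T -> C;
  bfs_linear : forall (a : C) (u v : bfs_sort) x,
    bfs_fun (a *: u + v) x = a * bfs_fun u x + bfs_fun v x;
  bfs_inj : injective bfs_fun }.

(* Functions on a lattice G are extended by 0 to the ambient space. *)
Definition admissible N (G : set 'rV[R]_N) (B : banach_fun_space 'rV[R]_N) : Prop :=
  [/\ forall (u : B) x, ~ G x -> bfs_fun u x = 0,
      forall (u : B) g, G g -> exists2 v : B,
        bfs_fun v = (fun x => bfs_fun u (x - g)) & `|v| = `|u|,
      forall g, G g -> exists v : B, bfs_fun v = (fun x => (x == g)%:R) &
      exists K : R, forall (u : B) (f : 'rV[R]_N -> C),
        (forall x, normc (f x) <= normc (bfs_fun u x)) ->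
        exists2 v : B, bfs_fun v = f & `|v| <= K%:C * `|u| ].

(* k belongs to m B, with k/m the element u of B. *)
Definition weighted T (m : T -> R) (B : banach_fun_space T) (k : T -> C) (u : B) : Prop :=
  (fun x => k x / (m x)%:C) = bfs_fun u.

(* B o q, for a bijection q: the norm is transported because the underlying
   Banach space is that of B. *)
Program Definition bfs_comp T T' (B : banach_fun_space T) (q : T' -> T) (qi : T -> T')
    (qK : cancel qi q) : banach_fun_space T' :=
  @BanachFunSpace T' (bfs_sort B) (fun u => bfs_fun u \o q) _ _.
Next Obligation. by move=> *; exact: bfs_linear. Qed.
Next Obligation.
move=> T T' B q qi qK u v /= e; apply: bfs_inj; apply/funext => x.
by rewrite -(qK x); exact: (congr1 (fun f => f (qi x)) e).
Qed.

(* 0 <= chi in C_0^oo with positive periodization: a cut-off defining [B] *)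
Definition cutoff N (G : set 'rV[R]_N) (chi : 'rV[R]_N -> R) : Prop :=
  [/\ smooth chi, compact (closure [set x | chi x != 0]), forall x, 0 <= chi x &
      forall x, 0 < rsum G (fun g => chi (x - g))].

Definition rmeasurable N (f : 'rV[R]_N -> R) : Prop :=
  measurable_fun setT (fun t => f (row_of_tup t)).

Definition locally_bounded N (u : 'rV[R]_N -> C) : Prop :=
  forall x : 'rV[R]_N, exists M : R, \forall y \near x, normc (u y) <= M.

(* [bracket G chi B] is the space [B]; [bracket_bound] leaves measurability out.
   The inequality is that of C: the right-hand side is required to be real. *)
Definition bracket_bound N (G : set 'rV[R]_N) (chi : 'rV[R]_N -> R)
    (B : banach_fun_space 'rV[R]_N) : set ('rV[R]_N -> C) :=
  [set u | locally_bounded u /\ exists v : B, forall x,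
      (normc (u x))%:C <= csum G (fun g => bfs_fun v g * (chi (x - g))%:C)].

Definition bracket N (G : set 'rV[R]_N) (chi : 'rV[R]_N -> R)
    (B : banach_fun_space 'rV[R]_N) : set ('rV[R]_N -> C) :=
  [set u | cmeasurable u /\ bracket_bound G chi B u].

End Lattices.

Section Weyl.
Variable R : realType.
Local Notation C := R[i].

(* The kernel at (x, y) of b^w, for a Schwartz symbol b on R^k x R^k. *)
Definition weyl_kernel k (b : 'rV[R]_(k + k) -> C) (x y : 'rV[R]_k) : C :=
  ((2 * pi) ^- k)%:C * cintegral (fun th : 'rV[R]_k =>
    cexp (0 +i* dotmx (x - y) th) * b (row_mx (2^-1 *: (x + y)) th)).

(* b^w a, for a Schwartz symbol b and a tempered distribution a. *)
Definition weyl_apply k (b : 'rV[R]_(k + k) -> C) (a : ('rV[R]_k -> C) -> C)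
    (x : 'rV[R]_k) : C := a (weyl_kernel b x).

(* The distribution kernel K of a^w, for a tempered symbol a: the duality bracket
   of K with f is obtained by substituting x = z + t/2, y = z - t/2 in the double
   integral of (2pi)^-k e^(i(x-y).th) a((x+y)/2, th) f(x, y). *)
Definition weyl_dist_kernel k (a : ('rV[R]_(k + k) -> C) -> C)
    (f : 'rV[R]_(k + k) -> C) : C :=
  a (fun p => ((2 * pi) ^- k)%:C * cintegral (fun t : 'rV[R]_k =>
    cexp (0 +i* dotmx t (rsubmx p)) *
    f (row_mx (lsubmx p + 2^-1 *: t) (lsubmx p - 2^-1 *: t)))).

Definition partition_unity N (L : set 'rV[R]_N) (chi : 'rV[R]_N -> C) : Prop :=
  schwartz chi /\ forall x, csum L (fun g => chi (x - g)) = 1.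

(* The space \tilde S(m, B) of distributions on R^k; [chi] is the partition of
   unity that defines it. *)
Definition Stilde k (L : set 'rV[R]_(k + k)) (chi : 'rV[R]_(k + k) -> C)
    (m : 'rV[R]_(k + k) -> R) (B : banach_fun_space R 'rV[R]_(k + k))
    : set (('rV[R]_k -> C) -> C) :=
  [set a | tempered a /\ exists u : B, bfs_fun u = (fun g =>
    if g \in L then (L2norm (weyl_apply (fun r => chi (r - g)) a) / m g)%:C else 0)].

End Weyl.

Section Symplectic.
Variables (R : realType) (n : nat).
Local Notation E := 'rV[R]_(n + n).
Local Notation EE := 'rV[R]_((n + n) + (n + n)).

(* l = (l'_x, l'_xi) |-> (l'_xi, - l'_x) *)
Definition symJ (l : E) : E := row_mx (rsubmx l) (- lsubmx l).
Definition symJinv (v : E) : E := row_mx (- rsubmx v) (lsubmx v).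

Lemma symJK : cancel symJ symJinv.
Proof. by move=> l; rewrite /symJ /symJinv row_mxKl row_mxKr opprK hsubmxK. Qed.

Lemma symJinvK : cancel symJinv symJ.
Proof. by move=> v; rewrite /symJ /symJinv row_mxKl row_mxKr opprK hsubmxK. Qed.

Definition qmap (p : EE) : EE :=
  row_mx (2^-1 *: (lsubmx p + rsubmx p)) (symJinv (rsubmx p - lsubmx p)).

Definition qmapinv (p : EE) : EE :=
  row_mx (lsubmx p - 2^-1 *: symJ (rsubmx p)) (lsubmx p + 2^-1 *: symJ (rsubmx p)).

Lemma qmapinvK : cancel qmapinv qmap.
Proof.
move=> p; rewrite /qmap /qmapinv row_mxKl row_mxKr.
set x := lsubmx p; set y := symJ _.
have -> : x - 2^-1 *: y + (x + 2^-1 *: y) = 2 *: x.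
  by rewrite addrACA addNr addr0 scaler_nat mulr2n.
have -> : x + 2^-1 *: y - (x - 2^-1 *: y) = y.
  by rewrite opprB addrC addrA subrK -scalerDl -mulr2n -[_ *+ 2]mulr_natl mulfV ?pnatr_eq0 // scale1r.
by rewrite scalerA mulVf ?pnatr_eq0// scale1r symJK hsubmxK.
Qed.

Lemma qmapK : cancel qmap qmapinv.
Proof.
move=> p; rewrite /qmap /qmapinv row_mxKl row_mxKr symJinvK.
set x := lsubmx p; set y := rsubmx p; rewrite -scalerBr -scalerDr.
have -> : x + y - (y - x) = 2 *: x.
  by rewrite opprB addrACA subrr addr0 scaler_nat mulr2n.
have -> : x + y + (y - x) = 2 *: y.
  by rewrite [LHS]addrC addrA subrK scaler_nat mulr2n.
by rewrite !scalerA mulVf ?pnatr_eq0// !scale1r hsubmxK.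
Qed.

Definition setX_row (A B : set E) : set EE :=
  [set p | A (lsubmx p) /\ B (rsubmx p)].

End Symplectic.

Section Bargmann.
Variables (R : realType) (n : nat).
Local Notation C := R[i].

(* The holomorphic quadratic form phi on C^n x C^n is given by its second
   derivatives phi''_xx, phi''_xy, phi''_yy. *)
Record quad_form := QuadForm {
  phi_xx : 'M[C]_n; phi_xy : 'M[C]_n; phi_yy : 'M[C]_n;
  phi_xx_sym : phi_xx^T = phi_xx; phi_yy_sym : phi_yy^T = phi_yy }.

Definition phase (P : quad_form) (x y : 'rV[C]_n) : C :=
  2^-1 * dotmx (x *m phi_xx P) x + dotmx (x *m phi_xy P) y
  + 2^-1 * dotmx (y *m phi_yy P) y.

Definition dphase_x (P : quad_form) (x y : 'rV[C]_n) : 'rV[C]_n :=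
  x *m phi_xx P + y *m (phi_xy P)^T.

Definition dphase_y (P : quad_form) (x y : 'rV[C]_n) : 'rV[C]_n :=
  x *m phi_xy P + y *m phi_yy P.

Definition bargmann_phase (P : quad_form) : Prop :=
  \det (phi_xy P) != 0 /\
  forall y : 'rV[R]_n, y != 0 ->
    0 < dotmx (y *m map_mx (@complex.Im R) (phi_yy P)) y.

Definition Phi (P : quad_form) (x : 'rV[C]_n) : R :=
  sup [set - complex.Im (phase P x (cplx_vec y)) | y in [set: 'rV[R]_n]].

Definition barg_kernel (P : quad_form) (x : 'rV[C]_n) (y : 'rV[R]_n) : C :=
  cexp ('i%C * phase P x (cplx_vec y)).

(* T on tempered distributions, and on L^2 functions. *)
Definition bargmann (P : quad_form) (c : R) (u : ('rV[R]_n -> C) -> C)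
    (x : 'rV[C]_n) : C := c%:C * u (barg_kernel P x).

Definition bargmann_fun (P : quad_form) (c : R) (u : 'rV[R]_n -> C)
    (x : 'rV[C]_n) : C :=
  c%:C * cintegral (fun y => barg_kernel P x y * u y).

Definition HPhi_sq (P : quad_form) (h : 'rV[C]_n -> C) : \bar R :=
  (\int[lebn R (n + n)]_t
     (normc (h (to_Cn (row_of_tup t))) ^+ 2 *
      expR (- 2 * Phi P (to_Cn (row_of_tup t))))%:E)%E.

(* Holomorphy is differentiability over the field C. *)
Definition HPhi (P : quad_form) : set ('rV[C]_n -> C) :=
  [set h | (forall x, differentiable (h : 'rV[C]_n -> C^o) x) /\
           (HPhi_sq P h < +oo)%E].

Definition bargmann_unitary (P : quad_form) (c : R) : Prop :=
  (forall u, inL2 u -> HPhi P (bargmann_fun P c u) /\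
     HPhi_sq P (bargmann_fun P c u) = L2sq u) /\
  (forall h, HPhi P h -> exists2 u, inL2 u & bargmann_fun P c u = h).

(* kappa_T solves eta = - phi'_y(x, y) for x; see [kappaTE]. *)
Definition kappaT (P : quad_form) (p : 'rV[C]_n * 'rV[C]_n) : 'rV[C]_n * 'rV[C]_n :=
  let x := - (p.2 + p.1 *m phi_yy P) *m invmx (phi_xy P) in
  (x, dphase_x P x p.1).

Lemma kappaTE (P : quad_form) (x y : 'rV[C]_n) : bargmann_phase P ->
  kappaT P (y, - dphase_y P x y) = (x, dphase_x P x y).
Proof.
move=> [dP _]; rewrite /kappaT /=; suff -> : - (- dphase_y P x y + y *m phi_yy P) *m
  invmx (phi_xy P) = x by [].
by rewrite /dphase_y opprD opprK addrK mulmxK // unitmxE unitfE.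
Qed.

(* pi o kappa_T on the real points of E. *)
Definition pi_kappaT (P : quad_form) (r : 'rV[R]_(n + n)) : 'rV[C]_n :=
  (kappaT P (cplx_vec (lsubmx r), cplx_vec (rsubmx r))).1.

(* e^(-Phi) T u *)
Definition wbargmann (P : quad_form) (c : R) (u : ('rV[R]_n -> C) -> C)
    (x : 'rV[C]_n) : C := (expR (- Phi P x))%:C * bargmann P c u x.

(* [Kbar P c a x y] is K(x, \bar y) for the operator a^w. *)
Definition Kbar (P : quad_form) (c : R) (a : ('rV[R]_(n + n) -> C) -> C)
    (x y : 'rV[C]_n) : C :=
  (c ^+ 2)%:C * weyl_dist_kernel a (fun p =>
    cexp ('i%C * (phase P x (cplx_vec (lsubmx p)) -
                conjc (phase P y (cplx_vec (rsubmx p)))))).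

Definition Keff (P : quad_form) (c : R) (a : ('rV[R]_(n + n) -> C) -> C)
    (x y : 'rV[C]_n) : C :=
  (expR (- Phi P x))%:C * Kbar P c a x y * (expR (- Phi P y))%:C.

(* v = a^w(u), in the sense of the effective kernel. *)
Definition weyl_image (P : quad_form) (c : R) (a : ('rV[R]_(n + n) -> C) -> C)
    (u v : ('rV[R]_n -> C) -> C) : Prop :=
  forall x : 'rV[C]_n, wbargmann P c v x =
    cintegral (fun z : 'rV[R]_(n + n) =>
      Keff P c a x (to_Cn z) * wbargmann P c u (to_Cn z)).

End Bargmann.

(* Main.v *)
Require Import Defs.
From HB Require Import structures.
From mathcomp Require Import all_boot all_order all_algebra.
From mathcomp Require Import complex ring lra zify.
From mathcomp Require Import all_classical all_reals all_analysis.
From mathcomp Require Import measurable_realfun.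
Require Import Defs.

Set Implicit Arguments.
Unset Strict Implicit.
Unset Printing Implicit Defensive.

Import Order.TTheory GRing.Theory Num.Theory.
Import numFieldNormedType.Exports.
Import ComplexField.Normc.

Local Open Scope classical_set_scope.
Local Open Scope complex_scope.
Local Open Scope ring_scope.

(** On a real phase space point [r], the kernel of the Bargmann transform at the point
    pi (kappa_T r) of C^n is, up to a unimodular factor and the weight exp(Phi), a Gaussian
    wave packet [wp bgauss r] centred at [r] ([barg_kernelE]). So exp(- Phi) T u is, up to
    phases, the function X |-> u (wp X), and the effective kernel of a^w is the matrix
    element [Kt X Y] of a^w between two packets ([KeffE]). Because the Wigner transform of
    a pair of packets is itself a packet of the doubled phase space, centred at q(X, Y)
    ([Wig_packets]), [Kt X Y] is up to phases the pairing of the symbol with that packet.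
    The theorem thus becomes a statement on pairings with packets.

    The heart of the matter is the description of the spaces of distributions by packets:
    a tempered [u] is in the space attached to m and B if and only if, for some natural
    number M and some w in B,
      |u (wp X)| <= <X - g>^M m(g) |w(g)|  for all X and all g in the lattice.
    Since the bound holds at every lattice point, with a polynomial loss, later
    estimates can choose the lattice point at will. That the bound suffices is
    [packets_Stilde]: the packets resolve the identity ([temp_resolution]), and a Schwartz
    function pairs with packets with rapid decrease ([stft_decay]). That it is necessary is
    [Stilde_packets]: the partition of unity expands u (wp X) over the lattice
    ([packet_expansion]); the terms near X are bounded by the L^2 norms that define the
    space, by Cauchy-Schwarz, and the distant ones by the rapid decrease of the localized
    operators, which makes them a fraction of the quantity being estimated, so that they are
    absorbed. The resulting convolution of an element of B with a rapidly decreasing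
    sequence stays in B because translations are isometric ([bfs_convolution]).

    Given these bounds for the symbol and for [u], the integrand of the image formula at Y
    in the cell of be is at most a constant times <X - al>^M k1(al, be) k2(be), where k1
    and k2 are of the form to which the hypothesis applies. The integral therefore converges
    and is at most a constant times <X - al>^M m3(al) |w3(al)| ([image_bound]). It remains to see that the
    function F thus obtained comes from a distribution: set c0 v(f) for the integral of
    F(X) <f, wp X> dX. The kernel [Kt] reproduces itself under packets ([Kt_resolution]),
    hence so does F, that is v (wp X) = F(X) ([imdist_wp]). Then [packets_Stilde] puts v in
    the space attached to m3 and B3, and [packets_bracket] gives the domination by
    translated cut-offs, as the periodized cut-off is bounded below. A distribution is
    determined by its packets, whence uniqueness.

    Two devices carry the analysis. A tempered distribution passes under an integral of
    Schwartz functions because Riemann sums converge in every seminorm ([temp_exchange]).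
    A sum over a lattice is an integral of a step function ([csum_cintegral]), so that
    exchanging sums and integrals is always Fubini's theorem. *)

(** * Lebesgue measure on R^N *)

Section AffineChange.
Variable R : realType.
Local Notation tupR N := (N.-tuple (measurableTypeR R)).
Local Notation leb := (@lebesgue_measure R).
Local Notation pushm m mf := (measure_function_pushforward__canonical__measure_function_Measure m mf).

(** Both sides are measures in [A], the right-hand one a multiple of a pushforward, and they
    agree on half-open intervals. *)
Lemma lebesgue_measure_affine (a b : R) (A : set (measurableTypeR R)) : a != 0 -> measurable A ->
  (leb A = `|a|%:E * leb ((fun x => a * x + b)%R @^-1` A))%E.
Proof.
move=> a0 mA.
have mf : measurable_fun setT ((fun x => a * x + b)%R : measurableTypeR R -> measurableTypeR R).
  by apply: measurable_funD => //; apply: measurable_funM.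
pose mu : measure _ _ := mscale (NngNum (normr_ge0 a)) (pushm leb mf).
rewrite (@lebesgue_measure_unique _ mu) // => X [[u v] _ <-] /=.
rewrite /mscale/= /pushforward.
have [an|ap|] := ltgtP a 0; last by move=> /eqP; rewrite (negbTE a0).
- have -> : (fun x : R => a * x + b) @^-1` [set x | x \in `]u, v]] =
     [set` `[(v - b) / a, (u - b) / a[].
    apply/seteqP; split => x /=; rewrite !in_itv/= => /andP[h1 h2]; apply/andP; split.
    + by rewrite ler_ndivrMr // mulrC; lra.
    + by rewrite ltr_ndivlMr // mulrC; lra.
    + by move: h2; rewrite ltr_ndivlMr // mulrC; lra.
    + by move: h1; rewrite ler_ndivrMr // mulrC; lra.
  rewrite !lebesgue_measure_itv /= !lte_fin ltr_nM2r ?invr_lt0 // ltrD2r.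
  case: ifPn => uv; last by rewrite mule0.
  by rewrite -!EFinD -EFinM ltr0_norm//; congr (_%:E); field.
- have -> : (fun x : R => a * x + b) @^-1` [set x | x \in `]u, v]] =
     [set` `](u - b) / a, (v - b) / a]].
    apply/seteqP; split => x /=; rewrite !in_itv/= => /andP[h1 h2]; apply/andP; split.
    + by rewrite ltr_pdivrMr // mulrC; lra.
    + by rewrite ler_pdivlMr // mulrC; lra.
    + by move: h1; rewrite ltr_pdivrMr // mulrC; lra.
    + by move: h2; rewrite ler_pdivlMr // mulrC; lra.
  rewrite !lebesgue_measure_itv /= !lte_fin ltr_pM2r ?invr_gt0 // ltrD2r.
  case: ifPn => uv; last by rewrite mule0.
  by rewrite -!EFinD -EFinM gtr0_norm//; congr (_%:E); field.
Qed.

Lemma lebesgue_integral_affine (a b : R) (f : measurableTypeR R -> \bar R) : a != 0 ->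
  measurable_fun setT f -> (forall x, 0 <= f x)%E ->
  (\int[leb]_x f x = `|a|%:E * \int[leb]_x f (a * x + b)%R)%E.
Proof.
move=> a0 mf f0.
have mA : measurable_fun setT ((fun x => a * x + b)%R : measurableTypeR R -> measurableTypeR R).
  by apply: measurable_funD => //; apply: measurable_funM.
transitivity (\int[mscale (NngNum (normr_ge0 a)) (pushm leb mA)]_x f x)%E.
  apply: eq_measure_integral => A mA' _.
  exact (lebesgue_measure_affine b a0 mA').
rewrite ge0_integral_mscale //= ge0_integral_pushforward //.
Qed.

Lemma lebnS_integral N (f : tupR N.+1 -> \bar R) : measurable_fun setT f ->
  (forall x, 0 <= f x)%E ->
  (\int[lebn R N.+1]_t f t = \int[leb]_x \int[lebn R N]_t f (cons_tup (x, t)))%E.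
Proof.
move=> mf f0.
transitivity (\int[pushm (leb \x lebn R N)%E (@measurable_cons_tup R N)]_t f t)%E.
  exact: eq_measure_integral.
rewrite ge0_integral_pushforward //.
apply: (@fubini_tonelli1 _ _ _ _ _ leb (lebn R N) (f \o @cons_tup R N)) => [|x].
  by apply: measurableT_comp => //; exact: measurable_cons_tup.
exact: f0.
exact: measurable_cons_tup.
Qed.
End AffineChange.

Section AffineRow.
Variable R : realType.
Local Notation tupR N := (N.-tuple (measurableTypeR R)).
Local Notation leb := (@lebesgue_measure R).

Definition aff_tup N (a : R) (b : 'rV[R]_N) (t : tupR N) : tupR N :=
  [tuple (a * tnth t i + b 0 i)%R | i < N].

Lemma row_of_aff_tup N (a : R) (b : 'rV[R]_N) (t : tupR N) :
  row_of_tup (aff_tup a b t) = a *: row_of_tup t + b.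
Proof. by apply/rowP => i; rewrite !mxE tnth_mktuple. Qed.

Lemma measurable_aff_tup N (a : R) (b : 'rV[R]_N) : measurable_fun setT (aff_tup a b).
Proof.
apply/measurable_fun_tnthP => i.
rewrite (_ : _ \o _ = (fun t : tupR N => a * tnth t i + b 0 i)).
  apply: measurable_funD => //; apply: measurable_funM => //; exact: measurable_tnth.
by apply/funext => t /=; rewrite tnth_mktuple.
Qed.

(** By induction on the dimension, one coordinate at a time. *)
Lemma lebn_affine N (a : R) (b : 'rV[R]_N) (f : tupR N -> \bar R) : a != 0 ->
  measurable_fun setT f -> (forall x, 0 <= f x)%E ->
  (\int[lebn R N]_t f t = (`|a| ^+ N)%:E * \int[lebn R N]_t f (aff_tup a b t))%E.
Proof.
move=> a0; elim: N b f => [|N IH] b f mf f0.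
  rewrite expr0 mul1e; apply: eq_integral => t _; congr f.
  by rewrite [RHS]tuple0 [LHS]tuple0.
rewrite !lebnS_integral //; last first.
  by apply: measurableT_comp => //; exact: measurable_aff_tup.
pose b' : 'rV[R]_N := \row_i b 0 (lift ord0 i).
pose g x := (\int[lebn R N]_t f (cons_tup (x, aff_tup a b' t)))%E.
have mg2 : measurable_fun setT (fun p : measurableTypeR R * tupR N => f (cons_tup (p.1, aff_tup a b' p.2))).
  apply: measurableT_comp => //.
  apply: (@measurableT_comp _ _ _ _ _ _ (@cons_tup R N)) => //.
    exact: measurable_cons_tup.
  apply/measurable_fun_pairP; split => /=; first exact: measurable_fst.
  apply: (@measurableT_comp _ _ _ _ _ _ (aff_tup a b')); first exact: measurable_aff_tup.
  exact: measurable_snd.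
have mg : measurable_fun setT g.
  by apply: (measurable_fun_fubini_tonelli_F
    (fun p : measurableTypeR R * tupR N => f (cons_tup (p.1, aff_tup a b' p.2)))).
have g0 x : (0 <= g x)%E by apply: integral_ge0.
have E := lebesgue_integral_affine (b 0 ord0) a0 mg g0.
transitivity (\int[leb]_x ((`|a| ^+ N)%:E * g x))%E.
  apply: eq_integral => x _; rewrite (IH b') //.
  apply: measurableT_comp => //; apply: measurableT_comp => //; first exact: measurable_cons_tup.
have -> : (\int[leb]_x ((`|a| ^+ N)%:E * g x) = (`|a| ^+ N)%:E * \int[leb]_x g x)%E.
  by apply: ge0_integralZl.
rewrite E muleA -EFinM -exprSr.
congr (_ * _)%E; apply: eq_integral => x _; rewrite /g.
apply: eq_integral => t _; congr f.
apply: eq_from_tnth => i; rewrite !tnth_mktuple /cons_tup /=.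
by case: (unliftP ord0 i) => [j|] ->; rewrite ?tnthS ?tnth0 ?tnth_mktuple ?mxE.
Qed.

(** A preimage is a countable union of preimages of boxes, so [w] is arbitrary; step
    functions on lattice cells are of this form. *)
Lemma measurable_floor_row M N (h : 'I_N -> tupR M -> R) (w : 'rV[int]_N -> R) :
  (forall i, measurable_fun setT (h i)) ->
  measurable_fun setT (fun t => w (\row_i Num.floor (h i t))).
Proof.
move=> mh _ Y mY; rewrite setTI.
have -> : (fun t => w (\row_i Num.floor (h i t))) @^-1` Y =
  \bigcup_z (if w z \in Y then \bigcap_(i in setT) (h i @^-1` `[(z 0 i)%:~R, (z 0 i + 1)%:~R[%classic)
     else set0).
  apply/seteqP; split => [t Yt|t [z _]] /=.
    exists (\row_i Num.floor (h i t)) => //.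
    by rewrite mem_set // => i _ /=; rewrite in_itv /= !mxE floor_le floorD1_gt.
  case: ifPn => // /set_mem Yz H; suff <- : z = \row_i Num.floor (h i t) by [].
  apply/rowP => i; have := H i I; rewrite /= in_itv /= mxE => /andP[h1 h2].
  by apply/esym/floor_def; rewrite h1.
apply: countable_bigcupT_measurable; first exact: countableP.
move=> z; case: ifPn => // _; apply: fin_bigcap_measurable; first exact: finite_finset.
by move=> i _; rewrite -[X in measurable X]setTI; apply: mh.
Qed.

(** A pointwise limit of the step functions obtained by rounding the coordinates to
    multiples of 1 / (j + 1). *)
Lemma continuous_rmeasurable N (f : 'rV[R]_N -> R) : continuous f -> rmeasurable f.
Proof.
move=> cf.
pose D (j : nat) (x : 'rV[R]_N) : 'rV[R]_N :=
  \row_i ((Num.floor (j.+1%:R * x 0 i))%:~R / j.+1%:R).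
apply: (@measurable_fun_cvg _ _ _ _ (fun j t => f (D j (row_of_tup t)))).
  move=> j; pose w (z : 'rV[int]_N) := f (\row_i ((z 0 i)%:~R / j.+1%:R)).
  rewrite (_ : (fun t => _) =
    (fun t => w (\row_i Num.floor ((fun i (t : tupR N) => j.+1%:R * tnth t i) i t)))).
    apply: measurable_floor_row => i; apply: measurable_funM => //.
    exact: measurable_tnth.
  by apply/funext => t; rewrite /w /D; congr f; apply/rowP => i; rewrite !mxE.
move=> t _; apply: (@cvg_comp _ _ _ (fun j => D j (row_of_tup t)) f _ (nbhs (row_of_tup t))); last exact: cf.
move: (row_of_tup t) => x.
apply/cvgrPdist_le => /= e e0; near=> j.
rewrite [leLHS]mx_normrE; apply/bigmax_leP; split; [exact: ltW|move=> [i k] _ /=].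
rewrite (ord1 i) /D !mxE.
have j0 : 0 < j.+1%:R :> R by [].
have h1 := floor_le (j.+1%:R * x 0 k); have h2 := floorD1_gt (j.+1%:R * x 0 k).
have -> : x 0 k - (Num.floor (j.+1%:R * x 0 k))%:~R / j.+1%:R =
   (j.+1%:R * x 0 k - (Num.floor (j.+1%:R * x 0 k))%:~R) / j.+1%:R.
  by rewrite [RHS]mulrBl mulrAC mulfV ?gt_eqF // mul1r.
rewrite ger0_norm ?divr_ge0 ?subr_ge0 // ler_pdivrMr //.
rewrite intrD in h2.
apply: (@le_trans _ _ 1); first by lra.
rewrite -ler_pdivrMl // mulr1 (@le_trans _ _ j%:R) ?ler_nat //; near: j.
exact: nbhs_infty_ger.
Unshelve. all: by end_near. Qed.
End AffineRow.

Section ProductMeasure.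
Variable R : realType.
Local Notation tupR N := (N.-tuple (measurableTypeR R)).
Local Notation leb := (@lebesgue_measure R).

Definition cat_tup a b (p : tupR a * tupR b) : tupR (a + b) := [tuple of p.1 ++ p.2].

Lemma measurable_cat_tup a b : measurable_fun setT (@cat_tup a b).
Proof.
apply/measurable_fun_tnthP => i.
case: (split_ordP i) => j ->.
  rewrite (_ : _ \o _ = (fun p => tnth p.1 j)).
    by apply: (measurableT_comp (measurable_tnth j)); exact: measurable_fst.
  by apply/funext => p /=; rewrite tnth_lshift.
rewrite (_ : _ \o _ = (fun p => tnth p.2 j)).
  by apply: (measurableT_comp (measurable_tnth j)); exact: measurable_snd.
by apply/funext => p /=; rewrite tnth_rshift.
Qed.

Lemma row_of_cat_tup a b (s : tupR a) (t : tupR b) :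
  row_of_tup (cat_tup (s, t)) = row_mx (row_of_tup s) (row_of_tup t).
Proof.
apply/rowP => i; rewrite !mxE; case: (split_ordP i) => j -> /=.
  by rewrite mxE (tnth_lshift s t).
by rewrite mxE (tnth_rshift s t).
Qed.

Lemma lebn_split a b (f : tupR (a + b) -> \bar R) : measurable_fun setT f ->
  (forall x, 0 <= f x)%E ->
  (\int[lebn R (a + b)]_t f t = \int[lebn R a]_s \int[lebn R b]_t f (cat_tup (s, t)))%E.
Proof.
elim: a f => [|a IH] f mf f0.
  rewrite integral_dirac //=.
    rewrite diracT mul1e; apply: eq_integral => t _; congr f.
    by apply: val_inj.
  apply: (measurable_fun_fubini_tonelli_F (f \o @cat_tup 0 b)) => [|x]; last exact: f0.
  by apply: measurableT_comp => //; exact: measurable_cat_tup.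
have mfc : measurable_fun setT (f \o @cat_tup a.+1 b).
  by apply: measurableT_comp => //; exact: measurable_cat_tup.
rewrite lebnS_integral; last 2 first.
- by apply: (measurable_fun_fubini_tonelli_F (f \o @cat_tup a.+1 b)) => // x; exact: f0.
- by move=> s; apply: integral_ge0.
transitivity (\int[leb]_x \int[lebn R (a + b)]_t f (@cons_tup _ (a + b) (x, t)))%E.
  exact: (@lebnS_integral R (a + b)).
apply: eq_integral => x _.
rewrite (IH (fun t => f (@cons_tup _ (a + b) (x, t)))) //; last first.
  apply: (@measurableT_comp _ _ _ _ _ _ f) => //.
  by apply: (@measurableT_comp _ _ _ _ _ _ (@cons_tup R (a + b))) => //; exact: measurable_cons_tup.
apply: eq_integral => s _; apply: eq_integral => t _; congr f; exact: val_inj.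
Qed.

Lemma lebn_prod N (g : 'I_N -> R -> R) (c : 'I_N -> R) :
  (forall i, measurable_fun setT (g i : measurableTypeR R -> R)) -> (forall i x, 0 <= g i x) ->
  (forall i, \int[leb]_x (g i x)%:E = (c i)%:E)%E ->
  (\int[lebn R N]_t (\prod_i g i (tnth t i))%:E = (\prod_i c i)%:E)%E.
Proof.
elim: N g c => [|N IH] g c mg g0 gc.
  rewrite (eq_integral (cst 1%E)) => [|t _]; last by rewrite big_ord0.
  by rewrite integral_cst //= mul1e /dirac indicT big_ord0.
rewrite lebnS_integral //; first last.
- by move=> t; rewrite lee_fin prodr_ge0.
- apply/measurable_EFinP; apply: measurable_prod => i _.
  by apply: measurableT_comp => //; exact: measurable_tnth.
transitivity (\int[leb]_x ((g ord0 x)%:E * (\prod_(i < N) c (lift ord0 i))%:E))%E.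
  apply: eq_integral => x _.
  rewrite -(IH (fun i => g (lift ord0 i)) (fun i => c (lift ord0 i))) //.
  rewrite -ge0_integralZl ?lee_fin //; first last.
  - by move=> t _; rewrite lee_fin prodr_ge0.
  - apply/measurable_EFinP; apply: measurable_prod => i _.
    by apply: measurableT_comp => //; exact: measurable_tnth.
  apply: eq_integral => t _; rewrite -EFinM big_ord_recl /cons_tup /= tnth0; congr (_ * _)%:E.
  by apply: eq_bigr => i _; rewrite tnthS.
under eq_integral do rewrite muleC.
rewrite ge0_integralZl ?gc //; first by rewrite -EFinM mulrC [in RHS]big_ord_recl.
- by apply/measurable_EFinP.
- by move=> x _; rewrite lee_fin.
rewrite lee_fin; apply: prodr_ge0 => i _; rewrite -lee_fin -gc.
  by apply: integral_ge0 => x _; rewrite lee_fin.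
Qed.

(** Each half-line contributes pi / 2. *)
Lemma integral_oneDsqrV : exists c : R, (\int[leb]_x ((1 + x ^+ 2)^-1)%:E = c%:E)%E.
Proof.
have mV : measurable_fun setT (fun x : measurableTypeR R => (1 + x ^+ 2)^-1 : R).
  by apply: continuous_measurable_fun; exact: continuous_oneDsqrV.
have V0 x : 0 <= (1 + x ^+ 2)^-1 :> R by rewrite invr_ge0 addr_ge0 ?sqr_ge0.
pose h (x : measurableTypeR R) : R := (1 + x ^+ 2)^-1 * \1_(`[0%R, +oo[%classic : set R) x.
have mh : measurable_fun setT h.
  by apply: measurable_funM => //; apply: measurable_indic.
have h0 x : 0 <= h x by rewrite mulr_ge0.
have H0 : (\int[leb]_x (h x)%:E = (pi / 2 : R)%:E)%E.
  rewrite -integral0y_oneDsqr [RHS]integral_mkcond; apply: eq_integral => x _.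
  by rewrite patchE /h indicE; case: ifP => _; rewrite ?mulr1 ?mulr0.
have mhE : measurable_fun setT (fun x => (h x)%:E) by exact/measurable_EFinP.
have H1 := @lebesgue_integral_affine R (-1) 0 (fun x => (h x)%:E).
have {}H1 : (\int[leb]_x (h (-1 * x + 0))%:E = (pi / 2 : R)%:E)%E.
  by rewrite -H0 H1 ?normrN1 ?mul1e // oppr_eq0 oner_eq0.
have mh1 : measurable_fun setT (fun x : measurableTypeR R => (h (-1 * x + 0))%:E).
  apply/measurable_EFinP; apply: (measurableT_comp mh).
  by apply: measurable_funD => //; apply: measurable_funM.
have L : (\int[leb]_x ((1 + x ^+ 2)^-1)%:E <= (pi / 2 + pi / 2 : R)%:E)%E.
  rewrite EFinD -{1}H0 -{1}H1 -ge0_integralD //; first last.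
    by move=> x _; rewrite lee_fin.
    by move=> x _; rewrite lee_fin.
  apply: ge0_le_integral => //.
  - by move=> x _; rewrite lee_fin.
  - by apply/measurable_EFinP.
  - by apply: emeasurable_funD.
  - move=> x _; rewrite -EFinD lee_fin /h mulN1r addr0 sqrrN -mulrDr ler_peMr //.
    rewrite !indicE !mem_setE !in_itv /= !andbT oppr_ge0.
    by case: (leP 0 x) => hx; [rewrite lerDl ler0n|rewrite (ltW hx) add0r].
exists (fine (\int[leb]_x ((1 + x ^+ 2)^-1)%:E)%E); rewrite fineK // ge0_fin_numE.
  by apply: (le_lt_trans L); rewrite ltry.
by apply: integral_ge0 => x _; rewrite lee_fin.
Qed.
End ProductMeasure.

(** * The Japanese bracket *)

Section Jbr.
Variable R : realType.
Implicit Types (N : nat).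

Lemma dotmx_ge0 N (x : 'rV[R]_N) : 0 <= dotmx x x.
Proof. by apply: sumr_ge0 => i _; rewrite -expr2 sqr_ge0. Qed.

Lemma jbr_sqr N (x : 'rV[R]_N) : jbr x ^+ 2 = 1 + dotmx x x.
Proof. by rewrite sqr_sqrtr // addr_ge0 // dotmx_ge0. Qed.

Lemma jbr_ge1 N (x : 'rV[R]_N) : 1 <= jbr x.
Proof.
rewrite -(@ler_pXn2r _ 2) ?nnegrE ?sqrtr_ge0 // jbr_sqr expr1n lerDl; exact: dotmx_ge0.
Qed.

Lemma jbr_gt0 N (x : 'rV[R]_N) : 0 < jbr x.
Proof. exact: lt_le_trans (jbr_ge1 x). Qed.

Lemma jbr_ge0 N (x : 'rV[R]_N) : 0 <= jbr x.
Proof. exact: ltW (jbr_gt0 x). Qed.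

Lemma jbrX_gt0 N (x : 'rV[R]_N) k : 0 < jbr x ^+ k.
Proof. by rewrite exprn_gt0 // jbr_gt0. Qed.

Lemma jbrX_ge1 N (x : 'rV[R]_N) k : 1 <= jbr x ^+ k.
Proof. by rewrite exprn_ege1 // jbr_ge1. Qed.

Lemma jbrX_ge0 N (x : 'rV[R]_N) k : 0 <= jbr x ^+ k.
Proof. exact: ltW (jbrX_gt0 x k). Qed.

Lemma jbrX_le N (x : 'rV[R]_N) k l : (k <= l)%N -> jbr x ^+ k <= jbr x ^+ l.
Proof. by move=> kl; rewrite ler_weXn2l // jbr_ge1. Qed.

Lemma jbrN N (x : 'rV[R]_N) : jbr (- x) = jbr x.
Proof.
by rewrite /jbr /dotmx; congr (Num.sqrt (1 + _)); apply: eq_bigr => i _; rewrite !mxE mulrNN.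
Qed.

Lemma jbrBC N (x y : 'rV[R]_N) : jbr (x - y) = jbr (y - x).
Proof. by rewrite -jbrN opprB. Qed.

Lemma jbr0 N : jbr (0 : 'rV[R]_N) = 1.
Proof. by rewrite /jbr /dotmx big1 ?addr0 ?sqrtr1 // => i _; rewrite mxE mul0r. Qed.

(** Peetre's inequality. *)
Lemma jbrD N (x y : 'rV[R]_N) : jbr (x + y) <= 2 * (jbr x * jbr y).
Proof.
rewrite -(@ler_pXn2r _ 2) ?nnegrE ?jbr_ge0 ?mulr_ge0 ?jbr_ge0 // !exprMn !jbr_sqr.
have h : dotmx (x + y) (x + y) <= 2 * dotmx x x + 2 * dotmx y y.
  rewrite /dotmx !mulr_sumr -big_split /=; apply: ler_sum => i _; rewrite !mxE.
  by have := sqr_ge0 (x 0 i - y 0 i); nra.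
by have := dotmx_ge0 x; have := dotmx_ge0 y; nra.
Qed.

Lemma jbrXD N (x y : 'rV[R]_N) k : jbr (x + y) ^+ k <= 2 ^+ k * (jbr x ^+ k * jbr y ^+ k).
Proof.
rewrite -!exprMn lerXn2r ?nnegrE ?jbrD ?jbr_ge0 ?mulr_ge0 ?jbr_ge0 //.
Qed.

Lemma dotmx_term N (x : 'rV[R]_N) i : x 0 i ^+ 2 <= dotmx x x.
Proof.
rewrite /dotmx (bigD1 i) //= expr2 lerDl; apply: sumr_ge0 => j _; rewrite -expr2; exact: sqr_ge0.
Qed.

Lemma coord_le_jbr N (x : 'rV[R]_N) i : `|x 0 i| <= jbr x.
Proof.
rewrite -(@ler_pXn2r _ 2) ?nnegrE ?jbr_ge0 // real_normK ?num_real // jbr_sqr.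
by have := dotmx_term x i; lra.
Qed.

Lemma coord_le_norm N (x : 'rV[R]_N) i : `|x 0 i| <= `|x|.
Proof. by rewrite [leRHS]mx_normrE; apply: (@le_bigmax _ _ _ 0 _ (0, i)). Qed.

Lemma dotmx_le_norm N (x : 'rV[R]_N) : dotmx x x <= N%:R * `|x| ^+ 2.
Proof.
rewrite /dotmx; apply: (@le_trans _ _ (\sum_(i < N) `|x| ^+ 2)).
  apply: ler_sum => i _; rewrite -expr2 -(@real_normK _ (x 0 i)) ?num_real //.
  by rewrite lerXn2r ?nnegrE // coord_le_norm.
by rewrite sumr_const card_ord mulr_natl.
Qed.

Lemma jbr_le_norm N (x : 'rV[R]_N) : jbr x <= N.+1%:R * (1 + `|x|).
Proof.
rewrite -(@ler_pXn2r _ 2) ?nnegrE ?jbr_ge0 ?mulr_ge0 ?addr_ge0 // jbr_sqr exprMn.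
have h := dotmx_le_norm x; have h2 : 0 <= `|x| by [].
have h3 : 0 <= N%:R :> R by [].
rewrite -natr1; nra.
Qed.

(** Linear changes of coordinates cost a constant in every estimate by brackets. *)
Lemma jbr_mulmx M N (A : 'M[R]_(M, N)) : exists2 C : R, 0 < C & forall x, jbr (x *m A) <= C * jbr x.
Proof.
pose S := \sum_j (\sum_i `|A i j|) ^+ 2.
have S0 : 0 <= S by apply: sumr_ge0 => j _; rewrite sqr_ge0.
exists (Num.sqrt (1 + S)); first by rewrite sqrtr_gt0; lra.
move=> x; rewrite -(@ler_pXn2r _ 2) ?nnegrE ?jbr_ge0 ?mulr_ge0 ?jbr_ge0 ?sqrtr_ge0 //.
rewrite jbr_sqr exprMn sqr_sqrtr; last lra.
rewrite mulrDl mul1r lerD //; first by rewrite exprn_ege1 // jbr_ge1.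
rewrite /dotmx /S mulr_suml; apply: ler_sum => j _; rewrite -expr2 -exprMn.
rewrite -(@real_normK _ ((x *m A) 0 j)) ?num_real // lerXn2r ?nnegrE ?mulr_ge0 ?jbr_ge0 //.
  by apply: sumr_ge0.
rewrite mxE mulr_suml; apply: (le_trans (ler_norm_sum _ _ _)); apply: ler_sum => i _.
by rewrite normrM mulrC ler_wpM2l // coord_le_jbr.
Qed.

Lemma dotmx_row_mx (K : pzSemiRingType) a b (x x' : 'rV[K]_a) (y y' : 'rV[K]_b) :
  dotmx (row_mx x y) (row_mx x' y') = dotmx x x' + dotmx y y'.
Proof.
rewrite /dotmx big_split_ord /=; congr (_ + _); apply: eq_bigr => i _.
  by rewrite !row_mxEl.
by rewrite !row_mxEr.
Qed.

Lemma jbr_row_mxl a b (x : 'rV[R]_a) (y : 'rV[R]_b) : jbr x <= jbr (row_mx x y).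
Proof.
rewrite -(@ler_pXn2r _ 2) ?nnegrE ?jbr_ge0 // !jbr_sqr dotmx_row_mx.
by have := dotmx_ge0 y; lra.
Qed.

Lemma jbr_row_mxr a b (x : 'rV[R]_a) (y : 'rV[R]_b) : jbr y <= jbr (row_mx x y).
Proof.
rewrite -(@ler_pXn2r _ 2) ?nnegrE ?jbr_ge0 // !jbr_sqr dotmx_row_mx.
by have := dotmx_ge0 x; lra.
Qed.

Lemma jbr_row_mx a b (x : 'rV[R]_a) (y : 'rV[R]_b) : jbr (row_mx x y) <= jbr x * jbr y.
Proof.
rewrite -(@ler_pXn2r _ 2) ?nnegrE ?mulr_ge0 ?jbr_ge0 // exprMn !jbr_sqr dotmx_row_mx.
by have := dotmx_ge0 x; have := dotmx_ge0 y; nra.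
Qed.

Lemma jbr_lsubmx a b (z : 'rV[R]_(a + b)) : jbr (lsubmx z) <= jbr z.
Proof. by rewrite -{2}(hsubmxK z) jbr_row_mxl. Qed.

Lemma continuous_coord N (i : 'I_N) : continuous (fun x : 'rV[R]_N => x 0 i).
Proof. exact: coord_continuous. Qed.

Lemma cont_cst (T : topologicalType) (a : R) : continuous (fun _ : T => a).
Proof. by move=> x; exact: cvg_cst. Qed.

Lemma cont_add (T : topologicalType) (f g : T -> R) :
  continuous f -> continuous g -> continuous (fun x => f x + g x).
Proof. by move=> cf cg x; exact: cvgD (cf x) (cg x). Qed.

Lemma cont_mul (T : topologicalType) (f g : T -> R) :
  continuous f -> continuous g -> continuous (fun x => f x * g x).
Proof. by move=> cf cg x; exact: cvgM (cf x) (cg x). Qed.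

Lemma cont_opp (T : topologicalType) (f : T -> R) :
  continuous f -> continuous (fun x => - f x).
Proof. by move=> cf x; exact: cvgN (cf x). Qed.

Lemma cont_comp (S T U : topologicalType) (f : S -> T) (g : T -> U) :
  continuous f -> continuous g -> continuous (fun x => g (f x)).
Proof. by move=> cf cg x; exact: (continuous_comp (cf x) (cg (f x))). Qed.

Lemma cont_sum (T : topologicalType) (I : Type) (r : seq I) (F : I -> T -> R) :
  (forall i, continuous (F i)) -> continuous (fun x => \sum_(i <- r) F i x).
Proof.
move=> cF; elim: r => [|i r IH].
  by under [X in continuous X]eq_fun do rewrite big_nil; exact: cont_cst.
by under [X in continuous X]eq_fun do rewrite big_cons; apply: cont_add.
Qed.

Lemma cont_exp (T : topologicalType) (f : T -> R) k : continuous f -> continuous (fun x => f x ^+ k).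
Proof.
move=> cf; elim: k => [|k IH].
  by under [X in continuous X]eq_fun do rewrite expr0; exact: cont_cst.
by under [X in continuous X]eq_fun do rewrite exprS; apply: cont_mul.
Qed.

Lemma continuous_jbr N : continuous (@jbr R N).
Proof.
apply: (@cont_comp _ _ _ (fun x : 'rV[R]_N => 1 + dotmx x x) (@Num.sqrt R)); last exact: sqrt_continuous.
apply: cont_add; first exact: cont_cst.
by apply: cont_sum => i; apply: cont_mul; exact: continuous_coord.
Qed.

Lemma cont_inv (T : topologicalType) (f : T -> R) : (forall x, f x != 0) ->
  continuous f -> continuous (fun x => (f x)^-1).
Proof. by move=> f0 cf x; exact: cvgV (f0 x) (cf x). Qed.

Lemma continuous_jbrXV N k : continuous (fun x : 'rV[R]_N => (jbr x ^+ k)^-1).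
Proof.
apply: cont_inv => [x|]; first by rewrite gt_eqF // jbrX_gt0.
by apply: cont_exp; exact: continuous_jbr.
Qed.
End Jbr.

(** * Complex numbers *)

Section ComplexNumbers.
Variable R : realType.
Local Notation C := R[i].
Local Notation Re := complex.Re.
Local Notation Im := complex.Im.
Implicit Types (z w : C).

Lemma normc_ge0 z : 0 <= normc z.
Proof. by case: z => a b; exact: sqrtr_ge0. Qed.

Lemma normc_sqr z : normc z ^+ 2 = Re z ^+ 2 + Im z ^+ 2.
Proof. by case: z => a b; rewrite /normc sqr_sqrtr // addr_ge0 ?sqr_ge0. Qed.

Lemma Re_le_normc z : `|Re z| <= normc z.
Proof.
rewrite -(@ler_pXn2r _ 2) ?nnegrE ?normc_ge0 // real_normK ?num_real // normc_sqr.
by rewrite lerDl sqr_ge0.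
Qed.

Lemma Im_le_normc z : `|Im z| <= normc z.
Proof.
rewrite -(@ler_pXn2r _ 2) ?nnegrE ?normc_ge0 // real_normK ?num_real // normc_sqr.
by rewrite lerDr sqr_ge0.
Qed.

Lemma normc_le_ReIm z : normc z <= `|Re z| + `|Im z|.
Proof.
rewrite -(@ler_pXn2r _ 2) ?nnegrE ?normc_ge0 ?addr_ge0 // normc_sqr.
rewrite -(@real_normK _ (Re z)) ?num_real // -(@real_normK _ (Im z)) ?num_real //.
by have h1 := normr_ge0 (Re z); have h2 := normr_ge0 (Im z); nra.
Qed.

Lemma normcD z w : normc (z + w) <= normc z + normc w.
Proof. exact: le_normcD. Qed.

Lemma normc_opp z : normc (- z) = normc z.
Proof. exact: normcN. Qed.

Lemma normcB z w : normc (z - w) <= normc z + normc w.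
Proof. by rewrite -(normc_opp w); exact: normcD. Qed.

Lemma normc_distC z w : normc (z - w) = normc (w - z).
Proof. by rewrite -normc_opp opprB. Qed.

Lemma normcR (r : R) : normc (r%:C) = `|r|.
Proof. by rewrite /normc /= expr0n /= addr0 sqrtr_sqr. Qed.

Lemma normc_conj z : normc (conjc z) = normc z.
Proof. by case: z => a b; rewrite /normc /= sqrrN. Qed.

Lemma normc_eq0 z : (normc z == 0) = (z == 0).
Proof. by apply/eqP/eqP => [/eq0_normc|->]; rewrite ?normc0. Qed.

Lemma normc_gt0 z : z != 0 -> 0 < normc z.
Proof. by rewrite lt0r normc_ge0 normc_eq0 andbT. Qed.

Lemma normc_sum (I : Type) (r : seq I) (P : pred I) (F : I -> C) :
  normc (\sum_(i <- r | P i) F i) <= \sum_(i <- r | P i) normc (F i).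
Proof.
elim/big_ind2 : _ => [|x a y b xa yb|//]; first by rewrite normc0.
exact: le_trans (normcD _ _) (lerD xa yb).
Qed.

Lemma ReD z w : Re (z + w) = Re z + Re w. Proof. by case: z; case: w. Qed.
Lemma ImD z w : Im (z + w) = Im z + Im w. Proof. by case: z; case: w. Qed.
Lemma ReN z : Re (- z) = - Re z. Proof. by case: z. Qed.
Lemma ImN z : Im (- z) = - Im z. Proof. by case: z. Qed.
Lemma ReM z w : Re (z * w) = Re z * Re w - Im z * Im w. Proof. by case: z; case: w. Qed.
Lemma ImM z w : Im (z * w) = Re z * Im w + Im z * Re w. Proof. by case: z; case: w. Qed.
Lemma ReConj z : Re (conjc z) = Re z. Proof. by case: z. Qed.
Lemma ImConj z : Im (conjc z) = - Im z. Proof. by case: z. Qed.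
Lemma ReIm_eq z w : Re z = Re w -> Im z = Im w -> z = w.
Proof. by case: z; case: w => /= ? ? ? ? -> ->. Qed.
Lemma conjcME z w : conjc (z * w) = conjc z * conjc w. Proof. exact: rmorphM. Qed.

Definition cis (t : R) : C := cexp (0 +i* t).

Lemma cisE t : cis t = cos t +i* sin t.
Proof.
rewrite /cis /cexp /= expR0; apply: ReIm_eq; rewrite ?ReM ?ImM /=; ring.
Qed.

Lemma normc_cis t : normc (cis t) = 1.
Proof. by rewrite cisE /normc cos2Dsin2 sqrtr1. Qed.

Lemma cisD s t : cis (s + t) = cis s * cis t.
Proof. by rewrite !cisE; apply: ReIm_eq; rewrite ?ReM ?ImM /= ?cosD ?sinD; ring. Qed.

Lemma cis0 : cis 0 = 1. Proof. by rewrite cisE cos0 sin0. Qed.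

Lemma conj_cis t : conjc (cis t) = cis (- t).
Proof. by rewrite !cisE cosN sinN. Qed.

Lemma cexpD z w : cexp (z + w) = cexp z * cexp w.
Proof.
case: z => a b; case: w => c d; rewrite /cexp /= expRD cosD sinD.
by apply: ReIm_eq; rewrite ?ReM ?ImM /=; ring.
Qed.

Lemma cexpE (a b : R) : cexp (a +i* b) = (expR a)%:C * cis b.
Proof. by rewrite cisE. Qed.

Lemma normc_cexp z : normc (cexp z) = expR (Re z).
Proof. by case: z => a b; rewrite cexpE normcM normc_cis mulr1 normcR ger0_norm // expR_ge0. Qed.

Lemma conj_cexp z : conjc (cexp z) = cexp (conjc z).
Proof.
case: z => a b; rewrite (_ : conjc (a +i* b) = a +i* (- b)) // !cexpE conjcME conj_cis.
by rewrite conjc_real.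
Qed.
End ComplexNumbers.

(** * Integrals of real and complex functions *)

Section Integrals.
Variable R : realType.
Local Notation C := R[i].
Local Notation Re := complex.Re.
Local Notation Im := complex.Im.

Definition rint N (f : 'rV[R]_N -> R) : Prop :=
  (lebn R N).-integrable setT (fun t => (f (row_of_tup t))%:E).

Definition rI N (f : 'rV[R]_N -> R) : R := \int[lebn R N]_t f (row_of_tup t).

Lemma rint_meas N (f : 'rV[R]_N -> R) : rint f -> rmeasurable f.
Proof. by move=> /measurable_int /measurable_EFinP. Qed.

Lemma rint_dom N (f g : 'rV[R]_N -> R) : rmeasurable f -> rint g ->
  (forall x, `|f x| <= g x) -> rint f.
Proof.
move=> mf ig fg; apply: (le_integrable _ _ _ ig) => //; first by apply/measurable_EFinP.
by move=> t _; rewrite !abse_EFin lee_fin (le_trans (fg _)) // ler_norm.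
Qed.

Lemma rintD N (f g : 'rV[R]_N -> R) : rint f -> rint g -> rint (fun x => f x + g x).
Proof. by move=> hf hg; apply: eq_integrable (integrableD measurableT hf hg). Qed.

Lemma rintZ N (f : 'rV[R]_N -> R) a : rint f -> rint (fun x => a * f x).
Proof. by move=> hf; apply: eq_integrable (integrableZl measurableT a hf). Qed.

Lemma rintN N (f : 'rV[R]_N -> R) : rint f -> rint (fun x => - f x).
Proof. by move=> /(rintZ (-1)); under eq_fun do rewrite mulN1r. Qed.

Lemma rID N (f g : 'rV[R]_N -> R) : rint f -> rint g -> rI (fun x => f x + g x) = rI f + rI g.
Proof. by move=> hf hg; apply: RintegralD. Qed.

Lemma rIZ N (f : 'rV[R]_N -> R) a : rint f -> rI (fun x => a * f x) = a * rI f.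
Proof. by move=> hf; apply: RintegralZl. Qed.

Lemma rIN N (f : 'rV[R]_N -> R) : rint f -> rI (fun x => - f x) = - rI f.
Proof.
by move=> /(rIZ (-1)) H; rewrite -mulN1r -H; congr rI; apply/funext => x; rewrite mulN1r.
Qed.

Lemma rI_le N (f g : 'rV[R]_N -> R) : rint f -> rint g -> (forall x, f x <= g x) -> rI f <= rI g.
Proof. by move=> hf hg fg; apply: le_Rintegral => // t _; exact: fg. Qed.

Lemma rI_ge0 N (f : 'rV[R]_N -> R) : (forall x, 0 <= f x) -> 0 <= rI f.
Proof. by move=> f0; apply: Rintegral_ge0 => t _; exact: f0. Qed.

Lemma prod_oneDsqr_le N (x : 'rV[R]_N) : \prod_i (1 + x 0 i ^+ 2) <= jbr x ^+ (N + N).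
Proof.
have -> : jbr x ^+ (N + N) = \prod_(i < N) (jbr x ^+ 2).
  by rewrite prodr_const card_ord -exprM mul2n addnn.
apply: ler_prod => i _; rewrite addr_ge0 ?sqr_ge0 //= jbr_sqr lerD2l; exact: dotmx_term.
Qed.

(** The bracket dominates the product of one-dimensional weights 1 + x_i^2, each of which
    has an integrable inverse. *)
Lemma rint_jbr N k : (N + N <= k)%N -> rint (fun x : 'rV[R]_N => (jbr x ^+ k)^-1).
Proof.
move=> Nk; have [c hc] := integral_oneDsqrV R.
have mV : measurable_fun setT (fun x : measurableTypeR R => (1 + x ^+ 2)^-1 : R).
  by apply: continuous_measurable_fun; exact: continuous_oneDsqrV.
have V0 x : 0 <= (1 + x ^+ 2)^-1 :> R by rewrite invr_ge0 addr_ge0 ?sqr_ge0.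
have P0 := @lebn_prod R N (fun _ x => (1 + x ^+ 2)^-1) (fun _ => c) (fun=> mV) (fun=> V0) (fun=> hc).
apply: (@rint_dom _ _ (fun x => \prod_i (1 + x 0 i ^+ 2)^-1)).
- by apply: continuous_rmeasurable; exact: continuous_jbrXV.
- apply/integrableP; split.
    apply/measurable_EFinP; apply: measurable_prod => i _.
    move: (measurableT_comp mV (measurable_tnth i)); congr (measurable_fun _ _).
    by apply/funext => t; rewrite /= mxE.
  apply: (@le_lt_trans _ _ (\prod_(i < N) c)%:E); last exact: ltry.
  rewrite -P0 le_eqVlt; apply/orP; left; apply/eqP; apply: eq_integral => t _.
   rewrite abse_EFin ger0_norm ?prodr_ge0 //.
  by congr EFin; apply: eq_bigr => i _; rewrite mxE.
- move=> x; rewrite ger0_norm ?invr_ge0 ?jbrX_ge0 // prodfV lef_pV2 ?posrE ?jbrX_gt0 //.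
    exact: le_trans (prod_oneDsqr_le x) (jbrX_le x Nk).
  by apply: prodr_gt0 => i _; rewrite ltr_wpDr ?sqr_ge0.
Qed.

Lemma cintegrableP N (f : 'rV[R]_N -> C) :
  cintegrable f <-> rint (fun x => Re (f x)) /\ rint (fun x => Im (f x)).
Proof. by []. Qed.

Lemma cint_dom N (f : 'rV[R]_N -> C) g : cmeasurable f -> rint g ->
  (forall x, normc (f x) <= g x) -> cintegrable f.
Proof.
move=> [m1 m2] ig fg; split.
  apply: (@rint_dom _ (fun x => Re (f x)) _ m1 ig) => x.
  exact: le_trans (Re_le_normc _) (fg x).
apply: (@rint_dom _ (fun x => Im (f x)) _ m2 ig) => x.
exact: le_trans (Im_le_normc _) (fg x).
Qed.

Lemma cint_meas N (f : 'rV[R]_N -> C) : cintegrable f -> cmeasurable f.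
Proof. by move=> /cintegrableP[/rint_meas h1 /rint_meas h2]. Qed.

Lemma eq_cintegral N (f g : 'rV[R]_N -> C) : f =1 g -> cintegral f = cintegral g.
Proof. by move=> /funext ->. Qed.

Lemma cintegrableD N (f g : 'rV[R]_N -> C) : cintegrable f -> cintegrable g ->
  cintegrable (fun x => f x + g x).
Proof.
move=> /cintegrableP[f1 f2] /cintegrableP[g1 g2]; apply/cintegrableP; split.
  by move: (rintD f1 g1); congr rint; apply/funext => x; rewrite ReD.
by move: (rintD f2 g2); congr rint; apply/funext => x; rewrite ImD.
Qed.

Lemma cintegrableZ N (f : 'rV[R]_N -> C) a : cintegrable f -> cintegrable (fun x => a * f x).
Proof.
move=> /cintegrableP[f1 f2]; apply/cintegrableP; split.
  move: (rintD (rintZ (Re a) f1) (rintZ (- Im a) f2)); congr rint; apply/funext => x.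
  by rewrite ReM mulNr.
move: (rintD (rintZ (Re a) f2) (rintZ (Im a) f1)); congr rint; apply/funext => x.
by rewrite ImM.
Qed.

Lemma cintegralD N (f g : 'rV[R]_N -> C) : cintegrable f -> cintegrable g ->
  cintegral (fun x => f x + g x) = cintegral f + cintegral g.
Proof.
move=> /cintegrableP[f1 f2] /cintegrableP[g1 g2]; apply: ReIm_eq; rewrite ?ReD ?ImD /=.
  by rewrite -(rID f1 g1); apply: eq_Rintegral => t _; rewrite ReD.
by rewrite -(rID f2 g2); apply: eq_Rintegral => t _; rewrite ImD.
Qed.

Lemma cintegralZ N (f : 'rV[R]_N -> C) a : cintegrable f ->
  cintegral (fun x => a * f x) = a * cintegral f.
Proof.
move=> /cintegrableP[f1 f2]; apply: ReIm_eq; rewrite ?ReM ?ImM /=.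
  rewrite -(rIZ (Re a) f1) -mulNr -(rIZ (- Im a) f2) -rID; [|exact: rintZ..].
  by apply: eq_Rintegral => t _; rewrite ReM mulNr.
rewrite -(rIZ (Re a) f2) -(rIZ (Im a) f1) -rID; [|exact: rintZ..].
by apply: eq_Rintegral => t _; rewrite ImM.
Qed.

Lemma cintegralZr N (f : 'rV[R]_N -> C) a : cintegrable f ->
  cintegral (fun x => f x * a) = cintegral f * a.
Proof.
by move=> hf; rewrite mulrC -cintegralZ //; apply: eq_cintegral => x; rewrite mulrC.
Qed.

Lemma cintegrableN N (f : 'rV[R]_N -> C) : cintegrable f -> cintegrable (fun x => - f x).
Proof.
by move=> /(cintegrableZ (-1)); congr cintegrable; apply/funext => x; rewrite mulN1r.
Qed.

Lemma cintegralN N (f : 'rV[R]_N -> C) : cintegrable f ->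
  cintegral (fun x => - f x) = - cintegral f.
Proof.
by move=> hf; rewrite -mulN1r -cintegralZ //; apply: eq_cintegral => x; rewrite mulN1r.
Qed.

Lemma cintegralB N (f g : 'rV[R]_N -> C) : cintegrable f -> cintegrable g ->
  cintegral (fun x => f x - g x) = cintegral f - cintegral g.
Proof. by move=> hf hg; rewrite cintegralD ?cintegralN //; exact: cintegrableN. Qed.

Lemma cintegrable_conj N (f : 'rV[R]_N -> C) : cintegrable f -> cintegrable (fun x => conjc (f x)).
Proof.
move=> /cintegrableP[f1 f2]; apply/cintegrableP; split.
  by move: f1; congr rint; apply/funext => t; rewrite ReConj.
by move: (rintN f2); congr rint; apply/funext => t; rewrite ImConj.
Qed.

Lemma cintegral_conj N (f : 'rV[R]_N -> C) : cintegrable f ->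
  cintegral (fun x => conjc (f x)) = conjc (cintegral f).
Proof.
move=> /cintegrableP[f1 f2]; apply: ReIm_eq; rewrite ?ReConj ?ImConj /=.
  by apply: eq_Rintegral => t _; rewrite ReConj.
by rewrite -(rIN f2); apply: eq_Rintegral => t _; rewrite ImConj.
Qed.

Lemma cintegral0 N : cintegral (fun _ : 'rV[R]_N => 0 : C) = 0.
Proof.
by apply: ReIm_eq; rewrite /= /Rintegral integral0.
Qed.

(** The integral is multiplied by its conjugate before taking real parts, which gives the
    sharp constant 1. *)
Lemma le_normc_cintegral N (f : 'rV[R]_N -> C) g : cintegrable f -> rint g ->
  (forall x, normc (f x) <= g x) -> normc (cintegral f) <= rI g.
Proof.
move=> hf ig fg; set z := cintegral f.
have g0 : 0 <= rI g by apply: rI_ge0 => x; exact: le_trans (normc_ge0 _) (fg x).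
have [->|z0] := eqVneq z 0; first by rewrite normc0.
have zp := normc_gt0 z0.
rewrite -(ler_pM2l zp) -expr2 normc_sqr.
have /cintegrableP[f1 f2] := hf.
have -> : Re z ^+ 2 + Im z ^+ 2 = rI (fun x => Re z * Re (f x) + Im z * Im (f x)).
  by rewrite rID ?rIZ //; exact: rintZ.
rewrite -rIZ //; apply: rI_le; [by apply: rintD; exact: rintZ|exact: rintZ|].
move=> x; have := Re_le_normc (conjc z * f x); rewrite normcM normc_conj ReM ReConj ImConj => h.
apply: (@le_trans _ _ (normc z * normc (f x))).
  by apply: (le_trans _ h); apply: le_trans (ler_norm _); rewrite mulNr opprK.
by rewrite ler_wpM2l // ltW.
Qed.
End Integrals.

Section Fubini.
Variable R : realType.
Local Notation C := R[i].
Local Notation Re := complex.Re.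
Local Notation Im := complex.Im.
Local Notation tupR N := (N.-tuple (measurableTypeR R)).
Local Notation pushm m mf := (measure_function_pushforward__canonical__measure_function_Measure m mf).

(** The measure on tuples of length a + b is the product measure carried by concatenation;
    this is what makes Fubini available. *)
Lemma lebn_catE a b (A : set (tupR (a + b))) : measurable A ->
  lebn R (a + b) A = pushforward (lebn R a \x lebn R b)%E (@cat_tup R a b) A.
Proof.
move=> mA.
have mf : measurable_fun setT (fun t => (\1_A t : R)%:E) by apply/measurable_EFinP; exact: measurable_indic.
have := @lebn_split R a b (fun t => (\1_A t)%:E) mf.
rewrite integral_indic // setIT => -> //.
rewrite -(@fubini_tonelli1 _ _ _ _ _ (lebn R a) (lebn R b) ((fun t => (\1_A t)%:E) \o @cat_tup R a b)) //; first last.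
- by move=> x; rewrite /= lee_fin.
- by apply: measurableT_comp => //; exact: measurable_cat_tup.
transitivity (\int[pushm (lebn R a \x lebn R b)%E (@measurable_cat_tup R a b)]_t (\1_A t)%:E)%E.
  by rewrite ge0_integral_pushforward //; exact: measurable_cat_tup.
by rewrite integral_indic // setIT.
Qed.

Variables (a b : nat) (g : 'rV[R]_a -> R) (h : 'rV[R]_b -> R).
Hypotheses (ig : rint g) (ih : rint h).

Section real.
Variable F : 'rV[R]_(a + b) -> R.
Hypothesis mF : rmeasurable F.
Hypothesis Fgh : forall x y, `|F (row_mx x y)| <= g x * h y.

Let f (p : tupR a * tupR b) := (F (row_mx (row_of_tup p.1) (row_of_tup p.2)))%:E.

Let mf : measurable_fun setT f.
Proof.
apply/measurable_EFinP.
move: (measurableT_comp mF (@measurable_cat_tup R a b)); congr (measurable_fun _ _).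
by apply/funext => -[s t] /=; rewrite row_of_cat_tup.
Qed.

Let iabs : exists2 K : R, 0 <= K & (\int[lebn R b]_t `|h (row_of_tup t)|%:E = K%:E)%E.
Proof.
exists (fine (\int[lebn R b]_t `|h (row_of_tup t)|%:E)%E).
  by apply: fine_ge0; apply: integral_ge0 => t _; rewrite lee_fin.
have /integrableP[_] := ih; under eq_integral do rewrite abse_EFin.
move=> H; rewrite fineK // ge0_fin_numE //.
by apply: integral_ge0 => t _; rewrite lee_fin.
Qed.

Let imf : (lebn R a \x lebn R b)%E.-integrable setT f.
Proof.
apply/(integrable12ltyP _ _ mf).
have [K K0 hK] := iabs.
have mh : measurable_fun setT (fun t => `|h (row_of_tup t)|%:E).
  by apply/measurable_EFinP; apply: measurableT_comp => //; exact: rint_meas ih.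
have mg : measurable_fun setT (fun t => `|g (row_of_tup t)|%:E).
  by apply/measurable_EFinP; apply: measurableT_comp => //; exact: rint_meas ig.
apply: (@le_lt_trans _ _ (\int[lebn R a]_s (`|g (row_of_tup s)|%:E * K%:E))%E).
  apply: ge0_le_integral => //.
  - by move=> s _; apply: integral_ge0.
  - apply: (@measurable_fun_fubini_tonelli_F _ _ _ _ _ _ (abse \o f)) => [|x]; last exact: abse_ge0.
    exact: measurableT_comp.
  - by apply: emeasurable_funM => //; exact: measurable_cst.
  move=> s _; rewrite -hK -ge0_integralZl //; apply: ge0_le_integral => //.
  - by apply: measurableT_comp => //; apply: measurableT_comp => //; exact: pair1_measurable.
  - by apply: emeasurable_funM => //; exact: measurable_cst.
  - move=> t _; rewrite /f abse_EFin -EFinM lee_fin -normrM.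
    exact: le_trans (Fgh _ _) (ler_norm _).
rewrite ge0_integralZr // ?lee_fin //.
rewrite lte_mul_pinfty ?lee_fin //; last by rewrite ltry.
- by apply: integral_ge0 => t _; rewrite lee_fin.
have /integrableP[_ H] := ig; rewrite ge0_fin_numE; first exact: H.
by apply: integral_ge0 => t _; rewrite lee_fin.
Qed.

Lemma rint_secl x : rint (fun y => F (row_mx x y)).
Proof.
apply: (@rint_dom _ _ _ (fun y => g x * h y)) => //; last exact: rintZ.
pose s : tupR a := [tuple x 0 i | i < a].
have sE : row_of_tup s = x by apply/rowP => i; rewrite mxE tnth_mktuple.
have /measurable_EFinP := measurableT_comp mf (@pair1_measurable _ _ (tupR a) (tupR b) s).
by rewrite /= sE.
Qed.

Lemma rint_secr y : rint (fun x => F (row_mx x y)).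
Proof.
apply: (@rint_dom _ _ _ (fun x => h y * g x)) => //; last 2 first.
- exact: rintZ.
- by move=> x; rewrite mulrC.
pose s : tupR b := [tuple y 0 i | i < b].
have sE : row_of_tup s = y by apply/rowP => i; rewrite mxE tnth_mktuple.
have /measurable_EFinP := measurableT_comp mf (@pair2_measurable _ _ (tupR a) (tupR b) s).
by rewrite /= sE.
Qed.

Let FE s : fubini_F (lebn R b) f s = (rI (fun y => F (row_mx (row_of_tup s) y)))%:E.
Proof.
rewrite /rI /Rintegral fineK //; apply: integrable_fin_num => //.
exact: (rint_secl (row_of_tup s)).
Qed.

Let GE t : fubini_G (lebn R a) f t = (rI (fun x => F (row_mx x (row_of_tup t))))%:E.
Proof.
rewrite /rI /Rintegral fineK //; apply: integrable_fin_num => //.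
exact: (rint_secr (row_of_tup t)).
Qed.

Lemma rint_rIl : rint (fun x => rI (fun y => F (row_mx x y))).
Proof.
have := integrable_fubini_F imf; congr (integrable _ _ _).
by apply/funext => s; exact: FE.
Qed.

Lemma rI_fubini : rI (fun x => rI (fun y => F (row_mx x y))) = rI (fun y => rI (fun x => F (row_mx x y))).
Proof.
congr fine; have := Fubini imf; congr (_ = _); apply: eq_integral => s _.
  exact: FE.
exact: GE.
Qed.

Let fE : f = (fun t => (F (row_of_tup t))%:E) \o @cat_tup R a b.
Proof. by apply/funext => -[s t] /=; rewrite row_of_cat_tup. Qed.

Lemma rI_split : rI F = rI (fun x => rI (fun y => F (row_mx x y))).
Proof.
congr fine.
rewrite (@eq_measure_integral _ _ _ _ (pushm (lebn R a \x lebn R b)%E (@measurable_cat_tup R a b))); last first.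
  by move=> A mA _; exact: lebn_catE.
rewrite integral_pushforward //; first last.
- by rewrite -fE.
- by apply/measurable_EFinP.
- exact: measurable_cat_tup.
rewrite -fE -integral12_prod_meas1 //; apply: eq_integral => s _; exact: FE.
Qed.
End real.

Variable F : 'rV[R]_(a + b) -> C.
Hypothesis mF : cmeasurable F.
Hypothesis Fgh : forall x y, normc (F (row_mx x y)) <= g x * h y.

Let F1 x y : `|Re (F (row_mx x y))| <= g x * h y.
Proof. exact: le_trans (Re_le_normc _) (Fgh x y). Qed.
Let F2 x y : `|Im (F (row_mx x y))| <= g x * h y.
Proof. exact: le_trans (Im_le_normc _) (Fgh x y). Qed.
Let m1 : rmeasurable (fun z => Re (F z)). Proof. by case: mF. Qed.
Let m2 : rmeasurable (fun z => Im (F z)). Proof. by case: mF. Qed.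

Lemma cintegrable_intl : cintegrable (fun x => cintegral (fun y => F (row_mx x y))).
Proof. by apply/cintegrableP; split; [exact: (rint_rIl m1 F1)|exact: (rint_rIl m2 F2)]. Qed.

Lemma cintegral_split : cintegral F = cintegral (fun x => cintegral (fun y => F (row_mx x y))).
Proof. by apply: ReIm_eq; [exact: (rI_split m1 F1)|exact: (rI_split m2 F2)]. Qed.

(** Domination by a product of integrable functions of the two variables is the form in
    which the hypothesis of Fubini's theorem is always met below. *)
Lemma cintegral_fubini : cintegral (fun x => cintegral (fun y => F (row_mx x y))) =
  cintegral (fun y => cintegral (fun x => F (row_mx x y))).
Proof. by apply: ReIm_eq; [exact: (rI_fubini m1 F1)|exact: (rI_fubini m2 F2)]. Qed.
End Fubini.

(** * Continuity *)

Section ComplexContinuity.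
Variable R : realType.
Local Notation C := R[i].
Local Notation Re := complex.Re.
Local Notation Im := complex.Im.

(** Taken componentwise, like [cmeasurable] and [cintegrable], so that the real results
    transfer without a topology on the complex numbers. *)
Definition ccont (T : topologicalType) (f : T -> C) : Prop :=
  continuous (fun x => Re (f x)) /\ continuous (fun x => Im (f x)).

Lemma ccont_cst (T : topologicalType) (a : C) : ccont (fun _ : T => a).
Proof. by split; exact: cont_cst. Qed.

Lemma eq_ccont (T : topologicalType) (f g : T -> C) : f =1 g -> ccont f -> ccont g.
Proof. by move=> /funext ->. Qed.

Lemma ccont_add (T : topologicalType) (f g : T -> C) :
  ccont f -> ccont g -> ccont (fun x => f x + g x).
Proof.
move=> [f1 f2] [g1 g2]; split.
  by rewrite (_ : (fun x => _) = fun x => Re (f x) + Re (g x)); [exact: cont_add|apply/funext => x; rewrite ReD].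
by rewrite (_ : (fun x => _) = fun x => Im (f x) + Im (g x)); [exact: cont_add|apply/funext => x; rewrite ImD].
Qed.

Lemma ccont_opp (T : topologicalType) (f : T -> C) : ccont f -> ccont (fun x => - f x).
Proof.
move=> [f1 f2]; split.
  by rewrite (_ : (fun x => _) = fun x => - Re (f x)); [exact: cont_opp|apply/funext => x; rewrite ReN].
by rewrite (_ : (fun x => _) = fun x => - Im (f x)); [exact: cont_opp|apply/funext => x; rewrite ImN].
Qed.

Lemma ccont_sub (T : topologicalType) (f g : T -> C) :
  ccont f -> ccont g -> ccont (fun x => f x - g x).
Proof. by move=> cf cg; apply: ccont_add => //; exact: ccont_opp. Qed.

Lemma ccont_mul (T : topologicalType) (f g : T -> C) :
  ccont f -> ccont g -> ccont (fun x => f x * g x).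
Proof.
move=> [f1 f2] [g1 g2]; split.
  rewrite (_ : (fun x => _) = fun x => Re (f x) * Re (g x) + - (Im (f x) * Im (g x))).
    by apply: cont_add; [exact: cont_mul|apply: cont_opp; exact: cont_mul].
  by apply/funext => x; rewrite ReM.
rewrite (_ : (fun x => _) = fun x => Re (f x) * Im (g x) + (Im (f x) * Re (g x))).
  by apply: cont_add; exact: cont_mul.
by apply/funext => x; rewrite ImM.
Qed.

Lemma ccont_conj (T : topologicalType) (f : T -> C) : ccont f -> ccont (fun x => conjc (f x)).
Proof.
move=> [f1 f2]; split.
  by rewrite (_ : (fun x => _) = fun x => Re (f x)) //; apply/funext => x; rewrite ReConj.
by rewrite (_ : (fun x => _) = fun x => - Im (f x)); [exact: cont_opp|apply/funext => x; rewrite ImConj].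
Qed.

Lemma ccont_comp (S T : topologicalType) (f : S -> T) (g : T -> C) :
  continuous f -> ccont g -> ccont (fun x => g (f x)).
Proof.
move=> cf [g1 g2]; split; first exact: (cont_comp cf g1).
exact: (cont_comp cf g2).
Qed.

Lemma ccont_real (T : topologicalType) (f : T -> R) : continuous f -> ccont (fun x => (f x)%:C).
Proof. by move=> cf; split => //=; exact: cont_cst. Qed.

Lemma ccont_cexp (T : topologicalType) (f : T -> C) : ccont f -> ccont (fun x => cexp (f x)).
Proof.
move=> [f1 f2].
have cE : continuous (fun x => expR (Re (f x))) by apply: (cont_comp f1); exact: continuous_expR.
have cc : continuous (fun x => cos (Im (f x))) by apply: (cont_comp f2); exact: continuous_cos.
have cs : continuous (fun x => sin (Im (f x))) by apply: (cont_comp f2); exact: continuous_sin.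
by apply: ccont_mul; [exact: ccont_real|split].
Qed.

Lemma ccont_cis (T : topologicalType) (f : T -> R) : continuous f -> ccont (fun x => cis (f x)).
Proof. by move=> cf; apply: ccont_cexp; split => //=; exact: cont_cst. Qed.

Lemma ccont_sum (T : topologicalType) (I : Type) (r : seq I) (F : I -> T -> C) :
  (forall i, ccont (F i)) -> ccont (fun x => \sum_(i <- r) F i x).
Proof.
move=> cF; elim: r => [|i r IH].
  by apply: (@eq_ccont _ (fun=> 0)); [move=> x; rewrite big_nil|exact: ccont_cst].
apply: (@eq_ccont _ (fun x => F i x + \sum_(j <- r) F j x)); last exact: ccont_add.
by move=> x; rewrite big_cons.
Qed.

Lemma cont_normc (T : topologicalType) (f : T -> C) : ccont f -> continuous (fun x => normc (f x)).
Proof.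
move=> [f1 f2].
rewrite (_ : (fun x => _) = fun x => Num.sqrt (Re (f x) ^+ 2 + Im (f x) ^+ 2)).
  apply: (cont_comp (g := @Num.sqrt R)); last exact: sqrt_continuous.
  by apply: cont_add; exact: cont_exp.
by apply/funext => x; case: (f x).
Qed.

Lemma ccont_cmeas N (f : 'rV[R]_N -> C) : ccont f -> cmeasurable f.
Proof. by move=> [f1 f2]; split; [exact: (continuous_rmeasurable f1)|exact: (continuous_rmeasurable f2)]. Qed.

Lemma cont_lsubmx a b : continuous (@lsubmx R 1 a b).
Proof. by move=> x; apply: differentiable_continuous; exact: differentiable_lsubmx. Qed.

Lemma cont_rsubmx a b : continuous (@rsubmx R 1 a b).
Proof. by move=> x; apply: differentiable_continuous; exact: differentiable_rsubmx. Qed.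

Lemma cont_mx (T : topologicalType) N (f : T -> 'rV[R]_N) :
  (forall i, continuous (fun x => f x 0 i)) -> continuous f.
Proof.
move=> cf x; apply/cvgrPdist_lt => e e0.
have H i : \forall y \near x, `|f x 0 i - f y 0 i| < e.
  by have /cvgrPdist_lt := cf i x; apply.
have : \forall y \near x, forall i, `|f x 0 i - f y 0 i| < e.
  by apply: filter_forall.
apply: filterS => y Hy.
rewrite [ltLHS]mx_normrE; apply: bigmax_lt => // -[i j] _ /=.
by rewrite (ord1 i) !mxE; exact: Hy.
Qed.

Lemma cont_mulmx M N (A : 'M[R]_(M, N)) : continuous (fun x : 'rV[R]_M => x *m A).
Proof.
apply: cont_mx => i; under [X in continuous X]eq_fun do rewrite mxE.
by apply: cont_sum => j; apply: cont_mul; [exact: continuous_coord|exact: cont_cst].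
Qed.

Lemma cont_row_mx (T : topologicalType) a b (f : T -> 'rV[R]_a) (g : T -> 'rV[R]_b) :
  continuous f -> continuous g -> continuous (fun x => row_mx (f x) (g x)).
Proof.
move=> cf cg; apply: cont_mx => i; case: (split_ordP i) => j ->.
  under [X in continuous X]eq_fun do rewrite row_mxEl.
  by apply: (cont_comp cf (g := fun x : 'rV[R]_a => x 0 j)); exact: continuous_coord.
under [X in continuous X]eq_fun do rewrite row_mxEr.
by apply: (cont_comp cg (g := fun x : 'rV[R]_b => x 0 j)); exact: continuous_coord.
Qed.

Lemma cont_addv (T : topologicalType) N (f g : T -> 'rV[R]_N) :
  continuous f -> continuous g -> continuous (fun x => f x + g x).
Proof. by move=> cf cg x; exact: cvgD (cf x) (cg x). Qed.

Lemma cont_oppv (T : topologicalType) N (f : T -> 'rV[R]_N) :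
  continuous f -> continuous (fun x => - f x).
Proof. by move=> cf x; exact: cvgN (cf x). Qed.

Lemma cont_scalev (T : topologicalType) N (a : R) (f : T -> 'rV[R]_N) :
  continuous f -> continuous (fun x => a *: f x).
Proof.
move=> cf; apply: cont_mx => i; under [X in continuous X]eq_fun do rewrite mxE.
apply: cont_mul; first exact: cont_cst.
by apply: (cont_comp cf (g := fun x : 'rV[R]_N => x 0 i)); exact: continuous_coord.
Qed.

Lemma cont_cstv (T U : topologicalType) (a : U) : continuous (fun _ : T => a).
Proof. by move=> x; exact: cvg_cst. Qed.

Lemma cont_id (T : topologicalType) : continuous (fun x : T => x).
Proof. by move=> x; exact: cvg_id. Qed.

Lemma cont_dotmx (T : topologicalType) N (f g : T -> 'rV[R]_N) :
  continuous f -> continuous g -> continuous (fun x => dotmx (f x) (g x)).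
Proof.
move=> cf cg; apply: cont_sum => i; apply: cont_mul.
  by apply: (cont_comp cf (g := fun x : 'rV[R]_N => x 0 i)); exact: continuous_coord.
by apply: (cont_comp cg (g := fun x : 'rV[R]_N => x 0 i)); exact: continuous_coord.
Qed.
End ComplexContinuity.

(** * Dominated convergence and changes of variables *)

Section Limits.
Variable R : realType.
Local Notation C := R[i].
Local Notation Re := complex.Re.
Local Notation Im := complex.Im.

(** Sequential continuity suffices, which is the form that dominated convergence yields. *)
Lemma seq_continuous N (f : 'rV[R]_N -> R) (x : 'rV[R]_N) :
  (forall u : nat -> 'rV[R]_N, u n @[n --> \oo] --> x -> f (u n) @[n --> \oo] --> f x) ->
  continuous_at x f.
Proof.
move=> H; apply: contrapT => nc.
have [e e0 He] : exists2 e, 0 < e & forall d, 0 < d -> exists y, `|x - y| < d /\ e <= `|f x - f y|.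
  apply: contrapT => ne; apply: nc; apply/(@cvgrPdist_lt _ _ _ (nbhs x) (nbhs_filter x)) => e e0.
  apply: contrapT => nn; apply: ne; exists e => // d d0.
  apply: contrapT => nd; apply: nn; apply/nbhs_ballP; exists d => //= y; rewrite -ball_normE /= => xy.
  by rewrite ltNge; apply/negP => h; apply: nd; exists y.
have /choice[u Hu] n : exists y, `|x - y| < n.+1%:R^-1 /\ e <= `|f x - f y|.
  by apply: He; rewrite invr_gt0.
have ux : u n @[n --> \oo] --> x.
  apply/cvgrPdist_lt => d d0; near=> n; apply: (lt_trans (Hu n).1).
  by near: n; exact: (near_infty_natSinv_lt (PosNum d0)).
have /cvgrPdist_lt/(_ _ e0)[n0 _ /(_ n0 (leqnn _))] := H u ux.
by rewrite /= ltNge (Hu n0).2.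
Unshelve. all: by end_near. Qed.

Lemma rI_dct N (f_ : nat -> 'rV[R]_N -> R) f g : (forall n, rmeasurable (f_ n)) ->
  rmeasurable f -> rint g -> (forall n x, `|f_ n x| <= g x) ->
  (forall x, f_ n x @[n --> \oo] --> f x) -> rI (f_ n) @[n --> \oo] --> rI f.
Proof.
move=> mf_ mf ig fg ff.
have [|||||_ _ H] := @dominated_convergence _ _ _ (lebn R N) setT measurableT
  (fun n t => (f_ n (row_of_tup t))%:E) (fun t => (f (row_of_tup t))%:E) (fun t => (g (row_of_tup t))%:E).
- by move=> n; apply/measurable_EFinP; exact: mf_.
- by apply/measurable_EFinP; exact: mf.
- by apply: aeW => t _; apply: cvg_EFin; [exact: nearW|exact: ff].
- exact: ig.
- by apply: aeW => t n _; rewrite abse_EFin lee_fin.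
have if_ : rint f.
  apply: (rint_dom mf ig) => x.
  apply: (cvgr_to_le (cvg_norm (ff x))).
  by apply: nearW => n; exact: fg.
apply: fine_cvg; rewrite fineK; first exact: H.
exact: integrable_fin_num.
Qed.

(** The dependence on the parameter need not be jointly continuous: step functions in the
    second variable are allowed. *)
Lemma cont_rI_par a b (f : 'rV[R]_a -> 'rV[R]_b -> R) (w : 'rV[R]_a -> R) (h : 'rV[R]_b -> R) :
  (forall x, rmeasurable (f x)) -> (forall y, continuous (fun x => f x y)) ->
  continuous w -> rint h -> (forall y, 0 <= h y) ->
  (forall x y, `|f x y| <= w x * h y) -> continuous (fun x => rI (f x)).
Proof.
move=> mf cf cw ih h0 fh x; apply: seq_continuous => u ux.
have wu : \forall n \near \oo, w (u n) <= w x + 1.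
  have /cvgrPdist_lt/(_ 1 ltr01) : w (u n) @[n --> \oo] --> w x by apply: cvg_comp ux (cw x).
  by apply: filterS => n /=; rewrite distrC => /(le_lt_trans (ler_norm _)); lra.
have [n0 _ wn0] := wu.
rewrite -(cvg_shiftn n0).
apply: (@rI_dct _ (fun n y => f (u (n + n0)) y) _ (fun y => (w x + 1) * h y)).
- by move=> n; exact: mf.
- exact: mf.
- exact: rintZ.
- move=> n y; apply: (le_trans (fh _ _)); rewrite ler_wpM2r //.
  by apply: wn0; rewrite /= leq_addl.
- move=> y; have : f (u n) y @[n --> \oo] --> f x y.
    exact: (cvg_comp u (fun x => f x y) ux (cf y x)).
  by rewrite -(cvg_shiftn n0).
Qed.

Lemma cont_rI a b (F : 'rV[R]_(a + b) -> R) (w : 'rV[R]_a -> R) (h : 'rV[R]_b -> R) :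
  continuous F -> continuous w -> rint h -> (forall y, 0 <= h y) ->
  (forall x y, `|F (row_mx x y)| <= w x * h y) ->
  continuous (fun x => rI (fun y => F (row_mx x y))).
Proof.
move=> cF cw ih h0 Fh; apply: (cont_rI_par (w := w) (h := h)) => // [x|y].
  apply: continuous_rmeasurable; apply: (cont_comp (g := F)) => //.
  by apply: cont_row_mx; [exact: cont_cstv|exact: cont_id].
apply: (cont_comp (g := F)) => //.
by apply: cont_row_mx; [exact: cont_id|exact: cont_cstv].
Qed.

Lemma ccont_cintegral a b (F : 'rV[R]_(a + b) -> C) (w : 'rV[R]_a -> R) (h : 'rV[R]_b -> R) :
  ccont F -> continuous w -> rint h -> (forall y, 0 <= h y) ->
  (forall x y, normc (F (row_mx x y)) <= w x * h y) ->
  ccont (fun x => cintegral (fun y => F (row_mx x y))).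
Proof.
move=> [c1 c2] cw ih h0 Fh; split.
  by apply: (cont_rI c1 cw ih h0) => x y; exact: le_trans (Re_le_normc _) (Fh x y).
by apply: (cont_rI c2 cw ih h0) => x y; exact: le_trans (Im_le_normc _) (Fh x y).
Qed.

Lemma cintegral_dct N (f_ : nat -> 'rV[R]_N -> C) f g : (forall n, cmeasurable (f_ n)) ->
  cmeasurable f -> rint g -> (forall n x, normc (f_ n x) <= g x) ->
  (forall x, normc (f_ n x - f x) @[n --> \oo] --> (0:R)) ->
  normc (cintegral (f_ n) - cintegral f) @[n --> \oo] --> (0:R).
Proof.
move=> mf_ [m1 m2] ig fg ff.
have H1 : rI (fun x => Re (f_ n x)) @[n --> \oo] --> rI (fun x => Re (f x)).
  apply: (rI_dct _ m1 ig) => [n|n x|x]; first by case: (mf_ n).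
    exact: le_trans (Re_le_normc _) (fg n x).
  apply/subr_cvg0/cvgr0Pnorm_le => e e0.
  have /cvgr0Pnorm_le/(_ _ e0) := ff x; apply: filterS => n.
  rewrite ger0_norm ?normc_ge0 // => h.
  by have := Re_le_normc (f_ n x - f x); rewrite ReD ReN; move=> /le_trans; apply.
have H2 : rI (fun x => Im (f_ n x)) @[n --> \oo] --> rI (fun x => Im (f x)).
  apply: (rI_dct _ m2 ig) => [n|n x|x]; first by case: (mf_ n).
    exact: le_trans (Im_le_normc _) (fg n x).
  apply/subr_cvg0/cvgr0Pnorm_le => e e0.
  have /cvgr0Pnorm_le/(_ _ e0) := ff x; apply: filterS => n.
  rewrite ger0_norm ?normc_ge0 // => h.
  by have := Im_le_normc (f_ n x - f x); rewrite ImD ImN; move=> /le_trans; apply.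
move/subr_cvg0/cvgr0Pnorm_le : H1 => H1; move/subr_cvg0/cvgr0Pnorm_le : H2 => H2.
apply/cvgr0Pnorm_le => e e0; have e2 : 0 < e / 2 by lra.
near=> n; rewrite ger0_norm ?normc_ge0 //; apply: (le_trans (normc_le_ReIm _)).
rewrite [e]splitr lerD // ?ReD ?ImD ?ReN ?ImN.
  by near: n; exact: H1.
by near: n; exact: H2.
Unshelve. all: by end_near. Qed.

Lemma rI_affine N (f : 'rV[R]_N -> R) (a : R) b : a != 0 -> rint f ->
  rint (fun x => f (a *: x + b)) /\ rI f = `|a| ^+ N * rI (fun x => f (a *: x + b)).
Proof.
move=> a0.
have aN : 0 < `|a| ^+ N by rewrite exprn_gt0 // normr_gt0.
have mfa (g : 'rV[R]_N -> R) : rmeasurable g -> rmeasurable (fun x => g (a *: x + b)).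
  move=> mg; move: (measurableT_comp mg (measurable_aff_tup a b)); congr (measurable_fun _ _).
  by apply/funext => t /=; rewrite row_of_aff_tup.
have pos (g : 'rV[R]_N -> R) : (forall x, 0 <= g x) -> rint g ->
    rint (fun x => g (a *: x + b)) /\ rI g = `|a| ^+ N * rI (fun x => g (a *: x + b)).
  move=> g0 ig; have mg := rint_meas ig.
  have E : (\int[lebn R N]_t (g (row_of_tup t))%:E =
      (`|a| ^+ N)%:E * \int[lebn R N]_t (g (a *: row_of_tup t + b))%:E)%E.
    have mg' : measurable_fun setT (fun t => (g (row_of_tup t))%:E) by apply/measurable_EFinP; exact: mg.
    rewrite (lebn_affine b a0 mg'); last by move=> t; rewrite lee_fin.
    by congr (_ * _)%E; apply: eq_integral => t _; rewrite row_of_aff_tup.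
  have G0 : (0 <= \int[lebn R N]_t (g (a *: row_of_tup t + b))%:E)%E.
    by apply: integral_ge0 => t _; rewrite lee_fin.
  have fin : (\int[lebn R N]_t (g (a *: row_of_tup t + b))%:E < +oo)%E.
    rewrite ltey; apply/eqP => Ey; move: E; rewrite Ey gt0_muley ?lte_fin // => E'.
    have := integrable_fin_num measurableT ig; rewrite E'. by [].
  split; last by rewrite /rI /Rintegral E fineM // ge0_fin_numE.
  apply/integrableP; split; first by apply/measurable_EFinP; exact: mfa.
  move: fin; congr (_ < _)%E; apply: eq_integral => t _.
  by rewrite abse_EFin ger0_norm.
move=> fi; have mf := rint_meas fi.
have ni : rint (fun x => `|f x|).
  move: (integrable_abse fi); congr (integrable _ _ _).
have pi_ : rint (fun x => `|f x| + f x) by exact: rintD.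
have [p1 p2] := pos _ (fun x => normr_ge0 _) ni.
have q0 (x : 'rV[R]_N) : 0 <= `|f x| + f x.
  by have := ler_norm (- f x); rewrite normrN; lra.
have [q1 q2] := pos _ q0 pi_.
have r1 : rint (fun x => f (a *: x + b)).
  move: (rintD q1 (rintN p1)); congr rint; apply/funext => x.
  by rewrite addrAC subrr add0r.
split => //.
have dec (g : 'rV[R]_N -> R) : rint g -> rint (fun x => `|g x|) ->
    rI g = rI (fun x => `|g x| + g x) - rI (fun x => `|g x|).
  by move=> g1 g2; rewrite rID // addrAC subrr add0r.
by rewrite (dec f) // (dec (fun x => f (a *: x + b))) // mulrBr q2 p2.
Qed.

Lemma cintegral_affine N (f : 'rV[R]_N -> C) (a : R) b : a != 0 -> cintegrable f ->
  cintegrable (fun x => f (a *: x + b)) /\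
  cintegral f = (`|a| ^+ N)%:C * cintegral (fun x => f (a *: x + b)).
Proof.
move=> a0 /cintegrableP[f1 f2].
have [g1 e1] := rI_affine b a0 f1; have [g2 e2] := rI_affine b a0 f2.
split; first by apply/cintegrableP.
apply: ReIm_eq; rewrite ?ReM ?ImM /= mul0r ?subr0 ?addr0; [exact: e1|exact: e2].
Qed.

Lemma cintegral_shift N (f : 'rV[R]_N -> C) b : cintegrable f ->
  cintegral (fun x => f (x + b)) = cintegral f.
Proof.
move=> /(cintegral_affine b (oner_neq0 _))[_ ->]; rewrite normr1 expr1n mul1r.
by apply: eq_cintegral => x; rewrite scale1r.
Qed.

Lemma cintegrable_shift N (f : 'rV[R]_N -> C) b : cintegrable f ->
  cintegrable (fun x => f (x + b)).
Proof.
move=> /(cintegral_affine b (oner_neq0 _))[+ _]; congr cintegrable.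
by apply/funext => x; rewrite scale1r.
Qed.
End Limits.

(** * Directional derivatives *)

Section Deriv.
Variable R : realType.
Local Notation C := R[i].
Local Notation Re := complex.Re.
Local Notation Im := complex.Im.
Local Notation ebase i := (delta_mx 0 i : 'rV[R]_(_)).

Lemma is_deriveP (V : normedModType R) (f : V -> R) x v d :
  is_derive x v f d <-> h^-1 * (f (h *: v + x) - f x) @[h --> (0:R)^'] --> d.
Proof.
split=> [[df <-]|cf]; first exact: df.
split; first by apply/cvg_ex; exists d.
exact: cvg_lim cf.
Qed.

Lemma is_derive_line N (f : 'rV[R]_N -> R) x v (t : R) d :
  is_derive (t *: v + x) v f d <-> is_derive t 1 (fun h : R => f (h *: v + x)) d.
Proof.
have E : (fun h : R => h^-1 * (f (h *: v + (t *: v + x)) - f (t *: v + x))) =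
  (fun h : R => h^-1 * (f ((h *: (1 : R) + t) *: v + x) - f (t *: v + x))).
  by apply/funext => h; rewrite [h *: 1]mulr1 scalerDl addrA.
split=> /is_deriveP H; apply/is_deriveP; last by rewrite E.
by rewrite -E.
Qed.

Lemma line_mvt N (f : 'rV[R]_N -> R) x v (df : 'rV[R]_N -> R) h :
  (forall y, is_derive y v f (df y)) ->
  exists2 t, `|t| <= `|h| & f (h *: v + x) - f x = h * df (t *: v + x).
Proof.
move=> H.
have D (t : R) : is_derive t 1 (fun h : R => f (h *: v + x)) (df (t *: v + x)).
  by apply/is_derive_line.
have W (a b : R) : {within `[a, b], continuous (fun h : R => f (h *: v + x))}.
  by apply: derivable_within_continuous => t _; case: (D t).
have f0 : f x = f ((0 : R) *: v + x) by rewrite scale0r add0r.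
have [h0|h0] := leP 0 h.
  have [t] := @MVT_segment _ _ _ 0 h h0 (fun t _ => D t) (W _ _).
  rewrite in_itv /= => /andP[t1 t2] E; exists t; first by rewrite !ger0_norm.
  by rewrite f0 E subr0 mulrC.
have [t] := @MVT_segment _ _ _ h 0 (ltW h0) (fun t _ => D t) (W _ _).
rewrite in_itv /= => /andP[t1 t2] E; exists t.
  by rewrite !ler0_norm ?lerN2 // ltW.
by rewrite -[LHS]opprB [X in - (X - _)]f0 E sub0r mulrN opprK mulrC.
Qed.

(** The derivative in a second direction is taken at a moving point; the mean value theorem
    and the continuity of the partial derivative control the displacement. *)
Lemma is_derive_addcoord N (f : 'rV[R]_N -> R) x v d c i (p : 'rV[R]_N -> R) :
  is_derive x v f d -> (forall y, is_derive y (ebase i) f (p y)) -> continuous p ->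
  is_derive x (v + c *: ebase i) f (d + c * p x).
Proof.
move=> /is_deriveP dv dp cp; apply/is_deriveP.
pose q h := h^-1 * (f ((h * c) *: ebase i + (h *: v + x)) - f (h *: v + x)).
have -> : (fun h => h^-1 * (f (h *: (v + c *: ebase i) + x) - f x)) =
   (fun h => h^-1 * (f (h *: v + x) - f x) + q h).
  apply/funext => h; rewrite /q -mulrDr; congr (_ * _).
  rewrite [RHS]addrC addrA subrK; congr (f _ - _).
  by rewrite scalerDr scalerA [X in X + x = _]addrC -addrA.
apply: cvgD => //; apply/cvgrPdist_le => e e0.
have ce : 0 < e / (`|c| + 1) by rewrite divr_gt0 // ltr_wpDl.
have /(@cvgrPdist_le _ _ _ (nbhs x) (nbhs_filter x)) /(_ _ ce) /nbhs_ballP[d' d0 Hd] := cp x.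
pose K := `|v| + `|c| * `|ebase i : 'rV[R]_N| + 1.
have K0 : 0 < K by rewrite ltr_wpDl // addr_ge0 // mulr_ge0.
have dK : 0 < d' / K by rewrite divr_gt0.
have N0 : \forall h \near (0:R)^', h != 0 by exact: nbhs_dnbhs_neq.
have N1 : \forall h \near (0:R)^', `|h| < d' / K.
  by exact: dnbhs0_lt.
near=> h.
have hn0 : h != 0 by near: h.
have hd : `|h| < d' / K by near: h.
have [t t1 E] := @line_mvt _ f (h *: v + x) (ebase i) p (h * c) dp.
have -> : q h = c * p (t *: ebase i + (h *: v + x)) by rewrite /q E -!mulrA mulKf.
rewrite -mulrBr normrM mulrC.
have : `|p x - p (t *: ebase i + (h *: v + x))| <= e / (`|c| + 1).
  apply: Hd; rewrite -ball_normE /=.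
  rewrite addrA opprD addrCA subrr addr0 normrN.
  apply: (le_lt_trans (ler_normD _ _)); rewrite !normrZ.
  rewrite ltr_pdivlMr // in hd; apply: le_lt_trans hd.
  rewrite /K mulrDr mulr1 mulrDr; move: t1; rewrite normrM => t1.
  have := ler_wpM2r (normr_ge0 (ebase i : 'rV[R]_N)) t1.
  have := normr_ge0 h; rewrite -mulrA. lra.
move=> H; apply: (@le_trans _ _ (e / (`|c| + 1) * `|c|)); first by rewrite ler_wpM2r.
by rewrite mulrAC ler_pdivrMr ?ltr_wpDl // mulrDr mulr1; lra.
Unshelve. all: by end_near. Qed.

(** Continuous partial derivatives determine all directional derivatives; the proof adds
    the coordinates one after another. *)
Lemma is_derive_dir N (f : 'rV[R]_N -> R) (p : 'I_N -> 'rV[R]_N -> R) x v :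
  (forall i y, is_derive y (ebase i) f (p i y)) -> (forall i, continuous (p i)) ->
  is_derive x v f (\sum_i v 0 i * p i x).
Proof.
move=> dp cp.
have -> : v = \sum_i v 0 i *: ebase i by exact: row_sum_delta.
have -> : \sum_i (\sum_i v 0 i *: ebase i) 0 i * p i x = \sum_i v 0 i * p i x.
  by rewrite -row_sum_delta.
elim: (index_enum _) => [|i r IH].
  by rewrite !big_nil; exact: is_derive0.
rewrite !big_cons addrC [X in is_derive _ _ _ X]addrC.
by apply: is_derive_addcoord.
Qed.

Lemma is_derive_comp N (g : R -> R) (u : 'rV[R]_N -> R) x v du dg :
  is_derive x v u du -> is_derive (u x) 1 g dg -> is_derive x v (fun y => g (u y)) (dg * du).
Proof.
move=> hu hg.
have [H1 _] := is_derive_line u x v 0 du; have [_ H2] := is_derive_line (fun y => g (u y)) x v 0 (dg * du).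
rewrite scale0r add0r in H1 H2; apply: H2.
apply: (@is_derive1_comp _ g (fun h : R => u (h *: v + x)) 0 dg du _ (H1 hu)).
by rewrite scale0r add0r.
Qed.

Lemma is_derive_aff M N (f : 'rV[R]_N -> R) (A : 'M[R]_(M, N)) b x v d :
  is_derive (x *m A + b) (v *m A) f d -> is_derive x v (fun y => f (y *m A + b)) d.
Proof.
move=> /is_deriveP H; apply/is_deriveP.
rewrite (_ : (fun h => _) = (fun h => h^-1 * (f (h *: (v *m A) + (x *m A + b)) - f (x *m A + b)))) //.
by apply/funext => h; rewrite mulmxDl -scalemxAl addrA.
Qed.

(** A relation rather than a function, so that the rules of calculus compute the
    derivative together with its existence. *)
Definition cder N (v : 'rV[R]_N) (f : 'rV[R]_N -> C) x (d : C) : Prop :=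
  is_derive x v (fun y => Re (f y)) (Re d) /\ is_derive x v (fun y => Im (f y)) (Im d).

Lemma eq_cder N v (f g : 'rV[R]_N -> C) x d d' : f =1 g -> d = d' -> cder v f x d -> cder v g x d'.
Proof. by move=> /funext -> ->. Qed.

Lemma cder_cst N v (a : C) (x : 'rV[R]_N) : cder v (fun=> a) x 0.
Proof. by split; exact: is_derive_cst. Qed.

Lemma cder_add N v (f g : 'rV[R]_N -> C) x d e : cder v f x d -> cder v g x e ->
  cder v (fun y => f y + g y) x (d + e).
Proof.
move=> [f1 f2] [g1 g2]; split; rewrite ?ReD ?ImD.
  rewrite (_ : (fun y => _) = (fun y => Re (f y)) + (fun y => Re (g y))); first exact: is_deriveD.
  by apply/funext => y; rewrite ReD.
rewrite (_ : (fun y => _) = (fun y => Im (f y)) + (fun y => Im (g y))); first exact: is_deriveD.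
by apply/funext => y; rewrite ImD.
Qed.

Lemma is_deriveMf N (f g : 'rV[R]_N -> R) x v d e : is_derive x v f d -> is_derive x v g e ->
  is_derive x v (fun y => f y * g y) (d * g x + f x * e).
Proof.
move=> hf hg; have := is_deriveM hf hg; congr is_derive.
by rewrite addrC [in LHS]/GRing.scale /= mulrC.
Qed.

Lemma is_deriveDf N (f g : 'rV[R]_N -> R) x v d e : is_derive x v f d -> is_derive x v g e ->
  is_derive x v (fun y => f y + g y) (d + e).
Proof. exact: is_deriveD. Qed.

Lemma is_deriveNf N (f : 'rV[R]_N -> R) x v d : is_derive x v f d ->
  is_derive x v (fun y => - f y) (- d).
Proof. exact: is_deriveN. Qed.

Lemma cder_mul N v (f g : 'rV[R]_N -> C) x d e : cder v f x d -> cder v g x e ->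
  cder v (fun y => f y * g y) x (d * g x + f x * e).
Proof.
move=> [f1 f2] [g1 g2]; split.
  have := is_deriveDf (is_deriveMf f1 g1) (is_deriveNf (is_deriveMf f2 g2)).
  congr is_derive; first by apply/funext => y; rewrite ReM.
  by rewrite ReD !ReM; ring.
have := is_deriveDf (is_deriveMf f1 g2) (is_deriveMf f2 g1).
congr is_derive; first by apply/funext => y; rewrite ImM.
by rewrite ImD !ImM; ring.
Qed.

Lemma cder_scale N v (f : 'rV[R]_N -> C) a x d : cder v f x d ->
  cder v (fun y => a * f y) x (a * d).
Proof.
by move=> /(cder_mul (cder_cst v a x)); rewrite mul0r add0r.
Qed.

Lemma cder_conj N v (f : 'rV[R]_N -> C) x d : cder v f x d ->
  cder v (fun y => conjc (f y)) x (conjc d).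
Proof.
move=> [f1 f2]; split.
  by move: f1; congr is_derive; [apply/funext => y; rewrite ReConj|rewrite ReConj].
by have := is_deriveNf f2; congr is_derive; [apply/funext => y; rewrite ImConj|rewrite ImConj].
Qed.

Lemma cder_cexp N v (f : 'rV[R]_N -> C) x d : cder v f x d ->
  cder v (fun y => cexp (f y)) x (d * cexp (f x)).
Proof.
move=> [f1 f2].
have hE := is_derive_comp f1 (is_derive_expR (Re (f x))).
have hc := is_derive_comp f2 (is_derive_cos (Im (f x))).
have hs := is_derive_comp f2 (is_derive_sin (Im (f x))).
have eE z : cexp z = (expR (Re z) * cos (Im z)) +i* (expR (Re z) * sin (Im z)) :> C.
  by apply: ReIm_eq; rewrite ?ReM ?ImM /=; ring.
split.
  have := is_deriveMf hE hc; congr is_derive; first by apply/funext => y; rewrite eE.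
  by rewrite eE ReM /=; ring.
have := is_deriveMf hE hs; congr is_derive; first by apply/funext => y; rewrite eE.
by rewrite eE ImM /=; ring.
Qed.

Lemma cder_aff M N v (f : 'rV[R]_N -> C) (A : 'M[R]_(M, N)) b x d :
  cder (v *m A) f (x *m A + b) d -> cder v (fun y => f (y *m A + b)) x d.
Proof. by move=> [h1 h2]; split; [exact: (is_derive_aff h1)|exact: (is_derive_aff h2)]. Qed.

Lemma cder_uniq N v (f : 'rV[R]_N -> C) x d : cder v f x d ->
  d = 'D_v (fun y => Re (f y)) x +i* 'D_v (fun y => Im (f y)) x.
Proof. by move=> [h1 h2]; rewrite !derive_val; case: d h1 h2. Qed.

Lemma cder_coord N v (x : 'rV[R]_N) i : cder v (fun y => (y 0 i)%:C) x (v 0 i)%:C.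
Proof.
split => /=; last exact: is_derive_cst.
apply/is_deriveP; apply: cvg_near_cst; near=> h.
rewrite !mxE addrK mulrA mulVf ?mul1r //.
by near: h; exact: nbhs_dnbhs_neq.
Unshelve. all: by end_near. Qed.

Lemma cder_sum N v (I : Type) (r : seq I) (F : I -> 'rV[R]_N -> C) x (d : I -> C) :
  (forall i, cder v (F i) x (d i)) ->
  cder v (fun y => \sum_(i <- r) F i y) x (\sum_(i <- r) d i).
Proof.
move=> dF; elim: r => [|i r IH].
  by apply: (eq_cder _ _ (cder_cst v 0 x)) => [y|]; rewrite big_nil.
by apply: (eq_cder _ _ (cder_add (dF i) IH)) => [y|]; rewrite big_cons.
Qed.

Lemma cder_dir N (f : 'rV[R]_N -> C) (p : 'I_N -> 'rV[R]_N -> C) x v :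
  (forall i y, cder (ebase i) f y (p i y)) -> (forall i, ccont (p i)) ->
  cder v f x (\sum_i (v 0 i)%:C * p i x).
Proof.
move=> dp cp; split.
  have := @is_derive_dir _ (fun y => Re (f y)) (fun i y => Re (p i y)) x v _ _.
  have -> : Re (\sum_i (v 0 i)%:C * p i x) = \sum_i v 0 i * Re (p i x).
    elim: (index_enum _) => [|i r IH]; first by rewrite !big_nil.
    by rewrite !big_cons ReD IH ReM /= mul0r subr0.
  by apply => i; [move=> y; case: (dp i y)|case: (cp i)].
have := @is_derive_dir _ (fun y => Im (f y)) (fun i y => Im (p i y)) x v _ _.
have -> : Im (\sum_i (v 0 i)%:C * p i x) = \sum_i v 0 i * Im (p i x).
  elim: (index_enum _) => [|i r IH]; first by rewrite !big_nil.
  by rewrite !big_cons ImD IH ImM /= mul0r addr0.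
by apply => i; [move=> y; case: (dp i y)|case: (cp i)].
Qed.
End Deriv.

(** * Smooth functions with bounds on all derivatives *)

Section Smooth.
Variable R : realType.
Local Notation C := R[i].
Local Notation Re := complex.Re.
Local Notation Im := complex.Im.
Local Notation ebase i := (delta_mx 0 i : 'rV[R]_(_)).
Local Notation fn N := ('rV[R]_N -> C).

Lemma csmoothP N (f : fn N) : csmooth f <-> forall s, ccont (cpderiv s f) /\
  forall x i, cder (ebase i) (cpderiv s f) x (cpderiv (i :: s) f x).
Proof.
split=> [[h1 h2] s|H].
  have [c1 d1] := h1 s; have [c2 d2] := h2 s; split; first by split.
  by move=> x i; split; [exact: (derivableP (d1 x i))|exact: (derivableP (d2 x i))].
split=> s; have [[c1 c2] d] := H s; split => //= x i; have [[h1 _] [h2 _]] := d x i => //.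
Qed.

Lemma csmooth_ccont N (f : fn N) : csmooth f -> ccont f.
Proof. by move=> /csmoothP/(_ [::])[+ _]; apply: eq_ccont => x; rewrite /cpderiv /=; case: (f x). Qed.

Lemma cpderiv_nil N (f : fn N) : cpderiv [::] f = f.
Proof. by apply/funext => x; rewrite /cpderiv /=; case: (f x). Qed.

Lemma cpderiv_cons N i s (f : fn N) : cpderiv (i :: s) f = cpderiv [:: i] (cpderiv s f).
Proof. by []. Qed.

Lemma cpderiv_cat N s1 s2 (f : fn N) : cpderiv (s1 ++ s2) f = cpderiv s1 (cpderiv s2 f).
Proof.
elim: s1 => [|i s1 IH]; first by rewrite cpderiv_nil.
by rewrite cat_cons cpderiv_cons IH.
Qed.

Lemma cpderiv_eq N (f g : fn N) i : (forall x, cder (ebase i) f x (g x)) -> cpderiv [:: i] f = g.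
Proof. by move=> H; apply/funext => x; rewrite (cder_uniq (H x)). Qed.

Lemma csmooth_cder N (f : fn N) i x : csmooth f -> cder (ebase i) f x (cpderiv [:: i] f x).
Proof. by move=> /csmoothP/(_ [::])[_ /(_ x i)]; rewrite cpderiv_nil. Qed.

Lemma csmooth_cpderiv N s (f : fn N) : csmooth f -> csmooth (cpderiv s f).
Proof.
move=> /csmoothP H; apply/csmoothP => s'; rewrite -cpderiv_cat; split; first by case: (H (s' ++ s)).
by move=> x i; rewrite -cpderiv_cat; case: (H (s' ++ s)) => _; apply.
Qed.

(** Coinduction principle for smoothness: a class of continuous functions that is
    stable under partial derivatives consists of smooth functions. *)
Lemma csmooth_coind N (D : fn N -> Prop) :
  (forall f, D f -> ccont f /\ forall i, exists2 g, D g & forall x, cder (ebase i) f x (g x)) ->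
  forall f, D f -> csmooth f /\ forall s, D (cpderiv s f).
Proof.
move=> H f Df.
have Ds s : D (cpderiv s f).
  elim: s => [|i s IH]; first by rewrite cpderiv_nil.
  have [_ /(_ i)[g Dg gE]] := H _ IH; by rewrite cpderiv_cons (cpderiv_eq gE).
split => //; apply/csmoothP => s; have [cf dH] := H _ (Ds s); split => // x i.
by have [g Dg gE] := dH i; rewrite cpderiv_cons (cpderiv_eq gE).
Qed.

(** The derivative of a product or of a composite is a linear combination of functions of
    the same kind, so the coinduction is run on linear spans. *)
Inductive cspan N (D : fn N -> Prop) : fn N -> Prop :=
| cspan_in f : D f -> cspan D f
| cspan_add f g : cspan D f -> cspan D g -> cspan D (fun x => f x + g x)
| cspan_scale a f : cspan D f -> cspan D (fun x => a * f x).

Definition linclosed N (B : fn N -> Prop) : Prop :=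
  (forall f g, B f -> B g -> B (fun x => f x + g x)) /\
  (forall a f, B f -> B (fun x => a * f x)).

Lemma cspan_sum N (D : fn N -> Prop) (I : eqType) (r : seq I) (i0 : I) (F : I -> fn N) :
  (forall i, cspan D (F i)) -> cspan D (F i0) -> cspan D (fun x => \sum_(i <- r) F i x).
Proof.
move=> DF D0; elim: r => [|i r IH].
  rewrite (_ : (fun x => _) = (fun x => 0 * F i0 x)); first exact: cspan_scale.
  by apply/funext => x; rewrite big_nil mul0r.
rewrite (_ : (fun x => _) = (fun x => F i x + \sum_(j <- r) F j x)); first exact: cspan_add.
by apply/funext => x; rewrite big_cons.
Qed.

(** Schwartz functions, functions of polynomial growth and families of Schwartz functions
    are the three cases of interest; the closure properties below then reduce to
    elementary properties of the bound [B]. *)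
Definition sm N (B : fn N -> Prop) (f : fn N) : Prop := csmooth f /\ forall s, B (cpderiv s f).

(** Coinduction for smoothness and the bound together: it is enough that each derivative of
    a member of [D] is a combination of members of [D]. *)
Lemma sm_coind N (D B : fn N -> Prop) : linclosed B ->
  (forall f, D f -> [/\ ccont f, B f & forall i, exists2 g, cspan D g &
     forall x, cder (ebase i) f x (g x)]) ->
  forall f, cspan D f -> sm B f.
Proof.
move=> [BD BZ] H f Df.
have BS g : cspan D g -> B g.
  elim=> [h /H[]//|h k _ + _|a h _]; [exact: BD|exact: BZ].
have [//|sf Ds] := @csmooth_coind _ (cspan D) _ f Df; last by split=> // s; exact: BS.
move=> g; elim=> [h /H[]//|h k _ [ch dh] _ [ck dk]|a h _ [ch dh]].
  split; first exact: ccont_add.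
  move=> i; have [h' h1 h2] := dh i; have [k' k1 k2] := dk i.
  by exists (fun x => h' x + k' x) => [|x]; [exact: cspan_add|exact: cder_add].
split; first by apply: ccont_mul => //; exact: ccont_cst.
move=> i; have [h' h1 h2] := dh i.
by exists (fun x => a * h' x) => [|x]; [exact: cspan_scale|exact: cder_scale].
Qed.

Lemma sm_smooth N (B : fn N -> Prop) f : sm B f -> csmooth f.
Proof. by case. Qed.

Lemma sm_ccont N (B : fn N -> Prop) f : sm B f -> ccont f.
Proof. by case=> /csmooth_ccont. Qed.

Lemma sm_bound N (B : fn N -> Prop) f : sm B f -> B f.
Proof. by case=> _ /(_ [::]); rewrite cpderiv_nil. Qed.

Lemma sm_cpderiv N (B : fn N -> Prop) s f : sm B f -> sm B (cpderiv s f).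
Proof.
by move=> [h1 h2]; split; [exact: csmooth_cpderiv|move=> s'; rewrite -cpderiv_cat].
Qed.

Lemma sm_sub N (B B' : fn N -> Prop) f : (forall g, B g -> B' g) -> sm B f -> sm B' f.
Proof. by move=> BB [h1 h2]; split=> // s; exact: BB. Qed.

Lemma sm_span N (B : fn N -> Prop) : linclosed B -> forall f, cspan (sm B) f -> sm B f.
Proof.
move=> lB; apply: (sm_coind lB) => f sf; split; [exact: sm_ccont sf|exact: sm_bound sf|].
move=> i; exists (cpderiv [:: i] f); first by apply: cspan_in; exact: sm_cpderiv.
by move=> x; apply: csmooth_cder; exact: sm_smooth sf.
Qed.

Lemma sm_add N (B : fn N -> Prop) f g : linclosed B -> sm B f -> sm B g -> sm B (fun x => f x + g x).
Proof. by move=> lB sf sg; apply: sm_span => //; apply: cspan_add; exact: cspan_in. Qed.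

Lemma sm_scale N (B : fn N -> Prop) a f : linclosed B -> sm B f -> sm B (fun x => a * f x).
Proof. by move=> lB sf; apply: sm_span => //; apply: cspan_scale; exact: cspan_in. Qed.

(** The class of all products is stable under derivation up to sums, so Leibniz's formula is
    never written out. *)
Lemma sm_mul N (B1 B2 B : fn N -> Prop) : linclosed B ->
  (forall f g, B1 f -> B2 g -> B (fun x => f x * g x)) ->
  forall f g, sm B1 f -> sm B2 g -> sm B (fun x => f x * g x).
Proof.
move=> lB BM f g sf sg.
pose D h := exists f g, [/\ sm B1 f, sm B2 g & h = (fun x => f x * g x)].
apply: (@sm_coind _ D) => //; last by apply: cspan_in; exists f, g.
move=> _ [f' [g' [s1 s2 ->]]]; split.
- by apply: ccont_mul; [exact: sm_ccont s1|exact: sm_ccont s2].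
- by apply: BM; [exact: sm_bound s1|exact: sm_bound s2].
move=> i; exists (fun x => cpderiv [:: i] f' x * g' x + f' x * cpderiv [:: i] g' x).
  apply: cspan_add; apply: cspan_in.
    by exists (cpderiv [:: i] f'), g'; split=> //; exact: sm_cpderiv.
  by exists f', (cpderiv [:: i] g'); split=> //; exact: sm_cpderiv.
by move=> x; apply: cder_mul; apply: csmooth_cder; [exact: sm_smooth s1|exact: sm_smooth s2].
Qed.

Lemma sm_aff M N (B1 : fn N -> Prop) (B : fn M -> Prop) (A : 'M[R]_(M, N)) b : linclosed B ->
  (forall f, B1 f -> B (fun x => f (x *m A + b))) ->
  forall f, sm B1 f -> sm B (fun x => f (x *m A + b)).
Proof.
move=> lB BA f sf.
pose D h := exists2 f, sm B1 f & h = (fun x => f (x *m A + b)).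
apply: (@sm_coind _ D) => //; last by apply: cspan_in; exists f.
move=> _ [g sg ->]; split.
- apply: ccont_comp; last exact: sm_ccont sg.
  by apply: cont_addv; [exact: cont_mulmx|exact: cont_cstv].
- by apply: BA; exact: sm_bound sg.
move=> i; exists (fun x => \sum_j ((ebase i *m A) 0 j)%:C * cpderiv [:: j] g (x *m A + b)).
  (* [cspan_sum] needs an index; in dimension 0 the sum is zero *)
  have [N0 _|j0] := pickP 'I_N.
    have P j : cspan D (fun x => ((ebase i *m A) 0 j)%:C * cpderiv [:: j] g (x *m A + b)).
      apply: (@cspan_scale _ _ _ (fun x => cpderiv [:: j] g (x *m A + b))).
      by apply: cspan_in; exists (cpderiv [:: j] g) => //; exact: sm_cpderiv.
    exact: (@cspan_sum _ _ _ _ N0 _ P (P N0)).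
  rewrite (_ : (fun x => _) = (fun x => 0 * g (x *m A + b))).
    by apply: cspan_scale; apply: cspan_in; exists g.
  by apply/funext => x; rewrite mul0r big1 // => j; have := j0 j.
move=> x; apply: cder_aff; apply: (@cder_dir _ _ _ (fun j => cpderiv [:: j] g)).
  by move=> j y; apply: csmooth_cder; exact: sm_smooth sg.
by move=> j; apply: sm_ccont; apply: sm_cpderiv; exact: sg.
Qed.

Lemma sm_conj N (B1 B : fn N -> Prop) : linclosed B ->
  (forall f, B1 f -> B (fun x => conjc (f x))) ->
  forall f, sm B1 f -> sm B (fun x => conjc (f x)).
Proof.
move=> lB BA f sf.
pose D h := exists2 f, sm B1 f & h = (fun x => conjc (f x)).
apply: (@sm_coind _ D) => //; last by apply: cspan_in; exists f.
move=> _ [g sg ->]; split.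
- by apply: ccont_conj; exact: sm_ccont sg.
- by apply: BA; exact: sm_bound sg.
move=> i; exists (fun x => conjc (cpderiv [:: i] g x)).
  by apply: cspan_in; exists (cpderiv [:: i] g) => //; exact: sm_cpderiv.
by move=> x; apply: cder_conj; apply: csmooth_cder; exact: sm_smooth sg.
Qed.

Lemma cpderivD N s (f g : fn N) : csmooth f -> csmooth g ->
  cpderiv s (fun x => f x + g x) = (fun x => cpderiv s f x + cpderiv s g x).
Proof.
move=> sf sg; elim: s => [|i s IH]; first by rewrite !cpderiv_nil.
rewrite cpderiv_cons IH; apply: cpderiv_eq => x.
by apply: cder_add; apply: csmooth_cder; exact: csmooth_cpderiv.
Qed.

Lemma cpderivZ N s a (f : fn N) : csmooth f ->
  cpderiv s (fun x => a * f x) = (fun x => a * cpderiv s f x).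
Proof.
move=> sf; elim: s => [|i s IH]; first by rewrite !cpderiv_nil.
rewrite cpderiv_cons IH; apply: cpderiv_eq => x.
by apply: cder_scale; apply: csmooth_cder; exact: csmooth_cpderiv.
Qed.
End Smooth.

(** * Differentiation under the integral sign *)

Section UnderTheIntegral.
Variable R : realType.
Local Notation C := R[i].
Local Notation Re := complex.Re.
Local Notation Im := complex.Im.
Local Notation ebase i := (delta_mx 0 i : 'rV[R]_(_)).

Lemma jbr_ebase_shift N (i : 'I_N) (x : 'rV[R]_N) (t : R) k : `|t| <= 1 ->
  jbr (t *: ebase i + x) ^+ k <= 4 ^+ k * jbr x ^+ k.
Proof.
move=> t1; rewrite -exprMn lerXn2r ?nnegrE ?jbr_ge0 ?mulr_ge0 ?jbr_ge0 //.
apply: (le_trans (jbrD _ _)); rewrite mulrA ler_wpM2r ?jbr_ge0 //.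
have : jbr (t *: ebase i : 'rV[R]_N) <= 2; last lra.
rewrite -(@ler_pXn2r _ 2) ?nnegrE ?jbr_ge0 // jbr_sqr.
have -> : dotmx (t *: ebase i) (t *: ebase i : 'rV[R]_N) = t ^+ 2.
  rewrite /dotmx (bigD1 i) //= big1 ?addr0 ?mxE ?eqxx /= ?mulr1 // => j ji.
  by rewrite !mxE (negbTE ji) andbF mulr0 mul0r.
have : t ^+ 2 <= 1 by rewrite -(@real_normK _ t) ?num_real // exprn_ile1.
by lra.
Qed.

Lemma is_derive_rI a b (F G : 'rV[R]_(a + b) -> R) (i : 'I_a) (M : R) k (h : 'rV[R]_b -> R) x :
  (forall x y, is_derive x (ebase i) (fun x => F (row_mx x y)) (G (row_mx x y))) ->
  (forall x, rint (fun y => F (row_mx x y))) -> rint h -> (forall y, 0 <= h y) ->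
  (forall x y, `|G (row_mx x y)| <= M * jbr x ^+ k * h y) ->
  is_derive x (ebase i) (fun x => rI (fun y => F (row_mx x y))) (rI (fun y => G (row_mx x y))).
Proof.
move=> dF iF ih h0 hG.
have M0 y : h y != 0 -> 0 <= M.
  move=> hy; have := le_trans (normr_ge0 _) (hG 0 y); rewrite jbr0 expr1n mulr1.
  by rewrite pmulr_lge0 // lt0r hy h0.
pose f t (y : b.-tuple (measurableTypeR R)) := F (row_mx (t *: ebase i + x) (row_of_tup y)).
have I0 : `](-1 : R), 1[%classic 0 by rewrite /= in_itv /= ltrN10 ltr01.
have df t (y : b.-tuple (measurableTypeR R)) :
    is_derive (t : R) 1 (f ^~ y) (G (row_mx (t *: ebase i + x) (row_of_tup y))).
  by have [H _] := is_derive_line (fun x => F (row_mx x (row_of_tup y))) x (ebase i) t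
       (G (row_mx (t *: ebase i + x) (row_of_tup y))); apply: H; exact: dF.
pose H y := `|M| * (4 ^+ k * jbr x ^+ k) * h y.
have H0 y : 0 <= H y by rewrite !mulr_ge0 // jbrX_ge0.
have iH : rint H by exact: rintZ.
have ub t (y : b.-tuple (measurableTypeR R)) : `](-1 : R), 1[%classic t -> setT y ->
    `|partial1of2 f t y| <= H (row_of_tup y).
  rewrite /= in_itv /= => /andP[t1 t2] _.
  rewrite partial1of2E (@derive_val _ _ _ _ _ _ _ (df t y)); apply: (le_trans (hG _ _)).
  rewrite ler_wpM2r //; apply: (@le_trans _ _ (`|M| * jbr (t *: ebase i + x) ^+ k)).
    by rewrite ler_wpM2r ?jbrX_ge0 // ler_norm.
  by rewrite ler_wpM2l // jbr_ebase_shift // ler_norml ltW // ltW.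
have intf t : `](-1 : R), 1[%classic t -> (lebn R b).-integrable setT (EFin \o f t).
  by move=> _; exact: iF.
have derf t (y : b.-tuple (measurableTypeR R)) : `](-1 : R), 1[%classic t -> setT y ->
    derivable (f ^~ y) t 1 by move=> _ _; case: (df t y).
have D1 := derivable_under_integral measurableT I0 intf derf (fun y => H0 (row_of_tup y)) iH ub.
have D2 := differentiation_under_integral measurableT I0 intf derf (fun y => H0 (row_of_tup y)) iH ub.
have [_ L] := is_derive_line (fun x => rI (fun y => F (row_mx x y))) x (ebase i) 0 (rI (fun y => G (row_mx x y))).
rewrite scale0r add0r in L; apply: L; split; first exact: D1.
rewrite -derive1E [LHS]D2; apply: eq_Rintegral => y _.
by rewrite partial1of2E (@derive_val _ _ _ _ _ _ _ (df 0 y)) scale0r add0r.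
Qed.

(** Polynomial growth in the parameter and an integrable majorant in the other variable
    bound the difference quotients near [x]. *)
Lemma cder_cintegral a b (F G : 'rV[R]_(a + b) -> C) (i : 'I_a) (M : R) k (h : 'rV[R]_b -> R) x :
  (forall x y, cder (ebase i) (fun x => F (row_mx x y)) x (G (row_mx x y))) ->
  (forall x, cintegrable (fun y => F (row_mx x y))) -> rint h -> (forall y, 0 <= h y) ->
  (forall x y, normc (G (row_mx x y)) <= M * jbr x ^+ k * h y) ->
  cder (ebase i) (fun x => cintegral (fun y => F (row_mx x y))) x
     (cintegral (fun y => G (row_mx x y))).
Proof.
move=> dF iF ih h0 hG; split.
  apply: (@is_derive_rI _ _ (fun z => Re (F z)) (fun z => Re (G z)) i M k h) => //.
  - by move=> x' y; case: (dF x' y).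
  - by move=> x'; have /cintegrableP[] := iF x'.
  - by move=> x' y; exact: le_trans (Re_le_normc _) (hG x' y).
apply: (@is_derive_rI _ _ (fun z => Im (F z)) (fun z => Im (G z)) i M k h) => //.
- by move=> x' y; case: (dF x' y).
- by move=> x'; have /cintegrableP[] := iF x'.
- by move=> x' y; exact: le_trans (Im_le_normc _) (hG x' y).
Qed.
End UnderTheIntegral.

(** * Polynomial growth and rapid decrease *)

Section Bounds.
Variable R : realType.
Local Notation C := R[i].
Local Notation fn N := ('rV[R]_N -> C).
Local Notation ebase i := (delta_mx 0 i : 'rV[R]_(_)).

Definition Bpoly N (f : fn N) : Prop := exists M k, forall x, normc (f x) <= M * jbr x ^+ k.
Definition Brd N (f : fn N) : Prop := forall k, exists M, forall x, jbr x ^+ k * normc (f x) <= M.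

(** The bound satisfied by a family of Schwartz functions of [y] indexed by [x], whose
    seminorms grow polynomially in [x]; wave packets are the example. *)
Definition Bsf a b (f : fn (a + b)) : Prop := forall k, exists M K, forall x y,
  jbr y ^+ k * normc (f (row_mx x y)) <= M * jbr x ^+ K.

Lemma Bpoly_ge0 N (f : fn N) : Bpoly f -> exists M k, 0 <= M /\ forall x, normc (f x) <= M * jbr x ^+ k.
Proof.
move=> [M [k H]]; exists `|M|, k; split => // x; apply: (le_trans (H x)).
by rewrite ler_wpM2r ?jbrX_ge0 // ler_norm.
Qed.

Lemma Brd_ge0 N (f : fn N) : Brd f -> forall k, exists2 M, 0 <= M & forall x, jbr x ^+ k * normc (f x) <= M.
Proof.
move=> H k; have [M HM] := H k; exists M => //.
by apply: le_trans (HM 0); rewrite mulr_ge0 ?normc_ge0 ?jbrX_ge0.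
Qed.

Lemma Bsf_ge0 a b (f : fn (a + b)) : Bsf f -> forall k, exists M K, 0 <= M /\ forall x y,
  jbr y ^+ k * normc (f (row_mx x y)) <= M * jbr x ^+ K.
Proof.
move=> H k; have [M [K HM]] := H k; exists `|M|, K; split => // x y; apply: (le_trans (HM x y)).
by rewrite ler_wpM2r ?jbrX_ge0 // ler_norm.
Qed.

Lemma linclosed_Bpoly N : linclosed (@Bpoly N).
Proof.
split=> [f g /Bpoly_ge0[M [k [M0 H]]] /Bpoly_ge0[M' [k' [M0' H']]]|a f [M [k H]]].
  exists (M + M'), (k + k')%N => x; apply: (le_trans (normcD _ _)); rewrite mulrDl lerD //.
    by apply: (le_trans (H x)); rewrite ler_wpM2l // jbrX_le // leq_addr.
  by apply: (le_trans (H' x)); rewrite ler_wpM2l // jbrX_le // leq_addl.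
by exists (normc a * M), k => x; rewrite normcM -mulrA ler_wpM2l ?normc_ge0.
Qed.

Lemma linclosed_Brd N : linclosed (@Brd N).
Proof.
split=> [f g H H' k|a f H k].
  have [M h] := H k; have [M' h'] := H' k; exists (M + M') => x.
  apply: (@le_trans _ _ (jbr x ^+ k * (normc (f x) + normc (g x)))).
    by rewrite ler_wpM2l ?jbrX_ge0 // normcD.
  by rewrite mulrDr lerD.
have [M h] := H k; exists (normc a * M) => x.
by rewrite normcM mulrCA ler_wpM2l ?normc_ge0.
Qed.

Lemma linclosed_Bsf a b : linclosed (@Bsf a b).
Proof.
split=> [f g H H' k|c f H k].
  have [M [K [M0 h]]] := Bsf_ge0 H k; have [M' [K' [M0' h']]] := Bsf_ge0 H' k.
  exists (M + M'), (K + K')%N => x y.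
  apply: (@le_trans _ _ (jbr y ^+ k * (normc (f (row_mx x y)) + normc (g (row_mx x y))))).
    by rewrite ler_wpM2l ?jbrX_ge0 // normcD.
  rewrite mulrDr mulrDl lerD //.
    by apply: (le_trans (h x y)); rewrite ler_wpM2l // jbrX_le // leq_addr.
  by apply: (le_trans (h' x y)); rewrite ler_wpM2l // jbrX_le // leq_addl.
have [M [K h]] := H k; exists (normc c * M), K => x y.
by rewrite normcM mulrCA -mulrA ler_wpM2l ?normc_ge0.
Qed.

(** The definition through constants for each weight and each word is the instance of rapid
    decrease in the calculus of bounds. *)
Lemma schwartzP N (f : fn N) : schwartz f <-> sm (@Brd N) f.
Proof.
by split=> -[h1 h2]; split=> //; [move=> s k; exact: h2|move=> k s; exact: h2].
Qed.

Lemma Brd_poly_mul N (f g : fn N) : Brd f -> Bpoly g -> Brd (fun x => f x * g x).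
Proof.
move=> H /Bpoly_ge0[M [k [M0 h]]] l; have [M' M0' h'] := Brd_ge0 H (l + k).
exists (M' * M) => x; rewrite normcM.
apply: (@le_trans _ _ (jbr x ^+ l * (normc (f x) * (M * jbr x ^+ k)))).
  by rewrite ler_wpM2l ?jbrX_ge0 // ler_wpM2l ?normc_ge0.
have -> : jbr x ^+ l * (normc (f x) * (M * jbr x ^+ k)) = jbr x ^+ (l + k) * normc (f x) * M.
  by rewrite exprD; ring.
by rewrite ler_wpM2r.
Qed.

Lemma Bsf_poly_mul a b (f g : fn (a + b)) : Bsf f -> Bpoly g -> Bsf (fun x => f x * g x).
Proof.
move=> H /Bpoly_ge0[M [k [M0 h]]] l; have [M' [K [M0' h']]] := Bsf_ge0 H (l + k).
exists (M' * M), (K + k)%N => x y; rewrite normcM.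
apply: (@le_trans _ _ (jbr y ^+ l * (normc (f (row_mx x y)) * (M * (jbr x ^+ k * jbr y ^+ k))))).
  rewrite ler_wpM2l ?jbrX_ge0 // ler_wpM2l ?normc_ge0 // (le_trans (h _)) // ler_wpM2l //.
  by rewrite -exprMn lerXn2r ?nnegrE ?mulr_ge0 ?jbr_ge0 // jbr_row_mx.
have -> : jbr y ^+ l * (normc (f (row_mx x y)) * (M * (jbr x ^+ k * jbr y ^+ k))) =
  jbr y ^+ (l + k) * normc (f (row_mx x y)) * (M * jbr x ^+ k) by rewrite exprD; ring.
apply: (@le_trans _ _ (M' * jbr x ^+ K * (M * jbr x ^+ k))).
  by rewrite ler_wpM2r ?mulr_ge0 ?jbrX_ge0.
by rewrite exprD le_eqVlt; apply/orP; left; apply/eqP; ring.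
Qed.

Lemma Bpoly_mul N (f g : fn N) : Bpoly f -> Bpoly g -> Bpoly (fun x => f x * g x).
Proof.
move=> /Bpoly_ge0[M [k [M0 h]]] /Bpoly_ge0[M' [k' [M0' h']]].
exists (M * M'), (k + k')%N => x; rewrite normcM exprD.
have -> : M * M' * (jbr x ^+ k * jbr x ^+ k') = (M * jbr x ^+ k) * (M' * jbr x ^+ k') by ring.
by rewrite ler_pM ?normc_ge0.
Qed.

Lemma Brd_poly N (f : fn N) : Brd f -> Bpoly f.
Proof. by move=> /(_ 0)[M H]; exists M, 0 => x; have := H x; rewrite expr0 mul1r mulr1. Qed.

Lemma Brd_sf a b (f : fn (a + b)) : Brd f -> Bsf f.
Proof.
move=> H k; have [M h] := H k; exists M, 0 => x y; rewrite mulr1.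
apply: le_trans (h (row_mx x y)); rewrite ler_wpM2r ?normc_ge0 //.
by rewrite lerXn2r ?nnegrE ?jbr_ge0 // jbr_row_mxr.
Qed.

Lemma sm_cst N (a : C) : sm (@Bpoly N) (fun=> a).
Proof.
apply: (@sm_coind _ _ (fun f => exists a, f = fun=> a) _ (@linclosed_Bpoly N)); last first.
  by apply: cspan_in; exists a.
move=> _ [c ->]; split; first exact: ccont_cst.
  by exists (normc c), 0 => x; rewrite mulr1.
move=> i; exists (fun=> 0); first by apply: cspan_in; exists 0.
by move=> x; exact: cder_cst.
Qed.

Lemma sm_coord N (i : 'I_N) : sm (@Bpoly N) (fun x => (x 0 i)%:C).
Proof.
apply: (@sm_coind _ _ (fun f => f = (fun x => (x 0 i)%:C) \/ exists a, f = fun=> a) _ (@linclosed_Bpoly N)); last first.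
  by apply: cspan_in; left.
move=> _ [->|[c ->]]; split.
- by apply: ccont_real; exact: continuous_coord.
- by exists 1, 1 => x; rewrite normcR mul1r expr1 coord_le_jbr.
- move=> j; exists (fun=> (ebase j 0 i)%:C); first by apply: cspan_in; right; exists (ebase j 0 i)%:C.
  by move=> x; exact: cder_coord.
- exact: ccont_cst.
- by exists (normc c), 0 => x; rewrite mulr1.
move=> j; exists (fun=> 0); first by apply: cspan_in; right; exists 0.
by move=> x; exact: cder_cst.
Qed.

Lemma eq_sm N (B : fn N -> Prop) f g : f =1 g -> sm B f -> sm B g.
Proof. by move=> /funext ->. Qed.

Lemma sm_sum N (I : Type) (r : seq I) (F : I -> fn N) :
  (forall i, sm (@Bpoly N) (F i)) -> sm (@Bpoly N) (fun x => \sum_(i <- r) F i x).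
Proof.
move=> sF; elim: r => [|i r IH].
  by apply: (@eq_sm _ _ (fun=> 0)) (sm_cst _ 0) => x; rewrite big_nil.
apply: (@eq_sm _ _ (fun x => F i x + \sum_(j <- r) F j x)) => [x|]; first by rewrite big_cons.
exact: sm_add (@linclosed_Bpoly N) (sF i) IH.
Qed.

Lemma sm_poly_mul N (f g : fn N) : sm (@Bpoly N) f -> sm (@Bpoly N) g ->
  sm (@Bpoly N) (fun x => f x * g x).
Proof. by apply: sm_mul; [exact: linclosed_Bpoly|exact: Bpoly_mul]. Qed.

Lemma sm_dotmx_lin N M (A B : 'M[R]_(N, M)) : sm (@Bpoly N) (fun x => (dotmx (x *m A) (x *m B))%:C).
Proof.
have sl (A' : 'M[R]_(N, M)) j : sm (@Bpoly N) (fun x => ((x *m A') 0 j)%:C).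
  apply: (@eq_sm _ _ (fun x => \sum_i ((A' i j)%:C * (x 0 i)%:C))) => [x|].
    rewrite mxE (rmorph_sum (real_complex R)); apply: eq_bigr => i _.
    by rewrite mulrC -rmorphM.
  by apply: sm_sum => i; apply: sm_scale; [exact: linclosed_Bpoly|exact: sm_coord].
apply: (@eq_sm _ _ (fun x => \sum_j ((x *m A) 0 j)%:C * ((x *m B) 0 j)%:C)) => [x|].
  by rewrite /dotmx (rmorph_sum (real_complex R)); apply: eq_bigr => i _; rewrite -rmorphM.
by apply: sm_sum => j; exact: sm_poly_mul.
Qed.

(** Every derivative of [cexp (phi x)] is a polynomially bounded factor times the
    exponential itself. *)
Lemma sm_cexp N (B : fn N -> Prop) (phi : fn N) : linclosed B -> sm (@Bpoly N) phi ->
  (forall a, Bpoly a -> B (fun x => a x * cexp (phi x))) -> sm B (fun x => cexp (phi x)).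
Proof.
move=> lB sp BP.
pose D f := exists2 a, sm (@Bpoly N) a & f = (fun x => a x * cexp (phi x)).
apply: (@sm_coind _ _ D _ lB); last first.
  by apply: cspan_in; exists (fun=> 1); [exact: sm_cst|apply/funext => x; rewrite mul1r].
move=> _ [a sa ->]; split.
- by apply: ccont_mul; [exact: sm_ccont sa|apply: ccont_cexp; exact: sm_ccont sp].
- by apply: BP; exact: sm_bound sa.
move=> i; exists (fun x => (cpderiv [:: i] a x + a x * cpderiv [:: i] phi x) * cexp (phi x)).
  apply: cspan_in; exists (fun x => cpderiv [:: i] a x + a x * cpderiv [:: i] phi x) => //.
  apply: sm_add; [exact: linclosed_Bpoly|exact: sm_cpderiv|].
  by apply: sm_poly_mul => //; exact: sm_cpderiv.
move=> x; apply: (eq_cder _ _ (cder_mul (csmooth_cder i x (sm_smooth sa))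
   (cder_cexp (csmooth_cder i x (sm_smooth sp))))) => //.
by rewrite mulrDl mulrA.
Qed.

Lemma sm_cis_dotmx N M (A B : 'M[R]_(N, M)) : sm (@Bpoly N) (fun x => cis (dotmx (x *m A) (x *m B))).
Proof.
apply: (@eq_sm _ _ (fun x => cexp ('i%C * (dotmx (x *m A) (x *m B))%:C))) => [x|].
  by congr cexp; apply: ReIm_eq; rewrite ?ReM ?ImM /=; ring.
apply: sm_cexp; first exact: linclosed_Bpoly.
  by apply: sm_scale; [exact: linclosed_Bpoly|exact: sm_dotmx_lin].
move=> a [K [k H]]; exists K, k => x; rewrite normcM normc_cexp.
by rewrite ReM /= mul0r mul1r subrr expR0 mulr1.
Qed.
End Bounds.

(** * Schwartz functions *)

Section SchwartzOps.
Variable R : realType.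
Local Notation C := R[i].
Local Notation fn N := ('rV[R]_N -> C).
Local Notation ebase i := (delta_mx 0 i : 'rV[R]_(_)).

Definition selL a b : 'M[R]_(a + b, a) := col_mx 1%:M 0.
Definition selR a b : 'M[R]_(a + b, b) := col_mx 0 1%:M.

Lemma mul_selL a b (z : 'rV[R]_(a + b)) : z *m selL a b = lsubmx z.
Proof. by rewrite -{1}(hsubmxK z) mul_row_col mulmx1 mulmx0 addr0. Qed.

Lemma mul_selR a b (z : 'rV[R]_(a + b)) : z *m selR a b = rsubmx z.
Proof. by rewrite -{1}(hsubmxK z) mul_row_col mulmx1 mulmx0 add0r. Qed.

Lemma schw_smooth N (f : fn N) : schwartz f -> csmooth f.
Proof. by case. Qed.

Lemma schw_ccont N (f : fn N) : schwartz f -> ccont f.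
Proof. by move=> /schw_smooth; exact: csmooth_ccont. Qed.

Lemma schw_Brd N (f : fn N) : schwartz f -> Brd f.
Proof. by move=> /schwartzP; exact: sm_bound. Qed.

Lemma schw_poly N (f : fn N) : schwartz f -> sm (@Bpoly R N) f.
Proof. by move=> /schwartzP; apply: sm_sub => g; exact: Brd_poly. Qed.

Lemma schw_add N (f g : fn N) : schwartz f -> schwartz g -> schwartz (fun x => f x + g x).
Proof. by move=> /schwartzP h1 /schwartzP h2; apply/schwartzP; apply: sm_add => //; exact: linclosed_Brd. Qed.

Lemma schw_scale N a (f : fn N) : schwartz f -> schwartz (fun x => a * f x).
Proof. by move=> /schwartzP h1; apply/schwartzP; apply: sm_scale => //; exact: linclosed_Brd. Qed.

Lemma schw_opp N (f : fn N) : schwartz f -> schwartz (fun x => - f x).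
Proof. by move=> /(schw_scale (-1)); congr schwartz; apply/funext => x; rewrite mulN1r. Qed.

Lemma schw_cpderiv N s (f : fn N) : schwartz f -> schwartz (cpderiv s f).
Proof. by move=> /schwartzP h1; apply/schwartzP; exact: sm_cpderiv. Qed.

Lemma schw_poly_mul N (f g : fn N) : schwartz f -> sm (@Bpoly R N) g -> schwartz (fun x => f x * g x).
Proof.
move=> /schwartzP h1 h2; apply/schwartzP; apply: (sm_mul _ (@Brd_poly_mul R N)) => //.
exact: linclosed_Brd.
Qed.

Lemma schw_mul N (f g : fn N) : schwartz f -> schwartz g -> schwartz (fun x => f x * g x).
Proof. by move=> h1 /schw_poly; exact: schw_poly_mul. Qed.

Lemma schw_conj N (f : fn N) : schwartz f -> schwartz (fun x => conjc (f x)).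
Proof.
move=> /schwartzP h1; apply/schwartzP; apply: (sm_conj _ _ h1); first exact: linclosed_Brd.
by move=> g Bg k; have [M H] := Bg k; exists M => x; rewrite normc_conj.
Qed.

Lemma sm_poly_aff M N (A : 'M[R]_(M, N)) b (f : fn N) : sm (@Bpoly R N) f ->
  sm (@Bpoly R M) (fun x => f (x *m A + b)).
Proof.
move=> sf; apply: (sm_aff _ _ sf); first exact: linclosed_Bpoly.
move=> g /Bpoly_ge0[K [k [K0 H]]]; have [c c0 hc] := jbr_mulmx A.
exists (K * (2 ^+ k * (c ^+ k * jbr b ^+ k))), k => x; apply: (le_trans (H _)).
rewrite -mulrA ler_wpM2l //; apply: (le_trans (jbrXD _ _ _)).
rewrite -[leRHS]mulrA ler_wpM2l ?exprn_ge0 // mulrAC ler_wpM2r ?jbrX_ge0 // -exprMn.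
by rewrite lerXn2r ?nnegrE ?mulr_ge0 ?jbr_ge0 // ltW.
Qed.

Lemma schw_aff N (A : 'M[R]_N) b (f : fn N) : A \in unitmx -> schwartz f ->
  schwartz (fun x => f (x *m A + b)).
Proof.
move=> uA /schwartzP sf; apply/schwartzP; apply: (sm_aff _ _ sf); first exact: linclosed_Brd.
move=> g Hg k; have [M M0 H] := Brd_ge0 Hg k; have [c c0 hc] := jbr_mulmx (invmx A).
exists ((2 * c * jbr b) ^+ k * M) => x.
apply: (@le_trans _ _ ((2 * c * jbr b) ^+ k * (jbr (x *m A + b) ^+ k * normc (g (x *m A + b))))).
  rewrite mulrA ler_wpM2r ?normc_ge0 // -exprMn lerXn2r ?nnegrE ?mulr_ge0 ?jbr_ge0 ?(ltW c0) //.
  have -> : jbr x = jbr ((x *m A + b - b) *m invmx A) by rewrite addrK mulmxK.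
  apply: (le_trans (hc _)); rewrite -!mulrA [2 * _]mulrCA ler_wpM2l ?(ltW c0) //.
  by apply: (le_trans (jbrD _ _)); rewrite jbrN [jbr b * _]mulrC.
by rewrite ler_wpM2l ?exprn_ge0 ?mulr_ge0 ?jbr_ge0 // ltW.
Qed.

Lemma schw_shift N b (f : fn N) : schwartz f -> schwartz (fun x => f (x + b)).
Proof.
by move=> /(schw_aff b (unitmx1 _ _)); congr schwartz; apply/funext => x; rewrite mulmx1.
Qed.

(** The weight in (x, y) is at most the product of the weights in x and in y. *)
Lemma schw_tensor a b (f : fn a) (g : fn b) : schwartz f -> schwartz g ->
  schwartz (fun z => f (lsubmx z) * g (rsubmx z)).
Proof.
move=> /schwartzP sf /schwartzP sg; apply/schwartzP.
pose Bl (h : fn (a + b)) := forall k, exists M, forall z, jbr (lsubmx z) ^+ k * normc (h z) <= M.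
pose Br (h : fn (a + b)) := forall k, exists M, forall z, jbr (rsubmx z) ^+ k * normc (h z) <= M.
have lBl : linclosed Bl.
  split=> [h h' H H' k|c h H k].
    have [M e] := H k; have [M' e'] := H' k; exists (M + M') => x.
    apply: (@le_trans _ _ (jbr (lsubmx x) ^+ k * (normc (h x) + normc (h' x)))).
      by rewrite ler_wpM2l ?jbrX_ge0 // normcD.
    by rewrite mulrDr lerD.
  have [M e] := H k; exists (normc c * M) => x.
  by rewrite normcM mulrCA ler_wpM2l ?normc_ge0.
have lBr : linclosed Br.
  split=> [h h' H H' k|c h H k].
    have [M e] := H k; have [M' e'] := H' k; exists (M + M') => x.
    apply: (@le_trans _ _ (jbr (rsubmx x) ^+ k * (normc (h x) + normc (h' x)))).
      by rewrite ler_wpM2l ?jbrX_ge0 // normcD.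
    by rewrite mulrDr lerD.
  have [M e] := H k; exists (normc c * M) => x.
  by rewrite normcM mulrCA ler_wpM2l ?normc_ge0.
have s1 : sm Bl (fun z => f (lsubmx z)).
  apply: (@eq_sm _ _ _ (fun z => f (z *m selL a b + 0))) => [z|]; first by rewrite addr0 mul_selL.
  apply: (sm_aff _ _ sf) => // h Bh k; have [M H] := Bh k; exists M => z.
  by rewrite addr0 mul_selL.
have s2 : sm Br (fun z => g (rsubmx z)).
  apply: (@eq_sm _ _ _ (fun z => g (z *m selR a b + 0))) => [z|]; first by rewrite addr0 mul_selR.
  apply: (sm_aff _ _ sg) => // h Bh k; have [M H] := Bh k; exists M => z.
  by rewrite addr0 mul_selR.
apply: (sm_mul _ _ s1 s2); first exact: linclosed_Brd.
move=> h h' Bh Bh' k; have [M H] := Bh k; have [M' H'] := Bh' k; exists (M * M') => z.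
rewrite normcM; apply: (@le_trans _ _ ((jbr (lsubmx z) ^+ k * normc (h z)) * (jbr (rsubmx z) ^+ k * normc (h' z)))).
  have -> : forall p q r s : R, (p * q) * (r * s) = (p * r) * (q * s) by move=> *; ring.
  rewrite ler_wpM2r ?mulr_ge0 ?normc_ge0 // -exprMn lerXn2r ?nnegrE ?mulr_ge0 ?jbr_ge0 //.
  by rewrite -{1}(hsubmxK z) jbr_row_mx.
by rewrite ler_pM ?mulr_ge0 ?jbrX_ge0 ?normc_ge0.
Qed.

Lemma slice_aff a b (x : 'rV[R]_a) (y : 'rV[R]_b) : row_mx x y = y *m row_mx 0 1%:M + row_mx x 0.
Proof. by rewrite mul_mx_row mulmx0 mulmx1 add_row_mx add0r addr0. Qed.

Lemma schw_slice a b (F : fn (a + b)) x : sm (@Bsf R a b) F -> schwartz (fun y => F (row_mx x y)).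
Proof.
move=> sF; apply/schwartzP.
apply: (@eq_sm _ _ _ (fun y => F (y *m row_mx 0 1%:M + row_mx x 0))) => [y|].
  by rewrite -slice_aff.
apply: (sm_aff _ _ sF); first exact: linclosed_Brd.
move=> g Bg k; have [M [K H]] := Bg k; exists (M * jbr x ^+ K) => y.
by rewrite -slice_aff.
Qed.

Lemma schw_slice_joint a b (F : fn (a + b)) x : schwartz F -> schwartz (fun y => F (row_mx x y)).
Proof. by move=> /schwartzP sF; apply: schw_slice; apply: sm_sub sF => g; exact: Brd_sf. Qed.

Lemma cpderiv_slice a b (F : fn (a + b)) x s : csmooth F ->
  cpderiv s (fun y => F (row_mx x y)) = (fun y => cpderiv (map (@rshift a b) s) F (row_mx x y)).
Proof.
move=> sF; elim: s => [|i s IH]; first by rewrite !cpderiv_nil.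
rewrite cpderiv_cons IH; apply: cpderiv_eq => y.
have := csmooth_cder (rshift a i) (row_mx x y) (csmooth_cpderiv (map (@rshift a b) s) sF).
rewrite -cpderiv_cons; have -> : ebase (rshift a i) = (ebase i : 'rV[R]_b) *m row_mx (0 : 'M[R]_(b, a)) 1%:M.
  rewrite mul_mx_row mulmx0 mulmx1; apply/rowP => j; rewrite !mxE.
  case: (split_ordP j) => j' ->; rewrite !mxE ?eqxx //= ?eq_lrshift // ?eq_rlshift // ?eq_rshift //.
rewrite slice_aff => /cder_aff; apply: eq_cder => // y'; by rewrite -slice_aff.
Qed.

Lemma sm_sf_poly_mul a b (F g : fn (a + b)) : sm (@Bsf R a b) F -> sm (@Bpoly R (a + b)) g ->
  sm (@Bsf R a b) (fun z => F z * g z).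
Proof. by apply: sm_mul; [exact: linclosed_Bsf|exact: Bsf_poly_mul]. Qed.

End SchwartzOps.

(** * Schwartz seminorms and tempered distributions *)

Section Seminorms.
Variable R : realType.
Local Notation C := R[i].
Local Notation Re := complex.Re.
Local Notation Im := complex.Im.
Local Notation fn N := ('rV[R]_N -> C).
Local Notation ebase i := (delta_mx 0 i : 'rV[R]_(_)).

(** Bounds for finitely many objects are made uniform by summing the constants; [Q] is
    monotone in both of them. *)
Lemma fin_unif (T : finType) (Q : T -> R -> nat -> Prop) :
  (forall t M K M' K', M <= M' -> (K <= K')%N -> Q t M K -> Q t M' K') ->
  (forall t, exists M K, 0 <= M /\ Q t M K) ->
  exists M K, 0 <= M /\ forall t, Q t M K.
Proof.
move=> mono H.
have /choice[f Hf] t : exists p : R * nat, 0 <= p.1 /\ Q t p.1 p.2.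
  by have [M [K HQ]] := H t; exists (M, K).
exists (\sum_t (f t).1), (\sum_t (f t).2)%N; split.
  by apply: sumr_ge0 => t _; case: (Hf t).
move=> t; have [h1 h2] := Hf t; apply: mono h2.
  by rewrite (bigD1 t) //= lerDl; apply: sumr_ge0 => i _; case: (Hf i).
by rewrite (bigD1 t) //= leq_addr.
Qed.

Lemma words_unif N k (Q : seq 'I_N -> R -> nat -> Prop) :
  (forall t M K M' K', M <= M' -> (K <= K')%N -> Q t M K -> Q t M' K') ->
  (forall t, exists M K, 0 <= M /\ Q t M K) ->
  exists M K, 0 <= M /\ forall t, (size t <= k)%N -> Q t M K.
Proof.
move=> mono H.
have [M [K [M0 HQ]]] := @fin_unif {bseq k of 'I_N} (fun t => Q (val t))
   (fun t => mono (val t)) (fun t => H (val t)).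
by exists M, K; split => // t tk; exact: (HQ (Bseq tk)).
Qed.

Let nset N k (f : fn N) := [set r : R | exists (s : seq 'I_N) (x : 'rV[R]_N),
    (size s <= k)%N /\ r = jbr x ^+ k * normc (cpderiv s f x)].

Let nset_ub N k (f : fn N) : schwartz f -> has_ubound (nset k f).
Proof.
move=> sf; have [|t|M [K [M0 H]]] := @words_unif N k (fun s M K => forall x, jbr x ^+ k * normc (cpderiv s f x) <= M).
- by move=> t M K M' K' MM _ h x; exact: le_trans (h x) MM.
- have [M M0 h] := Brd_ge0 (schw_Brd (schw_cpderiv t sf)) k.
  by exists M, 0.
by exists M => r [s [x [sk ->]]]; exact: H.
Qed.

Let nset0 N k (f : fn N) : nset k f !=set0.
Proof. by exists (jbr (0 : 'rV[R]_N) ^+ k * normc (cpderiv [::] f 0)), [::], 0. Qed.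

Lemma schwartz_norm_ub N k s (f : fn N) x : schwartz f -> (size s <= k)%N ->
  jbr x ^+ k * normc (cpderiv s f x) <= schwartz_norm k f.
Proof. by move=> sf sk; apply: ub_le_sup; [exact: nset_ub|exists s, x]. Qed.

Lemma schwartz_norm_le N k (f : fn N) M :
  (forall s x, (size s <= k)%N -> jbr x ^+ k * normc (cpderiv s f x) <= M) ->
  schwartz_norm k f <= M.
Proof.
by move=> H; apply: ge_sup; [exact: nset0|move=> r [s [x [sk ->]]]; exact: H].
Qed.

Lemma schwartz_norm_ge0 N k (f : fn N) : schwartz f -> 0 <= schwartz_norm k f.
Proof.
move=> sf; apply: le_trans (schwartz_norm_ub (s := [::]) 0 sf (leq0n k)).
by rewrite mulr_ge0 ?jbrX_ge0 ?normc_ge0.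
Qed.

Lemma sf_norm a b k (F : fn (a + b)) : sm (@Bsf R a b) F -> exists M K, 0 <= M /\
  forall X, schwartz_norm k (fun y => F (row_mx X y)) <= M * jbr X ^+ K.
Proof.
move=> sF; have [|t|M [K [M0 H]]] := @words_unif b k (fun s M K => forall X y,
   jbr y ^+ k * normc (cpderiv (map (@rshift a b) s) F (row_mx X y)) <= M * jbr X ^+ K).
- move=> t M K M' K' MM KK h X y; apply: (le_trans (h X y)).
  apply: (@le_trans _ _ (M' * jbr X ^+ K)); first by rewrite ler_wpM2r ?jbrX_ge0.
  rewrite ler_wpM2l ?jbrX_le // (le_trans _ MM) //.
  have := le_trans (mulr_ge0 (jbrX_ge0 _ _) (normc_ge0 _)) (h X y).
  by rewrite pmulr_lge0 ?jbrX_gt0.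
- exact: (Bsf_ge0 (sm_bound (sm_cpderiv (map (@rshift a b) t) sF)) k).
exists M, K; split => // X; apply: schwartz_norm_le => s y sk.
by rewrite cpderiv_slice; [exact: H|exact: sm_smooth sF].
Qed.

Lemma joint_norm a b k l (F : fn (a + b)) : schwartz F -> exists2 M, 0 <= M &
  forall X, jbr X ^+ l * schwartz_norm k (fun y => F (row_mx X y)) <= M.
Proof.
move=> sF; have [|t|M [K [M0 H]]] := @words_unif b k (fun s M K => forall X y,
   jbr X ^+ l * (jbr y ^+ k * normc (cpderiv (map (@rshift a b) s) F (row_mx X y))) <= M).
- by move=> t M K M' K' MM KK h X y; exact: le_trans (h X y) MM.
- have [M M0 h] := Brd_ge0 (schw_Brd (schw_cpderiv (map (@rshift a b) t) sF)) (l + k).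
  exists M, 0; split => // X y; apply: le_trans (h (row_mx X y)).
  rewrite mulrA ler_wpM2r ?normc_ge0 // exprD ler_pM ?jbrX_ge0 //.
    by rewrite lerXn2r ?nnegrE ?jbr_ge0 // jbr_row_mxl.
  by rewrite lerXn2r ?nnegrE ?jbr_ge0 // jbr_row_mxr.
exists M => // X; rewrite -ler_pdivlMl ?jbrX_gt0 //; apply: schwartz_norm_le => s y sk.
rewrite ler_pdivlMl ?jbrX_gt0 // cpderiv_slice; first exact: H.
exact: schw_smooth.
Qed.

(** The mean value theorem along the segment from [X] to [Y]; the segment stays at
    bounded distance from [X], so the weight at [X] serves for all its points. *)
Lemma sf_lip_pt a b k (G : fn (a + b)) : sm (@Bsf R a b) G -> exists M K, 0 <= M /\
  forall X Y y, `|X - Y| <= 1 ->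
  jbr y ^+ k * normc (G (row_mx X y) - G (row_mx Y y)) <= M * `|X - Y| * jbr X ^+ K.
Proof.
move=> sG; have [|t|M [K [M0 H]]] := @fin_unif _ (fun (i : 'I_(a + b)) M K => forall X y,
   jbr y ^+ k * normc (cpderiv [:: i] G (row_mx X y)) <= M * jbr X ^+ K).
- move=> t M K M' K' MM KK h X y; apply: (le_trans (h X y)).
  apply: (@le_trans _ _ (M' * jbr X ^+ K)); first by rewrite ler_wpM2r ?jbrX_ge0.
  rewrite ler_wpM2l ?jbrX_le // (le_trans _ MM) //.
  have := le_trans (mulr_ge0 (jbrX_ge0 _ _) (normc_ge0 _)) (h X y).
  by rewrite pmulr_lge0 ?jbrX_gt0.
- exact: (Bsf_ge0 (sm_bound (sm_cpderiv [:: t] sG)) k).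
pose c : R := 6 * a.+1%:R.
have c0 : 0 <= c by rewrite mulr_ge0.
exists (2 * ((a + b)%:R * (M * c ^+ K))), K; split; first by rewrite !mulr_ge0 ?exprn_ge0.
move=> X Y y XY.
pose v : 'rV[R]_(a + b) := row_mx (X - Y) 0; pose z0 := row_mx Y y.
have vz : v + z0 = row_mx X y by rewrite /v /z0 add_row_mx add0r subrK.
have vi i : `|v 0 i| <= `|X - Y|.
  case: (split_ordP i) => j ->; rewrite /v ?row_mxEl ?row_mxEr; first exact: coord_le_norm.
  by rewrite mxE normr0.
have dG z : cder v G z (\sum_i (v 0 i)%:C * cpderiv [:: i] G z).
  apply: (@cder_dir _ _ _ (fun i => cpderiv [:: i] G)) => [i y'|i].
    by apply: csmooth_cder; exact: sm_smooth sG.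
  by apply: sm_ccont; apply: sm_cpderiv; exact: sG.
have bnd t : `|t| <= 1 -> jbr y ^+ k * normc (\sum_i (v 0 i)%:C * cpderiv [:: i] G (t *: v + z0)) <=
    (a + b)%:R * (M * c ^+ K) * `|X - Y| * jbr X ^+ K.
  move=> t1; have -> : t *: v + z0 = row_mx (t *: (X - Y) + Y) y.
    by rewrite /v /z0 scale_row_mx scaler0 add_row_mx add0r.
  set xi := t *: (X - Y) + Y.
  have jx : jbr xi <= c * jbr X.
    have -> : xi = (xi - X) + X by rewrite subrK.
    apply: (le_trans (jbrD _ _)); rewrite mulrA ler_wpM2r ?jbr_ge0 //.
    have -> : xi - X = (t - 1) *: (X - Y).
      by rewrite /xi scalerBl scale1r -addrA; congr (_ + _); rewrite opprB.
    have := jbr_le_norm ((t - 1) *: (X - Y)).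
    have h1 : `|t - 1| <= 2 by apply: (le_trans (ler_normB _ _)); rewrite normr1; lra.
    have h2 : `|(t - 1) *: (X - Y)| <= 2.
      by rewrite normrZ; apply: (le_trans (ler_pM _ _ h1 XY)) => //; rewrite mulr1.
    move=> h3; have : a.+1%:R * (1 + `|(t - 1) *: (X - Y)|) <= a.+1%:R * 3 :> R.
      by rewrite ler_wpM2l //; lra.
    by rewrite /c; lra.
  apply: (@le_trans _ _ (jbr y ^+ k * \sum_i `|X - Y| * normc (cpderiv [:: i] G (row_mx xi y)))).
    rewrite ler_wpM2l ?jbrX_ge0 //; apply: (le_trans (normc_sum _ _ _)); apply: ler_sum => i _.
    by rewrite normcM normcR ler_wpM2r ?normc_ge0.
  rewrite mulr_sumr; apply: (@le_trans _ _ (\sum_(i < a + b) `|X - Y| * (M * (c ^+ K * jbr X ^+ K)))).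
    apply: ler_sum => i _; rewrite mulrCA ler_wpM2l //; apply: (le_trans (H i xi y)).
    by rewrite ler_wpM2l // -exprMn lerXn2r ?nnegrE ?mulr_ge0 ?jbr_ge0.
  by rewrite sumr_const card_ord -mulr_natl le_eqVlt; apply/orP; left; apply/eqP; ring.
have part (P : C -> R) : (forall z, `|P z| <= normc z) ->
    (forall z, is_derive z v (fun z => P (G z)) (P (\sum_i (v 0 i)%:C * cpderiv [:: i] G z))) ->
    jbr y ^+ k * `|P (G (row_mx X y)) - P (G (row_mx Y y))| <=
    (a + b)%:R * (M * c ^+ K) * `|X - Y| * jbr X ^+ K.
  move=> Pn dP; have [t] := line_mvt z0 1 dP.
  rewrite normr1 scale1r vz mul1r => t1 ->; apply: le_trans (bnd t t1).
  by rewrite ler_wpM2l ?jbrX_ge0.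
have h1 := part _ (@Re_le_normc R) (fun z => (dG z).1).
have h2 := part _ (@Im_le_normc R) (fun z => (dG z).2).
apply: (@le_trans _ _ (jbr y ^+ k * (`|Re (G (row_mx X y)) - Re (G (row_mx Y y))| +
   `|Im (G (row_mx X y)) - Im (G (row_mx Y y))|))).
  rewrite ler_wpM2l ?jbrX_ge0 //; apply: (le_trans (normc_le_ReIm _)).
  by rewrite ReD ReN ImD ImN.
rewrite mulrDr; apply: (le_trans (lerD h1 h2)).
by rewrite le_eqVlt; apply/orP; left; apply/eqP; ring.
Qed.

Lemma sf_lip a b k (F : fn (a + b)) : sm (@Bsf R a b) F -> exists M K, 0 <= M /\
  forall X Y, `|X - Y| <= 1 ->
  schwartz_norm k (fun y => F (row_mx X y) - F (row_mx Y y)) <= M * `|X - Y| * jbr X ^+ K.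
Proof.
move=> sF; have [|t|M [K [M0 H]]] := @words_unif b k (fun s M K => forall X Y y, `|X - Y| <= 1 ->
   jbr y ^+ k * normc (cpderiv (map (@rshift a b) s) F (row_mx X y) -
     cpderiv (map (@rshift a b) s) F (row_mx Y y)) <= M * `|X - Y| * jbr X ^+ K).
- move=> t M K M' K' MM KK h X Y y XY; apply: (le_trans (h X Y y XY)).
  have [->|XY0] := eqVneq X Y; first by rewrite subrr normr0 !mulr0 !mul0r.
  have M0 : 0 <= M.
    have := le_trans (mulr_ge0 (jbrX_ge0 _ _) (normc_ge0 _)) (h X Y y XY).
    by rewrite pmulr_lge0 ?jbrX_gt0 // pmulr_lge0 ?normr_gt0 ?subr_eq0.
  by rewrite ler_pM ?mulr_ge0 ?jbrX_ge0 ?jbrX_le // ler_wpM2r.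
- exact: (sf_lip_pt k (sm_cpderiv (map (@rshift a b) t) sF)).
exists M, K; split => // X Y XY; apply: schwartz_norm_le => s y sk.
have sl Z : csmooth (fun y => F (row_mx Z y)) by apply: schw_smooth; exact: schw_slice.
have -> : (fun y => F (row_mx X y) - F (row_mx Y y)) = (fun y => F (row_mx X y) + (-1) * F (row_mx Y y)).
  by apply/funext => z; rewrite mulN1r.
rewrite cpderivD // ?cpderivZ //; last first.
  have := schw_scale (-1) (schw_slice Y sF); exact: schw_smooth.
rewrite !cpderiv_slice ?mulN1r; [exact: H|exact: sm_smooth sF..].
Qed.

Section Tempered.
Variables (N : nat) (u : fn N -> C).
Hypothesis tu : tempered u.

Lemma temp_lin (a : C) f g : schwartz f -> schwartz g ->
  u (fun x => a * f x + g x) = a * u f + u g.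
Proof. by case: tu => h _; exact: h. Qed.

Lemma schw0 : schwartz (fun _ : 'rV[R]_N => 0 : C).
Proof.
apply/schwartzP; have [h1 h2] := sm_cst N (0 : C); split => // s k.
have -> : cpderiv s (fun _ : 'rV[R]_N => 0 : C) = fun=> 0.
  elim: s => [|i s IH]; first by rewrite cpderiv_nil.
  by rewrite cpderiv_cons IH; apply: cpderiv_eq => x; exact: cder_cst.
by exists 0 => x; rewrite normc0 mulr0.
Qed.

Lemma temp0 : u (fun=> 0) = 0.
Proof.
have := temp_lin 1 schw0 schw0; rewrite !mul1r.
have -> : (fun _ : 'rV[R]_N => 0 + 0 : C) = fun=> 0 by apply/funext => x; rewrite addr0.
by move/eqP; rewrite -subr_eq0 opprD addrA subrr add0r oppr_eq0 => /eqP.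
Qed.

Lemma tempD f g : schwartz f -> schwartz g -> u (fun x => f x + g x) = u f + u g.
Proof.
by move=> sf sg; rewrite -[u f]mul1r -temp_lin //; congr u; apply/funext => x; rewrite mul1r.
Qed.

Lemma tempZ a f : schwartz f -> u (fun x => a * f x) = a * u f.
Proof.
move=> sf; rewrite -[RHS]addr0 -temp0 -temp_lin //; last exact: schw0.
by congr u; apply/funext => x; rewrite addr0.
Qed.

Lemma tempB f g : schwartz f -> schwartz g -> u (fun x => f x - g x) = u f - u g.
Proof.
move=> sf sg; rewrite tempD //; last exact: schw_opp.
by rewrite -mulN1r -tempZ //; congr (_ + u _); apply/funext => x; rewrite mulN1r.
Qed.

Lemma temp_sum (I : Type) (r : seq I) (F : I -> fn N) : (forall i, schwartz (F i)) ->
  schwartz (fun x => \sum_(i <- r) F i x) /\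
  u (fun x => \sum_(i <- r) F i x) = \sum_(i <- r) u (F i).
Proof.
move=> sF; elim: r => [|i r [IH1 IH2]].
  have -> : (fun x => \sum_(i <- [::]) F i x) = fun=> 0 by apply/funext => x; rewrite big_nil.
  by rewrite big_nil temp0; split => //; exact: schw0.
have -> : (fun x => \sum_(j <- i :: r) F j x) = (fun x => F i x + \sum_(j <- r) F j x).
  by apply/funext => x; rewrite big_cons.
by rewrite big_cons -IH2 -tempD //; split => //; exact: schw_add.
Qed.

Lemma temp_bound : exists k M, 0 <= M /\ forall f, schwartz f -> normc (u f) <= M * schwartz_norm k f.
Proof.
case: tu => _ [k [M H]]; exists k, `|M|; split => // f sf; apply: (le_trans (H f sf)).
by rewrite ler_wpM2r ?schwartz_norm_ge0 // ler_norm.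
Qed.

Section family.
Variables (d : nat) (F : fn (d + N)).
Hypothesis sF : sm (@Bsf R d N) F.
Local Notation uF := (fun X => u (fun y => F (row_mx X y))).

Lemma temp_family_bound : exists M K, 0 <= M /\ forall X, normc (uF X) <= M * jbr X ^+ K.
Proof.
have [k [M [M0 H]]] := temp_bound; have [M' [K [M0' H']]] := sf_norm k sF.
exists (M * M'), K; split; first exact: mulr_ge0.
move=> X; apply: (le_trans (H _ (schw_slice X sF))).
by rewrite -mulrA ler_wpM2l.
Qed.

(** With [lip_ccont], this makes the pairing of a tempered distribution with a tame family
    a continuous function of the parameter. *)
Lemma temp_family_lip : exists M K, 0 <= M /\ forall X Y, `|X - Y| <= 1 ->
  normc (uF X - uF Y) <= M * `|X - Y| * jbr X ^+ K.
Proof.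
have [k [M [M0 H]]] := temp_bound; have [M' [K [M0' H']]] := sf_lip k sF.
exists (M * M'), K; split; first exact: mulr_ge0.
move=> X Y XY; rewrite -tempB; [|exact: schw_slice..].
apply: (@le_trans _ _ (M * schwartz_norm k (fun y => F (row_mx X y) - F (row_mx Y y)))).
  by apply: H; apply: schw_add; [exact: schw_slice|apply: schw_opp; exact: schw_slice].
by rewrite -!mulrA ler_wpM2l // mulrA; exact: H'.
Qed.
End family.

Lemma temp_joint_bound (d : nat) (F : fn (d + N)) l : schwartz F ->
  exists2 M, 0 <= M & forall X, jbr X ^+ l * normc (u (fun y => F (row_mx X y))) <= M.
Proof.
move=> sF; have [k [M [M0 H]]] := temp_bound; have [M' M0' H'] := joint_norm k l sF.
exists (M * M'); first exact: mulr_ge0.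
move=> X; apply: (@le_trans _ _ (jbr X ^+ l * (M * schwartz_norm k (fun y => F (row_mx X y))))).
  by rewrite ler_wpM2l ?jbrX_ge0 //; apply: H; exact: schw_slice_joint.
by rewrite mulrCA ler_wpM2l.
Qed.
End Tempered.

Lemma lip_ccont d (v : fn d) M K : (forall X Y, `|X - Y| <= 1 ->
  normc (v X - v Y) <= M * `|X - Y| * jbr X ^+ K) -> ccont v.
Proof.
move=> H.
have part (P : C -> R) : (forall z w, `|P z - P w| <= normc (z - w)) -> continuous (fun X => P (v X)).
  move=> Pn X; apply/(@cvgrPdist_le _ _ _ (nbhs X) (nbhs_filter X)) => e e0.
  pose D := `|M| * jbr X ^+ K + 1.
  have D0 : 0 < D by rewrite ltr_wpDl // mulr_ge0 // jbrX_ge0.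
  apply/nbhs_ballP; exists (Num.min 1 (e / D)) => /=; first by rewrite lt_min ltr01 divr_gt0.
  move=> Y; rewrite -ball_normE /= lt_min => /andP[h1 h2].
  apply: (le_trans (Pn _ _)); apply: (le_trans (H X Y (ltW h1))).
  rewrite ltr_pdivlMr // in h2; apply: le_trans (ltW h2).
  rewrite mulrAC [leRHS]mulrC ler_wpM2r // /D.
  by apply: (@le_trans _ _ (`|M| * jbr X ^+ K)); [rewrite ler_wpM2r ?jbrX_ge0 // ler_norm|lra].
split; apply: part => z w.
  by apply: le_trans (Re_le_normc _); rewrite ReD ReN.
by apply: le_trans (Im_le_normc _); rewrite ImD ImN.
Qed.
End Seminorms.

(** * Tempered distributions under the integral sign *)

Section RiemannSums.
Variable R : realType.
Local Notation C := R[i].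
Local Notation Re := complex.Re.
Local Notation Im := complex.Im.
Local Notation fn N := ('rV[R]_N -> C).
Local Notation ebase i := (delta_mx 0 i : 'rV[R]_(_)).

Lemma cmeas_mulr N (f : fn N) (g : 'rV[R]_N -> R) : cmeasurable f -> rmeasurable g ->
  cmeasurable (fun x => f x * (g x)%:C).
Proof.
move=> [m1 m2] mg; split.
  move: (measurable_funM m1 mg); congr (measurable_fun _ _); apply/funext => t.
  by rewrite /= ReM /= mulr0 subr0.
move: (measurable_funM m2 mg); congr (measurable_fun _ _); apply/funext => t.
by rewrite /= ImM /= mulr0 add0r.
Qed.

Lemma cintegrable_jbr N (f : fn N) M : cmeasurable f ->
  (forall x, normc (f x) <= M / jbr x ^+ (N + N)) -> cintegrable f.
Proof.
move=> mf H; apply: (cint_dom mf _ H).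
by apply: rintZ; apply: rint_jbr.
Qed.

Lemma le_cintegral_jbr N (f : fn N) M : cmeasurable f ->
  (forall x, normc (f x) <= M / jbr x ^+ (N + N)) ->
  normc (cintegral f) <= M * rI (fun x : 'rV[R]_N => (jbr x ^+ (N + N))^-1).
Proof.
move=> mf H; rewrite -rIZ; last exact: rint_jbr.
apply: le_normc_cintegral => //; first exact: cintegrable_jbr H.
by apply: rintZ; apply: rint_jbr.
Qed.

Lemma Brd_dec N (f : fn N) k : Brd f -> exists2 M, 0 <= M & forall x, normc (f x) <= M / jbr x ^+ k.
Proof.
move=> Bf; have [M M0 H] := Brd_ge0 Bf k; exists M => // x.
by rewrite ler_pdivlMr ?jbrX_gt0 // mulrC.
Qed.

Lemma schw_cintegrable N (f : fn N) : schwartz f -> cintegrable f.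
Proof.
move=> sf; have [M _ H] := Brd_dec (N + N) (schw_Brd sf).
by apply: cintegrable_jbr H; apply: ccont_cmeas; exact: schw_ccont.
Qed.

(** Riemann sums: integrals against a rapidly decreasing density are approximated
    by finite sums, uniformly over integrands with given polynomial and Lipschitz bounds. *)
Lemma riemann d (c : fn d) K : ccont c -> Brd c -> exists2 I : R, 0 <= I &
  forall j : nat, exists (T : finType) (a : T -> C) (pt : T -> 'rV[R]_d),
  forall (v : fn d) (A : R), 0 <= A -> ccont v ->
    (forall X, normc (v X) <= A * jbr X ^+ K) ->
    (forall X Y, `|X - Y| <= 1 -> normc (v X - v Y) <= A * `|X - Y| * jbr X ^+ K) ->
    normc (cintegral (fun X => c X * v X) - \sum_t a t * v (pt t)) <= A * I / j.+1%:R.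
Proof.
move=> cc Bc; have [B B0 HB] := Brd_ge0 Bc (K.+1 + (d + d)).
pose W := rI (fun x : 'rV[R]_d => (jbr x ^+ (d + d))^-1).
have W0 : 0 <= W by apply: rI_ge0 => x; rewrite invr_ge0 jbrX_ge0.
exists (B * W); first exact: mulr_ge0.
move=> j; pose J := j.+1; have J0 : 0 < J%:R :> R by [].
pose T : finType := {ffun 'I_d -> 'I_((J * J) * 2).+1}.
pose z (k : T) : 'rV[int]_d := \row_i ((k i : nat)%:Z - (J * J)%:Z).
pose pt (k : T) : 'rV[R]_d := \row_i ((z k 0 i)%:~R / J%:R).
pose fl (X : 'rV[R]_d) : 'rV[int]_d := \row_i Num.floor (J%:R * X 0 i).
pose ind (k : T) (X : 'rV[R]_d) : R := (fl X == z k)%:R.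
have mind k : rmeasurable (ind k).
  have := @measurable_floor_row R d d (fun i t => J%:R * row_of_tup t 0 i) (fun f => (f == z k)%:R).
  apply => i; apply: measurable_funM => //.
  move: (@measurable_tnth _ (measurableTypeR R) d i); congr (measurable_fun _ _).
  by apply/funext => t; rewrite mxE.
have cdec X : normc (c X) <= B / jbr X ^+ (d + d).
  rewrite ler_pdivlMr ?jbrX_gt0 // mulrC; apply: le_trans (HB X).
  by rewrite ler_wpM2r ?normc_ge0 // jbrX_le // leq_addl.
have icind k : cintegrable (fun X => c X * (ind k X)%:C).
  apply: (@cintegrable_jbr _ _ B); first by apply: cmeas_mulr => //; exact: ccont_cmeas.
  move=> X; apply: le_trans (cdec X); rewrite normcM normcR /ind.
  by case: eqP => _; rewrite ?normr1 ?normr0 ?mulr1 ?mulr0 // normc_ge0.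
exists T, (fun k => cintegral (fun X => c X * (ind k X)%:C)), pt => v A A0 cv vA vL.
(* the step function that takes on each small cube the value of [v] at its corner *)
pose st X := \sum_k (ind k X)%:C * v (pt k).
have Est : \sum_k cintegral (fun X => c X * (ind k X)%:C) * v (pt k) = cintegral (fun X => c X * st X)
   /\ cintegrable (fun X => c X * st X).
  rewrite /st; elim: (index_enum T) => [|k r [IH1 IH2]].
    rewrite big_nil; under [in cintegral _]eq_fun do rewrite big_nil mulr0.
    rewrite cintegral0; split => //.
    rewrite (_ : (fun X => _) = (fun X => 0 * (c X * (ind [ffun=> ord0] X)%:C))); last first.
      by apply/funext => X; rewrite big_nil mulr0 mul0r.
    by apply: cintegrableZ; exact: icind.
  have E X : c X * (\sum_(k <- k :: r) (ind k X)%:C * v (pt k)) =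
     v (pt k) * (c X * (ind k X)%:C) + c X * (\sum_(k <- r) (ind k X)%:C * v (pt k)).
    by rewrite big_cons; ring.
  rewrite big_cons IH1 (eq_cintegral E) cintegralD //; last by apply: cintegrableZ.
  rewrite cintegralZ // [v _ * _]mulrC; split => //.
  by move/funext : E => ->; apply: cintegrableD => //; apply: cintegrableZ.
case: Est => -> ist.
have key X : normc (v X - st X) <= A / J%:R * jbr X ^+ K.+1.
  have [k0 /eqP k0E|nk] := pickP (fun k => fl X == z k).
    have -> : st X = v (pt k0).
      rewrite /st (bigD1 k0) //= /ind k0E eqxx mul1r big1 ?addr0 // => k kk0.
      rewrite (_ : z k0 == z k = false) ?mul0r //; apply/negbTE; apply: contra kk0 => /eqP zE.
      apply/eqP/ffunP => i; apply/val_inj; have := congr1 (fun m : 'rV_d => m 0 i) zE.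
      by rewrite !mxE => /addIr[].
    have XD : `|X - pt k0| <= J%:R^-1.
      rewrite [leLHS]mx_normrE; apply/bigmax_leP; split=> [|[i0 i] _ /=]; first by rewrite invr_ge0 ltW.
      rewrite (ord1 i0) /pt -k0E /fl !mxE.
      have h1 := floor_le (J%:R * X 0 i); have h2 := floorD1_gt (J%:R * X 0 i).
      have -> : X 0 i - (Num.floor (J%:R * X 0 i))%:~R / J%:R =
        (J%:R * X 0 i - (Num.floor (J%:R * X 0 i))%:~R) / J%:R.
        by rewrite [RHS]mulrBl mulrAC mulfV ?gt_eqF // mul1r.
      rewrite intrD in h2.
      rewrite ger0_norm ?divr_ge0 ?subr_ge0 // ler_pdivrMr // mulVf ?gt_eqF //; lra.
    apply: (le_trans (vL _ _ (le_trans XD _))); first by rewrite invf_le1 // ler1n.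
    rewrite ler_pM ?mulr_ge0 ?jbrX_ge0 ?jbrX_le //.
    by rewrite ler_wpM2l.
  have -> : st X = 0 by rewrite /st big1 // => k _; rewrite /ind nk mul0r.
  rewrite subr0.
  (* outside the box of side J, the extra power of the bracket gains the factor 1/J *)
  have [i hi] : exists i, ~~ (`|fl X 0 i| <= (J * J)%:Z).
    apply/existsP; rewrite -negb_forall; apply/negP => /forallP H.
    pose k : T := [ffun i => inord (absz (fl X 0 i + (J * J)%:Z))].
    have := nk k; move/eqP; apply; apply/rowP => i; rewrite [RHS]mxE ffunE.
    have := H i; rewrite ler_norml => /andP[h1 h2].
    have h3 : 0 <= fl X 0 i + (J * J)%:Z by lia.
    rewrite inordK; last first.
      by rewrite ltnS -lez_nat gez0_abs //; move: h2; lia.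
    by rewrite gez0_abs // addrK.
  have jX : J%:R <= jbr X.
    apply: le_trans (coord_le_jbr X i); move: hi; rewrite -ltNge /fl mxE.
    set y := J%:R * X 0 i => hy.
    have yJ : (J * J)%:R <= `|y|.
      move: hy; rewrite lter_normr => /orP[hy|hy].
        rewrite lter_normr; apply/orP; left; apply: le_trans (floor_le y).
        by rewrite [leLHS]pmulrn ler_int; exact: ltW.
      rewrite lter_normr; apply/orP; right.
      have := floorD1_gt y; have : (Num.floor y + 1)%:~R <= (- (J * J)%:Z)%:~R :> R.
        by rewrite ler_int; lia.
      by rewrite rmorphN /= -pmulrn; lra.
    rewrite -(ler_pM2l J0) -natrM; apply: (le_trans yJ).
    by rewrite /y normrM ger0_norm // ltW.
  apply: (le_trans (vA X)).
  have -> : A / J%:R * jbr X ^+ K.+1 = (A * (jbr X / J%:R)) * jbr X ^+ K by rewrite exprS; ring.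
  by rewrite ler_wpM2r ?jbrX_ge0 // -[leLHS]mulr1 ler_wpM2l // ler_pdivlMr // mul1r.
have icv : cintegrable (fun X => c X * v X).
  apply: (@cintegrable_jbr _ _ (A * B)); first by apply: ccont_cmeas; apply: ccont_mul.
  move=> X; rewrite normcM ler_pdivlMr ?jbrX_gt0 //.
  apply: (@le_trans _ _ (normc (c X) * (A * jbr X ^+ K) * jbr X ^+ (d + d))).
    by rewrite ler_wpM2r ?jbrX_ge0 // ler_wpM2l ?normc_ge0.
  have -> : normc (c X) * (A * jbr X ^+ K) * jbr X ^+ (d + d) = A * (jbr X ^+ (K + (d + d)) * normc (c X)).
    by rewrite [jbr X ^+ (K + _)]exprD; ring.
  rewrite ler_wpM2l //; apply: le_trans (HB X).
  by rewrite ler_wpM2r ?normc_ge0 // jbrX_le // addSn leqnSn.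
rewrite -cintegralB //.
have -> : A * (B * W) / j.+1%:R = (A * B / J%:R) * W by rewrite /J; ring.
apply: le_cintegral_jbr; first by apply: cint_meas; apply: cintegrableD => //; exact: cintegrableN.
move=> X; rewrite -mulrBr normcM ler_pdivlMr ?jbrX_gt0 //.
apply: (@le_trans _ _ (normc (c X) * (A / J%:R * jbr X ^+ K.+1) * jbr X ^+ (d + d))).
  by rewrite ler_wpM2r ?jbrX_ge0 // ler_wpM2l ?normc_ge0.
have -> : normc (c X) * (A / J%:R * jbr X ^+ K.+1) * jbr X ^+ (d + d) =
   A / J%:R * (jbr X ^+ (K.+1 + (d + d)) * normc (c X)) by rewrite [jbr X ^+ (K.+1 + _)]exprD; ring.
have -> : A * B / J%:R = A / J%:R * B by ring.
by rewrite ler_wpM2l ?divr_ge0 ?(ltW J0).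
Qed.

End RiemannSums.

Section IntegralExchange.
Variable R : realType.
Local Notation C := R[i].
Local Notation fn N := ('rV[R]_N -> C).
Local Notation ebase i := (delta_mx 0 i : 'rV[R]_(_)).

Section exchange.
Variables (d N : nat) (c : fn d) (F : fn (d + N)).
Hypotheses (cc : ccont c) (Bc : Brd c) (sF : sm (@Bsf R d N) F).

Lemma ccont_slice (G : fn (d + N)) y : ccont G -> ccont (fun X => G (row_mx X y)).
Proof.
by move=> cG; apply: (ccont_comp (g := G)) => //; apply: cont_row_mx; [exact: cont_id|exact: cont_cstv].
Qed.

Let dom (G : fn (d + N)) : Bsf G -> exists2 M, 0 <= M & forall X y,
  normc (c X * G (row_mx X y)) <= M / jbr X ^+ (d + d).
Proof.
move=> BG; have [M [K [M0 HM]]] := Bsf_ge0 BG 0; have [M' M0' HM'] := Brd_dec (K + (d + d)) Bc.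
exists (M' * M); first exact: mulr_ge0.
move=> X y; rewrite normcM; apply: (le_trans (ler_pM _ _ (HM' X) (_ : _ <= M * jbr X ^+ K))); rewrite ?normc_ge0 //.
  by have := HM X y; rewrite expr0 mul1r.
rewrite exprD invfM le_eqVlt; apply/orP; left; apply/eqP.
have h := gt_eqF (jbrX_gt0 X K); field; rewrite h /=.
by rewrite gt_eqF // jbrX_gt0.
Qed.

Lemma cintegrable_family (G : fn (d + N)) y : sm (@Bsf R d N) G ->
  cintegrable (fun X => c X * G (row_mx X y)).
Proof.
move=> sG; have [M _ H] := dom (sm_bound sG).
apply: (@cintegrable_jbr _ _ _ M) => //.
by apply: ccont_cmeas; apply: ccont_mul => //; apply: ccont_slice; exact: sm_ccont sG.
Qed.

Variable f : fn N.
Hypothesis fE : forall y, f y = cintegral (fun X => c X * F (row_mx X y)).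

(** Derivatives in [y] pass inside the integral; this identifies every Schwartz seminorm of
    the integral with an integral of the same shape. *)
Lemma cpderiv_family s y :
  cpderiv s f y = cintegral (fun X => c X * cpderiv (map (@rshift d N) s) F (row_mx X y)).
Proof.
elim: s y => [|i s IH] y; first by rewrite !cpderiv_nil.
suff -> : cpderiv (i :: s) f =
  fun y => cintegral (fun X => c X * cpderiv (map (@rshift d N) (i :: s)) F (row_mx X y)) by [].
rewrite cpderiv_cons; apply: cpderiv_eq => {}y.
pose G := cpderiv (map (@rshift d N) s) F; pose G' := cpderiv (map (@rshift d N) (i :: s)) F.
have sG : sm (@Bsf R d N) G by exact: sm_cpderiv.
have sG' : sm (@Bsf R d N) G' by exact: sm_cpderiv.
pose P (H : fn (d + N)) : fn (N + d) := fun z => c (rsubmx z) * H (row_mx (rsubmx z) (lsubmx z)).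
have [M M0 HM] := dom (sm_bound sG').
have H := @cder_cintegral R N d (P G) (P G') i M 0 (fun X => (jbr X ^+ (d + d))^-1) y.
have PE H' y' : (fun X => P H' (row_mx y' X)) = (fun X => c X * H' (row_mx X y')).
  by apply/funext => X; rewrite /P row_mxKl row_mxKr.
have {}H : cder (ebase i) (fun y => cintegral (fun X => c X * G (row_mx X y))) y
    (cintegral (fun X => c X * G' (row_mx X y))).
  move: H; rewrite PE (_ : (fun x => _) = (fun y => cintegral (fun X => c X * G (row_mx X y)))); last first.
    by apply/funext => y'; rewrite PE.
  apply.
  - move=> y' X; rewrite {2}/P row_mxKl row_mxKr.
    apply: (@eq_cder _ _ _ (fun y => c X * G (row_mx X y)) _ _ (c X * cpderiv [:: i] (fun y => G (row_mx X y)) y')).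
    + by move=> y''; rewrite /P row_mxKl row_mxKr.
    + by rewrite (cpderiv_slice _ _ (sm_smooth sG)).
    apply: cder_scale; apply: csmooth_cder; apply: schw_smooth; exact: schw_slice.
  - by move=> y'; rewrite PE; exact: cintegrable_family.
  - exact: rint_jbr.
  - by move=> X; rewrite invr_ge0 jbrX_ge0.
  - by move=> y' X; rewrite /P row_mxKl row_mxKr mulr1; exact: HM.
by apply: eq_cder H => // y'; rewrite IH.
Qed.

(** A tempered distribution can be carried under an absolutely convergent integral
    of Schwartz functions: the Riemann sums converge in every Schwartz seminorm. *)
Lemma temp_exchange (u : fn N -> C) : tempered u -> schwartz f ->
  u f = cintegral (fun X => c X * u (fun y => F (row_mx X y))).
Proof.
move=> tu sf.
have [k [M [M0 HM]]] := temp_bound tu.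
have [M1 [K1 [M10 H1]]] := temp_family_bound tu sF.
have [M2 [K2 [M20 H2]]] := temp_family_lip tu sF.
pose G s := cpderiv (map (@rshift d N) s) F.
have [|s|M3 [K3 [M30 H3]]] := @words_unif R N k (fun s M K =>
    (forall X y, jbr y ^+ k * normc (G s (row_mx X y)) <= M * jbr X ^+ K) /\
    (forall X Y y, `|X - Y| <= 1 -> jbr y ^+ k * normc (G s (row_mx X y) - G s (row_mx Y y)) <=
       M * `|X - Y| * jbr X ^+ K)).
- move=> s A L A' L' AA LL [h h']; split.
    move=> X y; apply: (le_trans (h X y)).
    have A0 : 0 <= A.
      have := le_trans (mulr_ge0 (jbrX_ge0 _ _) (normc_ge0 _)) (h X y).
      by rewrite pmulr_lge0 ?jbrX_gt0.
    by rewrite ler_pM ?jbrX_ge0 ?jbrX_le.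
  move=> X Y y XY; apply: (le_trans (h' X Y y XY)).
  have A0 : 0 <= A.
    have := le_trans (mulr_ge0 (jbrX_ge0 _ _) (normc_ge0 _)) (h X y).
    by rewrite pmulr_lge0 ?jbrX_gt0.
  by rewrite ler_pM ?mulr_ge0 ?jbrX_ge0 ?jbrX_le // ler_wpM2r.
- have sG : sm (@Bsf R d N) (G s) by exact: sm_cpderiv.
  have [A [L [A0 h]]] := Bsf_ge0 (sm_bound sG) k.
  have [A' [L' [A0' h']]] := sf_lip_pt k sG.
  exists (A + A'), (L + L')%N; split; first exact: addr_ge0.
  split.
    move=> X y; apply: (le_trans (h X y)).
    by rewrite ler_pM ?jbrX_ge0 ?jbrX_le ?leq_addr // lerDl.
  move=> X Y y XY; apply: (le_trans (h' X Y y XY)).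
  by rewrite ler_pM ?mulr_ge0 ?jbrX_ge0 ?jbrX_le ?leq_addl // ler_wpM2r // lerDr.
pose K := (K1 + K2 + K3)%N.
have [I I0 HI] := @riemann R d c K cc Bc.
have uc : ccont (fun X => u (fun y => F (row_mx X y))) := lip_ccont H2.
pose D := M * (M3 * I) + (M1 + M2) * I.
have D0 : 0 <= D by rewrite addr_ge0 // !mulr_ge0 // addr_ge0.
(* The difference is bounded by D / (j + 1) for every j, through the j-th Riemann sum. *)
suff bnd : forall j : nat, normc (u f - cintegral (fun X => c X * u (fun y => F (row_mx X y)))) <= D / j.+1%:R.
  apply/eqP; rewrite -subr_eq0 -normc_eq0; apply/negP => /negP n0.
  have np : 0 < normc (u f - cintegral (fun X => c X * u (fun y => F (row_mx X y)))).
    by rewrite lt0r n0 normc_ge0.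
  set e := normc _ in bnd np.
  have := floorD1_gt (D / e).
  have fl0 : 0 <= Num.floor (D / e) by rewrite floor_ge0 divr_ge0 // ltW.
  have := bnd (absz (Num.floor (D / e))); rewrite ler_pdivlMr // => h.
  have E : (Num.floor (D / e) + 1)%:~R * e = e * (absz (Num.floor (D / e))).+1%:R :> R.
    rewrite mulrC; congr (_ * _); rewrite -natr1 intrD; congr (_ + _).
    by rewrite pmulrn gez0_abs.
  by rewrite ltr_pdivrMr // E ltNge h.
move=> j; have [T [a [pt HT]]] := HI j.
pose S y := \sum_t a t * F (row_mx (pt t) y).
have [sS uS] := @temp_sum _ _ _ tu T (index_enum T) (fun t y => a t * F (row_mx (pt t) y))
  (fun t => schw_scale (a t) (schw_slice (pt t) sF)).
have uS' : u S = \sum_t a t * u (fun y => F (row_mx (pt t) y)).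
  rewrite /S uS; apply: eq_bigr => t _; rewrite (tempZ tu) //; exact: schw_slice.
have j0 : 0 < j.+1%:R :> R by [].
have b1 : normc (u f - u S) <= M * (M3 * I) / j.+1%:R.
  rewrite -(tempB tu) //; apply: (le_trans (HM _ _)); first by apply: schw_add => //; exact: schw_opp.
  rewrite -mulrA ler_wpM2l //; apply: schwartz_norm_le => s y sk.
  have -> : (fun x => f x - S x) = (fun x => f x + (-1) * S x) by apply/funext => x; rewrite mulN1r.
  rewrite cpderivD; [|exact: schw_smooth|by apply: schw_smooth; exact: schw_scale].
  rewrite cpderivZ; last exact: schw_smooth.
  have -> : cpderiv s S y = \sum_t a t * G s (row_mx (pt t) y).
    rewrite /S /G; elim: (index_enum T) => [|t r IH].
      rewrite big_nil (_ : (fun y => _) = (fun y => 0 * f y)); last first.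
        by apply/funext => z; rewrite big_nil mul0r.
      by rewrite cpderivZ ?mul0r //; exact: schw_smooth.
    rewrite big_cons -IH.
    rewrite (_ : (fun y => _) = (fun y => a t * F (row_mx (pt t) y) + \sum_(t <- r) a t * F (row_mx (pt t) y))); last first.
      by apply/funext => z; rewrite big_cons.
    have sl := schw_slice (pt t) sF.
    rewrite cpderivD; [|by apply: schw_smooth; exact: schw_scale|]; last first.
      apply: schw_smooth; have [+ _] := @temp_sum _ _ _ tu T r (fun t y => a t * F (row_mx (pt t) y))
        (fun t => schw_scale (a t) (schw_slice (pt t) sF)); exact.
    rewrite cpderivZ; last exact: schw_smooth.
    by rewrite cpderiv_slice //; exact: sm_smooth sF.
  rewrite mulN1r cpderiv_family.
  have [h h'] := H3 s sk.
  pose v X := (jbr y ^+ k)%:C * G s (row_mx X y).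
  have -> : jbr y ^+ k * normc (cintegral (fun X => c X * G s (row_mx X y)) - \sum_t a t * G s (row_mx (pt t) y)) =
      normc (cintegral (fun X => c X * v X) - \sum_t a t * v (pt t)).
    rewrite -{1}(ger0_norm (jbrX_ge0 y k)) -normcR -normcM mulrBr; congr (normc (_ - _)).
      rewrite -cintegralZ; last by apply: cintegrable_family; exact: sm_cpderiv.
      by apply: eq_cintegral => X; rewrite /v mulrCA.
    by rewrite mulr_sumr; apply: eq_bigr => t _; rewrite /v mulrCA.
  apply: HT => //.
  - by apply: ccont_mul; [exact: ccont_cst|apply: ccont_slice; apply: (sm_ccont (B := @Bsf R d N)); exact: sm_cpderiv].
  - move=> X; rewrite normcM normcR ger0_norm ?jbrX_ge0 //; apply: (le_trans (h X y)).
    by rewrite ler_wpM2l // jbrX_le // leq_addl.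
  - move=> X Y XY; rewrite -mulrBr normcM normcR ger0_norm ?jbrX_ge0 //; apply: (le_trans (h' X Y y XY)).
    by rewrite ler_wpM2l ?mulr_ge0 // jbrX_le // leq_addl.
have b2 : normc (cintegral (fun X => c X * u (fun y => F (row_mx X y))) - u S) <= (M1 + M2) * I / j.+1%:R.
  rewrite uS'; apply: HT => //.
  - exact: addr_ge0.
  - move=> X; apply: (le_trans (H1 X)); rewrite ler_pM ?jbrX_ge0 ?jbrX_le // ?lerDl //.
    by rewrite /K -addnA leq_addr.
  - move=> X Y XY; apply: (le_trans (H2 X Y XY)).
    have hK : (K2 <= K)%N by rewrite /K addnAC leq_addl.
    by rewrite ler_pM ?mulr_ge0 ?jbrX_ge0 ?jbrX_le // ler_wpM2r // lerDr.
rewrite /D mulrDl; apply: (le_trans _ (lerD b1 b2)).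
rewrite [X in _ <= _ + X]normc_distC; apply: le_trans (normcD _ _).
by rewrite addrA subrK.
Qed.
End exchange.
End IntegralExchange.

(** * Wave packets *)

Section Packets.
Variable R : realType.
Local Notation C := R[i].
Local Notation fn N := ('rV[R]_N -> C).
Local Notation ebase i := (delta_mx 0 i : 'rV[R]_(_)).

Lemma jbr_shift_dec N (x y : 'rV[R]_N) k : (jbr (y + x) ^+ k)^-1 <= 2 ^+ k * jbr x ^+ k / jbr y ^+ k.
Proof.
rewrite ler_pdivlMr ?jbrX_gt0 // mulrC ler_pdivrMr ?jbrX_gt0 //.
have -> : jbr y = jbr (y + x - x) by rewrite addrK.
by apply: (le_trans (jbrXD _ _ _)); rewrite jbrN -mulrA [jbr x ^+ k * _]mulrC.
Qed.

Lemma cintegral_deriv0 N (f : fn N) i : schwartz f -> cintegral (cpderiv [:: i] f) = 0.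
Proof.
move=> sf; set f' := cpderiv [:: i] f.
have sf' : schwartz f' by exact: schw_cpderiv.
pose P (h : fn N) : fn (N + N) := fun z => h (rsubmx z + lsubmx z).
have PE h x : (fun y => P h (row_mx x y)) = (fun y => h (y + x)).
  by apply/funext => y; rewrite /P row_mxKl row_mxKr.
have [M M0 HM] := Brd_dec (N + N) (schw_Brd sf').
have := @cder_cintegral R N N (P f) (P f') i (M * 2 ^+ (N + N)) (N + N)
   (fun y => (jbr y ^+ (N + N))^-1) 0.
rewrite PE => H.
have {}H : cder (ebase i) (fun _ : 'rV[R]_N => cintegral f) 0 (cintegral f').
  have -> : cintegral f' = cintegral (fun y => f' (y + 0)) by apply: eq_cintegral => y; rewrite addr0.
  have -> : (fun _ : 'rV[R]_N => cintegral f) = (fun x => cintegral (fun y => P f (row_mx x y))).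
    by apply/funext => x; rewrite PE cintegral_shift //; exact: schw_cintegrable.
  apply: H.
  - move=> x y.
    apply: (@eq_cder _ _ _ (fun x => f (x *m 1%:M + y)) _ _ (f' (x *m 1%:M + y))).
    + by move=> x'; rewrite /P row_mxKl row_mxKr mulmx1 addrC.
    + by rewrite /P row_mxKl row_mxKr mulmx1 addrC.
    by apply: cder_aff; rewrite mulmx1; apply: csmooth_cder; exact: schw_smooth.
  - by move=> x; rewrite PE; apply: cintegrable_shift; exact: schw_cintegrable.
  - exact: rint_jbr.
  - by move=> y; rewrite invr_ge0 jbrX_ge0.
  - move=> x y; rewrite /P row_mxKl row_mxKr; apply: (le_trans (HM _)).
    by rewrite -!mulrA ler_wpM2l // !mulrA jbr_shift_dec.
by rewrite (cder_uniq H) -(cder_uniq (cder_cst (ebase i) (cintegral f) 0)).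
Qed.

(** Rapid decrease can be tested on powers of single coordinates. *)
Lemma jbrX_le_coord N (x : 'rV[R]_N) L : jbr x ^+ L <= (2 * N.+1%:R) ^+ L * (1 + \sum_j `|x 0 j| ^+ L).
Proof.
have S0 : 0 <= \sum_j `|x 0 j| ^+ L by apply: sumr_ge0 => j _; rewrite exprn_ge0.
have h : jbr x ^+ L <= (N.+1%:R * (1 + `|x|)) ^+ L.
  by rewrite lerXn2r ?nnegrE ?jbr_ge0 ?mulr_ge0 ?addr_ge0 // jbr_le_norm.
apply: (le_trans h); rewrite ![in X in X <= _]exprMn exprMn [2 ^+ L * _]mulrC -mulrA.
rewrite ler_wpM2l ?exprn_ge0 //.
have [x1|x1] := leP `|x| 1.
  apply: (@le_trans _ _ (2 ^+ L)); first by rewrite lerXn2r ?nnegrE ?addr_ge0 //; lra.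
  by rewrite -[leLHS]mulr1 ler_wpM2l ?exprn_ge0 // lerDl.
apply: (@le_trans _ _ ((2 * `|x|) ^+ L)).
  by rewrite lerXn2r ?nnegrE ?addr_ge0 ?mulr_ge0 //; lra.
rewrite exprMn ler_wpM2l ?exprn_ge0 //.
have xn : `|x| != 0 by rewrite gt_eqF // (lt_trans ltr01).
have [[i j] /= hij] := mx_norm_neq0 xn.
have -> : `|x| = `|x 0 j| by rewrite -(ord1 i) -hij.
rewrite (bigD1 j) //= addrCA lerDl addr_ge0 //.
by apply: sumr_ge0 => k _; rewrite exprn_ge0.
Qed.

Lemma sm_lin N (b : 'rV[R]_N) (c : R) : sm (@Bpoly R N) (fun p => (dotmx p b + c)%:C).
Proof.
apply: (@eq_sm _ _ _ (fun p => \sum_i ((b 0 i)%:C * (p 0 i)%:C) + c%:C)) => [p|].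
  rewrite [RHS](rmorphD (real_complex R)) /dotmx (rmorph_sum (real_complex R)); congr (_ + _).
  by apply: eq_bigr => i _; rewrite mulrC -rmorphM.
apply: sm_add; [exact: linclosed_Bpoly| |exact: sm_cst].
by apply: sm_sum => i; apply: sm_scale; [exact: linclosed_Bpoly|exact: sm_coord].
Qed.

Lemma sm_cis_lin N (b : 'rV[R]_N) (c : R) : sm (@Bpoly R N) (fun p => cis (dotmx p b + c)).
Proof.
apply: (@eq_sm _ _ _ (fun x => cexp ('i%C * (dotmx x b + c)%:C))) => [x|].
  by congr cexp; apply: ReIm_eq; rewrite ?ReM ?ImM /=; ring.
apply: sm_cexp; first exact: linclosed_Bpoly.
  by apply: sm_scale; [exact: linclosed_Bpoly|exact: sm_lin].
move=> a [K [k H]]; exists K, k => x; rewrite normcM normc_cexp.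
by rewrite ReM /= mul0r mul1r subrr expR0 mulr1.
Qed.

Lemma dotmxBl N (x y z : 'rV[R]_N) : dotmx (x - y) z = dotmx x z - dotmx y z.
Proof. by rewrite /dotmx -sumrB; apply: eq_bigr => i _; rewrite !mxE mulrBl. Qed.
Lemma dotmxDl N (x y z : 'rV[R]_N) : dotmx (x + y) z = dotmx x z + dotmx y z.
Proof. by rewrite /dotmx -big_split; apply: eq_bigr => i _; rewrite !mxE mulrDl. Qed.
Lemma dotmxC N (x y : 'rV[R]_N) : dotmx x y = dotmx y x.
Proof. by apply: eq_bigr => i _; rewrite mulrC. Qed.
Lemma dotmxDr N (x y z : 'rV[R]_N) : dotmx z (x + y) = dotmx z x + dotmx z y.
Proof. by rewrite !(dotmxC z) dotmxDl. Qed.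
Lemma dotmxBr N (x y z : 'rV[R]_N) : dotmx z (x - y) = dotmx z x - dotmx z y.
Proof. by rewrite !(dotmxC z) dotmxBl. Qed.
Lemma dotmxZl N a (x z : 'rV[R]_N) : dotmx (a *: x) z = a * dotmx x z.
Proof. by rewrite /dotmx mulr_sumr; apply: eq_bigr => i _; rewrite !mxE mulrA. Qed.
Lemma dotmxZr N a (x z : 'rV[R]_N) : dotmx z (a *: x) = a * dotmx z x.
Proof. by rewrite !(dotmxC z) dotmxZl. Qed.
Lemma dotmxNl N (x z : 'rV[R]_N) : dotmx (- x) z = - dotmx x z.
Proof. by rewrite -scaleN1r dotmxZl mulN1r. Qed.
Lemma dotmxNr N (x z : 'rV[R]_N) : dotmx z (- x) = - dotmx z x.
Proof. by rewrite !(dotmxC z) dotmxNl. Qed.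
Lemma dotmx0l N (z : 'rV[R]_N) : dotmx 0 z = 0.
Proof. by rewrite /dotmx big1 // => i _; rewrite mxE mul0r. Qed.
Lemma dotmx_realC N (x b : 'rV[R]_N) : (dotmx x b)%:C = \sum_i (b 0 i)%:C * (x 0 i)%:C.
Proof.
rewrite /dotmx (rmorph_sum (real_complex R)).
by apply: eq_bigr => i _; rewrite mulrC -rmorphM.
Qed.

Lemma dotmx_ebase N (b : 'rV[R]_N) j : dotmx (ebase j) b = b 0 j.
Proof.
rewrite /dotmx (bigD1 j) //= mxE !eqxx mul1r big1 ?addr0 // => k kj.
by rewrite mxE (negbTE kj) andbF mul0r.
Qed.

Lemma cder_cis_lin N (v b x : 'rV[R]_N) (c : R) :
  cder v (fun p => cis (dotmx p b + c)) x ('i%C * (dotmx v b)%:C * cis (dotmx x b + c)).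
Proof.
have e (t : R) : cis t = cexp ('i%C * t%:C).
  by congr cexp; apply: ReIm_eq; rewrite ?ReM ?ImM /=; ring.
have eD (p : 'rV[R]_N) : (dotmx p b + c)%:C = (dotmx p b)%:C + c%:C by rewrite -rmorphD.
apply: (@eq_cder _ _ _ (fun p => cexp ('i%C * (\sum_i (b 0 i)%:C * (p 0 i)%:C + c%:C))) _ _
  ('i%C * (\sum_i (b 0 i)%:C * (v 0 i)%:C + 0) * cexp ('i%C * (\sum_i (b 0 i)%:C * (x 0 i)%:C + c%:C)))).
- by move=> p; rewrite e eD dotmx_realC.
- by rewrite addr0 -!dotmx_realC e eD.
apply: cder_cexp; apply: cder_scale; apply: cder_add; last exact: cder_cst.
by apply: cder_sum => k; apply: cder_scale; exact: cder_coord.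
Qed.

(** Wave packet with profile [G], centred at the point [X] of phase space. The sign and
    the reference point of the phase are those of the Bargmann kernel at a real point. *)
Definition wp N (G : fn N) (X : 'rV[R]_(N + N)) (p : 'rV[R]_N) : C :=
  G (p - lsubmx X) * cis (- dotmx (p - lsubmx X) (rsubmx X)).

Definition ip N (f g : fn N) : C := cintegral (fun p => f p * conjc (g p)).

Lemma conj_wp N (G : fn N) X p : conjc (wp G X p) =
  conjc (G (p - lsubmx X)) * cis (dotmx (p - lsubmx X) (rsubmx X)).
Proof. by rewrite /wp conjcME conj_cis opprK. Qed.

Lemma wp_joint N (G : fn N) : schwartz G ->
  sm (@Bsf R (N + N) N) (fun z => wp G (lsubmx z) (rsubmx z)).
Proof.
move=> /schwartzP sG.
pose A : 'M[R]_(N + N + N, N) := selR _ _ _ - selL _ _ _ *m selL _ _ _.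
pose B : 'M[R]_(N + N + N, N) := selL _ _ _ *m selR _ _ _.
have AE (z : 'rV[R]_(N+N+N)) : z *m A = rsubmx z - lsubmx (lsubmx z) by rewrite /A mulmxBr mul_selR mulmxA !mul_selL.
have BE (z : 'rV[R]_(N+N+N)) : z *m B = rsubmx (lsubmx z) by rewrite /B mulmxA mul_selL mul_selR.
apply: sm_sf_poly_mul.
  apply: (@eq_sm _ _ _ (fun z => G (z *m A + 0))) => [z|]; first by rewrite addr0 AE.
  apply: (sm_aff _ _ sG); first exact: linclosed_Bsf.
  move=> g Bg k; have [M M0 H] := Brd_ge0 Bg k; exists (2 ^+ k * M), k => X y.
  rewrite addr0 AE row_mxKl row_mxKr; set q := y - lsubmx X.
  apply: (@le_trans _ _ (2 ^+ k * (jbr q ^+ k * normc (g q)) * jbr X ^+ k)); last first.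
    by rewrite ler_wpM2r ?jbrX_ge0 // ler_wpM2l ?exprn_ge0.
  have -> : 2 ^+ k * (jbr q ^+ k * normc (g q)) * jbr X ^+ k = 2 ^+ k * (jbr q ^+ k * jbr X ^+ k) * normc (g q) by ring.
  rewrite ler_wpM2r ?normc_ge0 //.
  have -> : y = q + lsubmx X by rewrite subrK.
  apply: (le_trans (jbrXD _ _ _)); rewrite ler_wpM2l ?exprn_ge0 // ler_wpM2l ?jbrX_ge0 //.
  by rewrite lerXn2r ?nnegrE ?jbr_ge0 // jbr_lsubmx.
apply: (@eq_sm _ _ _ (fun z => cis (dotmx (z *m (- A)) (z *m B)))); last exact: sm_cis_dotmx.
by move=> z; rewrite mulmxN AE BE dotmxNl.
Qed.

Lemma wp_schw N (G : fn N) X : schwartz G -> schwartz (wp G X).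
Proof.
move=> /wp_joint/(schw_slice X); congr schwartz; apply/funext => p.
by rewrite row_mxKl row_mxKr.
Qed.

Lemma schwartz_norm_mono N k k' (f : fn N) : schwartz f -> (k <= k')%N ->
  schwartz_norm k f <= schwartz_norm k' f.
Proof.
move=> sf kk; apply: schwartz_norm_le => s x sk.
apply: le_trans (schwartz_norm_ub x sf (leq_trans sk kk)).
by rewrite ler_wpM2r ?normc_ge0 // jbrX_le.
Qed.

(** A derivative costs one order in the seminorm; this is how integration by parts is paid
    for. *)
Lemma schwartz_norm_cpderiv N k i (f : fn N) : schwartz f ->
  schwartz_norm k (cpderiv [:: i] f) <= schwartz_norm k.+1 f.
Proof.
move=> sf; apply: schwartz_norm_le => s x sk; rewrite -cpderiv_cat.
apply: le_trans (schwartz_norm_ub x sf (_ : (size (s ++ [:: i]) <= k.+1)%N)).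
  by rewrite ler_wpM2r ?normc_ge0 // jbrX_le.
by rewrite size_cat addn1.
Qed.

(** Integration by parts: the pairing of a Schwartz function with a wave packet
    decreases rapidly in both phase space variables. *)
Lemma stft_decay N (G : fn N) : schwartz G -> forall L, exists K M, 0 <= M /\
  forall f X, schwartz f -> normc (ip f (wp G X)) * jbr X ^+ L <= M * schwartz_norm K f.
Proof.
move=> sG L.
pose V (h f : fn N) X := cintegral (fun p => f p * (h (p - lsubmx X) * cis (dotmx (p - lsubmx X) (rsubmx X)))).
have smc X : sm (@Bpoly R N) (fun p => cis (dotmx (p - lsubmx X) (rsubmx X))).
  apply: (@eq_sm _ _ _ (fun p => cis (dotmx p (rsubmx X) + - dotmx (lsubmx X) (rsubmx X)))).
    by move=> p; rewrite dotmxBl.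
  exact: sm_cis_lin.
have sV (h f : fn N) X : schwartz h -> schwartz f ->
    schwartz (fun p => f p * (h (p - lsubmx X) * cis (dotmx (p - lsubmx X) (rsubmx X)))).
  by move=> sh sf; apply: schw_mul => //; apply: schw_poly_mul => //; exact: schw_shift.
(* decay in the position variable, from that of both factors *)
have base (h : fn N) l : schwartz h -> exists K M, 0 <= M /\ forall f X, schwartz f ->
    jbr (lsubmx X) ^+ l * normc (V h f X) <= M * schwartz_norm K f.
  move=> sh; have [M M0 HM] := Brd_ge0 (schw_Brd sh) l.
  pose W := rI (fun x : 'rV[R]_N => (jbr x ^+ (N + N))^-1).
  have W0 : 0 <= W by apply: rI_ge0 => x; rewrite invr_ge0 jbrX_ge0.
  exists (l + (N + N))%N, (2 ^+ l * M * W); split; first by rewrite !mulr_ge0 ?exprn_ge0.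
  move=> f X sf; set nf := schwartz_norm _ f.
  have nf0 : 0 <= nf by exact: schwartz_norm_ge0.
  have -> : 2 ^+ l * M * W * nf = (2 ^+ l * M * nf) * W by ring.
  rewrite -ler_pdivlMl ?jbrX_gt0 // mulrA [_^-1 * _]mulrC.
  apply: le_cintegral_jbr; first by apply: ccont_cmeas; apply: schw_ccont; exact: sV.
  move=> p; rewrite 2!normcM normc_cis mulr1.
  rewrite ler_pdivlMr ?jbrX_gt0 // ler_pdivlMr ?jbrX_gt0 //.
  set q := p - lsubmx X.
  have hf : jbr p ^+ (l + (N + N)) * normc (f p) <= nf.
    by have := schwartz_norm_ub (s := [::]) p sf (leq0n (l + (N + N))); rewrite cpderiv_nil.
  have hj : jbr (lsubmx X) ^+ l <= 2 ^+ l * (jbr p ^+ l * jbr q ^+ l).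
    have -> : lsubmx X = p - q by rewrite /q opprB addrCA subrr addr0.
    by apply: (le_trans (jbrXD _ _ _)); rewrite jbrN.
  apply: (@le_trans _ _ (2 ^+ l * (jbr q ^+ l * normc (h q)) * (jbr p ^+ (l + (N + N)) * normc (f p)))).
    have -> : 2 ^+ l * (jbr q ^+ l * normc (h q)) * (jbr p ^+ (l + (N + N)) * normc (f p)) =
      (normc (f p) * normc (h q) * jbr p ^+ (N + N)) * (2 ^+ l * (jbr p ^+ l * jbr q ^+ l)).
      by rewrite [jbr p ^+ (l + _)]exprD; ring.
    by rewrite ler_wpM2l // !mulr_ge0 ?normc_ge0 ?jbrX_ge0.
  rewrite ler_pM ?mulr_ge0 ?exprn_ge0 ?jbr_ge0 ?normc_ge0 // ler_wpM2l ?exprn_ge0 //.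
(* integration by parts in the coordinate j gains a factor X_j in frequency *)
have step (h f : fn N) j X : schwartz h -> schwartz f ->
   'i%C * (rsubmx X 0 j)%:C * V h f X = - (V h (cpderiv [:: j] f) X + V (cpderiv [:: j] h) f X).
  move=> sh sf; have := cintegral_deriv0 j (sV h f X sh sf).
  have -> : cpderiv [:: j] (fun p => f p * (h (p - lsubmx X) * cis (dotmx (p - lsubmx X) (rsubmx X)))) =
     (fun p => cpderiv [:: j] f p * (h (p - lsubmx X) * cis (dotmx (p - lsubmx X) (rsubmx X))) +
       (f p * (cpderiv [:: j] h (p - lsubmx X) * cis (dotmx (p - lsubmx X) (rsubmx X))) +
        'i%C * (rsubmx X 0 j)%:C * (f p * (h (p - lsubmx X) * cis (dotmx (p - lsubmx X) (rsubmx X)))))).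
    apply: cpderiv_eq => p.
    have d1 := csmooth_cder j p (schw_smooth sf).
    have d2 : cder (ebase j) (fun p => h (p - lsubmx X)) p (cpderiv [:: j] h (p - lsubmx X)).
      apply: (@eq_cder _ _ _ (fun x => h (x *m 1%:M - lsubmx X)) _ _ (cpderiv [:: j] h (p *m 1%:M - lsubmx X))).
      - by move=> x; rewrite mulmx1.
      - by rewrite mulmx1.
      by apply: cder_aff; rewrite mulmx1; apply: csmooth_cder; exact: schw_smooth.
    have d3 : cder (ebase j) (fun p => cis (dotmx (p - lsubmx X) (rsubmx X))) p
        ('i%C * (rsubmx X 0 j)%:C * cis (dotmx (p - lsubmx X) (rsubmx X))).
      apply: (@eq_cder _ _ _ (fun x => cis (dotmx x (rsubmx X) + - dotmx (lsubmx X) (rsubmx X))) _ _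
        ('i%C * (dotmx (ebase j) (rsubmx X))%:C * cis (dotmx p (rsubmx X) + - dotmx (lsubmx X) (rsubmx X)))).
      - by move=> x; rewrite dotmxBl.
      - by rewrite dotmxBl dotmx_ebase.
      exact: cder_cis_lin.
    by apply: (eq_cder _ _ (cder_mul d1 (cder_mul d2 d3))) => //; ring.
  have i1 := schw_cintegrable (sV h (cpderiv [:: j] f) X sh (schw_cpderiv [:: j] sf)).
  have i2 := schw_cintegrable (sV (cpderiv [:: j] h) f X (schw_cpderiv [:: j] sh) sf).
  have i3 := schw_cintegrable (sV h f X sh sf).
  rewrite cintegralD //; last by apply: cintegrableD => //; exact: cintegrableZ.
  rewrite cintegralD //; last exact: cintegrableZ.
  by rewrite cintegralZ // addrA addrC => /eqP; rewrite addr_eq0 => /eqP.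
have pw j l : forall (h : fn N) L', schwartz h -> exists K M, 0 <= M /\ forall f X, schwartz f ->
    `|rsubmx X 0 j| ^+ l * (jbr (lsubmx X) ^+ L' * normc (V h f X)) <= M * schwartz_norm K f.
  elim: l => [|l IH] h L' sh.
    have [K [M [M0 H]]] := base h L' sh; exists K, M; split => // f X sf.
    by rewrite expr0 mul1r; exact: H.
  have [K1 [M1 [M10 H1]]] := IH h L' sh.
  have [K2 [M2 [M20 H2]]] := IH (cpderiv [:: j] h) L' (schw_cpderiv [:: j] sh).
  exists (K1.+1 + K2)%N, (M1 + M2); split; first exact: addr_ge0.
  move=> f X sf; have sf' := schw_cpderiv [:: j] sf.
  have nV : `|rsubmx X 0 j| * normc (V h f X) <= normc (V h (cpderiv [:: j] f) X) + normc (V (cpderiv [:: j] h) f X).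
    apply: le_trans (normcD _ _); rewrite -[leRHS]normc_opp -step // 2!normcM normcR.
    by rewrite (_ : normc 'i%C = 1) ?mul1r // /normc /= expr0n /= add0r expr1n sqrtr1.
  apply: (@le_trans _ _ (`|rsubmx X 0 j| ^+ l * (jbr (lsubmx X) ^+ L' *
       (normc (V h (cpderiv [:: j] f) X) + normc (V (cpderiv [:: j] h) f X))))).
    rewrite exprSr -!mulrA ler_wpM2l ?exprn_ge0 // mulrCA ler_wpM2l ?jbrX_ge0 //.
  rewrite !mulrDr mulrDl; apply: lerD.
    apply: (le_trans (H1 _ X sf')); rewrite ler_wpM2l //.
    apply: (le_trans (schwartz_norm_cpderiv K1 j sf)).
    by apply: schwartz_norm_mono => //; exact: leq_addr.
  apply: (le_trans (H2 _ X sf)); rewrite ler_wpM2l //.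
  by apply: schwartz_norm_mono => //; exact: leq_addl.
pose h p := conjc (G p); have sh : schwartz h by exact: schw_conj.
have VE f X : ip f (wp G X) = V h f X by apply: eq_cintegral => p; rewrite conj_wp.
have [K0 [M0 [M00 H0]]] := base h L sh.
have [|j|M1 [K1 [M10 H1]]] := @fin_unif R _ (fun (j : 'I_N) M K => forall f X, schwartz f ->
    `|rsubmx X 0 j| ^+ L * (jbr (lsubmx X) ^+ L * normc (V h f X)) <= M * schwartz_norm K f).
- move=> j M K M' K' MM KK H f X sf; apply: (le_trans (H f X sf)).
  have n0 := schwartz_norm_ge0 K sf; have n0' := schwartz_norm_ge0 K' sf.
  apply: (@le_trans _ _ (M' * schwartz_norm K f)); first by rewrite ler_wpM2r.
  have M'0 : 0 <= M' \/ M' < 0 by case: (leP 0 M') => ?; [left|right].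
  case: M'0 => M'0; first by rewrite ler_wpM2l // schwartz_norm_mono.
  have h1 : 0 <= M * schwartz_norm K f.
    by apply: le_trans (H f X sf); rewrite !mulr_ge0 ?exprn_ge0 ?jbr_ge0 ?normc_ge0.
  have nz : schwartz_norm K f = 0.
    apply/eqP; rewrite eq_le n0 andbT; rewrite leNgt; apply/negP => np.
    by move: h1; rewrite pmulr_lge0 // => M0'; move: (le_trans M0' MM); rewrite leNgt M'0.
  have := H (fun=> 0) X (schw0 R N).
  rewrite nz mulr0.
  have fz p : f p = 0.
    apply/eqP; rewrite -normc_eq0 eq_le normc_ge0 andbT.
    have := schwartz_norm_ub (s := [::]) p sf (leq0n K); rewrite cpderiv_nil nz.
    by rewrite pmulr_rle0 ?jbrX_gt0.
  move=> _; have -> : schwartz_norm K' f = 0; last by rewrite mulr0.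
  apply/eqP; rewrite eq_le n0' andbT; apply: schwartz_norm_le => s p _.
  have -> : cpderiv s f p = 0; last by rewrite normc0 mulr0.
  have -> : f = (fun=> 0 * 0) by apply/funext => q; rewrite fz mul0r.
  by rewrite cpderivZ ?mul0r //; apply: schw_smooth; exact: schw0.
- by have [K [M [M0' H]]] := pw j L h L sh; exists M, K.
exists (K0 + K1)%N, ((2 * N.+1%:R) ^+ L * (M0 + N%:R * M1)); split.
  by rewrite mulr_ge0 ?addr_ge0 ?mulr_ge0 ?exprn_ge0 ?mulr_ge0.
move=> f X sf; rewrite VE.
apply: (@le_trans _ _ (jbr (rsubmx X) ^+ L * (jbr (lsubmx X) ^+ L * normc (V h f X)))).
  rewrite mulrA [leLHS]mulrC ler_wpM2r ?normc_ge0 // mulrC -exprMn.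
  by rewrite lerXn2r ?nnegrE ?mulr_ge0 ?jbr_ge0 // -{1}(hsubmxK X) jbr_row_mx.
apply: (le_trans (ler_wpM2r _ (jbrX_le_coord _ L))); first by rewrite mulr_ge0 ?jbrX_ge0 ?normc_ge0.
rewrite -!mulrA ler_wpM2l ?exprn_ge0 ?mulr_ge0 // mulrDl mul1r [leRHS]mulrDl; apply: lerD.
  by apply: (le_trans (H0 f X sf)); rewrite ler_wpM2l // schwartz_norm_mono // leq_addr.
rewrite mulr_suml; apply: (@le_trans _ _ (\sum_(j < N) M1 * schwartz_norm (K0 + K1) f)).
  apply: ler_sum => j _; apply: (le_trans (H1 j f X sf)).
  by rewrite ler_wpM2l // schwartz_norm_mono // leq_addl.
by rewrite sumr_const card_ord -[leLHS]mulr_natl mulrA.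
Qed.
End Packets.

(** * The Fourier transform of Schwartz functions *)

Section PartialFourier.
Variable R : realType.
Local Notation C := R[i].
Local Notation fn N := ('rV[R]_N -> C).
Local Notation ebase i := (delta_mx 0 i : 'rV[R]_(_)).

Lemma schw_mul_poly N (f g : fn N) : sm (@Bpoly R N) g -> schwartz f -> schwartz (fun x => g x * f x).
Proof.
move=> sg sf; have := schw_poly_mul sf sg; congr schwartz.
by apply/funext => x; rewrite mulrC.
Qed.

(** Fourier transform in the second group of variables. *)
Definition pft a N (b : fn (a + N)) : fn (a + N) := fun w =>
  cintegral (fun th => cis (dotmx (rsubmx w) th) * b (row_mx (lsubmx w) th)).

Let pftF a N (b : fn (a + N)) : fn (a + N + N) := fun Z =>
  cis (dotmx (rsubmx (lsubmx Z)) (rsubmx Z)) * b (row_mx (lsubmx (lsubmx Z)) (rsubmx Z)).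

Let pftFE a N (b : fn (a + N)) w : (fun th => pftF b (row_mx w th)) =
  (fun th => cis (dotmx (rsubmx w) th) * b (row_mx (lsubmx w) th)).
Proof. by apply/funext => th; rewrite /pftF row_mxKl row_mxKr. Qed.

Let pftF_cont a N (b : fn (a + N)) : schwartz b -> ccont (pftF b).
Proof.
move=> sb; apply: ccont_mul.
  apply: ccont_cis; apply: cont_dotmx.
    exact: (cont_comp (@cont_lsubmx _ _ _) (@cont_rsubmx _ _ _)).
  exact: cont_rsubmx.
apply: ccont_comp; last exact: schw_ccont.
apply: cont_row_mx; last exact: cont_rsubmx.
exact: (cont_comp (@cont_lsubmx _ _ _) (@cont_lsubmx _ _ _)).
Qed.

Let pftF_bound a N (b : fn (a + N)) : schwartz b -> exists2 M, 0 <= M &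
  forall w th, normc (pftF b (row_mx w th)) <= M * (jbr th ^+ (N + N))^-1.
Proof.
move=> sb; have [M M0 HM] := Brd_dec (N + N) (schw_Brd sb); exists M => // w th.
rewrite /pftF row_mxKl row_mxKr normcM normc_cis mul1r; apply: (le_trans (HM _)).
by rewrite ler_wpM2l // lef_pV2 ?posrE ?jbrX_gt0 // lerXn2r ?nnegrE ?jbr_ge0 // jbr_row_mxr.
Qed.

Lemma cintegrable_pft a N (b : fn (a + N)) w : schwartz b ->
  cintegrable (fun th => cis (dotmx (rsubmx w) th) * b (row_mx (lsubmx w) th)).
Proof.
move=> sb; have [M M0 HM] := pftF_bound sb; rewrite -pftFE.
apply: (@cintegrable_jbr _ _ _ M) => [|th]; last exact: HM.
apply: ccont_cmeas; apply: ccont_comp; last exact: pftF_cont.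
by apply: cont_row_mx; [exact: cont_cstv|exact: cont_id].
Qed.

Lemma ccont_pft a N (b : fn (a + N)) : schwartz b -> ccont (pft b).
Proof.
move=> sb; have [M M0 HM] := pftF_bound sb.
apply: (@eq_ccont _ _ (fun w => cintegral (fun th => pftF b (row_mx w th)))).
  by move=> w; rewrite pftFE.
apply: (@ccont_cintegral _ _ _ _ (fun=> M) (fun th => (jbr th ^+ (N + N))^-1)).
- exact: pftF_cont.
- exact: cont_cst.
- exact: rint_jbr.
- by move=> y; rewrite invr_ge0 jbrX_ge0.
exact: HM.
Qed.

Lemma pft_bounded a N (b : fn (a + N)) : schwartz b ->
  exists M, forall w : 'rV[R]_(a + N), normc (pft b w) <= M.
Proof.
move=> sb; have [M M0 HM] := pftF_bound sb.
exists (M * rI (fun th : 'rV[R]_N => (jbr th ^+ (N + N))^-1)) => w.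
rewrite /pft -pftFE; apply: le_cintegral_jbr => [|th]; last exact: HM.
apply: ccont_cmeas; apply: ccont_comp; last exact: pftF_cont.
by apply: cont_row_mx; [exact: cont_cstv|exact: cont_id].
Qed.

Lemma pftZ a N (b : fn (a + N)) k w : schwartz b -> pft (fun x => k * b x) w = k * pft b w.
Proof.
move=> sb; rewrite /pft -cintegralZ; last exact: cintegrable_pft.
by apply: eq_cintegral => th; rewrite mulrCA.
Qed.

(** The Fourier transform trades multiplication by a coordinate for a derivative. *)
Lemma pft_mul_coord a N (b : fn (a + N)) (j : 'I_(a + N)) : schwartz b ->
  exists2 b' : fn (a + N), schwartz b' & forall w : 'rV[R]_(a + N), (w 0 j)%:C * pft b w = pft b' w.
Proof.
move=> sb; case: (splitP j) => i ji.
  have -> : j = lshift N i by apply/val_inj.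
  exists (fun y : 'rV[R]_(a + N) => (y 0 (lshift N i))%:C * b y).
    by apply: schw_mul_poly => //; exact: sm_coord.
  move=> w; rewrite /pft -cintegralZ; last exact: cintegrable_pft.
  by apply: eq_cintegral => th; rewrite row_mxEl mulrCA [w 0 _ in LHS](_ : _ = lsubmx w 0 i) // !mxE.
have -> : j = rshift a i by apply/val_inj.
set b1 := cpderiv [:: rshift a i] b; have sb1 : schwartz b1 by exact: schw_cpderiv.
exists (fun y => 'i%C * b1 y) => [|w]; first exact: schw_scale.
have sl (g : fn (a + N)) : schwartz g -> schwartz (fun th => cis (dotmx (rsubmx w) th) * g (row_mx (lsubmx w) th)).
  move=> sg; apply: schw_mul_poly; last exact: schw_slice_joint.
  apply: (@eq_sm _ _ _ (fun th => cis (dotmx th (rsubmx w) + 0))); first by move=> th; rewrite addr0 dotmxC.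
  exact: sm_cis_lin.
have := cintegral_deriv0 i (sl b sb).
have -> : cpderiv [:: i] (fun th => cis (dotmx (rsubmx w) th) * b (row_mx (lsubmx w) th)) =
  (fun th => 'i%C * (w 0 (rshift a i))%:C * (cis (dotmx (rsubmx w) th) * b (row_mx (lsubmx w) th)) +
     cis (dotmx (rsubmx w) th) * b1 (row_mx (lsubmx w) th)).
  apply: cpderiv_eq => th.
  have d1 := cder_cis_lin (ebase i) (rsubmx w) th 0.
  have d2 := csmooth_cder i th (schw_smooth (schw_slice_joint (lsubmx w) sb)).
  apply: (eq_cder _ _ (cder_mul d1 d2)).
    by move=> x; rewrite addr0 dotmxC.
  rewrite dotmx_ebase addr0 (dotmxC th) mxE cpderiv_slice; last exact: schw_smooth.
  by rewrite /= -/b1 !mulrA.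
have I1 := cintegrable_pft w sb; have I2 := cintegrable_pft w sb1.
rewrite cintegralD //; last exact: cintegrableZ.
rewrite cintegralZ // -/(pft b w) -/(pft b1 w) pftZ // => h.
have -> : pft b1 w = - ('i%C * (w 0 (rshift a i))%:C * pft b w).
  by apply/eqP; rewrite -addr_eq0 addrC h.
rewrite mulrN !mulrA -expr2 sqr_i !mulN1r.
by rewrite mulNr opprK.
Qed.

(** A derivative in the Fourier variable multiplies the function by a coordinate before
    the transform, and a derivative in the other variables passes inside. *)
Lemma pft_deriv a N (b : fn (a + N)) (j : 'I_(a + N)) : schwartz b ->
  exists2 b' : fn (a + N), schwartz b' & forall w : 'rV[R]_(a + N), cder (ebase j) (pft b) w (pft b' w).
Proof.
move=> sb.
have key b' : schwartz b' ->
   (forall w th, cder (ebase j) (fun w => pftF b (row_mx w th)) w (pftF b' (row_mx w th))) ->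
   forall w, cder (ebase j) (pft b) w (pft b' w).
  move=> sb' H w; have [M M0 HM] := pftF_bound sb'.
  have := @cder_cintegral R _ _ (pftF b) (pftF b') j M 0%N (fun th => (jbr th ^+ (N + N))^-1) w H.
  have E g x : cintegral (fun th => pftF g (row_mx x th)) = @pft a N g x by rewrite pftFE.
  have -> : (fun x => cintegral (fun th => pftF b (row_mx x th))) = pft b by apply/funext.
  rewrite E; apply.
  - by move=> x; rewrite pftFE; exact: cintegrable_pft.
  - exact: rint_jbr.
  - by move=> y; rewrite invr_ge0 jbrX_ge0.
  by move=> x y; rewrite expr0 mulr1.
have d1 (v w : 'rV[R]_(a + N)) th : cder v (fun w => cis (dotmx (rsubmx w) th)) w
    ('i%C * (dotmx (rsubmx v) th)%:C * cis (dotmx (rsubmx w) th)).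
  apply: (@eq_cder _ _ _ (fun x => cis (dotmx (x *m selR R a N + 0) th + 0)) _ _
     ('i%C * (dotmx (v *m selR R a N) th)%:C * cis (dotmx (w *m selR R a N + 0) th + 0))).
  - by move=> x; rewrite !addr0 mul_selR.
  - by rewrite !addr0 !mul_selR.
  by apply: (cder_aff (f := fun p => cis (dotmx p th + 0))); exact: cder_cis_lin.
have d2 (v w : 'rV[R]_(a + N)) th d : cder (row_mx (lsubmx v) 0) b (row_mx (lsubmx w) th) d ->
    cder v (fun w => b (row_mx (lsubmx w) th)) w d.
  have e (x : 'rV[R]_(a + N)) : row_mx (lsubmx x) th = x *m row_mx (selL R a N) 0 + row_mx 0 th.
    by rewrite mul_mx_row mul_selL mulmx0 add_row_mx addr0 add0r.
  move=> H; apply: (@eq_cder _ _ _ (fun x => b (x *m row_mx (selL R a N) 0 + row_mx 0 th)) _ _ d) => //.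
    by move=> x; rewrite e.
  by apply: cder_aff; rewrite -e mul_mx_row mulmx0 mul_selL.
case: (splitP j) => i ji.
  have je : j = lshift N i by apply/val_inj.
  exists (cpderiv [:: j] b); first exact: schw_cpderiv.
  apply: key => [|w th]; first exact: schw_cpderiv.
  have h1 : rsubmx (ebase j : 'rV[R]_(a + N)) = 0.
    by apply/rowP => k; rewrite je !mxE // eq_rlshift andbF.
  have h2 : row_mx (lsubmx (ebase j : 'rV[R]_(a + N))) 0 = ebase j.
    by rewrite -[RHS]hsubmxK h1.
  have := d2 (ebase j) w th (cpderiv [:: j] b (row_mx (lsubmx w) th)).
  rewrite h2 => /(_ (csmooth_cder _ _ (schw_smooth sb))) D2.
  apply: (eq_cder _ _ (cder_mul (d1 (ebase j) w th) D2)).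
    by move=> x; rewrite /pftF row_mxKl row_mxKr.
  by rewrite h1 dotmx0l mulr0 mul0r mul0r add0r /pftF row_mxKl row_mxKr.
have je : j = rshift a i by apply/val_inj.
have sb' : schwartz (fun y : 'rV[R]_(a + N) => 'i%C * ((y 0 j)%:C * b y)).
  by apply: schw_scale; apply: schw_mul_poly => //; exact: sm_coord.
exists (fun y : 'rV[R]_(a + N) => 'i%C * ((y 0 j)%:C * b y)) => //.
apply: key => // w th.
have h1 : rsubmx (ebase j : 'rV[R]_(a + N)) = ebase i.
  by apply/rowP => k; rewrite je !mxE eq_shift.
have h2 : row_mx (lsubmx (ebase j : 'rV[R]_(a + N))) (0 : 'rV[R]_N) = 0.
  by rewrite -[RHS]hsubmxK; congr row_mx; apply/rowP => k; rewrite ?je !mxE // eq_lrshift andbF.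
have := d2 (ebase j) w th 0; rewrite h2 => D2.
have {}D2 : cder (ebase j) (fun w => b (row_mx (lsubmx w) th)) w 0.
  apply: D2; apply: (@eq_cder _ _ _ b _ _ (\sum_k ((0 : 'rV[R]_(a + N)) 0 k)%:C * cpderiv [:: k] b (row_mx (lsubmx w) th))) => //.
    by rewrite big1 // => k _; rewrite mxE mul0r.
  apply: (@cder_dir R _ b (fun k => cpderiv [:: k] b)) => [k y|k]; first by apply: csmooth_cder; exact: schw_smooth.
  by apply: schw_ccont; exact: schw_cpderiv.
apply: (eq_cder _ _ (cder_mul (d1 (ebase j) w th) D2)).
  by move=> x; rewrite /pftF row_mxKl row_mxKr.
rewrite h1 dotmx_ebase mulr0 addr0 /pftF row_mxKl row_mxKr je row_mxEr.
by ring.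
Qed.

(** The class of all transforms is stable under derivation and under multiplication by
    coordinates; coinduction concludes. *)
Theorem schw_pft a N (b : fn (a + N)) : schwartz b -> schwartz (pft b).
Proof.
move=> sb; apply/schwartzP.
pose D (f : fn (a + N)) := exists2 b, schwartz b & f = pft b.
apply: (@sm_coind _ _ D (@Brd R _)); first exact: linclosed_Brd; last by apply: cspan_in; exists b.
move=> _ {b sb} [b sb ->]; split.
- exact: ccont_pft.
- move=> L.
  have pw j : exists M, forall w : 'rV[R]_(a + N), `|w 0 j| ^+ L * normc (pft b w) <= M.
    elim: L b sb => [|L IH] b sb.
      by have [M HM] := pft_bounded sb; exists M => w; rewrite expr0 mul1r.
    have [b' sb' H] := pft_mul_coord j sb; have [M HM] := IH b' sb'; exists M => w.
    by apply: le_trans (HM w); rewrite -H normcM normcR exprSr mulrA.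
  have [M0 HM0] := pft_bounded sb.
  have [M HM] := choice pw.
  exists ((2 * (a + N).+1%:R) ^+ L * (M0 + \sum_j M j)) => w.
  apply: (le_trans (ler_wpM2r (normc_ge0 _) (jbrX_le_coord w L))).
  rewrite -mulrA ler_wpM2l ?exprn_ge0 ?mulr_ge0 // mulrDl mul1r lerD //.
  by rewrite mulr_suml; apply: ler_sum => j _.
move=> j; have [b' sb' H] := pft_deriv j sb; exists (pft b') => //.
by apply: cspan_in; exists b'.
Qed.
End PartialFourier.

(** * Gaussians *)

Section Gaussian.
Variable R : realType.
Local Notation C := R[i].
Local Notation fn N := ('rV[R]_N -> C).

(** By compactness, positivity on the unit sphere of the sup norm is uniform; the rest is
    homogeneity. *)
Lemma quad_pos_lower N (Q : 'M[R]_N) :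
  (forall y : 'rV[R]_N, y != 0 -> 0 < dotmx (y *m Q) y) ->
  exists2 d, 0 < d & forall x : 'rV[R]_N, d * `|x| ^+ 2 <= dotmx (x *m Q) x.
Proof.
move=> pQ; pose q (y : 'rV[R]_N) := dotmx (y *m Q) y.
have cq : continuous q by apply: cont_dotmx; [exact: cont_mulmx|exact: cont_id].
(* The faces x_j = 1 of the unit cube are compact and avoid 0. *)
pose face (j : 'I_N) : set 'rV[R]_N := [set v | forall i, (if i == j then [set 1] else `[(-1)%R, 1%R]%classic) (v ord0 i)].
have faceP j : exists2 d, 0 < d & forall x, face j x -> d <= q x.
  have ne : face j !=set0.
    exists (\row_i 1) => i; rewrite mxE; case: ifP => // _.
    by rewrite /= in_itv /= lexx andbT; lra.
  have cf : compact (face j).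
    pose A (i : 'I_N) : set R := if i == j then [set 1] else `[(-1)%R, 1%R]%classic.
    have cA i : compact (A i) by rewrite /A; case: ifP => _; [exact: compact_set1|exact: segment_compact].
    exact: (rV_compact cA).
  have [|v vf hv] := @EVT_min_rV R N q (face j) ne cf.
    by apply: continuous_subspaceT.
  exists (q v) => [|x fx]; last by apply: hv; rewrite inE.
  apply: pQ; apply/eqP => v0; move: vf; rewrite inE => /(_ j); rewrite eqxx v0 mxE => /eqP.
  by rewrite eq_sym oner_eq0.
pose d j := projT1 (cid2 (faceP j)).
have d0 j : 0 < d j by rewrite /d; case: cid2.
have dq j x : face j x -> d j <= q x by rewrite /d; case: cid2 => /= e e0; apply.
have S0 : 0 <= \sum_j (d j)^-1 by apply: sumr_ge0 => j _; rewrite invr_ge0 ltW.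
exists (1 + \sum_j (d j)^-1)^-1 => [|x]; first by rewrite invr_gt0; lra.
have [->|x0] := eqVneq x 0; first by rewrite normr0 expr0n mulr0 mul0mx dotmx0l.
have xn : `|x| != 0 by rewrite normr_eq0.
have [[i j] /= hij] := mx_norm_neq0 xn.
have xj : `|x| = `|x 0 j| by rewrite -(ord1 i) -hij.
have xj0 : x 0 j != 0 by rewrite -normr_eq0 -xj.
have := dq j ((x 0 j)^-1 *: x).
have -> : q ((x 0 j)^-1 *: x) = q x / `|x| ^+ 2.
  by rewrite /q -scalemxAl dotmxZl dotmxZr mulrA -expr2 xj real_normK ?num_real // exprVn mulrC.
move=> h; have {}h : d j <= q x / `|x| ^+ 2.
  apply: h => k; rewrite mxE; case: eqP => [->|_] /=; first by rewrite mulVf.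
  rewrite in_itv /= -ler_norml normrM normfV -xj mulrC ler_pdivrMr ?normr_gt0 // mul1r.
  exact: coord_le_norm.
have x2 : 0 < `|x| ^+ 2 by rewrite exprn_gt0 // normr_gt0.
rewrite -ler_pdivlMr //; apply: le_trans h.
rewrite -[leRHS]invrK lef_pV2 ?posrE ?invr_gt0 //; last by lra.
rewrite (bigD1 j) //= addrCA lerDl addr_ge0 //.
by apply: sumr_ge0 => k _; rewrite invr_ge0 ltW.
Qed.

(** A Gaussian beats every power. *)
Lemma jbrX_le_expR N (d : R) (q : 'rV[R]_N -> R) L : 0 < d ->
  (forall x, d * `|x| ^+ 2 <= q x) ->
  exists2 M, 0 <= M & forall x, jbr x ^+ L <= M * expR (q x).
Proof.
move=> d0 dq; pose K : R := 2 * N.+1%:R ^+ 2; have K0 : 0 < K by rewrite mulr_gt0 // exprn_gt0.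
pose s := d / K / L.+1%:R; have s0 : 0 < s by rewrite !divr_gt0.
exists (s ^- L.+1 * expR d); first by rewrite mulr_ge0 ?expR_ge0 // invr_ge0 exprn_ge0 // ltW.
move=> x; have j1 := jbr_ge1 x.
apply: (@le_trans _ _ ((jbr x ^+ 2) ^+ L.+1)).
  by rewrite -exprM jbrX_le //; lia.
rewrite -mulrA ler_pdivlMl ?exprn_gt0 // -exprMn -expRD.
have -> : d + q x = L.+1%:R * ((d + q x) / L.+1%:R) by rewrite mulrCA divff ?mulr1.
rewrite [X in expR X]mulrC expRM_natr lerXn2r ?nnegrE ?expR_ge0 ?mulr_ge0 ?exprn_ge0 ?jbr_ge0 ?(ltW s0) ?(ltW d0) ?invr_ge0 ?(ltW K0) //.
apply: le_trans (expR_ge1Dx _).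
apply: (@le_trans _ _ ((d + q x) / L.+1%:R)); last by rewrite lerDr.
rewrite ler_pdivlMr // /s mulrAC divfK //.
have hj : jbr x ^+ 2 <= K * (1 + `|x| ^+ 2).
  apply: (@le_trans _ _ ((N.+1%:R * (1 + `|x|)) ^+ 2)).
    by rewrite lerXn2r ?nnegrE ?jbr_ge0 ?mulr_ge0 ?addr_ge0 // jbr_le_norm.
  have -> : K * (1 + `|x| ^+ 2) = N.+1%:R ^+ 2 * (2 * (1 + `|x| ^+ 2)) by rewrite /K; ring.
  rewrite exprMn ler_wpM2l ?exprn_ge0 //.
  by have := sqr_ge0 (1 - `|x|); nra.
have := dq x; have : d / K * jbr x ^+ 2 <= d * (1 + `|x| ^+ 2).
  by rewrite -mulrA ler_wpM2l ?(ltW d0) // ler_pdivrMl.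
by lra.
Qed.

Lemma Im_sum I r (F : I -> C) : complex.Im (\sum_(i <- r) F i) = \sum_(i <- r) complex.Im (F i).
Proof. by elim: r => [|i r IH]; rewrite ?big_nil // !big_cons ImD IH. Qed.

(** Complex Gaussian; it is Schwartz as soon as the imaginary part of the form is
    positive. *)
Definition cgauss N (A : 'M[C]_N) : fn N := fun y =>
  cexp ('i%C * (2^-1 * dotmx (cplx_vec y *m A) (cplx_vec y))).

Lemma cgauss0 N (A : 'M[C]_N) : cgauss A 0 = 1.
Proof.
rewrite /cgauss (_ : cplx_vec 0 = 0) ?mul0mx; last by apply/rowP => i; rewrite !mxE.
rewrite /dotmx big1 ?mulr0; last by move=> i _; rewrite mxE mul0r.
by rewrite /cexp /= expR0 cos0 sin0 mul1r.
Qed.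

Lemma Im_quad N (A : 'M[C]_N) (y : 'rV[R]_N) :
  complex.Im (2^-1 * dotmx (cplx_vec y *m A) (cplx_vec y)) =
  2^-1 * dotmx (y *m map_mx (@complex.Im R) A) y.
Proof.
have -> : (2^-1 : C) = (2^-1)%:C by rewrite fmorphV /= rmorphD.
rewrite ImM /= mul0r addr0; congr (_ * _).
rewrite /dotmx Im_sum; apply: eq_bigr => j _.
rewrite !mxE ImM /= mulr0 add0r; congr (_ * _); rewrite Im_sum.
by apply: eq_bigr => i _; rewrite !mxE ImM /= mul0r addr0.
Qed.

Lemma schw_cgauss N (A : 'M[C]_N) :
  (forall y : 'rV[R]_N, y != 0 -> 0 < dotmx (y *m map_mx (@complex.Im R) A) y) ->
  schwartz (cgauss A).
Proof.
move=> pA; apply/schwartzP; apply: sm_cexp; first exact: linclosed_Brd.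
  apply: sm_scale; first exact: linclosed_Bpoly.
  apply: sm_scale; first exact: linclosed_Bpoly.
  apply: (@eq_sm _ _ _ (fun y => \sum_j (\sum_i A i j * (y 0 i)%:C) * (y 0 j)%:C)).
    move=> y; rewrite /dotmx; apply: eq_bigr => j _; rewrite !mxE; congr (_ * _).
    by apply: eq_bigr => i _; rewrite mxE mulrC.
  apply: sm_sum => j; apply: sm_poly_mul; last exact: sm_coord.
  by apply: sm_sum => i; apply: sm_scale; [exact: linclosed_Bpoly|exact: sm_coord].
have [d d0 dq] := quad_pos_lower pA.
pose q (y : 'rV[R]_N) := 2^-1 * dotmx (y *m map_mx (@complex.Im R) A) y.
have qd y : (d / 2) * `|y| ^+ 2 <= q y by rewrite /q mulrC mulrA mulrC ler_wpM2l // mulrC.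
have nE (y : 'rV[R]_N) : normc (cexp ('i%C * (2^-1 * dotmx (cplx_vec y *m A) (cplx_vec y)))) = expR (- q y).
  rewrite normc_cexp ReM /= mul0r mul1r sub0r; congr expR; congr (- _).
  exact: Im_quad.
move=> a [Ma [k Ha]] L.
have [M M0 HM] := jbrX_le_expR (L + k) (divr_gt0 d0 (ltr0n R 2)) qd.
exists (`|Ma| * M) => x; rewrite normcM nE expRN.
rewrite mulrA ler_pdivrMr ?expR_gt0 //.
apply: (@le_trans _ _ (jbr x ^+ L * (`|Ma| * jbr x ^+ k))).
  rewrite ler_wpM2l ?jbrX_ge0 //; apply: (le_trans (Ha x)).
  by rewrite ler_wpM2r ?jbrX_ge0 // ler_norm.
by rewrite mulrCA -exprD -mulrA ler_wpM2l.
Qed.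

Definition gauss N : fn N := cgauss (('i%C)%:M).

Lemma schw_gauss N : schwartz (@gauss N).
Proof.
apply: schw_cgauss => y y0.
rewrite (_ : map_mx _ _ = 1%:M); last first.
  by apply/matrixP => i j; rewrite !mxE; case: eqP.
rewrite mulmx1; have [i yi] := rV0Pn _ y0.
rewrite /dotmx (bigD1 i) //= ltr_wpDr //; first by apply: sumr_ge0 => j _; rewrite -expr2 sqr_ge0.
by rewrite -expr2 exprn_even_gt0.
Qed.

Lemma gaussE N (y : 'rV[R]_N) : gauss y = (expR (- 2^-1 * dotmx y y))%:C.
Proof.
rewrite /gauss /cgauss mul_mx_scalar.
have -> : dotmx ('i%C *: cplx_vec y) (cplx_vec y) = 'i%C * (dotmx y y)%:C.
  rewrite /dotmx (rmorph_sum (real_complex R)) mulr_sumr; apply: eq_bigr => i _.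
  by rewrite !mxE rmorphM mulrA.
have -> : 'i%C * (2^-1 * ('i%C * (dotmx y y)%:C)) = (- 2^-1 * dotmx y y)%:C.
  transitivity ('i%C ^+ 2 * (2^-1 * (dotmx y y)%:C)); first by ring.
  by rewrite sqr_i rmorphM rmorphN fmorphV rmorph_nat mulN1r mulNr.
by rewrite cexpE cis0 mulr1.
Qed.
End Gaussian.

(** * Fourier inversion at the origin *)

Section Inversion.
Variable R : realType.
Local Notation C := R[i].
Local Notation fn N := ('rV[R]_N -> C).

(** A set of known positive measure, to detect that a continuous function is nonzero and
    to bound the volume of a lattice cell. *)
Definition box N (p : 'rV[R]_N) (r : R) (x : 'rV[R]_N) : R :=
  [forall i, p 0 i <= x 0 i < p 0 i + r]%:R.

Lemma boxE N (p : 'rV[R]_N) r x :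
  box p r x = \prod_i (p 0 i <= x 0 i < p 0 i + r)%R%:R.
Proof.
rewrite /box; case: (boolP [forall i, _]) => [/forallP h|].
  by rewrite big1 // => i _; rewrite h.
rewrite negb_forall => /existsP[i /negbTE h].
by rewrite (bigD1 i) //= h mul0r.
Qed.

Lemma box_ge0 N (p : 'rV[R]_N) r x : 0 <= box p r x.
Proof. by rewrite /box ler0n. Qed.

Lemma box_int N (p : 'rV[R]_N) (r : R) : 0 < r -> rint (box p r) /\ rI (box p r) = r ^+ N.
Proof.
move=> r0.
pose g (i : 'I_N) (x : R) : R := (p 0 i <= x < p 0 i + r)%R%:R.
have gE i x : g i x = \1_(`[p 0 i, p 0 i + r[%classic) x.
  by rewrite indicE /g; congr (_%:R); rewrite mem_setE in_itv.
have mg i : measurable_fun setT (g i : measurableTypeR R -> R).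
  rewrite (_ : g i = \1_(`[p 0 i, p 0 i + r[%classic)); last by apply/funext => x; exact: gE.
  exact: measurable_indic.
have Ig i : (\int[lebesgue_measure]_x (g i x)%:E = r%:E)%E.
  under eq_integral do rewrite gE.
  rewrite integral_indic //= setIT lebesgue_measure_itv /= lte_fin ltrDl r0 -EFinB.
  by congr (_%:E); rewrite addrAC subrr add0r.
have I := lebn_prod mg (fun i x => ler0n _ _) Ig.
have E (t : N.-tuple (measurableTypeR R)) : box p r (row_of_tup t) = \prod_i g i (tnth t i).
  by rewrite boxE; apply: eq_bigr => i _; rewrite mxE.
have mb : measurable_fun setT (fun t : N.-tuple (measurableTypeR R) => box p r (row_of_tup t)).
  rewrite (_ : (fun t => _) = fun t : N.-tuple (measurableTypeR R) => \prod_i g i (tnth t i)).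
    by apply: measurable_prod => i _; apply: measurableT_comp => //; exact: measurable_tnth.
  by apply/funext => t; rewrite E.
have J : (\int[lebn R N]_t (box p r (row_of_tup t))%:E = (r ^+ N)%:E)%E.
  under eq_integral do rewrite E.
  by rewrite I prodr_const card_ord.
split; last by rewrite /rI /Rintegral J.
apply/integrableP; split; first exact/measurable_EFinP.
under eq_integral do rewrite /= ger0_norm ?box_ge0 //.
by rewrite J ltry.
Qed.

(** If the function is positive at a point, it is bounded below on a small cube. *)
Lemma rI_eq0 N (g : 'rV[R]_N -> R) : continuous g -> (forall x, 0 <= g x) ->
  rint g -> rI g <= 0 -> forall x, g x = 0.
Proof.
move=> cg g0 ig Ig x; apply/eqP; rewrite eq_le g0 andbT leNgt; apply/negP => gx.
have e0 : 0 < g x / 2 by rewrite divr_gt0.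
have /(@cvgrPdist_lt _ _ _ (nbhs x) (nbhs_filter x)) /(_ _ e0) := cg x.
move=> /nbhs_ballP[e /= ep he].
have e20 : 0 < e / 2 by rewrite divr_gt0.
have [ib Ib] := box_int x e20.
have : g x / 2 * (e / 2) ^+ N <= rI g.
  rewrite -Ib -rIZ //; apply: rI_le => //; first exact: rintZ.
  move=> y; rewrite /box; case: (boolP [forall i, _]) => [/forallP h|_]; last by rewrite mulr0.
  rewrite mulr1; have : `|g x - g y| < g x / 2.
    apply: he; split=> // i j; rewrite -ball_normE /=; have := h j; rewrite (ord1 i) => /andP[h1 h2].
    by rewrite distrC ger0_norm; lra.
  by rewrite ltr_norml => /andP[_]; lra.
by move/le_trans/(_ Ig); rewrite leNgt mulr_gt0 // exprn_gt0.
Qed.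

(** Fourier transform, without normalization and with the sign of [pft]. *)
Definition fhat N (f : fn N) : fn N := fun t => cintegral (fun th => cis (dotmx t th) * f th).

Lemma fhat_pft a N (b : fn (a + N)) z t : pft b (row_mx z t) = fhat (fun th => b (row_mx z th)) t.
Proof. by rewrite /pft /fhat row_mxKl row_mxKr. Qed.

Lemma schw_fhat N (f : fn N) : schwartz f -> schwartz (fhat f).
Proof.
move=> sf; have sb := schw_pft (schw_tensor (@schw_gauss R N) sf).
have := schw_slice_joint (0 : 'rV[R]_N) sb; congr schwartz.
apply/funext => t; rewrite fhat_pft; congr fhat; apply/funext => th.
by rewrite row_mxKl row_mxKr /gauss cgauss0 mul1r.
Qed.

Lemma normc_cvg_uniq (u : nat -> C) a b : normc (u n - a) @[n --> \oo] --> 0 ->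
  normc (u n - b) @[n --> \oo] --> 0 -> a = b.
Proof.
move=> ha hb; apply/eqP; rewrite -subr_eq0 -normc_eq0 eq_le normc_ge0 andbT.
have h : (fun n => normc (u n - a) + normc (u n - b)) @ \oo --> (0 : R).
  by rewrite -[X in _ --> X]addr0; exact: cvgD.
apply: (ler_cvg_to (cvg_cst (normc (a - b))) h); apply: nearW => n.
rewrite (normc_distC (u n) a).
have -> : a - b = (a - u n) + (u n - b) by rewrite addrA subrK.
exact: normcD.
Qed.

Lemma gauss_le1 N (x : 'rV[R]_N) : normc (gauss x) <= 1.
Proof.
rewrite gaussE normcR ger0_norm ?expR_ge0 // -expR0 ler_expR mulNr oppr_le0 mulr_ge0 //.
by apply: sumr_ge0 => i _; rewrite -expr2 sqr_ge0.
Qed.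

(** The constant (2 pi)^N of the inversion formula, as the value that the formula gives for
    the Gaussian. *)
Definition kap N : C := cintegral (fhat (@gauss R N)).

Let eps (n : nat) : R := n.+1%:R^-1.
Let eps_gt0 n : 0 < eps n. Proof. by rewrite invr_gt0. Qed.
Let eps_cvg : eps n @[n --> \oo] --> (0 : R).
Proof. exact: cvg_harmonic. Qed.

Let eps_shrink N (f : fn N) x : ccont f ->
  normc (f (eps n *: x) - f 0) @[n --> \oo] --> 0.
Proof.
move=> cf; have cg : continuous (fun y => normc (f y - f 0)).
  by apply: cont_normc; apply: ccont_sub => //; exact: ccont_cst.
have -> : 0 = normc (f 0 - f 0) :> R by rewrite subrr normc0.
apply: (@cvg_comp _ _ _ (fun n => eps n *: x) (fun y => normc (f y - f 0)) _ (nbhs (0 : 'rV[R]_N))).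
  have h : (fun n => eps n *: x) @ \oo --> (0 : R) *: x by apply: cvgZr_tmp; exact: eps_cvg.
  by rewrite scale0r in h; exact: h.
exact: cg.
Qed.

Lemma schw_rint N (f : fn N) : schwartz f -> rint (fun x => normc (f x)).
Proof.
move=> sf; have [M M0 HM] := Brd_dec (N + N) (schw_Brd sf).
apply: (@rint_dom _ _ _ (fun x => M * (jbr x ^+ (N + N))^-1)).
- by apply: continuous_rmeasurable; apply: cont_normc; exact: schw_ccont.
- by apply: rintZ; exact: rint_jbr.
by move=> x; rewrite ger0_norm ?normc_ge0.
Qed.

Lemma schw_dilate N (f : fn N) a : a != 0 -> schwartz f -> schwartz (fun x => f (a *: x)).
Proof.
move=> a0 sf; have ua : (a%:M : 'M[R]_N) \in unitmx.
  by rewrite unitmxE det_scalar unitfE expf_neq0.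
have := schw_aff 0 ua sf; congr schwartz.
by apply/funext => x; rewrite addr0 mul_mx_scalar.
Qed.

Lemma schw_fhat_integrand N (f : fn N) t : schwartz f -> schwartz (fun th => cis (dotmx t th) * f th).
Proof.
move=> sf; apply: schw_mul_poly => //.
apply: (@eq_sm _ _ _ (fun th => cis (dotmx th t + 0))); last exact: sm_cis_lin.
by move=> th; rewrite addr0 dotmxC.
Qed.

(** Fubini in the form used throughout: two partially evaluated integrals of one dominated
    continuous integrand. *)
Lemma fubini_eq a b (k : 'rV[R]_a -> 'rV[R]_b -> C) (g : 'rV[R]_a -> R) (h : 'rV[R]_b -> R)
    (A : fn a) (B : fn b) : rint g -> rint h ->
  ccont (fun Z : 'rV[R]_(a + b) => k (lsubmx Z) (rsubmx Z)) ->
  (forall x y, normc (k x y) <= g x * h y) ->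
  (forall x, cintegral (k x) = A x) -> (forall y, cintegral (fun x => k x y) = B y) ->
  cintegral A = cintegral B.
Proof.
move=> ig ih ck Hk HA HB.
pose F (Z : 'rV[R]_(a + b)) := k (lsubmx Z) (rsubmx Z).
have FE x y : F (row_mx x y) = k x y by rewrite /F row_mxKl row_mxKr.
have := @cintegral_fubini R a b g h ig ih F (ccont_cmeas ck) _.
move=> H; rewrite (_ : A = fun x => cintegral (fun y => F (row_mx x y))); last first.
  by apply/funext => x; rewrite -HA; apply: eq_cintegral => y; rewrite FE.
rewrite (_ : B = fun y => cintegral (fun x => F (row_mx x y))); last first.
  by apply/funext => y; rewrite -HB; apply: eq_cintegral => x; rewrite FE.
by apply: H => x y; rewrite FE.
Qed.

Lemma cis_scaleE N a (t th : 'rV[R]_N) : dotmx (a *: t) th = dotmx t (a *: th).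
Proof. by rewrite dotmxZl dotmxZr. Qed.

(** Regularize the divergent integral of the exponential by a dilation of [G]. *)
Lemma cintegral_fhat N (G f : fn N) : schwartz G -> G 0 = 1 -> (forall x, normc (G x) <= 1) ->
  schwartz f -> cintegral (fhat f) = cintegral (fhat G) * f 0.
Proof.
move=> sG G01 G1 sf; have shf := schw_fhat sf; have shG := schw_fhat sG.
have sGe n : ccont (fun t : 'rV[R]_N => G (eps n *: t)).
  apply: ccont_comp; last exact: schw_ccont.
  by apply: cont_scalev; exact: cont_id.
have en0 n : eps n != 0 by rewrite gt_eqF.
have inner n th : cintegral (fun t => cis (dotmx t th) * G (eps n *: t)) =
   ((eps n ^+ N)^-1)%:C * fhat G ((eps n)^-1 *: th).
  have [_] := cintegral_affine 0 (en0 n) (schw_cintegrable (schw_fhat_integrand ((eps n)^-1 *: th) sG)).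
  move=> h; rewrite /fhat h ger0_norm ?(ltW (eps_gt0 n)) //.
  rewrite mulrA -rmorphM mulVf ?expf_neq0 // mul1r.
  by apply: eq_cintegral => t; rewrite addr0 -cis_scaleE scalerA divff // scale1r dotmxC.
have swap n : cintegral (fun t => G (eps n *: t) * fhat f t) =
   cintegral (fun th => f (eps n *: th) * fhat G th).
  transitivity (cintegral (fun th => f th * cintegral (fun t => cis (dotmx t th) * G (eps n *: t)))).
    apply: (@fubini_eq _ _ (fun t th => G (eps n *: t) * (cis (dotmx t th) * f th)) _ _ _ _
      (schw_rint (schw_dilate (en0 n) sG)) (schw_rint sf)).
    + apply: ccont_mul; last apply: ccont_mul.
      * exact: (ccont_comp (@cont_lsubmx _ _ _) (sGe n)).
      * by apply: ccont_cis; apply: cont_dotmx; [exact: cont_lsubmx|exact: cont_rsubmx].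
      exact: (ccont_comp (@cont_rsubmx _ _ _) (schw_ccont sf)).
    + by move=> x y; rewrite normcM normcM normc_cis mul1r.
    + by move=> t; rewrite cintegralZ //; apply: schw_cintegrable; exact: schw_fhat_integrand.
    move=> th; rewrite -cintegralZ; last first.
      have := schw_cintegrable (schw_fhat_integrand th (schw_dilate (en0 n) sG)); congr cintegrable.
      by apply/funext => t; rewrite dotmxC.
    by apply: eq_cintegral => t; ring.
  under eq_cintegral do rewrite inner.
  have sfG : schwartz (fun th => f th * fhat G ((eps n)^-1 *: th)).
    apply: schw_mul; first exact: sf.
    by apply: schw_dilate; [rewrite invr_neq0|exact: shG].
  have [_] := cintegral_affine 0 (en0 n) (schw_cintegrable sfG).
  rewrite ger0_norm ?(ltW (eps_gt0 n)) // => h.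
  under eq_cintegral do rewrite mulrCA.
  rewrite cintegralZ; last exact: schw_cintegrable.
  rewrite h mulrA -rmorphM mulVf ?expf_neq0 // mul1r.
  by apply: eq_cintegral => x; rewrite addr0 scalerA mulVf // scale1r.
apply: (@normc_cvg_uniq (fun n => cintegral (fun t => G (eps n *: t) * fhat f t))).
- apply: (@cintegral_dct _ _ _ _ (fun t => normc (fhat f t))).
  + move=> n; apply: ccont_cmeas; apply: ccont_mul => //; exact: schw_ccont.
  + by apply: ccont_cmeas; exact: schw_ccont.
  + exact: schw_rint.
  + by move=> n x; rewrite normcM -[leRHS]mul1r ler_wpM2r ?normc_ge0 // G1.
  move=> x; have -> : (fun n => normc (G (eps n *: x) * fhat f x - fhat f x)) =
      (fun n => normc (G (eps n *: x) - G 0) * normc (fhat f x)).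
    by apply/funext => n; rewrite -normcM mulrBl G01 mul1r.
  by rewrite -(mul0r (normc (fhat f x))); apply: cvgM; [apply: eps_shrink; exact: schw_ccont|exact: cvg_cst].
have -> : cintegral (fhat G) * f 0 = cintegral (fun th => f 0 * fhat G th) by rewrite cintegralZ 1?mulrC //; exact: schw_cintegrable.
rewrite (_ : (fun n => _) = fun n => normc (cintegral (fun th => f (eps n *: th) * fhat G th) - cintegral (fun th => f 0 * fhat G th))); last first.
  by apply/funext => n; rewrite swap.
have [M M0 HM] := Brd_dec 0 (schw_Brd sf).
apply: (@cintegral_dct _ _ _ _ (fun t => M * normc (fhat G t))).
- move=> n; apply: ccont_cmeas; apply: ccont_mul; last exact: schw_ccont.
  by apply: schw_ccont; exact: schw_dilate.
- by apply: ccont_cmeas; apply: ccont_mul; [exact: ccont_cst|exact: schw_ccont].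
- by apply: rintZ; exact: schw_rint.
- move=> n x; rewrite normcM ler_wpM2r ?normc_ge0 //.
  by apply: (le_trans (HM _)); rewrite expr0 divr1.
move=> x; have -> : (fun n => normc (f (eps n *: x) * fhat G x - f 0 * fhat G x)) =
    (fun n => normc (f (eps n *: x) - f 0) * normc (fhat G x)).
  by apply/funext => n; rewrite -normcM mulrBl.
by rewrite -(mul0r (normc (fhat G x))); apply: cvgM; [apply: eps_shrink; exact: schw_ccont|exact: cvg_cst].
Qed.

(** Translations turn this special case into the full inversion formula. *)
Lemma fourier_inversion0 N (f : fn N) : schwartz f -> cintegral (fhat f) = kap N * f 0.
Proof.
by move=> sf; apply: cintegral_fhat => //; [exact: schw_gauss|exact: cgauss0|exact: gauss_le1].
Qed.

Lemma fhat_shift N (f : fn N) x t : schwartz f ->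
  fhat (fun y => f (y + x)) t = cis (- dotmx t x) * fhat f t.
Proof.
move=> sf; rewrite /fhat -cintegralZ; last by apply: schw_cintegrable; exact: schw_fhat_integrand.
rewrite -[RHS](@cintegral_shift _ _ _ x); last first.
  by apply: cintegrableZ; apply: schw_cintegrable; exact: schw_fhat_integrand.
apply: eq_cintegral => y; rewrite mulrA -cisD dotmxDr; congr (cis _ * _); ring.
Qed.

Lemma ip_selfE N (f : fn N) : schwartz f ->
  rint (fun x => normc (f x) ^+ 2) /\ ip f f = (rI (fun x => normc (f x) ^+ 2))%:C.
Proof.
move=> sf; have sE t : f t * conjc (f t) = (normc (f t) ^+ 2)%:C.
  by rewrite normc_sqr; case: (f t) => a b; apply: ReIm_eq => /=; ring.
split.
  have := schw_rint (schw_mul sf (schw_conj sf)); congr rint; apply/funext => t.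
  by rewrite normcM normc_conj expr2.
apply: ReIm_eq; first by apply: eq_Rintegral => t _; rewrite sE.
transitivity (complex.Im (cintegral (fun _ : 'rV[R]_N => 0))); last by rewrite cintegral0.
by apply: eq_Rintegral => t _; rewrite sE.
Qed.

Lemma ip_eq0 N (f : fn N) : schwartz f -> ip f f = 0 -> forall x, f x = 0.
Proof.
move=> sf; have [ir ->] := ip_selfE sf => /(congr1 (@complex.Re R)) /= h x.
apply/eqP; rewrite -normc_eq0 -sqrf_eq0.
rewrite (@rI_eq0 N (fun x => normc (f x) ^+ 2)) ?h //.
  by apply: cont_exp; apply: cont_normc; exact: schw_ccont.
by move=> y; exact: sqr_ge0.
Qed.

(** If [kap] vanished, so would the inverse transform of [fhat gauss], hence
    by Parseval the L2 norm of that function. *)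
Lemma kap_neq0 N : kap N != 0.
Proof.
apply/eqP => k0; have sG : schwartz (@gauss R N) := @schw_gauss R N.
have kG x : cintegral (fun t => cis (- dotmx t x) * fhat (@gauss R N) t) = 0.
  have h := fourier_inversion0 (schw_shift x sG); rewrite k0 mul0r in h; rewrite -h.
  by apply: eq_cintegral => t; rewrite fhat_shift.
move: (@gauss R N) (@gaussE R N) sG kG => g gE sG kG.
have shG := schw_fhat sG.
have h : cintegral (fun t => fhat g t * conjc (fhat g t)) = cintegral (fun _ : 'rV[R]_N => 0).
  apply: (@fubini_eq _ _ (fun t th => fhat g t * (cis (- dotmx t th) * conjc (g th))) _ _ _ _
    (schw_rint shG) (schw_rint sG)).
  - apply: ccont_mul; last apply: ccont_mul.
    + exact: (ccont_comp (@cont_lsubmx _ _ _) (schw_ccont shG)).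
    + by apply: ccont_cis; apply: cont_opp; apply: cont_dotmx; [exact: cont_lsubmx|exact: cont_rsubmx].
    by apply: ccont_conj; exact: (ccont_comp (@cont_rsubmx _ _ _) (schw_ccont sG)).
  - by move=> x y; rewrite normcM normcM normc_cis mul1r normc_conj.
  - move=> t; have -> : conjc (fhat g t) = cintegral (fun th => conjc (cis (dotmx t th) * g th)).
      by rewrite cintegral_conj //; apply: schw_cintegrable; exact: schw_fhat_integrand.
    rewrite -cintegralZ; last first.
      by apply: cintegrable_conj; apply: schw_cintegrable; exact: schw_fhat_integrand.
    by apply: eq_cintegral => th; rewrite conjcME conj_cis.
  move=> th; rewrite -[RHS](mulr0 (conjc (g th))) -(kG th) -cintegralZ; last first.
    apply: schw_cintegrable; apply: schw_mul_poly => //.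
    apply: (@eq_sm _ _ _ (fun t => cis (dotmx t (- th) + 0))); last exact: sm_cis_lin.
    by move=> t; rewrite addr0 dotmxNr.
  by apply: eq_cintegral => t; ring.
rewrite cintegral0 in h.
have z0 : fhat g 0 = 0 by exact: (ip_eq0 shG h).
have h1 : rI (fun th : 'rV[R]_N => expR (- 2^-1 * dotmx th th)) = 0.
  rewrite -[RHS]/(complex.Re (0 : C)) -z0; apply: eq_Rintegral => t _ /=.
  by rewrite dotmx0l cis0 mul1r gE.
have := @rI_eq0 N (fun th => expR (- 2^-1 * dotmx th th)) _ (fun=> expR_ge0 _) _ _ 0.
rewrite h1 dotmx0l mulr0 expR0 => H.
suff /eqP : (1 : R) = 0 by rewrite oner_eq0.
apply: H => //.
  apply: (@cont_comp _ _ _ (fun th : 'rV[R]_N => - 2^-1 * dotmx th th) expR); last exact: continuous_expR.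
  by apply: cont_mul; [exact: cont_cst|apply: cont_dotmx; exact: cont_id].
have := schw_rint sG; congr rint; apply/funext => t.
by rewrite gE normcR ger0_norm ?expR_ge0.
Qed.
End Inversion.

(** * Resolution of the identity by wave packets *)

Section Resolution.
Variable R : realType.
Local Notation C := R[i].
Local Notation fn N := ('rV[R]_N -> C).

Lemma schw_bounded N (f : fn N) : schwartz f -> exists2 M, 0 <= M & forall x, normc (f x) <= M.
Proof.
by move=> sf; have [M M0 HM] := Brd_dec 0 (schw_Brd sf); exists M => // x; have := HM x; rewrite expr0 divr1.
Qed.

Lemma ccont_wp_joint N (G : fn N) : schwartz G ->
  ccont (fun Z : 'rV[R]_(N + N + N) => wp G (lsubmx Z) (rsubmx Z)).
Proof. by move=> sG; exact: (sm_ccont (wp_joint sG)). Qed.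

Lemma normc_wp N (G : fn N) X p : normc (wp G X p) = normc (G (p - lsubmx X)).
Proof. by rewrite /wp normcM normc_cis mulr1. Qed.

Lemma ccont_ip_wp N (G f : fn N) : schwartz G -> schwartz f -> ccont (fun X => ip f (wp G X)).
Proof.
move=> sG sf; have [M M0 HM] := schw_bounded sG.
pose F (Z : 'rV[R]_(N + N + N)) := f (rsubmx Z) * conjc (wp G (lsubmx Z) (rsubmx Z)).
have FE X p : F (row_mx X p) = f p * conjc (wp G X p) by rewrite /F row_mxKl row_mxKr.
apply: (@eq_ccont _ _ (fun X => cintegral (fun p => F (row_mx X p)))).
  by move=> X; apply: eq_cintegral => p; rewrite FE.
apply: (@ccont_cintegral _ _ _ _ (fun=> M) (fun p => normc (f p))).
- apply: ccont_mul; first exact: (ccont_comp (@cont_rsubmx _ _ _) (schw_ccont sf)).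
  by apply: ccont_conj; exact: ccont_wp_joint.
- exact: cont_cst.
- exact: schw_rint.
- by move=> y; exact: normc_ge0.
by move=> X p; rewrite FE normcM normc_conj normc_wp mulrC ler_wpM2r ?normc_ge0.
Qed.

Lemma Brd_ip_wp N (G f : fn N) : schwartz G -> schwartz f -> Brd (fun X => ip f (wp G X)).
Proof.
move=> sG sf L; have [K [M [M0 H]]] := stft_decay sG L.
by exists (M * schwartz_norm K f) => X; rewrite mulrC; exact: H.
Qed.

Lemma jbrX_splitV a b (x : 'rV[R]_a) (y : 'rV[R]_b) k l :
  (jbr (row_mx x y) ^+ (k + l))^-1 <= (jbr x ^+ k)^-1 * (jbr y ^+ l)^-1.
Proof.
rewrite -invfM lef_pV2 ?posrE ?mulr_gt0 ?jbrX_gt0 // exprD.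
by rewrite ler_pM ?jbrX_ge0 // lerXn2r ?nnegrE ?jbr_ge0 // ?jbr_row_mxl ?jbr_row_mxr.
Qed.

(** Rapid decrease in both variables supplies the product majorant required by Fubini. *)
Lemma cintegral_split_Brd a b (F : fn (a + b)) : ccont F -> Brd F ->
  cintegral F = cintegral (fun x => cintegral (fun y => F (row_mx x y))).
Proof.
move=> cF BF; have [M M0 HM] := Brd_dec ((a + a) + (b + b)) BF.
apply: (@cintegral_split _ _ _ (fun x => M * (jbr x ^+ (a + a))^-1) (fun y => (jbr y ^+ (b + b))^-1)).
- by apply: rintZ; exact: rint_jbr.
- exact: rint_jbr.
- exact: ccont_cmeas.
by move=> x y; apply: (le_trans (HM _)); rewrite -mulrA ler_wpM2l // jbrX_splitV.
Qed.

(** The resolution of the identity by wave packets: integrating over the frequency of [X]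
    is Fourier inversion, and the position integral then gives the norm of [G]. *)
Lemma stft_inversion N (G f : fn N) : schwartz G -> schwartz f -> forall y,
  cintegral (fun X => ip f (wp G X) * wp G X y) = kap R N * ip G G * f y.
Proof.
move=> sG sf y.
have cc : ccont (fun X => ip f (wp G X) * wp G X y).
  apply: ccont_mul; first exact: ccont_ip_wp.
  apply: (@eq_ccont _ _ (fun X => wp G (lsubmx (row_mx X y)) (rsubmx (row_mx X y)))).
    by move=> X; rewrite row_mxKl row_mxKr.
  apply: (ccont_comp _ (ccont_wp_joint sG)).
  by apply: cont_row_mx; [exact: cont_id|exact: cont_cstv].
have [M M0 HM] := schw_bounded sG.
rewrite cintegral_split_Brd //; last first.
  move=> k; have [M1 H1] := Brd_ip_wp sG sf k; exists (M1 * M) => X.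
  rewrite normcM normc_wp mulrA ler_pM ?mulr_ge0 ?jbrX_ge0 ?normc_ge0 //.
have inner x : cintegral (fun xi => ip f (wp G (row_mx x xi)) * wp G (row_mx x xi) y) =
    kap R N * f y * (G (y - x) * conjc (G (y - x))).
  pose phi p := f p * conjc (G (p - x)).
  have sphi : schwartz phi by apply: schw_mul => //; apply: schw_conj; exact: schw_shift.
  have := fourier_inversion0 (schw_shift y sphi); rewrite add0r => h.
  have -> : kap R N * f y * (G (y - x) * conjc (G (y - x))) = G (y - x) * (kap R N * phi y).
    by rewrite /phi; ring.
  rewrite -h -cintegralZ; last by apply: schw_cintegrable; apply: schw_fhat; exact: schw_shift.
  apply: eq_cintegral => xi; rewrite fhat_shift //.
  have -> : ip f (wp G (row_mx x xi)) = cis (- dotmx x xi) * fhat phi xi.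
    rewrite /ip /fhat -cintegralZ; last by apply: schw_cintegrable; exact: schw_fhat_integrand.
    apply: eq_cintegral => p; rewrite conj_wp row_mxKl row_mxKr dotmxBl cisD /phi (dotmxC xi); ring.
  rewrite /wp row_mxKl row_mxKr dotmxBl opprB cisD (dotmxC xi).
  rewrite (_ : cis (- dotmx x xi) * fhat phi xi * (G (y - x) * _) =
    G (y - x) * ((cis (- dotmx x xi) * cis (dotmx x xi)) * cis (- dotmx y xi) * fhat phi xi)); last by ring.
  by rewrite -cisD addNr cis0 mul1r.
rewrite (eq_cintegral inner) cintegralZ; last first.
  have := schw_cintegrable (schw_mul sG (schw_conj sG)) => /cintegral_affine - /(_ (-1) y).
  rewrite oppr_eq0 oner_eq0 => /(_ isT) [+ _]; congr cintegrable; apply/funext => x.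
  by rewrite scaleN1r addrC.
rewrite mulrAC; congr (_ * _); congr (_ * _).
have := schw_cintegrable (schw_mul sG (schw_conj sG)) => /cintegral_affine - /(_ (-1) y).
rewrite oppr_eq0 oner_eq0 => /(_ isT) [_ +].
rewrite normrN1 expr1n mul1r /ip => ->; apply: eq_cintegral => x.
by rewrite scaleN1r addrC.
Qed.

(** [temp_exchange] applied to the resolution of the identity; in particular a tempered
    distribution is determined by its pairings with wave packets. *)
Lemma temp_resolution N (G f : fn N) u : schwartz G -> tempered u -> schwartz f ->
  kap R N * ip G G * u f = cintegral (fun X => ip f (wp G X) * u (wp G X)).
Proof.
move=> sG tu sf; rewrite -tempZ //.
have H y : kap R N * ip G G * f y = cintegral (fun X => ip f (wp G X) *
    (fun Z : 'rV[R]_(N + N + N) => wp G (lsubmx Z) (rsubmx Z)) (row_mx X y)).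
  rewrite -(stft_inversion sG sf y); apply: eq_cintegral => X.
  by rewrite row_mxKl row_mxKr.
have sf' : schwartz (fun y => kap R N * ip G G * f y) by exact: schw_scale.
have E := temp_exchange (ccont_ip_wp sG sf) (Brd_ip_wp sG sf) (wp_joint sG) H tu sf'.
rewrite {}E; apply: eq_cintegral => X; congr (_ * u _); apply/funext => y.
by rewrite row_mxKl row_mxKr.
Qed.

Lemma ip_self_neq0 N (G : fn N) x : schwartz G -> G x != 0 -> ip G G != 0.
Proof. by move=> sG; apply: contraNneq => /(ip_eq0 sG)->. Qed.
End Resolution.

(** * The Wigner transform and the Weyl quantization *)

Section Wigner.
Variable R : realType.
Local Notation C := R[i].
Local Notation fn N := ('rV[R]_N -> C).

(** The map (p, t) |-> (p + t/2, p - t/2). *)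
Definition midmx k : 'M[R]_(k + k) := block_mx 1%:M 1%:M (2^-1)%:M (- (2^-1)%:M).
(** The map (x, y) |-> ((x + y)/2, x - y). *)
Definition unmidmx k : 'M[R]_(k + k) := block_mx (2^-1)%:M 1%:M (2^-1)%:M (- 1%:M).

Lemma mul_midmx k (p t : 'rV[R]_k) : row_mx p t *m midmx k = row_mx (p + 2^-1 *: t) (p - 2^-1 *: t).
Proof. by rewrite /midmx mul_row_block !mulmx1 mulmxN !mul_mx_scalar. Qed.

Lemma mul_unmidmx k (x y : 'rV[R]_k) : row_mx x y *m unmidmx k = row_mx (2^-1 *: (x + y)) (x - y).
Proof. by rewrite /unmidmx mul_row_block mulmxN !mulmx1 !mul_mx_scalar scalerDr. Qed.

Lemma midmxK k : midmx k *m unmidmx k = 1%:M.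
Proof.
apply/row_matrixP => i; rewrite [LHS]rowE [RHS]rowE mulmxA mulmx1.
set e := delta_mx 0 i; rewrite -(hsubmxK e) mul_midmx mul_unmidmx.
set p := lsubmx e; set t := rsubmx e; congr row_mx.
  by apply/rowP => j; rewrite !mxE; lra.
by apply/rowP => j; rewrite !mxE; lra.
Qed.

Lemma midmx_unit k : midmx k \in unitmx.
Proof. by case/mulmx1_unit: (midmxK k). Qed.
Lemma unmidmx_unit k : unmidmx k \in unitmx.
Proof. by case/mulmx1_unit: (midmxK k). Qed.

Lemma schw_mid k (Q : fn (k + k)) A : A \in unitmx -> schwartz Q -> schwartz (fun z => Q (z *m A)).
Proof. by move=> uA sQ; have := schw_aff 0 uA sQ; congr schwartz; apply/funext => z; rewrite addr0. Qed.

(** The map dual to the one from symbols to Weyl kernels, see [weyl_wigner]; its phase has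
    the sign of [weyl_dist_kernel]. *)
Definition Wig k (S : fn (k + k)) : fn (k + k) := pft (fun z => S (z *m midmx k)).

Lemma WigE k (S : fn (k + k)) p xi : Wig S (row_mx p xi) =
  cintegral (fun t => cis (dotmx t xi) * S (row_mx (p + 2^-1 *: t) (p - 2^-1 *: t))).
Proof.
rewrite /Wig /pft row_mxKl row_mxKr; apply: eq_cintegral => t.
by rewrite mul_midmx dotmxC.
Qed.

Lemma schw_Wig k (S : fn (k + k)) : schwartz S -> schwartz (Wig S).
Proof. by move=> sS; apply: schw_pft; apply: schw_mid => //; exact: midmx_unit. Qed.

Lemma cintegral_split_schw a b (F : fn (a + b)) : schwartz F ->
  cintegral F = cintegral (fun x => cintegral (fun y => F (row_mx x y))).
Proof. by move=> sF; apply: cintegral_split_Brd; [exact: schw_ccont|exact: schw_Brd]. Qed.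

Lemma schw_fubini a b (F : fn (a + b)) : schwartz F ->
  cintegral (fun x => cintegral (fun y => F (row_mx x y))) =
  cintegral (fun y => cintegral (fun x => F (row_mx x y))).
Proof.
move=> sF; have [M M0 HM] := Brd_dec ((a + a) + (b + b)) (schw_Brd sF).
apply: (@cintegral_fubini _ _ _ (fun x => M * (jbr x ^+ (a + a))^-1) (fun y => (jbr y ^+ (b + b))^-1)).
- by apply: rintZ; exact: rint_jbr.
- exact: rint_jbr.
- by apply: ccont_cmeas; exact: schw_ccont.
by move=> x y; apply: (le_trans (HM _)); rewrite -mulrA ler_wpM2l // jbrX_splitV.
Qed.

Lemma schw_cintegrablel a b (F : fn (a + b)) y : schwartz F ->
  cintegrable (fun x => F (row_mx x y)).
Proof.
move=> sF; have [M M0 HM] := Brd_dec (a + a) (schw_Brd sF).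
apply: (@cintegrable_jbr _ _ _ M) => [|x].
  apply: ccont_cmeas; apply: ccont_comp; last exact: schw_ccont.
  by apply: cont_row_mx; [exact: cont_id|exact: cont_cstv].
apply: (le_trans (HM _)); rewrite ler_wpM2l // lef_pV2 ?posrE ?jbrX_gt0 //.
by rewrite lerXn2r ?nnegrE ?jbr_ge0 // jbr_row_mxl.
Qed.

Lemma schw_cintegrable_int a b (F : fn (a + b)) : schwartz F ->
  cintegrable (fun x => cintegral (fun y => F (row_mx x y))).
Proof.
move=> sF; have [M M0 HM] := Brd_dec ((a + a) + (b + b)) (schw_Brd sF).
apply: (@cintegrable_intl _ _ _ (fun x => M * (jbr x ^+ (a + a))^-1) (fun y => (jbr y ^+ (b + b))^-1)).
- by apply: rintZ; exact: rint_jbr.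
- exact: rint_jbr.
- by apply: ccont_cmeas; exact: schw_ccont.
by move=> x y; apply: (le_trans (HM _)); rewrite -mulrA ler_wpM2l // jbrX_splitV.
Qed.

Lemma cintegral_mid k (Q : fn (k + k)) : schwartz Q ->
  cintegral (fun x => cintegral (fun y => Q (row_mx x y))) =
  cintegral (fun p => cintegral (fun t => Q (row_mx (p + 2^-1 *: t) (p - 2^-1 *: t)))).
Proof.
move=> sQ; pose A : 'M[R]_(k + k) := block_mx 1%:M 1%:M 0 (- 1%:M).
have AE (y t : 'rV[R]_k) : row_mx y t *m A = row_mx y (y - t).
  by rewrite mul_row_block !mulmx1 mulmx0 addr0 mulmxN mulmx1.
have uA : A \in unitmx.
  have AA : A *m A = 1%:M.
    apply/row_matrixP => i; rewrite [LHS]rowE [RHS]rowE mulmxA mulmx1.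
    set e := delta_mx 0 i; rewrite -(hsubmxK e) !AE; congr row_mx.
    by rewrite opprB addrCA subrr addr0.
  by case/mulmx1_unit: AA.
have s1 := schw_mid uA sQ; have s2 := schw_mid (midmx_unit k) sQ.
transitivity (cintegral (fun y => cintegral (fun t => Q (row_mx y t *m A)))).
  apply: eq_cintegral => y; under [RHS]eq_cintegral do rewrite AE.
  have := schw_cintegrable (schw_slice_joint y sQ) => /cintegral_affine - /(_ (-1) y).
  rewrite oppr_eq0 oner_eq0 => /(_ isT) [_ ->]; rewrite normrN1 expr1n mul1r.
  by apply: eq_cintegral => t; rewrite scaleN1r addrC.
rewrite (schw_fubini s1).
transitivity (cintegral (fun t => cintegral (fun p => Q (row_mx p t *m midmx k)))).
  apply: eq_cintegral => t; rewrite -(@cintegral_shift _ _ _ (2^-1 *: t)).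
    apply: eq_cintegral => p; rewrite AE mul_midmx; congr (Q (row_mx _ _)).
    by apply/rowP => j; rewrite !mxE; lra.
  exact: (schw_cintegrablel t s1).
rewrite -(schw_fubini s2); apply: eq_cintegral => p; apply: eq_cintegral => t.
by rewrite mul_midmx.
Qed.

(** Weyl quantization is dual to the Wigner transform. *)
Lemma weyl_wigner k (b S : fn (k + k)) : schwartz b -> schwartz S ->
  cintegral (fun x => cintegral (fun y => weyl_kernel b x y * S (row_mx x y))) =
  ((2 * pi) ^- k)%:C * cintegral (fun r => b r * Wig S r).
Proof.
move=> sb sS; set c := ((2 * pi) ^- k)%:C.
pose Q z := c * pft b (z *m unmidmx k) * S z.
have sQ : schwartz Q.
  apply: schw_mul => //; apply: schw_scale; apply: schw_mid; first exact: unmidmx_unit.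
  exact: schw_pft.
have QE x y : weyl_kernel b x y * S (row_mx x y) = Q (row_mx x y).
  rewrite /Q mul_unmidmx /weyl_kernel /pft row_mxKl row_mxKr.
  by congr (_ * _ * _); apply: eq_cintegral => th; rewrite cexpE expR0 mul1r.
transitivity (cintegral (fun x => cintegral (fun y => Q (row_mx x y)))).
  by apply: eq_cintegral => x; apply: eq_cintegral => y; rewrite QE.
have sbW : schwartz (fun r => b r * Wig S r) by apply: schw_mul => //; exact: schw_Wig.
rewrite cintegral_mid // cintegral_split_schw // -cintegralZ; last first.
  exact: (schw_cintegrable_int sbW).
apply: eq_cintegral => p.
pose K (t th : 'rV[R]_k) := cis (dotmx t th) * b (row_mx p th) * S (row_mx (p + 2^-1 *: t) (p - 2^-1 *: t)).
rewrite -cintegralZ; last exact: (schw_cintegrable (schw_slice_joint p sbW)).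
have sSp : schwartz (fun t => S (row_mx (p + 2^-1 *: t) (p - 2^-1 *: t))).
  have := schw_slice_joint p (schw_mid (midmx_unit k) sS); congr schwartz.
  by apply/funext => t; rewrite mul_midmx.
have sbp := schw_slice_joint p sb.
apply: (@fubini_eq _ _ _ (fun t th => c * K t th) (fun t => normc c * normc (S (row_mx (p + 2^-1 *: t) (p - 2^-1 *: t)))) (fun th => normc (b (row_mx p th)))).
- by apply: rintZ; exact: schw_rint.
- exact: schw_rint.
- apply: ccont_mul; first exact: ccont_cst.
  apply: ccont_mul; first apply: ccont_mul.
  + by apply: ccont_cis; apply: cont_dotmx; [exact: cont_lsubmx|exact: cont_rsubmx].
  + exact: (ccont_comp (@cont_rsubmx _ _ _) (schw_ccont sbp)).
  exact: (ccont_comp (@cont_lsubmx _ _ _) (schw_ccont sSp)).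
- move=> t th; rewrite /K 3!normcM normc_cis mul1r -mulrA ler_wpM2l ?normc_ge0 //.
  by rewrite mulrC.
- move=> t; rewrite /Q -mul_midmx -mulmxA midmxK mulmx1 mul_midmx.
  rewrite /pft row_mxKl row_mxKr -mulrA -cintegralZr; last first.
    exact: (schw_cintegrable (schw_fhat_integrand t sbp)).
  rewrite cintegralZ //; apply: (schw_cintegrable (f := fun th => K t th)).
  have := schw_scale (S (row_mx (p + 2^-1 *: t) (p - 2^-1 *: t))) (schw_fhat_integrand t sbp).
  by congr schwartz; apply/funext => th; rewrite /K mulrC.
move=> th; rewrite WigE mulrA -cintegralZ.
  by apply: eq_cintegral => t; rewrite /K; ring.
have := schw_cintegrable (schw_fhat_integrand th sSp); congr cintegrable.
by apply/funext => t; rewrite dotmxC.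
Qed.

(** Fourier inversion at the origin, in the variable t; this is the formula for the trace
    of an operator as the integral of its symbol. *)
Lemma cintegral_Wig k (S : fn (k + k)) : schwartz S ->
  cintegral (Wig S) = kap R k * cintegral (fun p => S (row_mx p p)).
Proof.
move=> sS; rewrite cintegral_split_schw; last exact: schw_Wig.
have sSm := schw_mid (midmx_unit k) sS.
rewrite -cintegralZ; last first.
  have [M M0 HM] := Brd_dec (k + k) (schw_Brd sS).
  apply: (@cintegrable_jbr _ _ _ M) => [|p].
    apply: ccont_cmeas; apply: ccont_comp; last exact: schw_ccont.
    by apply: cont_row_mx; exact: cont_id.
  apply: (le_trans (HM _)); rewrite ler_wpM2l // lef_pV2 ?posrE ?jbrX_gt0 //.
  by rewrite lerXn2r ?nnegrE ?jbr_ge0 // jbr_row_mxl.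
apply: eq_cintegral => p; rewrite -[LHS]/(cintegral (fun t => pft _ (row_mx p t))).
under eq_cintegral do rewrite fhat_pft.
rewrite fourier_inversion0; last exact: (schw_slice_joint p sSm).
by rewrite mul_midmx scaler0 addr0 subr0.
Qed.
End Wigner.

(** * Lattice sums as integrals *)

Section Cells.
Variable R : realType.
Local Notation C := R[i].
Local Notation fn N := ('rV[R]_N -> C).
Local Notation tupR N := (N.-tuple (measurableTypeR R)).

(** The integer vector labelling the cell of [z] in the tiling of R^N by the
    translates of [{z | z *m A \in [0, 1)^N}]. *)
Definition cell N (A : 'M[R]_N) (z : 'rV[R]_N) : 'rV[int]_N :=
  \row_i Num.floor ((z *m A) 0 i).

Definition cellvol N (A : 'M[R]_N) : \bar R :=
  (\int[lebn R N]_t ((cell A (row_of_tup t) == 0)%:R)%:E)%E.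

Definition lat N (b : 'M[R]_N) (z : 'rV[int]_N) : 'rV[R]_N := map_mx intr z *m b.

Lemma measurable_cell N (A : 'M[R]_N) (w : 'rV[int]_N -> R) :
  rmeasurable (fun z => w (cell A z)).
Proof.
apply: (@measurable_floor_row _ _ _ (fun i t => (row_of_tup t *m A) 0 i)) => i.
apply: (@continuous_rmeasurable R N (fun z => (z *m A) 0 i)).
by apply: (@cont_comp _ _ _ (fun z : 'rV[R]_N => z *m A) (fun z : 'rV[R]_N => z 0 i)); [exact: cont_mulmx|exact: continuous_coord].
Qed.

Lemma cell_shift N (A : 'M[R]_N) (z : 'rV[R]_N) (m : 'rV[int]_N) : A \in unitmx ->
  cell A (z + map_mx intr m *m invmx A) = cell A z + m.
Proof.
move=> uA; rewrite /cell mulmxDl mulmxKV //; apply/rowP => i; rewrite !mxE.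
by rewrite floorDrz ?intr_int // intrKfloor.
Qed.

(** All cells are translates of one another. *)
Lemma cellvol_shift N (A : 'M[R]_N) (m : 'rV[int]_N) : A \in unitmx ->
  (\int[lebn R N]_t ((cell A (row_of_tup t) == m)%:R)%:E = cellvol A)%E.
Proof.
move=> uA; rewrite /cellvol (@lebn_affine _ _ 1 (map_mx intr m *m invmx A)) ?oner_eq0 //.
- rewrite normr1 expr1n mul1e; apply: eq_integral => t _.
  have -> : row_of_tup (aff_tup 1 (map_mx intr m *m invmx A) t) =
     row_of_tup t + map_mx intr m *m invmx A.
    by apply/rowP => i; rewrite !mxE tnth_mktuple mul1r !mxE.
  by rewrite cell_shift // -subr_eq0 addrK.
- by apply/measurable_EFinP; apply: (@measurable_cell _ A (fun z => (z == m)%:R)).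
Qed.

Definition cvol N (A : 'M[R]_N) : R := fine (cellvol A).

(** The cell is a bounded set, contained in a cube. *)
Lemma cellvolE N (A : 'M[R]_N) : A \in unitmx -> cellvol A = (cvol A)%:E.
Proof.
move=> uA; rewrite fineK //.
have [K K0 HK] := jbr_mulmx (invmx A).
pose r := K * (N.+1%:R * 2) + 1.
have r0 : 0 < r by rewrite ltr_wpDl // mulr_ge0 // ltW.
have [ib Ib] := box_int (- (\row_(i < N) r)) (mulr_gt0 (ltr0n R 2) r0).
have V0 : (0 <= cellvol A)%E by apply: integral_ge0 => t _; rewrite lee_fin.
rewrite ge0_fin_numE //.
have [_] := integrableP _ _ _ ib; apply: le_lt_trans.
apply: ge0_le_integral => //.
- by apply/measurable_EFinP; apply: (@measurable_cell _ A (fun z => (z == 0)%:R)).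
- by apply/measurable_EFinP; apply: measurableT_comp => //; exact: rint_meas.
move=> t _; rewrite lee_fin ger0_norm ?box_ge0 //; set z := row_of_tup t.
case: eqP => [cz|]; last by rewrite box_ge0.
rewrite /box; case: (boolP [forall i, _]) => // /forallP[] i.
have hz : `|z 0 i| <= K * (N.+1%:R * 2).
  apply: (le_trans (coord_le_jbr _ _)); rewrite -{1}(mulmxK uA z).
  apply: (le_trans (HK _)); rewrite ler_wpM2l ?(ltW K0) //; apply: (le_trans (jbr_le_norm _)).
  rewrite ler_wpM2l // -[2]/(1 + 1) lerD2l.
  rewrite [leLHS]mx_normrE; apply/bigmax_leP; split => // -[i' j] _ /=.
  have /rowP/(_ j) := cz; rewrite !mxE (ord1 i') => /eqP; rewrite floor_eq => /andP[h1 h2].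
  by rewrite ger0_norm // ltW //; move: h2; rewrite add0r.
by move: hz; rewrite !mxE ler_norml /r => /andP[h1 h2]; apply/andP; split; lra.
Qed.

(** Monotone convergence and completeness apply to series, hence this passage from sums
    over [Z^N]. *)
Lemma esum_pickle N (g : 'rV[int]_N -> R) :
  (forall z, 0 <= g z) ->
  (\esum_(z in setT) (g z)%:E =
   \sum_(0 <= i <oo) if pickle_inv i is Some z then (g z)%:E else 0)%E.
Proof.
move=> g0; rewrite nneseries_esumT; last first.
  by move=> i; case: pickle_inv => // z; rewrite lee_fin.
rewrite (_ : \esum_(z in setT) (g z)%:E = \esum_(i in range (@pickle 'rV[int]_N))
    if pickle_inv i is Some z then (g z)%:E else 0)%E.
  rewrite [LHS]esum_mkcond; apply: eq_esum => i _.
  case: ifPn => //; case E : (pickle_inv i) => [z|] // /negP[].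
  by rewrite inE; exists z => //; have := @pickle_invK 'rV[int]_N i; rewrite E.
rewrite (@reindex_esum _ _ _ setT _ (@pickle 'rV[int]_N)).
  by apply: eq_esum => z _; rewrite pickleK_inv.
split; first by move=> x _; exists x.
  by move=> x y _ _; exact: (pcan_inj (@pickleK 'rV[int]_N)).
by move=> y [x _ <-]; exists x.
Qed.

(** The integral of a step function is its sum over the cells times their common volume. *)
Lemma cell_integral N (A : 'M[R]_N) (g : 'rV[int]_N -> R) : A \in unitmx -> (forall z, 0 <= g z) ->
  (\int[lebn R N]_t (g (cell A (row_of_tup t)))%:E = (cvol A)%:E * \esum_(z in setT) (g z)%:E)%E.
Proof.
move=> uA g0.
pose F (i : nat) : set (tupR N) := [set t | pickle (cell A (row_of_tup t)) = i].
have mF i : measurable (F i).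
  have := @measurable_cell _ A (fun z => (pickle z == i)%:R) measurableT [set 1] (measurable_set1 _).
  rewrite setTI; congr measurable; apply/seteqP; split => t /=.
    by case: eqP => // _ /eqP; rewrite eq_sym oner_eq0.
  by rewrite /F /= => ->; rewrite eqxx.
have FT : \bigcup_i F i = setT by apply/seteqP; split => // t _; exists (pickle (cell A (row_of_tup t))).
have mg : measurable_fun setT (fun t : tupR N => (g (cell A (row_of_tup t)))%:E).
  by apply/measurable_EFinP; exact: measurable_cell.
have tF : trivIset setT F.
  by apply/trivIsetP => i j _ _ ij; apply/seteqP; split => // t [] /= h1 h2; move: ij; rewrite -h1 -h2 eqxx.
have := @ge0_integral_bigcup _ _ R (lebn R N) F (fun t => (g (cell A (row_of_tup t)))%:E) mF.
rewrite FT => -> //; last by move=> t _; rewrite lee_fin.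
pose a (i : nat) : \bar R := if pickle_inv i is Some z then (g z)%:E else 0%E.
have a0 i : (0 <= a i)%E by rewrite /a; case: pickle_inv => // z; rewrite lee_fin.
transitivity (\sum_(0 <= i <oo) ((cvol A)%:E * a i))%E.
  apply: eq_eseriesr => i _; rewrite /a.
  case E : (pickle_inv i) => [z|] /=; last first.
    rewrite mule0 (_ : F i = set0) ?integral_set0 //.
    apply/seteqP; split => // t /= h; move: E; rewrite -h.
    by rewrite pickleK_inv.
  have Fz t : F i t <-> cell A (row_of_tup t) = z.
    have := @pickle_invK 'rV[int]_N i; rewrite E /= => zi; rewrite /F /= -zi; split => [|-> //].
    by move/(pcan_inj (@pickleK 'rV[int]_N)).
  transitivity (\int[lebn R N]_(t in F i) ((g z)%:E * ((cell A (row_of_tup t) == z)%:R)%:E))%E.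
    by apply: eq_integral => t; rewrite inE => /Fz ->; rewrite eqxx mule1.
  have mi : measurable_fun setT (fun t : tupR N => ((cell A (row_of_tup t) == z)%:R : R)%:E).
    by apply/measurable_EFinP; apply: (@measurable_cell _ A (fun z' => (z' == z)%:R)).
  rewrite ge0_integralZl ?lee_fin //; first last.
  - exact: measurable_funTS.
  rewrite [RHS]muleC; congr (_ * _)%E; rewrite -(cellvolE uA) -(cellvol_shift z uA).
  rewrite integral_mkcond; apply: eq_integral => t _; rewrite patchE.
  case: ifPn => // /negP; rewrite inE => nF; case: eqP => // /Fz //.
by rewrite nneseriesZl // esum_pickle.
Qed.
End Cells.

Section LatticeSums.
Variable R : realType.
Local Notation C := R[i].
Local Notation fn N := ('rV[R]_N -> C).
Local Notation tupR N := (N.-tuple (measurableTypeR R)).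

Section lattice.
Variables (N : nat) (b : 'M[R]_N).
Hypothesis ub : b \in unitmx.
Let L := [set map_mx intr z *m b | z in [set: 'rV[int]_N]].

Lemma lat_in z : L (lat b z). Proof. by exists z. Qed.

Lemma lat_inj : injective (lat b).
Proof.
move=> x y /(congr1 (mulmx^~ (invmx b))); rewrite /lat !mulmxK // => h.
by apply/rowP => i; have /rowP/(_ i) := h; rewrite !mxE => /intr_inj.
Qed.

Lemma esum_lat (f : 'rV[R]_N -> \bar R) :
  (\esum_(x in L) f x = \esum_(z in setT) f (lat b z))%E.
Proof.
apply: reindex_esum; split; first by move=> z _; exact: lat_in.
  by move=> x y _ _; exact: lat_inj.
by move=> y [z _ <-]; exists z.
Qed.

Lemma cvol1 : cvol (1%:M : 'M[R]_N) = 1.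
Proof.
have [_ Ib] := box_int (0 : 'rV[R]_N) (@ltr01 R).
transitivity (rI (box (0 : 'rV[R]_N) 1)); last by rewrite Ib expr1n.
rewrite /cvol /cellvol /rI /Rintegral; congr fine.
apply: eq_integral => t _; congr (_%:E); rewrite /box; congr (_%:R); congr nat_of_bool.
set z := row_of_tup t.
apply/eqP/forallP => [cz i|h].
  have /rowP/(_ i) := cz; rewrite mxE mulmx1 [RHS]mxE => /eqP.
  by rewrite floor_eq [(0 : 'rV[R]_N) 0 i]mxE !add0r.
apply/rowP => i; rewrite mxE mulmx1 [RHS]mxE; apply/eqP; rewrite floor_eq !add0r.
by have := h i; rewrite [(0 : 'rV[R]_N) 0 i]mxE add0r.
Qed.

Variable A : 'M[R]_N.
Hypothesis uA : A \in unitmx.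

(** The point of the lattice labelling the cell of [z]. With it a sum over the lattice is an
    integral over R^N of a function of [fl z], and exchanging it with an integral is an
    instance of Fubini. *)
Definition fl (z : 'rV[R]_N) := lat b (cell A z).

Lemma cvol_ge0 : 0 <= cvol A.
Proof. by apply: fine_ge0; apply: integral_ge0 => t _; rewrite lee_fin. Qed.

Lemma ge0_esum_int (f : 'rV[R]_N -> R) : (forall x, 0 <= f x) ->
  (\int[lebn R N]_t (f (fl (row_of_tup t)))%:E = (cvol A)%:E * \esum_(x in L) (f x)%:E)%E.
Proof. by move=> f0; rewrite esum_lat -(@cell_integral _ _ A (fun z => f (lat b z))). Qed.

Lemma rmeasurable_fl (f : 'rV[R]_N -> R) : rmeasurable (fun z => f (fl z)).
Proof. exact: (@measurable_cell _ _ A (fun z => f (lat b z))). Qed.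

Lemma ge0_rsum (f : 'rV[R]_N -> R) : (forall x, 0 <= f x) ->
  (\esum_(x in L) (f x)%:E < +oo)%E ->
  rint (fun z => f (fl z)) /\ rI (fun z => f (fl z)) = cvol A * fine (\esum_(x in L) (f x)%:E).
Proof.
move=> f0 fo; have e0 : (0 <= \esum_(x in L) (f x)%:E)%E by apply: esum_ge0 => x _; rewrite lee_fin.
have E := ge0_esum_int f0.
have ef : (\esum_(x in L) (f x)%:E)%E \is a fin_num by rewrite ge0_fin_numE.
split; last by rewrite /rI /Rintegral E fineM.
apply/integrableP; split; first by apply/measurable_EFinP; exact: rmeasurable_fl.
under eq_integral do rewrite /= ger0_norm //.
by rewrite E -(fineK ef) -EFinM ltry.
Qed.

Lemma rsum_rI (f : 'rV[R]_N -> R) : (\esum_(x in L) `|f x|%:E < +oo)%E ->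
  rint (fun z => f (fl z)) /\ rI (fun z => f (fl z)) = cvol A * rsum L f.
Proof.
move=> fo.
have p0 x : 0 <= (f^\+)%R x by exact: funrpos_ge0.
have n0 x : 0 <= (f^\-)%R x by exact: funrneg_ge0.
have po : (\esum_(x in L) ((f^\+)%R x)%:E < +oo)%E.
  apply: le_lt_trans fo; apply: le_esum => x _; rewrite lee_fin /funrpos.
  by rewrite ge_max ler_norm normr_ge0.
have no : (\esum_(x in L) ((f^\-)%R x)%:E < +oo)%E.
  apply: le_lt_trans fo; apply: le_esum => x _; rewrite lee_fin /funrneg.
  by rewrite ge_max normr_ge0 andbT -normrN ler_norm.
have [ip Ip] := ge0_rsum p0 po; have [im Im] := ge0_rsum n0 no.
have fE z : f (fl z) = (f^\+)%R (fl z) + - (f^\-)%R (fl z).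
  by rewrite -[in LHS](funrposBneg f).
have e : (fun z => f (fl z)) = (fun z => (f^\+)%R (fl z) + - (f^\-)%R (fl z)) by exact/funext.
rewrite e; split; first by apply: rintD => //; exact: rintN.
by rewrite rID // ?rIN // ?Ip ?Im /rsum ?mulrBr //; exact: rintN.
Qed.

(** Absolute convergence of the sum is integrability of the step function. *)
Lemma csum_cintegral (f : fn N) : csummable L f ->
  cintegrable (fun z => f (fl z)) /\ cintegral (fun z => f (fl z)) = (cvol A)%:C * csum L f.
Proof.
rewrite /csummable /summable => fo.
have {}fo : (\esum_(x in L) (normc (f x))%:E < +oo)%E.
  apply: le_lt_trans fo; apply: le_esum => x _; rewrite abse_EFin lee_fin; exact: ler_norm.
have [|ir Ir] := @rsum_rI (fun x => complex.Re (f x)).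
  by apply: le_lt_trans fo; apply: le_esum => x _; rewrite lee_fin Re_le_normc.
have [|ii Ii] := @rsum_rI (fun x => complex.Im (f x)).
  by apply: le_lt_trans fo; apply: le_esum => x _; rewrite lee_fin Im_le_normc.
split; first by apply/cintegrableP.
rewrite /csum; apply: ReIm_eq; rewrite ?ReM ?ImM /= ?mul0r ?subr0 ?addr0 -?Ir -?Ii //.
Qed.

(** The point z A b and the label of its cell are at bounded distance, and a bounded
    displacement costs a constant. *)
Lemma jbr_fl : exists2 K, 0 < K & forall X z,
  jbr (X - z *m A *m b) <= K * jbr (X - fl z) /\ jbr (X - fl z) <= K * jbr (X - z *m A *m b).
Proof.
have [K K0 HK] := jbr_mulmx b.
pose K' := 2 * (K * (N.+1%:R * 2)); have K'0 : 0 < K' by rewrite !mulr_gt0.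
exists K' => // X z.
pose d := z *m A - map_mx intr (cell A z).
have jd : jbr (d *m b) <= K * (N.+1%:R * 2).
  apply: (le_trans (HK _)); rewrite ler_wpM2l ?(ltW K0) //.
  apply: (le_trans (jbr_le_norm _)); rewrite ler_wpM2l // -[2]/(1 + 1) lerD2l.
  rewrite [leLHS]mx_normrE; apply/bigmax_leP; split => // -[i j] _ /=.
  rewrite (ord1 i) mxE [X in _ + X]mxE [X in _ - X]mxE [X in _ - X%:~R]mxE.
  have := floor_itv ((z *m A) 0 j); rewrite intrD => /andP[h1 h2].
  by rewrite ger0_norm ?subr_ge0 // lerBlDl ltW.
have dE : z *m A *m b = fl z + d *m b by rewrite /d mulmxBl addrC subrK.
have n1 (x y : 'rV[R]_N) : jbr (x + y) <= 2 * jbr x * jbr y by rewrite -mulrA; exact: jbrD.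
have K'E x : K' * x = 2 * x * (K * (N.+1%:R * 2)) by rewrite /K'; ring.
split; rewrite K'E.
  rewrite dE opprD addrA; apply: (le_trans (n1 _ _)); rewrite jbrN.
  by rewrite ler_wpM2l // mulr_ge0 ?jbr_ge0.
have -> : X - fl z = (X - z *m A *m b) + d *m b by rewrite dE opprD addrA subrK.
by apply: (le_trans (n1 _ _)); rewrite ler_wpM2l // mulr_ge0 ?jbr_ge0.
Qed.

End lattice.
End LatticeSums.

Section LatticeDecay.
Variable R : realType.
Local Notation C := R[i].
Local Notation fn N := ('rV[R]_N -> C).
Variables (N : nat) (b : 'M[R]_N).
Hypothesis ub : b \in unitmx.
Let L := [set map_mx intr z *m b | z in [set: 'rV[int]_N]].
Local Notation fl1 := (fl b 1%:M).

Let u1 : (1%:M : 'M[R]_N) \in unitmx. Proof. exact: unitmx1. Qed.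

Lemma jbr_fl1 : exists2 K, 0 < K & forall X t,
  jbr (t - X *m invmx b) <= K * jbr (X - fl1 t) /\ jbr (X - fl1 t) <= K * jbr (t - X *m invmx b).
Proof.
have [K1 K10 H1] := jbr_fl b 1%:M.
have [K2 K20 H2] := jbr_mulmx (invmx b); have [K3 K30 H3] := jbr_mulmx b.
have tE t X : t - X *m invmx b = (t *m b - X) *m invmx b by rewrite mulmxBl mulmxK.
have tE' t X : t *m b - X = (t - X *m invmx b) *m b by rewrite mulmxBl mulmxKV.
exists (K2 * K1 + K3 * K1) => [|X t]; first by rewrite addr_gt0 // mulr_gt0.
have [] := H1 X t; rewrite mulmx1 jbrBC => h1 h2; split.
  apply: (@le_trans _ _ (K2 * K1 * jbr (X - fl1 t))); last by rewrite ler_wpM2r ?jbr_ge0 // lerDl mulr_ge0 // ltW.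
  by rewrite tE; apply: (le_trans (H2 _)); rewrite -mulrA ler_wpM2l // ltW.
apply: (@le_trans _ _ (K3 * K1 * jbr (t - X *m invmx b))); last by rewrite ler_wpM2r ?jbr_ge0 // lerDr mulr_ge0 // ltW.
apply: (le_trans h2); rewrite [K3 * _]mulrC -mulrA ler_wpM2l ?(ltW K10) //.
by rewrite tE'; exact: H3.
Qed.

(** The bound is uniform in [X]: up to a constant the integrand is a translate of the fixed
    function [jbr x ^- k]. *)
Lemma jbr_fl_int k : (N + N <= k)%N -> exists2 W, 0 <= W & forall X,
  rint (fun t => (jbr (X - fl1 t) ^+ k)^-1) /\ rI (fun t => (jbr (X - fl1 t) ^+ k)^-1) <= W.
Proof.
move=> Nk; have [K K0 HK] := jbr_fl1.
pose W := rI (fun t : 'rV[R]_N => (jbr t ^+ k)^-1).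
have W0 : 0 <= W by apply: rI_ge0 => t; rewrite invr_ge0 jbrX_ge0.
exists (K ^+ k * W) => [|X]; first by rewrite mulr_ge0 // exprn_ge0 // ltW.
have [ir Ir] := rI_affine (- (X *m invmx b)) (oner_neq0 R) (rint_jbr R Nk).
pose g t := K ^+ k * (jbr (1 *: t - X *m invmx b) ^+ k)^-1.
have ig : rint g by exact: rintZ ir.
have h t : (jbr (X - fl1 t) ^+ k)^-1 <= g t.
  rewrite /g scale1r ler_pdivlMr ?jbrX_gt0 // mulrC ler_pdivrMr ?jbrX_gt0 // -exprMn.
  by rewrite lerXn2r ?nnegrE ?mulr_ge0 ?jbr_ge0 ?(ltW K0) //; case: (HK X t).
have i1 : rint (fun t => (jbr (X - fl1 t) ^+ k)^-1).
  apply: (rint_dom _ ig) => [|t]; first exact: (@rmeasurable_fl _ _ b 1%:M (fun x => (jbr (X - x) ^+ k)^-1)).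
  by rewrite ger0_norm // invr_ge0 jbrX_ge0.
split => //; apply: (le_trans (rI_le i1 ig h)).
by rewrite /g rIZ // /W Ir normr1 expr1n mul1r.
Qed.

Lemma jbr_fl_shift (X : 'rV[R]_N) t l : (jbr (X - fl1 t) ^+ l)^-1 <= 2 ^+ l * jbr X ^+ l * (jbr (0 - fl1 t) ^+ l)^-1.
Proof.
rewrite ler_pdivlMr ?jbrX_gt0 // mulrC ler_pdivrMr ?jbrX_gt0 //.
have -> : 0 - fl1 t = (X - fl1 t) + (- X) by rewrite addrAC subrr.
by apply: (le_trans (jbrXD _ _ _)); rewrite jbrN -!mulrA ler_wpM2l ?exprn_ge0 // mulrC.
Qed.

Lemma esum_jbr k X : (N + N <= k)%N -> (\esum_(x in L) ((jbr (X - x) ^+ k)^-1)%:E < +oo)%E.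
Proof.
move=> Nk; have [W W0 HW] := jbr_fl_int Nk; have [/integrableP[_]] := HW X.
have g0 (x : 'rV[R]_N) : 0 <= (jbr (X - x) ^+ k)^-1 by rewrite invr_ge0 jbrX_ge0.
under eq_integral do rewrite /= ger0_norm //.
by rewrite (@ge0_esum_int _ _ b ub 1%:M u1 (fun x => (jbr (X - x) ^+ k)^-1) g0) cvol1 mul1e.
Qed.

Lemma csummable_dec (f : fn N) M X k : (N + N <= k)%N ->
  (forall x, normc (f x) <= M * (jbr (X - x) ^+ k)^-1) -> csummable L f.
Proof.
move=> Nk Hf; rewrite /csummable /summable.
apply: (@le_lt_trans _ _ (\esum_(x in L) (`|M|%:E * ((jbr (X - x) ^+ k)^-1)%:E))%E).
  apply: le_esum => x _; rewrite lee_fin ger0_norm ?normc_ge0 //.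
  by apply: (le_trans (Hf x)); rewrite ler_wpM2r ?invr_ge0 ?jbrX_ge0 // ler_norm.
have g0 (x : 'rV[R]_N) : 0 <= (jbr (X - x) ^+ k)^-1 by rewrite invr_ge0 jbrX_ge0.
have g0' (x : 'rV[R]_N) : 0 <= `|M| * (jbr (X - x) ^+ k)^-1 by rewrite mulr_ge0.
rewrite -[X in (X < _)%E]mul1e -(@cvol1 R N) //.
rewrite -(@ge0_esum_int _ _ b ub 1%:M u1 (fun x => `|M| * (jbr (X - x) ^+ k)^-1) g0').
have [W W0 HW] := jbr_fl_int Nk; have [+ _] := HW X.
move=> /(rintZ `|M|) /integrableP[_]; apply: le_lt_trans.
apply: ge0_le_integral => //.
- by move=> t _; rewrite lee_fin.
- by apply/measurable_EFinP; exact: (@rmeasurable_fl _ _ b 1%:M (fun x => `|M| * (jbr (X - x) ^+ k)^-1)).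
- apply/measurable_EFinP; apply: measurableT_comp => //.
  exact: (@rmeasurable_fl _ _ b 1%:M (fun x => `|M| * (jbr (X - x) ^+ k)^-1)).
by move=> t _; rewrite lee_fin ler_norm.
Qed.

Lemma partition_int (chi : fn N) x : partition_unity L chi ->
  cintegral (fun t => chi (x - fl1 t)) = 1.
Proof.
move=> [sc Hc]; have [M M0 HM] := Brd_dec (N + N) (schw_Brd sc).
have cs : csummable L (fun g => chi (x - g)) by apply: (@csummable_dec _ M x (N + N)).
have [_ ->] := csum_cintegral ub u1 cs.
by rewrite Hc cvol1 mulr1.
Qed.
End LatticeDecay.

(** * Admissible Banach spaces *)

Section BanachLattice.
Variable R : realType.
Local Notation C := R[i].
Local Notation fn N := ('rV[R]_N -> C).

Lemma ge0_ReC (z : C) : 0 <= z -> z = (complex.Re z)%:C.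
Proof. by case: z => a c; rewrite lecE /= => /andP[/eqP -> _]. Qed.

(** Norms take values in the nonnegative complex numbers; this is the corresponding real
    number. *)
Definition bnorm (B : completeNormedModType C) (v : B) : R := complex.Re `|v|.

Lemma bnormE (B : completeNormedModType C) (v : B) : `|v| = (bnorm v)%:C.
Proof. exact: ge0_ReC. Qed.

Lemma bnorm_ge0 (B : completeNormedModType C) (v : B) : 0 <= bnorm v.
Proof. by have := normr_ge0 v; rewrite bnormE lecR. Qed.

Variables (N : nat) (b : 'M[R]_N) (B : banach_fun_space R 'rV[R]_N).
Hypothesis ub : b \in unitmx.
Let L := [set map_mx intr z *m b | z in [set: 'rV[int]_N]].
Hypothesis adm : admissible L B.

Lemma bfs0 x : bfs_fun (0 : B) x = 0.
Proof.
have := bfs_linear 1 (0 : B) 0 x; rewrite scaler0 addr0 mul1r => h.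
by apply: (addIr (bfs_fun (0 : B) x)); rewrite add0r -h.
Qed.

Lemma bfsD (u v : B) x : bfs_fun (u + v) x = bfs_fun u x + bfs_fun v x.
Proof. by have := bfs_linear 1 u v x; rewrite scale1r mul1r. Qed.

Lemma bfsZ a (u : B) x : bfs_fun (a *: u) x = a * bfs_fun u x.
Proof. by have := bfs_linear a u 0 x; rewrite addr0 bfs0 addr0. Qed.

Lemma bfs_sum I r (F : I -> B) x : bfs_fun (\sum_(i <- r) F i) x = \sum_(i <- r) bfs_fun (F i) x.
Proof. by elim: r => [|i r IH]; rewrite ?big_nil ?bfs0 // !big_cons bfsD IH. Qed.

(** Solidity makes the evaluation at a point of the lattice continuous. *)
Lemma bfs_eval g : L g -> exists2 K, 0 <= K & forall v : B, normc (bfs_fun v g) <= K * bnorm v.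
Proof.
move=> Lg; have [_ _ /(_ _ Lg)[d dE] [K HK]] := adm.
have d0 : 0 < bnorm d.
  rewrite lt_neqAle bnorm_ge0 andbT eq_sym; apply/eqP => h.
  have : `|d| = 0 by rewrite bnormE h.
  move/eqP; rewrite normr_eq0 => /eqP d0.
  by have := congr1 (fun f => f g) dE; rewrite /= d0 bfs0 eqxx => /eqP; rewrite eq_sym oner_eq0.
exists (`|K| / bnorm d) => [|v]; first by rewrite divr_ge0 // ltW.
have [|v' v'E nv'] := HK v (fun x => bfs_fun v g * (x == g)%:R).
  move=> x; case: eqP => [->|_]; first by rewrite mulr1.
  by rewrite mulr0 normc0 normc_ge0.
have e : v' = bfs_fun v g *: d by apply: bfs_inj; rewrite v'E; apply/funext => x; rewrite bfsZ dE.
move: nv'; rewrite e normrZ !bnormE.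
have -> : `|bfs_fun v g| = (normc (bfs_fun v g))%:C by [].
rewrite -!rmorphM lecR => h; rewrite mulrAC ler_pdivlMr //; apply: (le_trans h).
by rewrite ler_wpM2r ?bnorm_ge0 // ler_norm.
Qed.

(** Convolution by a summable weight stays in the space: translates of [|u|] are
    summed in norm. *)
Lemma bfs_convolution (u : B) k : (N + N <= k)%N -> exists w : B, forall g, L g ->
  let f t := normc (bfs_fun u (fl b 1%:M t)) * (jbr (fl b 1%:M t - g) ^+ k)^-1 in
  rint f /\ rI f <= normc (bfs_fun w g).
Proof.
move=> Nk; have [off trans _ [K HK]] := adm.
have [|v0 v0E _] := HK u (fun x => (normc (bfs_fun u x))%:C).
  by move=> x; rewrite normcR ger0_norm ?normc_ge0.
have tr z : exists2 v : B, bfs_fun v = (fun x => bfs_fun v0 (x - lat b z)) & `|v| = `|v0|.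
  by apply: trans; exact: lat_in.
pose V z := projT1 (cid2 (tr z)).
have VE z : bfs_fun (V z) = (fun x => (normc (bfs_fun u (x - lat b z)))%:C).
  by rewrite /V; case: cid2 => v /= -> _; rewrite v0E.
have Vn z : `|V z| = `|v0| by rewrite /V; case: cid2.
pose w z : R := (jbr (lat b z) ^+ k)^-1.
have w0 z : 0 <= w z by rewrite invr_ge0 jbrX_ge0.
pose a (i : nat) : R := if pickle_inv i is Some z then w z else 0.
have a0 i : 0 <= a i by rewrite /a; case: pickle_inv.
pose s (i : nat) : B := if pickle_inv i is Some z then (w z)%:C *: V z else 0.
have sn i : `|s i| = (a i * bnorm v0)%:C.
  rewrite /s /a; case: pickle_inv => [z|]; last by rewrite normr0 mul0r.
  rewrite normrZ Vn bnormE rmorphM; congr (_ * _).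
  by have -> : `|(w z)%:C : C| = (normc (w z)%:C)%:C by []; rewrite normcR ger0_norm.
have aS : (\sum_(0 <= i <oo) (a i)%:E < +oo)%E.
  have := esum_jbr ub 0 Nk; rewrite esum_lat //.
  under eq_esum do rewrite sub0r jbrN.
  rewrite (@esum_pickle _ _ w w0); congr (_ < _)%E.
  by apply: eq_eseriesr => i _; rewrite /a; case: pickle_inv.
have ca : cvgn (series a).
  apply: nondecreasing_is_cvgn.
    move=> m n mn; rewrite /series /= (big_cat_nat _ mn) //= lerDl.
    by apply: sumr_ge0.
  exists (fine (\sum_(0 <= i <oo) (a i)%:E)%E) => _ [n _ <-].
  rewrite -lee_fin fineK; last by rewrite ge0_fin_numE // nneseries_ge0 // => i _ _; rewrite lee_fin.
  rewrite /series /= -sumEFin; apply: nneseries_lim_ge => i _ _.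
  by rewrite lee_fin.
have cs : cvgn (series s).
  apply/cauchy_cvgP/cauchy_seriesP => e e0.
  have eR : e = (complex.Re e)%:C by apply: ge0_ReC; exact: ltW.
  have e'0 : 0 < complex.Re e by move: e0; rewrite eR ltcR.
  have b1 : 0 < bnorm v0 + 1 by rewrite ltr_wpDl // bnorm_ge0.
  have /cauchy_cvgP/cauchy_seriesP/(_ _ (divr_gt0 e'0 b1)) := ca.
  apply: filterS => n /= h.
  apply: (le_lt_trans (ler_norm_sum _ _ _)).
  under eq_bigr do rewrite sn.
  rewrite eR -rmorph_sum ltcR -mulr_suml.
  move: h; rewrite ger0_norm ?sumr_ge0 // ltr_pdivlMr // => h.
  apply: le_lt_trans h; rewrite ler_wpM2l ?sumr_ge0 //; lra.
pose W := lim (series s @ \oo).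
have cW : series s @ \oo --> W by [].
exists W => g Lg f.
have Sg n : bfs_fun (series s n) g = (\sum_(0 <= i < n) (if pickle_inv i is Some z then w z * normc (bfs_fun u (g - lat b z)) else 0))%:C.
  rewrite /series /= bfs_sum rmorph_sum; apply: eq_bigr => i _.
  rewrite /s; case: pickle_inv => [z|]; last by rewrite bfs0.
  by rewrite bfsZ VE rmorphM.
have [Kg Kg0 HKg] := bfs_eval Lg.
have part n : \sum_(0 <= i < n) (if pickle_inv i is Some z then w z * normc (bfs_fun u (g - lat b z)) else 0) <= normc (bfs_fun W g).
  set p := \sum_(0 <= i < n) _.
  have p0 (i : nat) : 0 <= (if pickle_inv i is Some z then w z * normc (bfs_fun u (g - lat b z)) else 0).
    by case: pickle_inv => // z; rewrite mulr_ge0 ?normc_ge0.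
  rewrite leNgt; apply/negP => lt.
  pose e := (p - normc (bfs_fun W g)) / (Kg + 1).
  have K1 : 0 < Kg + 1 by rewrite ltr_wpDl.
  have e0 : 0 < e by rewrite divr_gt0 // subr_gt0.
  have e0C : 0 < e%:C by rewrite ltcR.
  have := cW => /cvgrPdist_lt /(_ _ e0C) [M _ HM].
  have := HM (maxn M n) (leq_maxl _ _); rewrite bnormE ltcR.
  set m := maxn M n => hm.
  have pm : p <= normc (bfs_fun (series s m) g).
    rewrite Sg normcR ger0_norm; last by apply: sumr_ge0 => i _.
    rewrite /p [leRHS](@big_cat_nat _ _ _ n) //= ?leq_maxr //.
    by rewrite lerDl; apply: sumr_ge0 => i _.
  have h1 : normc (bfs_fun (series s m) g) <= normc (bfs_fun W g) + Kg * bnorm (W - series s m).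
    apply: le_trans (lerD (lexx _) (HKg _)).
    have -> : bfs_fun (series s m) g = bfs_fun W g - bfs_fun (W - series s m) g.
      have -> : W - series s m = (-1) *: series s m + W by rewrite scaleN1r addrC.
      by rewrite bfsD bfsZ mulN1r opprD opprK addrC subrK.
    exact: normcB.
  have h2 : Kg * bnorm (W - series s m) <= Kg * e by rewrite ler_wpM2l // ltW.
  have : p <= normc (bfs_fun W g) + Kg * e by lra.
  rewrite -lerBlDl -[leLHS](divfK (lt0r_neq0 K1)) -/e; nra.
have f0 x : 0 <= normc (bfs_fun u x) * (jbr (x - g) ^+ k)^-1 by rewrite mulr_ge0 ?normc_ge0 // invr_ge0 jbrX_ge0.
have E : (\esum_(x in L) (normc (bfs_fun u x) * (jbr (x - g) ^+ k)^-1)%:E <= (normc (bfs_fun W g))%:E)%E.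
  rewrite (@reindex_esum _ _ _ L _ (fun y => g - y)); last first.
    have Lsub x : L x -> L (g - x).
      case: Lg => zg _ <- [zx _ <-]; exists (zg - zx) => //.
      by rewrite -mulmxBl; congr (_ *m _); apply/rowP => i; rewrite !mxE intrB.
    split; first by move=> x Lx; exact: Lsub.
      by move=> x y _ _ /addrI /oppr_inj.
    by move=> y Ly; exists (g - y); [exact: Lsub|rewrite opprB addrC subrK].
  rewrite esum_lat //.
  rewrite (eq_esum (b := fun z => (w z * normc (bfs_fun u (g - lat b z)))%:E)); last first.
    by move=> z _; rewrite addrAC subrr add0r jbrN mulrC.
  rewrite esum_pickle; last by move=> z; rewrite mulr_ge0 ?normc_ge0.
  apply: lime_le.
    by apply: is_cvg_nneseries => i _ _; case: pickle_inv => // z; rewrite lee_fin mulr_ge0 ?normc_ge0.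
  apply: nearW => n; have := part n; rewrite -lee_fin -sumEFin; apply: le_trans.
  by rewrite le_eqVlt; apply/orP; left; apply/eqP; apply: eq_bigr => i _; case: pickle_inv.
have [|i1 I1] := @ge0_rsum _ _ _ ub 1%:M (unitmx1 _ _) _ f0; first exact: (le_lt_trans E (ltry _)).
split; first exact: i1.
rewrite I1 cvol1 mul1r -[leRHS]/(fine (normc (bfs_fun W g))%:E); apply: fine_le => //.
by rewrite ge0_fin_numE ?(le_lt_trans E (ltry _)) // esum_ge0 // => x _; rewrite lee_fin.
Qed.
End BanachLattice.

(** * Weyl kernels in phase space *)

Section WeylKernel.
Variable R : realType.
Local Notation C := R[i].
Local Notation fn N := ('rV[R]_N -> C).

Definition swapmx k : 'M[R]_(k + k) := block_mx 0 1%:M 1%:M 0.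

Lemma mul_swapmx k (x y : 'rV[R]_k) : row_mx x y *m swapmx k = row_mx y x.
Proof. by rewrite /swapmx mul_row_block !mulmx1 !mulmx0 addr0 add0r. Qed.

Lemma swapmx_unit k : swapmx k \in unitmx.
Proof.
suff /mulmx1_unit[] : swapmx k *m swapmx k = 1%:M by [].
apply/row_matrixP => i; rewrite [LHS]rowE [RHS]rowE mulmxA mulmx1.
by set e := delta_mx 0 i; rewrite -(hsubmxK e) !mul_swapmx.
Qed.

Lemma schw_slicel k (F : fn (k + k)) y : schwartz F -> schwartz (fun x : 'rV[R]_k => F (row_mx x y)).
Proof.
move=> sF; have := schw_slice_joint y (schw_mid (swapmx_unit k) sF); congr schwartz.
by apply/funext => x; rewrite mul_swapmx.
Qed.

Lemma schw_cintegral_family k (F : fn (k + k)) : schwartz F ->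
  schwartz (fun x : 'rV[R]_k => cintegral (fun y => F (row_mx x y))).
Proof.
move=> sF; have := schw_slicel 0 (schw_pft sF); congr schwartz.
apply/funext => x; rewrite fhat_pft; apply: eq_cintegral => y.
by rewrite dotmx0l cis0 mul1r.
Qed.

Lemma schw_Bsf a b (F : fn (a + b)) : schwartz F -> sm (@Bsf R a b) F.
Proof.
move/schwartzP; apply: sm_sub => f Bf k; have [M HM] := Bf k; exists M, 0%N => x y.
rewrite expr0 mulr1; apply: le_trans (HM (row_mx x y)).
rewrite ler_wpM2r ?normc_ge0 // lerXn2r ?nnegrE ?jbr_ge0 //; exact: jbr_row_mxr.
Qed.

(** As a partial Fourier transform of the symbol, composed with a linear change of
    variables, the Weyl kernel is visibly a Schwartz function of both variables. *)
Definition wker k (b : fn (k + k)) : fn (k + k) := fun z =>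
  ((2 * pi) ^- k)%:C * pft b (z *m unmidmx R k).

Lemma wkerE k (b : fn (k + k)) x y : wker b (row_mx x y) = weyl_kernel b x y.
Proof.
by rewrite /wker mul_unmidmx /weyl_kernel /pft row_mxKl row_mxKr.
Qed.

Lemma schw_wker k (b : fn (k + k)) : schwartz b -> schwartz (wker b).
Proof.
by move=> sb; apply: schw_scale; apply: schw_mid; [exact: unmidmx_unit|exact: schw_pft].
Qed.

(** Covariance of the Weyl quantization under phase space translations. *)
Lemma weyl_kernel_shift k (b : fn (k + k)) be x y : schwartz b ->
  weyl_kernel (fun r => b (r - be)) x y =
  cis (dotmx (x - y) (rsubmx be)) * weyl_kernel b (x - lsubmx be) (y - lsubmx be).
Proof.
move=> sb; rewrite /weyl_kernel mulrCA; congr (_ * _).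
have -> : x - lsubmx be - (y - lsubmx be) = x - y by rewrite opprB addrA subrK.
set d := x - y; set m := 2^-1 *: (x - lsubmx be + (y - lsubmx be)).
have mE : m = 2^-1 *: (x + y) - lsubmx be.
  by apply/rowP => i; rewrite !mxE; lra.
have sI : schwartz (fun th => cis (dotmx d th) * b (row_mx m th)).
  by apply: schw_fhat_integrand; exact: schw_slice_joint.
transitivity (cintegral (fun th => cis (dotmx d (rsubmx be)) * (fun th => cis (dotmx d th) * b (row_mx m th)) (th - rsubmx be))).
  apply: eq_cintegral => th; rewrite -/(cis _) dotmxBr mulrA -cisD.
  rewrite addrCA subrr addr0; congr (_ * b _).
  by rewrite mE -{1}(hsubmxK be) opp_row_mx add_row_mx.
rewrite cintegralZ; last exact: (cintegrable_shift _ (schw_cintegrable sI)).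
rewrite (cintegral_shift _ (schw_cintegrable sI)).
by [].
Qed.

(** A phase space translation permutes the packets up to unimodular factors. *)
Lemma ip_wp_cov N (f G : fn N) p w X : schwartz f -> schwartz G ->
  normc (ip (fun y => cis (- dotmx y w) * f (y - p)) (wp G X)) =
  normc (ip f (wp G (X - row_mx p w))).
Proof.
move=> sf sG; pose h y := f y * conjc (wp G (X - row_mx p w) y).
have sh : schwartz h by apply: schw_mul => //; apply: schw_conj; exact: wp_schw.
have -> : ip (fun y => cis (- dotmx y w) * f (y - p)) (wp G X) =
    cis (- dotmx (lsubmx X) w) * ip f (wp G (X - row_mx p w)).
  rewrite /ip -/h -(@cintegral_shift _ _ h (- p)); last exact: schw_cintegrable.
  rewrite -cintegralZ; last by apply: cintegrable_shift; exact: schw_cintegrable.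
  apply: eq_cintegral => y; rewrite /h !conj_wp.
  have e1 : lsubmx (X - row_mx p w) = lsubmx X - p by rewrite linearB /= row_mxKl.
  have e2 : rsubmx (X - row_mx p w) = rsubmx X - w by rewrite linearB /= row_mxKr.
  rewrite e1 e2 opprB addrA subrK dotmxBr cisD (dotmxBl y (lsubmx X) w) opprB cisD.
  transitivity ((cis (- dotmx (lsubmx X) w) * cis (dotmx (lsubmx X) w)) * (cis (- dotmx y w) * f (y - p) *
    (conjc (G (y - lsubmx X)) * cis (dotmx (y - lsubmx X) (rsubmx X))))); last by ring.
  by rewrite -cisD addNr cis0 mul1r.
by rewrite normcM normc_cis mul1r.
Qed.

End WeylKernel.

Section PhaseSpaceKernel.
Variable R : realType.
Local Notation C := R[i].
Local Notation fn N := ('rV[R]_N -> C).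

(** Fubini for an integrand that is a step function of the first variable and continuous in
    the second: an exchange of a lattice sum with an integral. *)
Lemma ccont_fubini_fl a b (B : 'M[R]_a) (h : 'rV[R]_a -> 'rV[R]_b -> C) (g1 : 'rV[R]_a -> R)
    (g2 : 'rV[R]_b -> R) (P : fn a) (Q : fn b) :
  rint g1 -> rint g2 -> (forall x, ccont (h x)) ->
  (forall x y, normc (h (fl B 1%:M x) y) <= g1 x * g2 y) ->
  (forall x, cintegral (h (fl B 1%:M x)) = P x) ->
  (forall y, cintegral (fun x => h (fl B 1%:M x) y) = Q y) ->
  cintegral P = cintegral Q.
Proof.
move=> i1 i2 ch Hh HP HQ.
pose F (Z : 'rV[R]_(a + b)) := h (fl B 1%:M (lsubmx Z)) (rsubmx Z).
have mreal (w : 'rV[int]_a -> 'rV[R]_b -> R) : (forall z, continuous (w z)) ->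
    rmeasurable (fun Z : 'rV[R]_(a + b) => w (cell 1%:M (lsubmx Z)) (rsubmx Z)).
  move=> cw _ Y mY; rewrite setTI.
  have -> : (fun t => w (cell 1%:M (lsubmx (row_of_tup t : 'rV[R]_(a + b)))) (rsubmx (row_of_tup t))) @^-1` Y =
    \bigcup_z ([set t | cell 1%:M (lsubmx (row_of_tup t : 'rV[R]_(a + b))) = z] `&`
      (fun t => w z (rsubmx (row_of_tup t : 'rV[R]_(a + b)))) @^-1` Y).
    apply/seteqP; split => [t Yt|t [z _] [/= <-]//].
    by exists (cell 1%:M (lsubmx (row_of_tup t : 'rV[R]_(a + b)))).
  apply: countable_bigcupT_measurable => [|z]; first exact: countableP.
  apply: measurableI.
    pose v (z' : 'rV[int]_a) : R := (z' == z)%:R.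
    have := @measurable_floor_row R (a + b) a (fun i t => (row_of_tup t *m selL R a b) 0 i) v.
    have -> : (fun t => v (\row_i Num.floor ((row_of_tup t *m selL R a b) 0 i))) =
              (fun t => v (cell 1%:M (lsubmx (row_of_tup t : 'rV[R]_(a + b))))).
      by apply/funext => t; congr v; apply/rowP => i; rewrite mxE [RHS]mxE mulmx1 mul_selL.
    have mm i : measurable_fun setT (fun t : (a + b).-tuple (measurableTypeR R) => (row_of_tup t *m selL R a b) 0 i).
      apply: (@continuous_rmeasurable R (a + b) (fun z => (z *m selL R a b) 0 i)).
      by apply: (@cont_comp _ _ _ (fun z : 'rV[R]_(a + b) => z *m selL R a b) (fun z : 'rV[R]_a => z 0 i)); [exact: cont_mulmx|exact: continuous_coord].
    move=> /(_ mm) => /(_ measurableT [set 1] (measurable_set1 _)); rewrite setTI; congr measurable.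
    apply/seteqP; split => t /=; rewrite /v.
      by case: eqP => // _ /eqP; rewrite eq_sym oner_eq0.
    by move=> ->; rewrite eqxx.
  have cz : continuous (fun Z : 'rV[R]_(a + b) => w z (rsubmx Z)).
    by apply: (@cont_comp _ _ _ _ (w z)); [exact: cont_rsubmx|exact: cw].
  by have := continuous_rmeasurable cz measurableT mY; rewrite setTI.
have mF : cmeasurable F.
  by split; [apply: (mreal (fun z y => complex.Re (h (lat B z) y)))|apply: (mreal (fun z y => complex.Im (h (lat B z) y)))] => z; case: (ch (lat B z)).
have FE x y : F (row_mx x y) = h (fl B 1%:M x) y by rewrite /F row_mxKl row_mxKr.
rewrite (_ : P = fun x => cintegral (fun y => F (row_mx x y))); last first.
  by apply/funext => x; rewrite -HP; apply: eq_cintegral => y; rewrite FE.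
rewrite (_ : Q = fun y => cintegral (fun x => F (row_mx x y))); last first.
  by apply/funext => y; rewrite -HQ; apply: eq_cintegral => x; rewrite FE.
by apply: (@cintegral_fubini R a b g1 g2 i1 i2 F mF) => x y; rewrite FE.
Qed.

Variables (k : nat) (G : fn k).
Hypothesis sG : schwartz G.

(** The wave packet on R^(k + k) with profile [pairw] at [paircentre X Z] is the
    conjugate of the tensor product of a packet at X and a conjugate packet at Z. *)
Definition pairw : fn (k + k) := fun z => conjc (G (lsubmx z)) * G (rsubmx z).
Definition paircentre (X Z : 'rV[R]_(k + k)) : 'rV[R]_((k + k) + (k + k)) :=
  row_mx (row_mx (lsubmx X) (lsubmx Z)) (row_mx (- rsubmx X) (rsubmx Z)).

Lemma schw_pairw : schwartz pairw.
Proof. exact: (schw_tensor (schw_conj sG) sG). Qed.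

Lemma conj_wp_pair X Z y y' :
  conjc (wp pairw (paircentre X Z) (row_mx y y')) = wp G X y * conjc (wp G Z y').
Proof.
rewrite !conj_wp /paircentre !row_mxKl !row_mxKr opp_row_mx add_row_mx.
rewrite /pairw row_mxKl row_mxKr dotmx_row_mx cisD dotmxNr conjcME conjcK /wp; ring.
Qed.

Lemma jbr_paircentre X Z : jbr X <= jbr (paircentre X Z) /\ jbr Z <= jbr (paircentre X Z).
Proof.
have dd N (x : 'rV[R]_N) : 0 <= dotmx x x by apply: sumr_ge0 => i _; rewrite -expr2 sqr_ge0.
have E : dotmx (paircentre X Z) (paircentre X Z) = dotmx X X + dotmx Z Z.
  have dX (Y : 'rV[R]_(k + k)) : dotmx Y Y = dotmx (lsubmx Y) (lsubmx Y) + dotmx (rsubmx Y) (rsubmx Y).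
    by rewrite -{1 2}(hsubmxK Y) dotmx_row_mx.
  rewrite (dX X) (dX Z) /paircentre !dotmx_row_mx dotmxNl dotmxNr opprK; ring.
by rewrite /jbr !ler_sqrt ?addr_ge0 ?dd // E; split; rewrite lerD2l ?lerDl ?lerDr dd.
Qed.

Lemma paircentreB X Z be : paircentre (X - be) (Z - be) =
  paircentre X Z - row_mx (row_mx (lsubmx be) (lsubmx be)) (row_mx (- rsubmx be) (rsubmx be)).
Proof.
by rewrite /paircentre !opp_row_mx !add_row_mx; congr (row_mx (row_mx _ _) (row_mx _ _)); rewrite linearB // opprB opprK addrC.
Qed.

Variable chi : fn (k + k).
Hypothesis sc : schwartz chi.
Let chis be : fn (k + k) := fun r => chi (r - be).

Lemma schw_chis be : schwartz (chis be).
Proof. exact: schw_shift. Qed.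

(** The matrix element of the Weyl operator of [chi (r - be)] between the packets at [X] and
    [Z]. As the pairing of a Schwartz kernel with one packet of the doubled phase space
    it decreases rapidly by [stft_decay]. *)
Definition Hker be X Z : C := ip (wker (chis be)) (wp pairw (paircentre X Z)).

(** By covariance it is enough to treat [be = 0]; uniformity in [be] comes for free. *)
Lemma Hker_decay L : exists2 M, 0 <= M & forall be X Z,
  normc (Hker be X Z) <= M * (jbr (X - be) ^+ L)^-1 * (jbr (Z - be) ^+ L)^-1.
Proof.
have [K [M [M0 HM]]] := stft_decay schw_pairw (L + L).
have sw := schw_wker sc; have n0 := schwartz_norm_ge0 K sw.
exists (M * schwartz_norm K (wker chi)) => [|be X Z]; first exact: mulr_ge0.
pose p := row_mx (lsubmx be) (lsubmx be); pose w := row_mx (- rsubmx be) (rsubmx be).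
have -> : Hker be X Z = ip (fun z => cis (- dotmx z w) * wker chi (z - p)) (wp pairw (paircentre X Z)).
  apply: eq_cintegral => z; congr (_ * _); rewrite -(hsubmxK z) wkerE (weyl_kernel_shift be _ _ sc).
  rewrite -wkerE /p opp_row_mx add_row_mx; congr (cis _ * _).
  by rewrite /w dotmx_row_mx dotmxNr dotmxBl opprD opprK.
rewrite ip_wp_cov //; last exact: schw_pairw.
rewrite -paircentreB; set W := paircentre _ _.
have [h1 h2] := jbr_paircentre (X - be) (Z - be).
rewrite -mulrA -invfM ler_pdivlMr ?mulr_gt0 ?jbrX_gt0 //.
apply: le_trans (HM _ W sw); rewrite ler_wpM2l ?normc_ge0 // exprD.
by rewrite ler_pM ?jbrX_ge0 // lerXn2r ?nnegrE ?jbr_ge0.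
Qed.

Let S X Z : fn (k + k) := fun z => wp G X (lsubmx z) * conjc (wp G Z (rsubmx z)).

Let sS X Z : schwartz (S X Z).
Proof. exact: (schw_tensor (wp_schw X sG) (schw_conj (wp_schw Z sG))). Qed.

Lemma HkerE be X Z : Hker be X Z = ((2 * pi) ^- k)%:C * cintegral (fun r => chi (r - be) * Wig (S X Z) r).
Proof.
rewrite -(weyl_wigner (schw_chis be) (sS X Z)) /Hker /ip cintegral_split_schw; last first.
  by apply: schw_mul; [apply: schw_wker; exact: schw_chis|apply: schw_conj; apply: wp_schw; exact: schw_pairw].
apply: eq_cintegral => y; apply: eq_cintegral => y'.
by rewrite conj_wp_pair wkerE /S row_mxKl row_mxKr.
Qed.
End PhaseSpaceKernel.

(** * Expansion of a distribution over the lattice *)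

Section LatticeExpansion.
Variable R : realType.
Local Notation C := R[i].
Local Notation fn N := ('rV[R]_N -> C).
Variables (k : nat) (G : fn k) (chi : fn (k + k)) (b : 'M[R]_(k + k)).
Hypotheses (sG : schwartz G) (ub : b \in unitmx).
Let L := [set map_mx intr z *m b | z in [set: 'rV[int]_(k + k)]].
Hypothesis pu : partition_unity L chi.
Let sc : schwartz chi. Proof. by case: pu. Qed.
Local Notation H := (Hker G chi).
Local Notation fl1 := (fl b 1%:M).

(** The factor by which the localized Weyl operators sum to a multiple of the identity, equal
    to 1 since [kap] is (2 pi)^k. *)
Definition kap2 : C := ((2 * pi) ^- k)%:C * kap R k.

Lemma kap2_neq0 : kap2 != 0.
Proof.
rewrite mulf_neq0 ?kap_neq0 // -normc_eq0 normcR normr_eq0 invr_neq0 //.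
by rewrite expf_neq0 // mulf_neq0 // gt_eqF // pi_gt0.
Qed.

Let S X Z : fn (k + k) := fun z => wp G X (lsubmx z) * conjc (wp G Z (rsubmx z)).
Let sS X Z : schwartz (S X Z).
Proof. exact: (schw_tensor (wp_schw X sG) (schw_conj (wp_schw Z sG))). Qed.

Lemma partition_cintegrable r : cintegrable (fun t => chi (r - fl1 t)).
Proof.
have [M M0 HM] := Brd_dec ((k + k) + (k + k)) (schw_Brd sc).
have cs : csummable L (fun g => chi (r - g)) by apply: (@csummable_dec _ _ _ ub _ M r ((k + k) + (k + k))).
by have [] := csum_cintegral ub (unitmx1 _ _) cs.
Qed.

Lemma schw_mull (w : fn k) (F : fn (k + k)) : schwartz w -> schwartz F ->
  schwartz (fun z => w (lsubmx z) * F z).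
Proof.
move=> sw sF; apply: schw_mul_poly => //.
have := sm_poly_aff (selL R k k) 0 (schw_poly sw); congr sm; apply/funext => z.
by rewrite addr0 mul_selL.
Qed.

Lemma schw_mulr (w : fn k) (F : fn (k + k)) : schwartz w -> schwartz F ->
  schwartz (fun z => F z * w (rsubmx z)).
Proof.
move=> sw sF; apply: schw_poly_mul => //.
have := sm_poly_aff (selR R k k) 0 (schw_poly sw); congr sm; apply/funext => z.
by rewrite addr0 mul_selR.
Qed.

(** The localized symbols add up to 1, whose Weyl quantization is the identity. *)
Lemma Hker_sum X Z : cintegral (fun t => H (fl1 t) X Z) = kap2 * ip (wp G X) (wp G Z).
Proof.
pose l := ((k + k) + (k + k))%N.
have [M M0 HM] := Brd_dec l (schw_Brd sc).
have [W W0 HW] := jbr_fl_int ub (leqnn l).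
have sW := schw_Wig (sS X Z).
have := @cintegral_Wig _ _ (S X Z) (sS X Z).
have -> : cintegral (fun p => S X Z (row_mx p p)) = ip (wp G X) (wp G Z).
  by apply: eq_cintegral => p; rewrite /S row_mxKl row_mxKr.
move=> E; rewrite /kap2 -mulrA -E -cintegralZ; last exact: schw_cintegrable.
have HE be : H be X Z = ((2 * pi) ^- k)%:C * cintegral (fun r => chi (r - be) * Wig (S X Z) r) by exact: HkerE.
move: (((2 * pi) ^- k)%:C) HE => c0 HE.
pose g (r : 'rV[R]_(k + k)) := normc c0 * (M * 2 ^+ l * (jbr r ^+ l * normc (Wig (S X Z) r))).
apply: (@ccont_fubini_fl _ _ _ b (fun be r => c0 * (chi (r - be) * Wig (S X Z) r))
   (fun t => (jbr (0 - fl1 t) ^+ l)^-1) g).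
- by case: (HW 0).
- apply: rintZ; apply: rintZ.
  have [K K0 HK] := Brd_dec (l + l) (schw_Brd sW).
  apply: (@rint_dom _ _ _ (fun r => K * (jbr r ^+ l)^-1)).
  + apply: continuous_rmeasurable; apply: cont_mul.
      by apply: cont_exp; exact: continuous_jbr.
    by apply: cont_normc; exact: schw_ccont.
  + by apply: rintZ; exact: rint_jbr.
  move=> r; rewrite ger0_norm ?mulr_ge0 ?jbrX_ge0 ?normc_ge0 // mulrC -ler_pdivlMr ?jbrX_gt0 //.
  by apply: (le_trans (HK r)); rewrite exprD invfM mulrA.
- move=> be; apply: ccont_mul; first exact: ccont_cst.
  by apply: ccont_mul; apply: schw_ccont => //; exact: schw_shift.
- move=> t r; rewrite normcM normcM.
  have -> : (jbr (0 - fl1 t) ^+ l)^-1 * g r = normc c0 * ((M * (2 ^+ l * jbr r ^+ l * (jbr (0 - fl1 t) ^+ l)^-1)) * normc (Wig (S X Z) r)).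
    by rewrite /g; ring.
  rewrite ler_wpM2l ?normc_ge0 // ler_wpM2r ?normc_ge0 //.
  by apply: (le_trans (HM _)); rewrite ler_wpM2l //; exact: jbr_fl_shift.
- move=> t; rewrite HE cintegralZ //; apply: schw_cintegrable.
  by apply: schw_mul => //; exact: schw_shift.
move=> r; have ir := partition_cintegrable r.
rewrite cintegralZ; last first.
  have := cintegrableZ (Wig (S X Z) r) ir; congr cintegrable.
  by apply/funext => t; rewrite mulrC.
by congr (_ * _); rewrite cintegralZr // partition_int // mul1r.
Qed.

Variable a : fn k -> C.
Hypothesis ta : tempered a.

Definition Tpair be X : C :=
  cintegral (fun y => weyl_apply (fun r => chi (r - be)) a y * wp G X y).

(** The adjoint of the localized operator is moved onto the packet, and the distribution is
    then evaluated through its own packets. *)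
Lemma TpairE be X : kap R k * ip G G * Tpair be X = cintegral (fun Z => H be X Z * a (wp G Z)).
Proof.
have sw : schwartz (wker (fun r => chi (r - be))) by apply: schw_wker; exact: schw_shift.
pose g y' := cintegral (fun y => wp G X y * wker (fun r => chi (r - be)) (row_mx y y')).
have sX := wp_schw X sG.
pose Q (z : 'rV[R]_(k + k)) := wp G X (lsubmx z) * wker (fun r => chi (r - be)) z.
have sQ : schwartz Q by exact: schw_mull.
have sg : schwartz g.
  have e : g = fun x => cintegral (fun y => Q (row_mx x y *m swapmx R k)).
    by apply/funext => y'; apply: eq_cintegral => y; rewrite mul_swapmx /Q row_mxKl.
  rewrite e; exact: (schw_cintegral_family (schw_mid (swapmx_unit R k) sQ)).
have gT : a g = Tpair be X.
  rewrite (temp_exchange (schw_ccont sX) (schw_Brd sX) (schw_Bsf sw) (fun y' => erefl (g y')) ta sg).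
  apply: eq_cintegral => y.
  have -> : (fun y' => wker (fun r => chi (r - be)) (row_mx y y')) = weyl_kernel (fun r => chi (r - be)) y.
    by apply/funext => y'; rewrite wkerE.
  exact: mulrC.
rewrite -gT (temp_resolution sG ta sg); apply: eq_cintegral => Z; congr (_ * _).
rewrite /Hker /ip cintegral_split_schw; last first.
  by apply: schw_mul => //; apply: schw_conj; apply: wp_schw; exact: schw_pairw.
have sQc : schwartz (fun z => Q z * conjc (wp G Z (rsubmx z))).
  exact: (schw_mulr (schw_conj (wp_schw Z sG)) sQ).
transitivity (cintegral (fun y' => cintegral (fun y => Q (row_mx y y') * conjc (wp G Z y')))).
  have gE y' : g y' = cintegral (fun y => Q (row_mx y y')).
    by apply: eq_cintegral => y; rewrite /Q row_mxKl.
  by apply: eq_cintegral => y'; rewrite gE (cintegralZr _ (schw_cintegrablel y' sQ)).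
have := schw_fubini sQc.
move=> E; transitivity (cintegral (fun y => cintegral (fun y' => Q (row_mx y y') * conjc (wp G Z (rsubmx (row_mx y y')))))).
  by rewrite E; apply: eq_cintegral => y'; apply: eq_cintegral => y; rewrite row_mxKr.
apply: eq_cintegral => y; apply: eq_cintegral => y'.
by rewrite conj_wp_pair /Q row_mxKl row_mxKr; ring.
Qed.
End LatticeExpansion.

Section NearPackets.
Variable R : realType.
Local Notation C := R[i].
Local Notation fn N := ('rV[R]_N -> C).

(** A Weyl operator with Schwartz symbol maps tempered distributions to rapidly decreasing
    functions, so that the L^2 norm in the definition of the symbol spaces is finite. *)
Lemma weyl_apply_cont k (chi : fn (k + k)) (a : fn k -> C) be :
  schwartz chi -> tempered a -> ccont (weyl_apply (fun r => chi (r - be)) a) /\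
  Brd (weyl_apply (fun r => chi (r - be)) a).
Proof.
move=> sc ta; have sw : schwartz (wker (fun r => chi (r - be))) by apply: schw_wker; exact: schw_shift.
have E y : (fun y' => wker (fun r => chi (r - be)) (row_mx y y')) = weyl_kernel (fun r => chi (r - be)) y.
  by apply/funext => y'; rewrite wkerE.
split.
  have [M [K [M0 HM]]] := temp_family_lip ta (schw_Bsf sw).
  by apply: (@lip_ccont _ _ _ M K) => X Y XY; rewrite /weyl_apply -!E; exact: HM.
move=> l; have [M M0 HM] := temp_joint_bound ta l sw.
by exists M => X; rewrite /weyl_apply -E.
Qed.

Lemma order_function_nat N (m : 'rV[R]_N -> R) : order_function m ->
  exists (C0 : R) (l : nat), 0 < C0 /\ forall x y, m x <= C0 * jbr (x - y) ^+ l * m y.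
Proof.
move=> [m0 [C0 [N0 [C00 N01 H]]]]; exists C0, (Num.bound N0); split => // x y.
apply: (le_trans (H x y)); rewrite ler_wpM2r ?(ltW (m0 y)) // ler_wpM2l ?(ltW C00) //.
rewrite -powR_mulrn ?jbr_ge0 // ler_powR ?jbr_ge1 // ltW // archi_boundP //.
by rewrite (le_trans ler01).
Qed.

Lemma L2normE N (f : fn N) : rI (fun x => normc (f x) ^+ 2) = L2norm f ^+ 2.
Proof.
rewrite /L2norm sqr_sqrtr //.
by apply: (@rI_ge0 _ _ (fun x => normc (f x) ^+ 2)) => x; exact: sqr_ge0.
Qed.

(** From 2 |f g| <= la |f|^2 + |g|^2 / la, with la close to the quotient of the two norms; a
    small parameter covers the case of a vanishing norm. *)
Lemma cauchy_schwarz N (f g : fn N) : cmeasurable (fun x => f x * g x) ->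
  rint (fun x => normc (f x) ^+ 2) -> rint (fun x => normc (g x) ^+ 2) ->
  normc (cintegral (fun x => f x * g x)) <= L2norm f * L2norm g.
Proof.
move=> mfg jf jg; pose al := L2norm f; pose be := L2norm g.
have al0 : 0 <= al by exact: sqrtr_ge0.
have be0 : 0 <= be by exact: sqrtr_ge0.
have A2 : rI (fun x => normc (f x) ^+ 2) = al ^+ 2.
  exact: L2normE.
have B2 : rI (fun x => normc (g x) ^+ 2) = be ^+ 2.
  exact: L2normE.
set x := normc _; have key la : 0 < la -> 2 * x <= la * al ^+ 2 + la^-1 * be ^+ 2.
  move=> la0; pose G y := 2^-1 * (la * normc (f y) ^+ 2 + la^-1 * normc (g y) ^+ 2).
  have iG : rint G by apply: rintZ; apply: rintD; exact: rintZ.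
  have hG y : normc (f y * g y) <= G y.
    rewrite normcM /G; set p := normc (f y); set q := normc (g y).
    have la' : 0 < la^-1 by rewrite invr_gt0.
    have e : la * la^-1 = 1 by rewrite divff // gt_eqF.
    have := mulr_ge0 (ltW la') (sqr_ge0 (la * p - q)).
    have -> : la^-1 * (la * p - q) ^+ 2 = (la * la^-1) * (la * p ^+ 2) - 2 * (la * la^-1) * (p * q) + la^-1 * q ^+ 2 by ring.
    by rewrite e; lra.
  have := le_normc_cintegral (cint_dom mfg iG hG) iG hG.
  rewrite /G rIZ; last by apply: rintD; exact: rintZ.
  rewrite -/x rID; [|exact: rintZ|exact: rintZ].
  by rewrite !rIZ // A2 B2; lra.
(* la := (be + d) / (al + d), with d so small that the error is below e *)
apply/ler_addgt0Pr => e e0.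
pose d := e / (al + be + 1); have d0 : 0 < d by rewrite divr_gt0 // ltr_wpDl // addr_ge0.
have ad : 0 < al + d by rewrite ltr_wpDl.
have bd : 0 < be + d by rewrite ltr_wpDl.
have := key ((be + d) / (al + d)) (divr_gt0 bd ad); rewrite invf_div => h.
have h1 : (be + d) / (al + d) * al ^+ 2 <= (be + d) * al.
  rewrite expr2 mulrA ler_wpM2r // -mulrA ler_piMr ?(ltW bd) //.
  by rewrite mulrC ler_pdivrMr // mul1r lerDl ltW.
have h2 : (al + d) / (be + d) * be ^+ 2 <= (al + d) * be.
  rewrite expr2 mulrA ler_wpM2r // -mulrA ler_piMr ?(ltW ad) //.
  by rewrite mulrC ler_pdivrMr // mul1r lerDl ltW.
have h3 : d * (al + be) <= e.
  rewrite /d mulrAC ler_pdivrMr; first by nra.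
  by rewrite ltr_wpDl // addr_ge0.
rewrite -/al -/be; nra.
Qed.

Variables (k : nat) (G : fn k) (chi : fn (k + k)) (b : 'M[R]_(k + k)).
Hypotheses (sG : schwartz G) (ub : b \in unitmx).
Let L := [set map_mx intr z *m b | z in [set: 'rV[int]_(k + k)]].
Hypothesis pu : partition_unity L chi.
Let sc : schwartz chi. Proof. by case: pu. Qed.
Local Notation H := (Hker G chi).
Local Notation fl1 := (fl b 1%:M).
Variable a : fn k -> C.
Hypothesis ta : tempered a.

Lemma Brd_rint2 N (f : fn N) : ccont f -> Brd f -> rint (fun x => normc (f x) ^+ 2).
Proof.
move=> cf Bf; have [M M0 HM] := Brd_dec (N + N) Bf.
apply: (@rint_dom _ _ _ (fun x => M ^+ 2 * (jbr x ^+ (N + N))^-1)).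
- by apply: continuous_rmeasurable; apply: cont_exp; exact: cont_normc.
- by apply: rintZ; exact: rint_jbr.
move=> x; rewrite ger0_norm ?sqr_ge0 //.
apply: (@le_trans _ _ ((M * (jbr x ^+ (N + N))^-1) ^+ 2)).
  by rewrite lerXn2r ?nnegrE ?normc_ge0 // mulr_ge0 // invr_ge0 jbrX_ge0.
rewrite exprMn ler_wpM2l ?sqr_ge0 // expr2 ler_piMr ?invr_ge0 ?jbrX_ge0 //.
by rewrite invf_le1 ?jbrX_gt0 // jbrX_ge1.
Qed.

Lemma L2norm_wp X : L2norm (wp G X) = L2norm G.
Proof.
have [_ Ig] := rI_affine (- lsubmx X) (oner_neq0 R) (Brd_rint2 (schw_ccont sG) (schw_Brd sG)).
rewrite /L2norm; congr Num.sqrt; rewrite -[RHS]/(rI (fun x => normc (G x) ^+ 2)) Ig normr1 expr1n mul1r.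
by apply: eq_Rintegral => t _; rewrite normc_wp scale1r.
Qed.

(** The contribution of one lattice point is bounded by the L^2 norm that defines the symbol
    space; this is used for lattice points close to the packet. *)
Lemma Tpair_near be X : normc (Tpair G chi a be X) <= L2norm (weyl_apply (fun r => chi (r - be)) a) * L2norm G.
Proof.
have [cw Bw] := weyl_apply_cont be sc ta; have sX := wp_schw X sG.
rewrite -(L2norm_wp X); apply: cauchy_schwarz.
- by apply: ccont_cmeas; apply: ccont_mul => //; exact: schw_ccont.
- exact: Brd_rint2.
by apply: Brd_rint2; [exact: schw_ccont|exact: schw_Brd].
Qed.
End NearPackets.

Section PacketExpansion.
Variable R : realType.
Local Notation C := R[i].
Local Notation fn N := ('rV[R]_N -> C).

Lemma temp_packets N (G : fn N) (a : fn N -> C) : schwartz G -> tempered a ->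
  ccont (fun Z => a (wp G Z)) /\
  exists (M : R) (K : nat), 0 <= M /\ forall Z, normc (a (wp G Z)) <= M * jbr Z ^+ K.
Proof.
move=> sG ta.
have E Z : (fun y => (fun z : 'rV[R]_(N + N + N) => wp G (lsubmx z) (rsubmx z)) (row_mx Z y)) = wp G Z.
  by apply/funext => y; rewrite row_mxKl row_mxKr.
split.
  have [M [K [M0 HM]]] := temp_family_lip ta (wp_joint sG).
  by apply: (@lip_ccont _ _ _ M K) => X Y XY; rewrite -!E; exact: HM.
have [M [K [M0 HM]]] := temp_family_bound ta (wp_joint sG).
by exists M, K; split => // Z; rewrite -E.
Qed.

Lemma jbrXV_split N (x y : 'rV[R]_N) l : (jbr x ^+ l)^-1 * (jbr y ^+ l)^-1 <= 2 ^+ l * (jbr (x - y) ^+ l)^-1.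
Proof.
rewrite -invfM ler_pdivlMr ?jbrX_gt0 // mulrC ler_pdivrMr ?mulr_gt0 ?jbrX_gt0 //.
by apply: (le_trans (jbrXD _ _ _)); rewrite jbrN.
Qed.

Variables (k : nat) (G : fn k) (chi : fn (k + k)) (b : 'M[R]_(k + k)).
Hypotheses (sG : schwartz G) (ub : b \in unitmx).
Let L := [set map_mx intr z *m b | z in [set: 'rV[int]_(k + k)]].
Hypothesis pu : partition_unity L chi.
Let sc : schwartz chi. Proof. by case: pu. Qed.
Local Notation H := (Hker G chi).
Local Notation fl1 := (fl b 1%:M).
Variable a : fn k -> C.
Hypothesis ta : tempered a.
Let d := ((k + k) + (k + k))%N.

Lemma ccont_Hker be X : ccont (fun Z => H be X Z).
Proof.
have sw : schwartz (wker (fun r => chi (r - be))) by apply: schw_wker; exact: schw_shift.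
apply: (ccont_comp _ (ccont_ip_wp (schw_pairw sG) sw)).
apply: cont_row_mx; apply: cont_row_mx; [exact: cont_cstv|exact: cont_lsubmx|exact: cont_cstv|exact: cont_rsubmx].
Qed.

Let P X be := cintegral (fun Z => H be X Z * a (wp G Z)).

(** The value at a packet is the sum, over the lattice, of its parts seen by the operators
    of the partition of unity. *)
Lemma packet_expansion X : cintegrable (fun t => P X (fl1 t)) /\
  cintegral (fun t => P X (fl1 t)) = kap2 R k * (kap R k * ip G G) * a (wp G X).
Proof.
have [ca [Ma [Ka [Ma0 Ha]]]] := temp_packets sG ta.
have [l lE] : exists l : nat, l = (d + Ka)%N by exists (d + Ka)%N.
have [M M0 HM] := Hker_decay sG sc (d + l).
have [W W0 HW] := jbr_fl_int ub (leqnn d).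
pose g1 t := (jbr (X - fl1 t) ^+ d)^-1.
have i1 : rint g1 by case: (HW X).
pose c2 := M * (2 ^+ l * (2 ^+ l * jbr X ^+ l)) * Ma.
pose g2 (Z : 'rV[R]_(k + k)) := c2 * (jbr Z ^+ d)^-1.
have i2 : rint g2 by apply: rintZ; exact: rint_jbr.
have Hb t Z : normc (H (fl1 t) X Z * a (wp G Z)) <= g1 t * g2 Z.
  rewrite normcM; set be := fl1 t.
  have h1 : normc (H be X Z) <= M * ((jbr (X - be) ^+ d)^-1 * (2 ^+ l * (2 ^+ l * jbr X ^+ l * (jbr Z ^+ l)^-1))).
    apply: (le_trans (HM be X Z)); rewrite -mulrA ler_wpM2l //.
    have e : (jbr (X - be) ^+ (d + l))^-1 = (jbr (X - be) ^+ d)^-1 * (jbr (X - be) ^+ l)^-1 by rewrite exprD invfM.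
    rewrite e -[leLHS]mulrA; apply: ler_wpM2l; first by rewrite invr_ge0 jbrX_ge0.
    apply: (@le_trans _ _ ((jbr (X - be) ^+ l)^-1 * (jbr (Z - be) ^+ l)^-1)).
      rewrite ler_wpM2l ?invr_ge0 ?jbrX_ge0 // lef_pV2 ?posrE ?jbrX_gt0 //.
      by rewrite jbrX_le // leq_addl.
    apply: (le_trans (jbrXV_split _ _ _)); rewrite ler_wpM2l ?exprn_ge0 //.
    have -> : X - be - (Z - be) = X - Z by rewrite opprB addrA subrK.
    by rewrite jbrBC; apply: (le_trans (jbr_shift_dec _ _ _)); rewrite jbrN.
  apply: (le_trans (ler_pM (normc_ge0 _) (normc_ge0 _) h1 (Ha Z))).
  have e2 : jbr Z ^+ l = jbr Z ^+ d * jbr Z ^+ Ka by rewrite lE exprD.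
  rewrite /g1 /g2 /c2 e2.
  set z1 := jbr Z ^+ d; set z2 := jbr Z ^+ Ka.
  have z20 : z2 != 0 by rewrite gt_eqF // jbrX_gt0.
  have z10 : z1 != 0 by rewrite gt_eqF // jbrX_gt0.
  rewrite le_eqVlt; apply/orP; left; apply/eqP; field.
  by rewrite z20 z10 gt_eqF ?jbrX_gt0.
have ch be : ccont (fun Z => H be X Z * a (wp G Z)) by apply: ccont_mul => //; exact: ccont_Hker.
split.
  apply: (@cint_dom _ _ _ (fun t => rI g2 * g1 t)).
  - by split; [exact: (rmeasurable_fl b 1%:M (fun be => complex.Re (P X be)))|exact: (rmeasurable_fl b 1%:M (fun be => complex.Im (P X be)))].
  - exact: rintZ.
  move=> t; rewrite mulrC -rIZ //.
  apply: le_normc_cintegral; [|exact: rintZ|exact: Hb].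
  by apply: (cint_dom (ccont_cmeas (ch _)) (rintZ (g1 t) i2)) => Z; exact: Hb.
transitivity (cintegral (fun Z => kap2 R k * ip (wp G X) (wp G Z) * a (wp G Z))).
  have HQ Z : cintegral (fun t => H (fl1 t) X Z * a (wp G Z)) = kap2 R k * ip (wp G X) (wp G Z) * a (wp G Z).
    rewrite cintegralZr ?Hker_sum //.
    have [M1 M10 HM1] := Hker_decay sG sc d.
    apply: (@cint_dom _ _ _ (fun t => M1 * g1 t)).
    - by split; [exact: (rmeasurable_fl b 1%:M (fun be => complex.Re (H be X Z)))|exact: (rmeasurable_fl b 1%:M (fun be => complex.Im (H be X Z)))].
    - exact: rintZ.
    move=> t; apply: (le_trans (HM1 _ _ _)); rewrite -[leRHS]mulr1 /g1 ler_wpM2l ?mulr_ge0 ?invr_ge0 ?jbrX_ge0 //.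
    by rewrite invf_le1 ?jbrX_gt0 // jbrX_ge1.
  exact: (@ccont_fubini_fl R _ _ b (fun be Z => H be X Z * a (wp G Z)) g1 g2 (fun t => P X (fl1 t)) _ i1 i2 ch Hb (fun t => erefl _) HQ).
rewrite -mulrA (temp_resolution sG ta (wp_schw X sG)) -cintegralZ; last first.
  have [KK [MM [MM0 HMM]]] := stft_decay sG (d + Ka).
  set nn := MM * schwartz_norm KK (wp G X).
  have sX := wp_schw X sG.
  apply: (@cintegrable_jbr _ _ _ (nn * Ma)).
    by apply: ccont_cmeas; apply: ccont_mul => //; exact: ccont_ip_wp.
  move=> Z; rewrite normcM ler_pdivlMr ?jbrX_gt0 //.
  apply: (@le_trans _ _ ((normc (ip (wp G X) (wp G Z)) * jbr Z ^+ (d + Ka)) * Ma)).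
    rewrite (exprD (jbr Z) d Ka); have := Ha Z => h.
    apply: (@le_trans _ _ (normc (ip (wp G X) (wp G Z)) * (Ma * jbr Z ^+ Ka) * jbr Z ^+ d)); last by rewrite le_eqVlt; apply/orP; left; apply/eqP; ring.
    by rewrite ler_wpM2r ?jbrX_ge0 // ler_wpM2l ?normc_ge0.
  by rewrite ler_wpM2r //; exact: HMM.
by apply: eq_cintegral => Z; rewrite mulrA.
Qed.
End PacketExpansion.

(** * Wave packet description of the symbol spaces *)

Section StildePackets.
Variable R : realType.
Local Notation C := R[i].
Local Notation fn N := ('rV[R]_N -> C).
Variables (k : nat) (G : fn k) (chi : fn (k + k)) (b : 'M[R]_(k + k)).
Hypotheses (sG : schwartz G) (G0 : ip G G != 0) (ub : b \in unitmx).
Let L := [set map_mx intr z *m b | z in [set: 'rV[int]_(k + k)]].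
Hypothesis pu : partition_unity L chi.
Let sc : schwartz chi. Proof. by case: pu. Qed.
Local Notation H := (Hker G chi).
Local Notation fl1 := (fl b 1%:M).
Variable a : fn k -> C.
Hypothesis ta : tempered a.
Let d := ((k + k) + (k + k))%N.
Let P X be := cintegral (fun Z => H be X Z * a (wp G Z)).
Let s be := L2norm (weyl_apply (fun r => chi (r - be)) a).

Let P_near X be : normc (P X be) <= normc (kap R k * ip G G) * L2norm G * s be.
Proof.
rewrite /P -(TpairE sG pu ta) normcM -mulrA ler_wpM2l ?normc_ge0 // mulrC.
exact: (Tpair_near sG pu ta).
Qed.

Let P_far M : exists2 K, 0 <= K & forall X be g D, 0 <= D ->
  (forall Z, normc (a (wp G Z)) <= D * jbr (Z - g) ^+ M) ->
  normc (P X be) <= K * D * (jbr (X - be) ^+ (M + d.+1))^-1 * jbr (be - g) ^+ M.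
Proof.
have [C1 C10 HC] := Hker_decay sG sc (M + d.+1).
pose W := rI (fun Z : 'rV[R]_(k + k) => (jbr Z ^+ d)^-1).
have W0 : 0 <= W by apply: rI_ge0 => x; rewrite invr_ge0 jbrX_ge0.
exists (C1 * 2 ^+ M * W) => [|X be g D D0 HD]; first by rewrite !mulr_ge0 ?exprn_ge0.
set q := (jbr (X - be) ^+ (M + d.+1))^-1.
have [ir Ir] := rI_affine (- be) (oner_neq0 R) (rint_jbr R (leqnn d)).
pose c := C1 * q * (D * 2 ^+ M * jbr (be - g) ^+ M).
pose h Z := c * (jbr (1 *: Z - be) ^+ d)^-1.
have ih : rint h by exact: rintZ ir.
have Hh Z : normc (H be X Z * a (wp G Z)) <= h Z.
  rewrite normcM; apply: (le_trans (ler_pM (normc_ge0 _) (normc_ge0 _) (HC be X Z) (HD Z))).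
  have j1 : jbr (Z - g) ^+ M <= 2 ^+ M * (jbr (Z - be) ^+ M * jbr (be - g) ^+ M).
    have -> : Z - g = (Z - be) + (be - g) by rewrite addrA subrK.
    exact: jbrXD.
  have j2 : (jbr (Z - be) ^+ (M + d.+1))^-1 * jbr (Z - be) ^+ M <= (jbr (Z - be) ^+ d)^-1.
    rewrite (exprD _ M) mulrC invfM mulrA divff ?gt_eqF ?jbrX_gt0 // mul1r.
    by rewrite lef_pV2 ?posrE ?jbrX_gt0 // jbrX_le.
  rewrite /h /c scale1r -/q; set z1 := (jbr (Z - be) ^+ (M + d.+1))^-1 in j2 *.
  have z10 : 0 <= z1 by rewrite invr_ge0 jbrX_ge0.
  have q0 : 0 <= q by rewrite invr_ge0 jbrX_ge0.
  apply: (@le_trans _ _ (C1 * q * z1 * (D * (2 ^+ M * (jbr (Z - be) ^+ M * jbr (be - g) ^+ M))))).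
    by rewrite ler_wpM2l ?mulr_ge0 // ler_wpM2l.
  have -> : C1 * q * z1 * (D * (2 ^+ M * (jbr (Z - be) ^+ M * jbr (be - g) ^+ M))) =
    C1 * q * (D * 2 ^+ M * jbr (be - g) ^+ M) * (z1 * jbr (Z - be) ^+ M) by ring.
  by rewrite ler_wpM2l // !mulr_ge0 ?exprn_ge0 ?jbr_ge0.
have cP : ccont (fun Z => H be X Z * a (wp G Z)).
  by apply: ccont_mul; [exact: ccont_Hker pu _ _|case: (temp_packets sG ta)].
apply: (le_trans (le_normc_cintegral (cint_dom (ccont_cmeas cP) ih Hh) ih Hh)).
rewrite /h rIZ // /c; move: Ir; rewrite normr1 expr1n mul1r -/W => <-.
by rewrite le_eqVlt; apply/orP; left; apply/eqP; ring.
Qed.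

Variables (m : 'rV[R]_(k + k) -> R) (B : banach_fun_space R 'rV[R]_(k + k)).
Hypotheses (om : order_function m) (adm : admissible L B).

(** Far from X the contributions of the lattice points are a small multiple of the
    quantity to be bounded, and are absorbed. *)
Theorem Stilde_packets : Stilde L chi m B a -> exists (M : nat) (w : B), forall X g, L g ->
  normc (a (wp G X)) <= jbr (X - g) ^+ M * (m g * normc (bfs_fun w g)).
Proof.
move=> [_ [u uE]].
have [_ [Ma [Ka [Ma0 Ha]]]] := temp_packets sG ta.
have [C0 [l [C00 Hm]]] := order_function_nat om.
have m0 x : 0 < m x by case: om.
have [w0 Hw0] := bfs_convolution ub adm u (leqnn d).
pose M := (Ka + l + d)%N.
have [K K0 HK] := P_far M.
have [W W0 HW] := jbr_fl_int ub (leqnn d).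
pose c1 := normc (kap R k * ip G G) * L2norm G.
have c10 : 0 <= c1 by rewrite mulr_ge0 ?normc_ge0 // sqrtr_ge0.
pose c2 := normc (kap2 R k * (kap R k * ip G G)).
have c20 : 0 < c2 by apply: normc_gt0; apply: mulf_neq0; [exact: kap2_neq0|apply: mulf_neq0; [exact: kap_neq0|exact: G0]].
(* the radius beyond which the far terms amount to at most half of the bound *)
pose Rr := 2 * (K * 2 ^+ M * W / c2) + 1.
have R0 : 0 < Rr by rewrite ltr_wpDl // !mulr_ge0 ?invr_ge0 ?exprn_ge0 ?(ltW c20).
pose AR := c1 * (2 * Rr) ^+ M.
have AR0 : 0 <= AR by rewrite mulr_ge0 // exprn_ge0 // mulr_ge0 // ltW.
exists M, ((2 * AR * C0 / c2)%:C *: w0) => X g Lg.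
have sE be : L be -> s be = m be * normc (bfs_fun u be).
  move=> Lbe; rewrite uE mem_set // normcR normrM normfV !ger0_norm ?(ltW (m0 _)) ?sqrtr_ge0 //.
  by rewrite mulrCA divff ?mulr1 // gt_eqF.
have [iu Iu] := Hw0 g Lg.
pose sig t := s (fl1 t) * (jbr (fl1 t - g) ^+ M)^-1.
have sig_le t : sig t <= C0 * m g * (normc (bfs_fun u (fl1 t)) * (jbr (fl1 t - g) ^+ d)^-1).
  rewrite /sig sE; last exact: lat_in.
  set be := fl1 t; set nu := normc _.
  apply: (@le_trans _ _ (C0 * jbr (be - g) ^+ l * m g * nu * (jbr (be - g) ^+ (l + d))^-1)).
    rewrite ler_pM ?mulr_ge0 ?normc_ge0 ?invr_ge0 ?jbrX_ge0 ?(ltW (m0 _)) //.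
      by rewrite ler_wpM2r ?normc_ge0.
    by rewrite lef_pV2 ?posrE ?jbrX_gt0 // jbrX_le // /M -addnA leq_addl.
  rewrite (exprD _ l d); set z1 := jbr _ ^+ l; set z2 := jbr _ ^+ d.
  rewrite le_eqVlt; apply/orP; left; apply/eqP; field.
  by rewrite !gt_eqF ?jbrX_gt0.
have sig0 t : 0 <= sig t by rewrite mulr_ge0 ?sqrtr_ge0 // invr_ge0 jbrX_ge0.
have isig : rint sig.
  apply: (@rint_dom _ _ _ (fun t => C0 * m g * (normc (bfs_fun u (fl1 t)) * (jbr (fl1 t - g) ^+ d)^-1))).
  - exact: (rmeasurable_fl b 1%:M (fun be => s be * (jbr (be - g) ^+ M)^-1)).
  - exact: rintZ.
  by move=> t; rewrite ger0_norm.
have Isig : rI sig <= C0 * m g * normc (bfs_fun w0 g).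
  apply: (le_trans (rI_le isig (rintZ _ iu) sig_le)); rewrite rIZ //.
  by rewrite ler_wpM2l // mulr_ge0 // ltW.
(* an admissible constant D improves to  AR/c2 * rI sig + D/2 *)
have improve D : 0 <= D -> (forall Z, normc (a (wp G Z)) <= D * jbr (Z - g) ^+ M) ->
    forall Z, normc (a (wp G Z)) <= (AR / c2 * rI sig + D / 2) * jbr (Z - g) ^+ M.
  move=> D0 HD Z; have [iP EP] := packet_expansion sG ub pu ta Z.
  have [iW IW] := HW Z.
  pose h t := jbr (Z - g) ^+ M * (AR * sig t + K * D * 2 ^+ M / Rr * (jbr (Z - fl1 t) ^+ d)^-1).
  have ih : rint h by apply: rintZ; apply: rintD; exact: rintZ.
  have Hh t : normc (P Z (fl1 t)) <= h t.
    rewrite /h /sig; set be := fl1 t.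
    have [near|far] := leP (jbr (Z - be)) Rr.
      apply: (le_trans (P_near Z be)); rewrite -/c1.
      have j1 : jbr (be - g) ^+ M <= (2 * Rr) ^+ M * jbr (Z - g) ^+ M.
        rewrite -exprMn lerXn2r ?nnegrE ?mulr_ge0 ?jbr_ge0 ?(ltW R0) //.
        have -> : be - g = (be - Z) + (Z - g) by rewrite addrA subrK.
        apply: (le_trans (jbrD _ _)); rewrite -mulrA ler_wpM2l // ler_wpM2r ?jbr_ge0 //.
        by rewrite jbrBC.
      apply: (@le_trans _ _ (jbr (Z - g) ^+ M * (AR * (s be * (jbr (be - g) ^+ M)^-1)))).
        have -> : jbr (Z - g) ^+ M * (AR * (s be * (jbr (be - g) ^+ M)^-1)) =
          c1 * s be * (((2 * Rr) ^+ M * jbr (Z - g) ^+ M) / jbr (be - g) ^+ M) by rewrite /AR; ring.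
        by rewrite ler_peMr ?mulr_ge0 ?sqrtr_ge0 // ler_pdivlMr ?jbrX_gt0 // mul1r.
      rewrite ler_wpM2l ?jbrX_ge0 // lerDl !mulr_ge0 ?exprn_ge0 ?invr_ge0 ?jbrX_ge0 ?(ltW R0) //.
    apply: (le_trans (HK Z be g D D0 HD)).
    apply: (@le_trans _ _ (jbr (Z - g) ^+ M * (K * D * 2 ^+ M / Rr * (jbr (Z - be) ^+ d)^-1))); last first.
      rewrite ler_wpM2l ?jbrX_ge0 // lerDr; apply: mulr_ge0; first exact: AR0.
      by apply: mulr_ge0; [exact: sqrtr_ge0|rewrite invr_ge0 jbrX_ge0].
    have j1 : jbr (be - g) ^+ M <= 2 ^+ M * (jbr (Z - be) ^+ M * jbr (Z - g) ^+ M).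
      have -> : be - g = (be - Z) + (Z - g) by rewrite addrA subrK.
      by rewrite -(jbrBC be Z); exact: jbrXD.
    apply: (le_trans (ler_wpM2l _ j1)); first by rewrite !mulr_ge0 ?invr_ge0 ?jbrX_ge0.
    rewrite addnS exprS (exprD _ M d).
    set z0 := jbr (Z - be); set z1 := z0 ^+ M; set z2 := z0 ^+ d.
    have z0p : 0 < z0 by exact: jbr_gt0.
    have z1p : 0 < z1 by exact: jbrX_gt0.
    have z2p : 0 < z2 by exact: jbrX_gt0.
    have -> : K * D * (z0 * (z1 * z2))^-1 * (2 ^+ M * (z1 * jbr (Z - g) ^+ M)) =
      jbr (Z - g) ^+ M * (K * D * 2 ^+ M * z2^-1) * z0^-1 by field; rewrite !gt_eqF.
    have -> : jbr (Z - g) ^+ M * (K * D * 2 ^+ M / Rr * z2^-1) =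
      jbr (Z - g) ^+ M * (K * D * 2 ^+ M * z2^-1) * Rr^-1 by ring.
    rewrite ler_wpM2l; first by [].
      by rewrite !mulr_ge0 ?exprn_ge0 ?jbr_ge0 ?invr_ge0 ?(ltW z2p).
    by rewrite lef_pV2 ?posrE // ltW.
  have := le_normc_cintegral iP ih Hh; rewrite EP normcM -/c2 => hP.
  have Ih : rI h = jbr (Z - g) ^+ M * (AR * rI sig + K * D * 2 ^+ M / Rr * rI (fun t => (jbr (Z - fl1 t) ^+ d)^-1)).
    by rewrite /h rIZ; [rewrite rID; [rewrite !rIZ|exact: rintZ|exact: rintZ]|apply: rintD; exact: rintZ].
  rewrite Ih in hP; rewrite -(ler_pM2l c20); apply: (le_trans hP).
  have -> : c2 * ((AR / c2 * rI sig + D / 2) * jbr (Z - g) ^+ M) =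
    jbr (Z - g) ^+ M * (AR * rI sig + c2 * D / 2) by field; rewrite gt_eqF.
  rewrite ler_wpM2l ?jbrX_ge0 // lerD2l.
  apply: (@le_trans _ _ (K * D * 2 ^+ M / Rr * W)).
    by rewrite ler_wpM2l // !mulr_ge0 ?exprn_ge0 ?invr_ge0 ?(ltW R0).
  have -> : K * D * 2 ^+ M / Rr * W = D * c2 * (K * 2 ^+ M * W / c2) / Rr by field; rewrite !gt_eqF.
  rewrite ler_pdivrMr // /Rr; set y := K * 2 ^+ M * W / c2.
  have : 0 <= D * c2 by rewrite mulr_ge0 // ltW.
  by nra.
(* the least admissible constant, finite by temperedness *)
pose E := [set normc (a (wp G Z)) / jbr (Z - g) ^+ M | Z in [set: 'rV[R]_(k + k)]].
have bE : has_sup E.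
  split; first by exists (normc (a (wp G 0)) / jbr (0 - g) ^+ M); exists 0.
  exists (Ma * (2 ^+ M * jbr g ^+ M)) => _ [Z _ <-].
  rewrite ler_pdivrMr ?jbrX_gt0 //; apply: (le_trans (Ha Z)); rewrite -mulrA ler_wpM2l //.
  apply: (@le_trans _ _ (jbr Z ^+ M)); first by rewrite jbrX_le // /M -addnA leq_addr.
  have -> : Z = (Z - g) + g by rewrite subrK.
  by apply: (le_trans (jbrXD _ _ _)); rewrite subrK -mulrA ler_wpM2l ?exprn_ge0 // mulrC.
have supE Z : normc (a (wp G Z)) <= sup E * jbr (Z - g) ^+ M.
  rewrite -ler_pdivrMr ?jbrX_gt0 //; apply: sup_upper_bound => //.
  by exists Z.
have sup0 : 0 <= sup E.
  have := supE 0; rewrite -[X in _ <= X * _]mulr1; have := normc_ge0 (a (wp G 0)) => h1 h2.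
  by have := le_trans h1 h2; rewrite mulr1 pmulr_lge0 // jbrX_gt0.
have hs : sup E <= AR / c2 * rI sig + sup E / 2.
  apply: ge_sup => [|_ [Z _ <-]]; first by case: bE.
  by rewrite ler_pdivrMr ?jbrX_gt0 //; exact: improve.
have hs2 : sup E <= 2 * AR * C0 / c2 * (m g * normc (bfs_fun w0 g)).
  apply: (@le_trans _ _ (2 * (AR / c2 * rI sig))); first by lra.
  have : AR / c2 * rI sig <= AR / c2 * (C0 * m g * normc (bfs_fun w0 g)).
    by rewrite ler_wpM2l // divr_ge0 // ltW.
  by lra.
rewrite mulrC; apply: (le_trans (supE X)); rewrite ler_wpM2r ?jbrX_ge0 //.
have nn : 0 <= 2 * AR * C0 / c2.
  by apply: divr_ge0; [apply: mulr_ge0; [apply: mulr_ge0|exact: ltW]|exact: ltW].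
apply: (le_trans hs2); rewrite bfsZ normcM normcR (ger0_norm nn) mulrCA.
exact: lexx.
Qed.
End StildePackets.

Section PacketsStilde.
Variable R : realType.
Local Notation C := R[i].
Local Notation fn N := ('rV[R]_N -> C).
Variables (k : nat) (G : fn k) (chi : fn (k + k)).
Hypotheses (sG : schwartz G) (G0 : ip G G != 0) (sc : schwartz chi).
Let d := ((k + k) + (k + k))%N.

(** The Weyl kernel at [y], localized at [g], is a phase space translate of a Schwartz
    function; expanding it in packets turns the bound on packets into a pointwise one. *)
Lemma weyl_apply_packets M : exists2 K, 0 <= K & forall v g D, tempered v -> 0 <= D ->
  (forall X, normc (v (wp G X)) <= D * jbr (X - g) ^+ M) ->
  forall y, normc (weyl_apply (fun r => chi (r - g)) v y) <= K * D * (jbr (y - lsubmx g) ^+ (k + k))^-1.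
Proof.
have [K1 [M1 [M10 H1]]] := stft_decay sG (M + d).
have sw := schw_wker sc.
have [M2 M20 H2] := joint_norm K1 (k + k) sw.
pose W := rI (fun X : 'rV[R]_(k + k) => (jbr X ^+ d)^-1).
have W0 : 0 <= W by apply: rI_ge0 => x; rewrite invr_ge0 jbrX_ge0.
pose c1 := normc (kap R k * ip G G).
have c10 : 0 < c1 by apply: normc_gt0; apply: mulf_neq0; [exact: kap_neq0|exact: G0].
exists (c1^-1 * (M1 * M2 * W)) => [|v g D tv D0 HD y].
  by apply: mulr_ge0; [rewrite invr_ge0 ltW|rewrite !mulr_ge0].
set z := y - lsubmx g.
pose f0 y' := wker chi (row_mx z y').
have sf0 : schwartz f0 by exact: schw_slice_joint.
pose f1 y' := cis (- dotmx y' (rsubmx g)) * f0 (y' - lsubmx g).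
have sf1 : schwartz f1.
  apply: schw_mul_poly; last exact: schw_shift.
  apply: (@eq_sm _ _ _ (fun y' => cis (dotmx y' (- rsubmx g) + 0))); last exact: sm_cis_lin.
  by move=> y'; rewrite addr0 dotmxNr.
have fE : weyl_kernel (fun r => chi (r - g)) y = fun y' => cis (dotmx y (rsubmx g)) * f1 y'.
  apply/funext => y'; rewrite (weyl_kernel_shift g y y' sc) /f1 /f0 wkerE dotmxBl cisD -mulrA.
  by [].
have vE : normc (weyl_apply (fun r => chi (r - g)) v y) = normc (v f1).
  by rewrite /weyl_apply fE tempZ // normcM normc_cis mul1r.
rewrite vE; have ci : ccont (fun X => ip f1 (wp G X) * v (wp G X)).
  by apply: ccont_mul; [exact: ccont_ip_wp|case: (temp_packets sG tv)].
set q := (jbr z ^+ (k + k))^-1.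
have [ir Ir] := rI_affine (- g) (oner_neq0 R) (rint_jbr R (leqnn d)).
pose c := M1 * (M2 * q) * D.
pose h X := c * (jbr (1 *: X - g) ^+ d)^-1.
have ih : rint h by exact: rintZ ir.
have Hh X : normc (ip f1 (wp G X) * v (wp G X)) <= h X.
  rewrite normcM ip_wp_cov // hsubmxK.
  have h1 : normc (ip f0 (wp G (X - g))) <= M1 * (M2 * q) * (jbr (X - g) ^+ (M + d))^-1.
    rewrite ler_pdivlMr ?jbrX_gt0 //; apply: (le_trans (H1 f0 (X - g) sf0)).
    rewrite ler_wpM2l // ler_pdivlMr ?jbrX_gt0 // mulrC; exact: H2.
  apply: (le_trans (ler_pM (normc_ge0 _) (normc_ge0 _) h1 (HD X))).
  rewrite /h /c scale1r (exprD _ M d); set z1 := jbr _ ^+ M; set z2 := jbr _ ^+ d.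
  rewrite le_eqVlt; apply/orP; left; apply/eqP; field.
  by rewrite !gt_eqF ?jbrX_gt0.
have hP : c1 * normc (v f1) <= M1 * (M2 * q) * D * W.
  rewrite /c1 -normcM (temp_resolution sG tv sf1).
  apply: (le_trans (le_normc_cintegral (cint_dom (ccont_cmeas ci) ih Hh) ih Hh)).
  rewrite normr1 expr1n mul1r in Ir; rewrite /h rIZ // -Ir; exact: lexx.
rewrite -(ler_pM2l c10); apply: (le_trans hP).
rewrite le_eqVlt; apply/orP; left; apply/eqP; field.
by rewrite gt_eqF.
Qed.

Lemma L2norm_weyl_packets M : exists2 K, 0 <= K & forall v g D, tempered v -> 0 <= D ->
  (forall X, normc (v (wp G X)) <= D * jbr (X - g) ^+ M) ->
  L2norm (weyl_apply (fun r => chi (r - g)) v) <= K * D.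
Proof.
have [K K0 HK] := weyl_apply_packets M.
pose W := rI (fun X : 'rV[R]_k => (jbr X ^+ (k + k))^-1).
have W0 : 0 <= W by apply: rI_ge0 => x; rewrite invr_ge0 jbrX_ge0.
exists (K * Num.sqrt W) => [|v g D tv D0 HD]; first by rewrite mulr_ge0 ?sqrtr_ge0.
set f := weyl_apply _ v.
have fb y : normc (f y) <= K * D * (jbr (y - lsubmx g) ^+ (k + k))^-1 by exact: HK.
have [cf Bf] := weyl_apply_cont g sc tv.
have i2 := Brd_rint2 cf Bf.
have [ir Ir] := rI_affine (- lsubmx g) (oner_neq0 R) (rint_jbr R (leqnn (k + k))).
have KD0 : 0 <= K * D by exact: mulr_ge0.
have -> : K * Num.sqrt W * D = Num.sqrt ((K * D) ^+ 2 * W).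
  by rewrite sqrtrM ?sqr_ge0 // sqrtr_sqr ger0_norm //; ring.
rewrite /L2norm ler_sqrt ?mulr_ge0 ?sqr_ge0 //.
rewrite -[leLHS]/(rI (fun y => normc (f y) ^+ 2)) /W Ir normr1 expr1n mul1r -rIZ //.
apply: rI_le => //; first exact: rintZ.
move=> y; rewrite scale1r; apply: (@le_trans _ _ ((K * D * (jbr (y - lsubmx g) ^+ (k + k))^-1) ^+ 2)).
  by rewrite lerXn2r ?nnegrE ?normc_ge0 // mulr_ge0 // invr_ge0 jbrX_ge0.
rewrite exprMn ler_wpM2l ?sqr_ge0 // expr2 ler_piMr ?invr_ge0 ?jbrX_ge0 //.
by rewrite invf_le1 ?jbrX_gt0 // jbrX_ge1.
Qed.

Variables (L : set 'rV[R]_(k + k)) (m : 'rV[R]_(k + k) -> R) (B : banach_fun_space R 'rV[R]_(k + k)).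
Hypotheses (m0 : forall x, 0 < m x) (adm : admissible L B).

(** The bound at the lattice point [g] controls the L^2 norm attached to [g], with a
    constant that does not depend on [g]; solidity of [B] concludes. *)
Theorem packets_Stilde v (M : nat) (w : B) : tempered v ->
  (forall X g, L g -> normc (v (wp G X)) <= jbr (X - g) ^+ M * (m g * normc (bfs_fun w g))) ->
  Stilde L chi m B v.
Proof.
move=> tv Hv; split => //; have [K K0 HK] := L2norm_weyl_packets M.
have [_ _ _ [S HS]] := adm.
set f := fun g : 'rV[R]_(k + k) => _; have [|u uE _] := HS (K%:C *: w) f; last by exists u.
move=> g; rewrite /f bfsZ normcM normcR (ger0_norm K0).
case: ifPn => [|_]; last by rewrite normc0 mulr_ge0 ?normc_ge0.
rewrite inE => Lg; rewrite normcR ger0_norm; last by rewrite divr_ge0 ?sqrtr_ge0 // ltW.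
rewrite ler_pdivrMr // -mulrA [_ * m g]mulrC; apply: HK => //.
  by rewrite mulr_ge0 ?normc_ge0 // ltW.
by move=> X; rewrite [leRHS]mulrC; exact: Hv.
Qed.
End PacketsStilde.

(** * Domination by translated cut-offs *)

Section Bracket.
Variable R : realType.
Local Notation C := R[i].
Local Notation fn N := ('rV[R]_N -> C).
Variables (N : nat) (b : 'M[R]_N) (B : banach_fun_space R 'rV[R]_N) (chi : 'rV[R]_N -> R).
Hypothesis ub : b \in unitmx.
Let L := [set map_mx intr z *m b | z in [set: 'rV[int]_N]].
Hypotheses (adm : admissible L B) (cut : cutoff L chi).
Local Notation fl1 := (fl b 1%:M).
Let u1 : (1%:M : 'M[R]_N) \in unitmx. Proof. exact: unitmx1. Qed.

Lemma lat_sub x y : L x -> L y -> L (x - y).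
Proof.
move=> [p _ <-] [q _ <-]; exists (p - q) => //.
by rewrite -mulmxBl; congr (_ *m _); apply/rowP => i; rewrite !mxE intrB.
Qed.

Lemma lat0 : L 0.
Proof. by exists 0 => //; rewrite (_ : map_mx _ _ = 0) ?mul0mx //; apply/rowP => i; rewrite !mxE. Qed.

Lemma cutoff_cont : continuous chi.
Proof. by case: cut => sc _ _ _; case: (sc [::]). Qed.

Lemma cutoff_bound : exists r M, [/\ 0 <= r, 0 <= M & forall x, chi x != 0 -> jbr x <= r /\ chi x <= M].
Proof.
have [_ cc c0 _] := cut; set K := closure _ in cc.
have subK x : chi x != 0 -> K x by move=> h; exact: subset_closure.
have [[x0 Kx0]|nK] := pselect (K !=set0); last first.
  exists 0, 0; split=> // x /subK Kx; by exfalso; apply: nK; exists x.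
have [x1 _ h1] := EVT_max_rV (ex_intro _ x0 Kx0) cc (continuous_subspaceT (@continuous_jbr R N)).
have [x2 _ h2] := EVT_max_rV (ex_intro _ x0 Kx0) cc (continuous_subspaceT cutoff_cont).
exists (jbr x1), (chi x2); split => // [|x /subK Kx]; first exact: jbr_ge0.
by split; [apply: h1|apply: h2]; rewrite inE.
Qed.

Lemma cutoff_dec k : exists2 M, 0 <= M & forall x, chi x <= M * (jbr x ^+ k)^-1.
Proof.
have [r [M [r0 M0 H]]] := cutoff_bound; exists (M * r ^+ k) => [|x]; first by rewrite mulr_ge0 ?exprn_ge0.
have [e|/H[h1 h2]] := eqVneq (chi x) 0.
  by rewrite e mulr_ge0 ?invr_ge0 ?jbrX_ge0 // mulr_ge0 ?exprn_ge0.
apply: (le_trans h2); rewrite -mulrA -[leLHS]mulr1 ler_wpM2l // ler_pdivlMr ?jbrX_gt0 // mul1r.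
by rewrite lerXn2r ?nnegrE ?jbr_ge0.
Qed.

Let cutE x : rint (fun t => chi (x - fl1 t)) /\ rI (fun t => chi (x - fl1 t)) = rsum L (fun g => chi (x - g)).
Proof.
have [M M0 HM] := cutoff_dec (N + N); have [_ _ c0 _] := cut.
have cs : csummable L (fun g => (chi (x - g))%:C : C).
  by apply: (@csummable_dec _ _ _ ub _ M x (N + N)) => // g; rewrite normcR ger0_norm.
have fo : (\esum_(g in L) `|chi (x - g)|%:E < +oo)%E.
  move: cs; rewrite /csummable /summable; congr (_ < _)%E; apply: eq_esum => g _.
  by rewrite normcR abse_EFin normr_id.
by have := rsum_rI ub u1 fo; rewrite cvol1 mul1r.
Qed.

(** The periodized cut-off is continuous, so it attains a positive minimum on a compact
    fundamental cell. *)
Lemma cutoff_lower : exists2 e, 0 < e & forall x, e <= rsum L (fun g => chi (x - g)).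
Proof.
have [_ _ c0 cp] := cut.
have [M M0 HM] := cutoff_dec (N + N).
pose p x := rI (fun t => chi (x - fl1 t)).
have cp0 : continuous p.
  have [W W0 HW] := jbr_fl_int ub (leqnn (N + N)).
  apply: (@cont_rI_par R _ _ (fun x t => chi (x - fl1 t)) (fun x => M * 2 ^+ (N + N) * jbr x ^+ (N + N)) (fun t => (jbr (0 - fl1 t) ^+ (N + N))^-1)).
  - by move=> x; exact: (rmeasurable_fl b 1%:M (fun g => chi (x - g))).
  - move=> t; apply: (@cont_comp _ _ _ (fun x : 'rV[R]_N => x - fl1 t) chi); last exact: cutoff_cont.
    by apply: cont_addv; [exact: cont_id|exact: cont_cstv].
  - by apply: cont_mul; [exact: cont_cst|apply: cont_exp; exact: continuous_jbr].
  - by case: (HW 0).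
  - by move=> t; rewrite invr_ge0 jbrX_ge0.
  move=> x t; rewrite ger0_norm //; apply: (le_trans (HM _)).
  by rewrite -!mulrA ler_wpM2l // mulrA; exact: jbr_fl_shift.
(* the closed fundamental cell *)
pose D : set 'rV[R]_N := [set y *m b | y in [set y : 'rV[R]_N | forall i, `[0%R, 1%R]%classic (y ord0 i)]].
have cD : compact D.
  apply: (@continuous_compact _ _ (fun y : 'rV[R]_N => y *m b)).
    by apply: continuous_subspaceT; exact: cont_mulmx.
  pose A (i : 'I_N) : set R := `[0%R, 1%R]%classic.
  have cA i : compact (A i) by exact: segment_compact.
  exact: (rV_compact cA).
have D0 : D !=set0.
  by exists 0, 0; rewrite ?mul0mx // => i /=; rewrite mxE in_itv /= lexx ler01.
have [x0 _ Hx0] := EVT_min_rV D0 cD (continuous_subspaceT cp0).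
exists (p x0) => [|x]; first by rewrite /p; have [_ ->] := cutE x0; exact: cp.
pose t := x *m invmx b; pose be := fl1 t.
have Dx : D (x - be).
  exists (t - map_mx intr (cell 1%:M t)); last by rewrite mulmxBl /t mulmxKV.
  move=> i; have e : (t - map_mx intr (cell 1%:M t)) ord0 i = t 0 i - (Num.floor (t 0 i))%:~R.
    by rewrite mxE [X in _ + X]mxE [X in _ - X]mxE [X in _ - X%:~R]mxE mulmx1.
  rewrite e /= in_itv /=; have := floor_itv (t 0 i); rewrite intrD => /andP[h1 h2].
  by apply/andP; split; [rewrite subr_ge0|rewrite lerBlDl ltW].
have -> : rsum L (fun g => chi (x - g)) = rsum L (fun g => chi (x - be - g)).
  have Lbe : L be by exact: lat_in.
  have key (f : 'rV[R]_N -> \bar R) : esum L (fun g => f (x - g)) = esum L (fun g => f (x - be - g)).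
    rewrite (@reindex_esum _ _ _ L _ (fun g => be + g)).
      by apply: eq_esum => g _; rewrite opprD addrA.
    split; last 2 first.
    - by move=> y z _ _ /addrI.
    - by move=> y Ly; exists (y - be); [exact: lat_sub|rewrite addrC subrK].
    by move=> y Ly; rewrite -[y]opprK -[- y]sub0r; apply: lat_sub => //; apply: lat_sub => //; exact: lat0.
  rewrite /rsum; congr (fine _ - fine _).
    exact: (key (fun y => ((chi^\+)%R y)%:E)).
  exact: (key (fun y => ((chi^\-)%R y)%:E)).
have [_ <-] := cutE (x - be).
by apply: Hx0; rewrite inE.
Qed.

(** Evaluation at 0 is continuous and translations are isometric. *)
Lemma bfs_bounded (v : B) : exists2 K, 0 <= K & forall g, normc (bfs_fun v g) <= K.
Proof.
have [off tr _ _] := adm; have [K K0 HK] := bfs_eval adm lat0.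
exists (K * bnorm v) => [|g]; first by rewrite mulr_ge0 // bnorm_ge0.
have [Lg|nLg] := pselect (L g); last by rewrite off // normc0 mulr_ge0 // bnorm_ge0.
have [v' v'E nv] : exists2 v' : B, bfs_fun v' = (fun x => bfs_fun v (x - - g)) & `|v'| = `|v|.
  by apply: tr; rewrite -sub0r; apply: lat_sub => //; exact: lat0.
by have := HK v'; rewrite v'E /bnorm nv sub0r opprK.
Qed.

Variable m : 'rV[R]_N -> R.
Hypothesis om : order_function m.

(** A bound by wave packet estimates at the lattice points gives a bound by a sum of
    translated cut-offs: the periodized cut-off is bounded below. *)
Lemma packets_bracket (F : fn N) (M : nat) (w : B) :
  (forall X g, L g -> normc (F X) <= jbr (X - g) ^+ M * (m g * normc (bfs_fun w g))) ->
  bracket_bound L chi B (fun x => F x / (m x)%:C).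
Proof.
move=> HF; have m0 x : 0 < m x by case: om.
have [C0 [l [C00 Hm]]] := order_function_nat om.
have [_ _ c0 cp] := cut.
have [r [Mc [r0 Mc0 Hr]]] := cutoff_bound.
have [e e0 He] := cutoff_lower.
have [_ _ _ [S HS]] := adm.
have [Kw Kw0 HKw] := bfs_bounded w.
have nE x : normc (F x / (m x)%:C) = normc (F x) / m x.
  by rewrite normcM -fmorphV normcR ger0_norm // invr_ge0 ltW.
have HFm x g : L g -> normc (F x / (m x)%:C) <= C0 * jbr (x - g) ^+ (M + l) * normc (bfs_fun w g).
  move=> Lg; rewrite nE ler_pdivrMr //; apply: (le_trans (HF x g Lg)).
  apply: (@le_trans _ _ (jbr (x - g) ^+ M * ((C0 * jbr (x - g) ^+ l * m x) * normc (bfs_fun w g)))).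
    rewrite ler_wpM2l ?jbrX_ge0 // ler_wpM2r ?normc_ge0 //.
    by apply: (le_trans (Hm g x)); rewrite jbrBC.
  by rewrite exprD le_eqVlt; apply/orP; left; apply/eqP; ring.
split.
  move=> x; exists (C0 * (jbr x + 1) ^+ (M + l) * Kw).
  have := @continuous_jbr R N x.
  move=> /(@cvgrPdist_lt _ _ _ (nbhs x) (nbhs_filter x)) /(_ _ (@ltr01 R)).
  apply: filterS => y hy; apply: (le_trans (HFm y 0 lat0)); rewrite subr0.
  apply: ler_pM; rewrite ?normc_ge0 ?HKw //.
    by rewrite mulr_ge0 ?jbrX_ge0 // ltW.
  rewrite ler_wpM2l ?(ltW C00) // lerXn2r ?nnegrE ?jbr_ge0 ?addr_ge0 ?jbr_ge0 //.
  by move: hy; rewrite distrC => /(le_lt_trans (ler_norm _)); lra.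
pose K := C0 * r ^+ (M + l); have K0 : 0 <= K by rewrite mulr_ge0 ?exprn_ge0 // ltW.
have Ke0 : 0 <= K / e by apply: divr_ge0 => //; exact: ltW.
have [|v vE _] := HS ((K / e)%:C *: w) (fun g => (K / e * normc (bfs_fun w g))%:C).
  by move=> g; rewrite bfsZ normcM 2!normcR normrM (ger0_norm (normc_ge0 _)).
exists v => x.
pose phi g := K / e * normc (bfs_fun w g) * chi (x - g).
have kw0 g : 0 <= K / e * normc (bfs_fun w g) by apply: mulr_ge0 => //; exact: normc_ge0.
have phi0 g : 0 <= phi g by apply: mulr_ge0.
have [Md Md0 HMd] := cutoff_dec (N + N).
have cs : csummable L (fun g => bfs_fun v g * (chi (x - g))%:C).
  apply: (@csummable_dec _ _ _ ub _ (K / e * Kw * Md) x (N + N)) => // g.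
  rewrite vE normcM !normcR (ger0_norm (c0 _)) (ger0_norm (kw0 _)).
  rewrite -[leRHS]mulrA; apply: ler_pM => //.
  by rewrite ler_wpM2l.
have [ic Ic] := csum_cintegral ub u1 cs; rewrite cvol1 mul1r in Ic.
rewrite -Ic; have pE t : bfs_fun v (fl1 t) * (chi (x - fl1 t))%:C = (phi (fl1 t))%:C.
  by rewrite vE -rmorphM.
have -> : cintegral (fun t => bfs_fun v (fl1 t) * (chi (x - fl1 t))%:C) = (rI (fun t => phi (fl1 t)))%:C.
  apply: ReIm_eq; first by apply: eq_Rintegral => t _; rewrite pE.
  transitivity (complex.Im (cintegral (fun _ : 'rV[R]_N => 0))); last by rewrite cintegral0.
  by apply: eq_Rintegral => t _; rewrite pE.
rewrite lecR; have [ir Ir] := cutE x.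
have ip : rint (fun t => phi (fl1 t)).
  have [+ _] := (cintegrableP _).1 ic; congr rint; apply/funext => t.
  by rewrite pE.
set nF := normc _; have nF0 : 0 <= nF by exact: normc_ge0.
apply: (@le_trans _ _ (nF / e * rI (fun t => chi (x - fl1 t)))).
  by rewrite Ir mulrAC ler_pdivlMr // ler_wpM2l.
rewrite -rIZ //; apply: rI_le => //; first exact: rintZ.
move=> t; rewrite /phi; set g := fl1 t.
have [->|/Hr[h1 _]] := eqVneq (chi (x - g)) 0; first by rewrite !mulr0.
rewrite ler_wpM2r // mulrAC ler_pM2r ?invr_gt0 //.
apply: (le_trans (HFm x g (lat_in _ _))); rewrite ler_wpM2r ?normc_ge0 // /K ler_wpM2l ?(ltW C00) //.
by rewrite lerXn2r ?nnegrE ?jbr_ge0.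
Qed.
End Bracket.

(** * The Bargmann transform *)

Section BargmannGeometry.
Variables (R : realType) (n : nat) (P : quad_form R n).
Hypothesis bP : bargmann_phase P.
Local Notation C := R[i].
Local Notation fn N := ('rV[R]_N -> C).

Definition bgauss : fn n := cgauss (phi_yy P).

Lemma schw_bgauss : schwartz bgauss.
Proof. by apply: schw_cgauss; case: bP. Qed.

Lemma ip_bgauss : ip bgauss bgauss != 0.
Proof. by apply: (@ip_self_neq0 _ _ _ 0); [exact: schw_bgauss|rewrite /bgauss cgauss0 oner_eq0]. Qed.

Lemma dotmxDlC (x y z : 'rV[C]_n) : dotmx (x + y) z = dotmx x z + dotmx y z.
Proof. by rewrite /dotmx -big_split; apply: eq_bigr => i _; rewrite !mxE mulrDl. Qed.
Lemma dotmxDrC (x y z : 'rV[C]_n) : dotmx z (x + y) = dotmx z x + dotmx z y.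
Proof. by rewrite /dotmx -big_split; apply: eq_bigr => i _; rewrite !mxE mulrDr. Qed.
Lemma dotmxNlC (x z : 'rV[C]_n) : dotmx (- x) z = - dotmx x z.
Proof. by rewrite /dotmx -sumrN; apply: eq_bigr => i _; rewrite !mxE mulNr. Qed.
Lemma dotmxE (x y : 'rV[C]_n) : dotmx x y = (x *m y^T) 0 0.
Proof. by rewrite mxE; apply: eq_bigr => i _; rewrite mxE. Qed.

Lemma dotmx_sym (A : 'M[C]_n) (x y : 'rV[C]_n) : A^T = A -> dotmx (x *m A) y = dotmx (y *m A) x.
Proof.
move=> sA; have e : (x *m A *m y^T)^T = y *m A *m x^T by rewrite !trmx_mul trmxK sA mulmxA.
by rewrite !dotmxE -e [RHS]mxE.
Qed.

Lemma dotmx_cplx N (x y : 'rV[R]_N) : dotmx (cplx_vec x) (cplx_vec y) = (dotmx x y)%:C.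
Proof. by rewrite /dotmx (rmorph_sum (real_complex R)); apply: eq_bigr => i _; rewrite !mxE rmorphM. Qed.

Lemma cplx_vecD N (x y : 'rV[R]_N) : cplx_vec (x + y) = cplx_vec x + cplx_vec y.
Proof. exact: map_mxD. Qed.
Lemma cplx_vecZ N a (x : 'rV[R]_N) : cplx_vec (a *: x) = a%:C *: cplx_vec x.
Proof. exact: map_mxZ. Qed.

Lemma pi_kappaTE r : pi_kappaT P r *m phi_xy P =
  - (cplx_vec (rsubmx r) + cplx_vec (lsubmx r) *m phi_yy P).
Proof.
by rewrite /pi_kappaT /kappaT /= mulmxKV // unitmxE unitfE; case: bP.
Qed.

(** At the point of C^n that corresponds to the real point r = (y, eta), the phase has
    derivative - eta at y: its Taylor expansion there is this polynomial. *)
Lemma phase_shift r s : phase P (pi_kappaT P r) (cplx_vec (lsubmx r + s)) =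
  phase P (pi_kappaT P r) (cplx_vec (lsubmx r)) - (dotmx s (rsubmx r))%:C
  + 2^-1 * dotmx (cplx_vec s *m phi_yy P) (cplx_vec s).
Proof.
set y := cplx_vec (lsubmx r); set t := cplx_vec s; set e := cplx_vec (rsubmx r).
rewrite /phase pi_kappaTE -/y -/e cplx_vecD -/y -/t mulmxDl !dotmxDlC !dotmxDrC !dotmxNlC !dotmxDlC.
rewrite (dotmx_sym t y (phi_yy_sym P)) -dotmx_cplx -/t -/e.
have -> : dotmx t e = dotmx e t by rewrite /dotmx; apply: eq_bigr => i _; rewrite mulrC.
have two : (2 : C) != 0 by rewrite pnatr_eq0.
by field.
Qed.

(** The phase left over when the Bargmann kernel is compared with a packet. *)
Definition bphase r : R := complex.Re (phase P (pi_kappaT P r) (cplx_vec (lsubmx r))).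

Lemma cexp_i (w : C) : cexp ('i%C * w) = (expR (- complex.Im w))%:C * cis (complex.Re w).
Proof.
rewrite (_ : 'i%C * w = - complex.Im w +i* complex.Re w) ?cexpE //.
by apply: ReIm_eq; rewrite ?ReM ?ImM /=; ring.
Qed.

Lemma cexp_cgauss s : cexp ('i%C * (2^-1 * dotmx (cplx_vec s *m phi_yy P) (cplx_vec s))) = bgauss s.
Proof. by []. Qed.

Lemma barg_kernel_shift r s : barg_kernel P (pi_kappaT P r) (lsubmx r + s) =
  cexp ('i%C * phase P (pi_kappaT P r) (cplx_vec (lsubmx r))) * (bgauss s * cis (- dotmx s (rsubmx r))).
Proof.
rewrite /barg_kernel phase_shift -cexp_cgauss.
set A := phase _ _ _; set D := dotmx s _; set Q := 2^-1 * _.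
have -> : 'i%C * (A - D%:C + Q) = 'i%C * A + ('i%C * Q + (0 +i* (- D))).
  rewrite !mulrDr -addrA; congr (_ + _); rewrite addrC; congr (_ + _).
  by apply: ReIm_eq; rewrite ?ReM ?ImM ?ReN ?ImN /=; ring.
by rewrite !cexpD.
Qed.

(** By [phase_shift] the supremum that defines Phi is attained at the base point. *)
Lemma PhiE r : Phi P (pi_kappaT P r) = - complex.Im (phase P (pi_kappaT P r) (cplx_vec (lsubmx r))).
Proof.
have [_ pos] := bP.
have q0 s : 0 <= dotmx (s *m map_mx (@complex.Im R) (phi_yy P)) s.
  have [->|s0] := eqVneq s 0; first by rewrite mul0mx dotmx0l.
  exact/ltW/pos.
rewrite /Phi; apply/eqP; rewrite eq_le; apply/andP; split.
  apply: ge_sup; first by exists (- complex.Im (phase P (pi_kappaT P r) (cplx_vec 0))), 0.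
  move=> _ [y _ <-].
  have -> : y = lsubmx r + (y - lsubmx r) by rewrite addrC subrK.
  rewrite phase_shift ImD ImD ImN Im_quad /= oppr0 addr0 lerN2 lerDl.
  by rewrite mulr_ge0.
apply: sup_upper_bound; last by exists (lsubmx r).
split; first by exists (- complex.Im (phase P (pi_kappaT P r) (cplx_vec 0))), 0.
exists (- complex.Im (phase P (pi_kappaT P r) (cplx_vec (lsubmx r)))) => _ [y _ <-].
have -> : y = lsubmx r + (y - lsubmx r) by rewrite addrC subrK.
rewrite phase_shift ImD ImD ImN Im_quad /= oppr0 addr0 lerN2 lerDl.
by rewrite mulr_ge0.
Qed.

(** On a real point, the kernel of the Bargmann transform is a wave packet up to a
    unimodular factor and the weight. *)
Lemma barg_kernelE r : barg_kernel P (pi_kappaT P r) =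
  (fun y => cis (bphase r) * (expR (Phi P (pi_kappaT P r)))%:C * wp bgauss r y).
Proof.
apply/funext => y; rewrite -{1}(subrK (lsubmx r) y) [X in barg_kernel _ _ X]addrC barg_kernel_shift.
by rewrite cexp_i -PhiE /wp [_%:C * cis _]mulrC.
Qed.
End BargmannGeometry.

Section RealPoints.
Variables (R : realType) (n : nat) (P : quad_form R n).
Hypothesis bP : bargmann_phase P.
Local Notation C := R[i].

Definition of_Cn (w : 'rV[C]_n) : 'rV[R]_(n + n) :=
  row_mx (map_mx (@complex.Re R) w) (map_mx (@complex.Im R) w).

Lemma of_CnK w : to_Cn (of_Cn w) = w.
Proof.
apply/rowP => i; rewrite mxE /of_Cn row_mxEl row_mxEr !mxE.
by case: (w 0 i).
Qed.

Lemma of_CnP a (w w' : 'rV[C]_n) : of_Cn (a%:C *: w + w') = a *: of_Cn w + of_Cn w'.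
Proof.
rewrite /of_Cn scale_row_mx add_row_mx; congr row_mx; apply/rowP => i.
  by rewrite !mxE ReD ReM /= mul0r subr0.
by rewrite !mxE ImD ImM /= mul0r addr0.
Qed.

Lemma pi_kappaTP a r r' : pi_kappaT P (a *: r + r') = a%:C *: pi_kappaT P r + pi_kappaT P r'.
Proof.
rewrite /pi_kappaT /kappaT /= !linearP /= !cplx_vecD !cplx_vecZ mulmxDl -scalemxAl.
rewrite [in LHS]addrACA -scalerDr opprD mulmxDl -scalerN -scalemxAl.
by [].
Qed.

(** The real matrix of pi o kappa_T. It carries the Lebesgue measure of C^n to phase space
    up to a constant, which is absorbed in the cell volume. *)
Definition kapmx : 'M[R]_(n + n) := \matrix_i of_Cn (pi_kappaT P (delta_mx 0 i)).

Lemma mul_kapmx r : r *m kapmx = of_Cn (pi_kappaT P r).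
Proof.
have f0 : of_Cn (pi_kappaT P 0) = 0.
  have := congr1 of_Cn (pi_kappaTP (-1) 0 0); rewrite scaler0 add0r of_CnP scaleN1r => ->.
  by rewrite addNr.
rewrite mulmx_sum_row [in RHS](matrix_sum_delta r) big_ord1.
elim: (index_enum _) => [|i s IH]; first by rewrite !big_nil f0.
by rewrite !big_cons pi_kappaTP of_CnP rowK IH.
Qed.

(** If r = (y, eta) is in the kernel then eta + y phi_yy = 0; its imaginary part and
    positivity give y = 0, hence eta = 0. *)
Lemma kapmx_unit : kapmx \in unitmx.
Proof.
rewrite -row_free_unit; apply: inj_row_free => r; rewrite mul_kapmx => /(congr1 (@to_Cn R n)).
rewrite of_CnK => h0.
have {}h0 : pi_kappaT P r = 0 by rewrite h0; apply/rowP => i; rewrite !mxE.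
have := pi_kappaTE bP r; rewrite h0 mul0mx => /esym/eqP; rewrite oppr_eq0 => /eqP h.
have hi i : complex.Im ((cplx_vec (lsubmx r) *m phi_yy P) 0 i) = (lsubmx r *m map_mx (@complex.Im R) (phi_yy P)) 0 i.
  rewrite !mxE Im_sum; apply: eq_bigr => j _; rewrite !mxE ImM /= mul0r addr0 //.
have y0 : lsubmx r = 0.
  apply/eqP; apply/negPn/negP => ny; have [_ /(_ _ ny)] := bP.
  have -> : lsubmx r *m map_mx (@complex.Im R) (phi_yy P) = 0.
    apply/rowP => i; rewrite -hi; have /rowP/(_ i)/(congr1 (@complex.Im R)) := h.
    by rewrite mxE ImD !mxE /= add0r.
  by rewrite dotmx0l ltxx.
have e0 : rsubmx r = 0.
  apply/rowP => i; have /rowP/(_ i)/(congr1 (@complex.Re R)) := h.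
  rewrite y0 (_ : cplx_vec 0 = 0) ?mul0mx ?addr0; last by apply/rowP => j; rewrite !mxE.
  by rewrite !mxE.
by rewrite -(hsubmxK r) y0 e0 row_mx0.
Qed.

Definition realpt (z : 'rV[R]_(n + n)) := z *m invmx kapmx.

Lemma pi_realpt z : pi_kappaT P (realpt z) = to_Cn z.
Proof. by rewrite -[LHS]of_CnK -mul_kapmx mulmxKV // kapmx_unit. Qed.

Lemma pi_surj x : exists r, x = pi_kappaT P r.
Proof. by exists (realpt (of_Cn x)); rewrite pi_realpt of_CnK. Qed.
End RealPoints.

(** * Weyl operators between wave packets *)

Section WignerPackets.
Variable R : realType.
Local Notation C := R[i].
Local Notation fn N := ('rV[R]_N -> C).

Lemma schw_Wig_integrand k (S : 'rV[R]_(k + k) -> C) p xi : schwartz S ->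
  schwartz (fun t => cis (dotmx t xi) * S (row_mx (p + 2^-1 *: t) (p - 2^-1 *: t))).
Proof.
move=> sS; have := schw_fhat_integrand xi (schw_slice_joint p (schw_mid (midmx_unit R k) sS)).
by congr schwartz; apply/funext => t; rewrite mul_midmx dotmxC.
Qed.

Variables (n : nat) (G : fn n).
Hypothesis sG : schwartz G.

Definition tens (f g : fn n) : fn (n + n) := fun z => f (lsubmx z) * conjc (g (rsubmx z)).

Lemma schw_tens f g : schwartz f -> schwartz g -> schwartz (tens f g).
Proof. by move=> sf sg; exact: (schw_tensor sf (schw_conj sg)). Qed.

(** The profile of the packets of the doubled phase space that appear in the Wigner
    transforms of pairs of packets. *)
Definition wigwin : fn (n + n) := Wig (tens G G).

Definition pairphase (X Y : 'rV[R]_(n + n)) : R :=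
  dotmx (lsubmx X - lsubmx Y) (2^-1 *: (rsubmx X + rsubmx Y)).

Lemma schw_wigwin : schwartz wigwin.
Proof. by apply: schw_Wig; exact: schw_tens. Qed.

(** A shift of t by x - y in the Wigner integral recentres both packets at the origin; what
    remains is the Wigner transform of the profiles, and the displacement is q. *)
Lemma Wig_packets X Y : Wig (tens (wp G X) (wp G Y)) =
  (fun r => cis (pairphase X Y) * wp wigwin (@qmap R n (row_mx X Y)) r).
Proof.
apply/funext => r; rewrite -(hsubmxK r); set p := lsubmx r; set xi := rsubmx r.
set x := lsubmx X; set a := rsubmx X; set y := lsubmx Y; set b := rsubmx Y.
pose u := p - 2^-1 *: (x + y); pose w := xi - 2^-1 *: (a + b).
have Q1 : lsubmx (@qmap R n (row_mx X Y)) = row_mx (2^-1 *: (x + y)) (2^-1 *: (a + b)).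
  by rewrite /qmap row_mxKl row_mxKl row_mxKr -scale_row_mx -add_row_mx !hsubmxK.
have Q2 : rsubmx (@qmap R n (row_mx X Y)) = row_mx (a - b) (y - x).
  rewrite /qmap row_mxKr row_mxKl row_mxKr /symJinv /symJinv.
  have -> : rsubmx (Y - X) = b - a by rewrite linearB.
  have -> : lsubmx (Y - X) = y - x by rewrite linearB.
  by rewrite opprB.
have E1 : row_mx p xi - row_mx (2^-1 *: (x + y)) (2^-1 *: (a + b)) = row_mx u w.
  by rewrite opp_row_mx add_row_mx.
rewrite [in RHS]/wp Q1 Q2 E1 /wigwin !WigE.
have sI := schw_Wig_integrand p xi (schw_tens (wp_schw X sG) (wp_schw Y sG)).
have sJ := schw_Wig_integrand u w (schw_tens sG sG).
rewrite -(cintegral_shift (x - y) (schw_cintegrable sI)) [RHS]mulrCA -cintegralZr; last first.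
  exact: schw_cintegrable.
apply: eq_cintegral => s; rewrite /tens !row_mxKl !row_mxKr conj_wp /wp -/x -/y -/a -/b.
have -> : p + 2^-1 *: (s + (x - y)) - x = u + 2^-1 *: s.
  by apply/rowP => i; rewrite !mxE; lra.
have -> : p - 2^-1 *: (s + (x - y)) - y = u - 2^-1 *: s.
  by apply/rowP => i; rewrite !mxE; lra.
set A := G _; set B := conjc _.
transitivity ((cis (dotmx (s + (x - y)) xi) * (cis (- dotmx (u + 2^-1 *: s) a) * cis (dotmx (u - 2^-1 *: s) b))) * (A * B)); first by ring.
transitivity ((cis (dotmx s w) * (cis (- dotmx (row_mx u w) (row_mx (a - b) (y - x))) * cis (pairphase X Y))) * (A * B)); last by ring.
rewrite -!cisD; congr (cis _ * _).
rewrite /pairphase -/x -/y -/a -/b dotmx_row_mx (dotmxC w) /w.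
move: (u) (x) (y) (a) (b) (xi) => u' x' y' a' b' xi'.
rewrite !(dotmxDl, dotmxDr, dotmxNl, dotmxNr, dotmxZl, dotmxZr); lra.
Qed.
End WignerPackets.

Section PairKernel.
Variable R : realType.
Local Notation C := R[i].
Local Notation fn N := ('rV[R]_N -> C).

Lemma sm_Bsf_aff1 d d' N (A : 'M[R]_(d, d')) (b : 'rV[R]_d') (F : fn (d' + N)) :
  sm (@Bsf R d' N) F -> sm (@Bsf R d N) (fun z => F (row_mx (lsubmx z *m A + b) (rsubmx z))).
Proof.
move=> sF; pose M : 'M[R]_(d + N, d' + N) := block_mx A 0 0 1%:M.
have E z : row_mx (lsubmx z *m A + b) (rsubmx z) = z *m M + row_mx b 0.
  by rewrite -{3}(hsubmxK z) /M mul_row_block !mulmx0 mulmx1 addr0 add0r add_row_mx addr0.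
apply: (@eq_sm _ _ _ (fun z => F (z *m M + row_mx b 0))); first by move=> z; rewrite E.
apply: (sm_aff _ _ sF); first exact: linclosed_Bsf.
move=> f Bf k; have [C0 [K HK]] := Bf k.
have [CA CA0 HA] := jbr_mulmx A.
exists (`|C0| * (2 * CA * jbr b) ^+ K), K => x y.
rewrite -E row_mxKl row_mxKr; apply: (le_trans (HK _ _)); rewrite -[leRHS]mulrA.
apply: (@le_trans _ _ (`|C0| * jbr (x *m A + b) ^+ K)); first by rewrite ler_wpM2r ?jbrX_ge0 // ler_norm.
rewrite ler_wpM2l // -exprMn lerXn2r ?nnegrE ?jbr_ge0 ?mulr_ge0 ?jbr_ge0 ?(ltW CA0) //.
apply: (le_trans (jbrD _ _)).
have -> : 2 * CA * jbr b * jbr x = 2 * ((CA * jbr x) * jbr b) by ring.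
by rewrite ler_wpM2l // ler_wpM2r ?jbr_ge0.
Qed.

Variables (n : nat) (G : fn n).
Hypothesis sG : schwartz G.
Local Notation E := 'rV[R]_(n + n).

Definition Jmx : 'M[R]_(n + n) := block_mx 0 1%:M (- 1%:M) 0.

Lemma mul_Jmx (v : E) : v *m Jmx = symJinv v.
Proof.
by rewrite -{1}(hsubmxK v) /Jmx mul_row_block !mulmx0 !mulmx1 mulmxN mulmx1 add0r addr0.
Qed.

(** For fixed [Y] the map q is affine in [X], so families of packets composed with q remain
    tame families. *)
Lemma qmap_aff (X Y : E) : @qmap R n (row_mx X Y) =
  X *m row_mx (2^-1)%:M (- Jmx) + @qmap R n (row_mx 0 Y).
Proof.
rewrite mul_mx_row mul_mx_scalar mulmxN mul_Jmx /qmap !row_mxKl !row_mxKr add_row_mx.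
congr row_mx; first by rewrite scalerDr add0r.
by rewrite -!mul_Jmx mulmxBl subr0 addrC.
Qed.

Lemma sm_cis_pairphase Y : sm (@Bpoly R (n + n)) (fun X => cis (pairphase X Y)).
Proof.
pose q := 2^-1 *: row_mx (rsubmx Y) (- lsubmx Y).
apply: (@eq_sm _ _ _ (fun X => cis (dotmx (X *m selL R n n) (X *m (2^-1 *: selR R n n))) *
   cis (dotmx X q + - (2^-1 * dotmx (lsubmx Y) (rsubmx Y))))).
  move=> X; rewrite -cisD; congr cis; rewrite mul_selL -scalemxAr mul_selR /pairphase.
  rewrite -[X in dotmx X q]hsubmxK /q scale_row_mx dotmx_row_mx.
  by rewrite scalerN !(dotmxDl, dotmxDr, dotmxNl, dotmxNr, dotmxZl, dotmxZr) (dotmxC (rsubmx X)); lra.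
by apply: sm_poly_mul; [exact: sm_cis_dotmx|exact: sm_cis_lin].
Qed.

Lemma sm_Wig_family Y : sm (@Bsf R (n + n) (n + n))
  (fun z => Wig (tens (wp G (lsubmx z)) (wp G Y)) (rsubmx z)).
Proof.
pose F (z : 'rV[R]_((n + n) + (n + n) + (n + n))) := wp (wigwin G) (lsubmx z) (rsubmx z).
have sF := wp_joint (schw_wigwin sG).
apply: (@eq_sm _ _ _ (fun z => F (row_mx (lsubmx z *m row_mx (2^-1)%:M (- Jmx) + @qmap R n (row_mx 0 Y)) (rsubmx z)) *
   cis (pairphase (lsubmx z) Y))).
  by move=> z; rewrite -qmap_aff Wig_packets // mulrC /F row_mxKl row_mxKr.
apply: sm_sf_poly_mul; first exact: sm_Bsf_aff1.
have := sm_poly_aff (selL R (n + n) (n + n)) 0 (sm_cis_pairphase Y); congr sm.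
by apply/funext => z; rewrite addr0 mul_selL.
Qed.

(** This lets the resolution of the identity by packets pass inside the Wigner transform,
    in the proof of [Kt_resolution]. *)
Lemma Wig_tempered (g : fn n) (r : E) : schwartz g -> tempered (fun f : fn n => Wig (tens f g) r).
Proof.
move=> sg; pose h t := cis (dotmx t (rsubmx r)) * conjc (g (lsubmx r - 2^-1 *: t)).
have WE f : Wig (tens f g) r = cintegral (fun t => h t * f (lsubmx r + 2^-1 *: t)).
  rewrite -{1}(hsubmxK r) WigE; apply: eq_cintegral => t.
  by rewrite /tens row_mxKl row_mxKr /h; ring.
have sg' : schwartz (fun t => g (lsubmx r - 2^-1 *: t)).
  have h0 : - (2^-1 : R) != 0 by rewrite oppr_eq0 invr_eq0 pnatr_eq0.
  have ug : ((- 2^-1)%:M : 'M[R]_n) \in unitmx by rewrite unitmxE det_scalar unitfE expf_neq0.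
  have := schw_aff (lsubmx r) ug sg; congr schwartz; apply/funext => t.
  by rewrite mul_mx_scalar scaleNr addrC.
have sh : schwartz h.
  apply: schw_mul_poly; last exact: schw_conj.
  apply: (@eq_sm _ _ _ (fun t => cis (dotmx t (rsubmx r) + 0))); last exact: sm_cis_lin.
  by move=> t; rewrite addr0.
have sf' f : schwartz f -> schwartz (fun t => f (lsubmx r + 2^-1 *: t)).
  move=> sf; have h0 : (2^-1 : R) != 0 by rewrite invr_eq0 pnatr_eq0.
  have ug : ((2^-1)%:M : 'M[R]_n) \in unitmx by rewrite unitmxE det_scalar unitfE expf_neq0.
  have := schw_aff (lsubmx r) ug sf; congr schwartz; apply/funext => t.
  by rewrite mul_mx_scalar addrC.
split.
  move=> c f1 f2 s1 s2; rewrite !WE -cintegralZ; last first.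
    by apply: schw_cintegrable; apply: schw_mul => //; exact: sf'.
  rewrite -cintegralD.
  - by apply: eq_cintegral => t; ring.
  - by apply: cintegrableZ; apply: schw_cintegrable; apply: schw_mul => //; exact: sf'.
  by apply: schw_cintegrable; apply: schw_mul => //; exact: sf'.
exists 0%N, (rI (fun t => normc (h t))) => f sf; rewrite WE [leRHS]mulrC -rIZ; last exact: schw_rint.
apply: le_normc_cintegral.
- by apply: schw_cintegrable; apply: schw_mul => //; exact: sf'.
- by apply: rintZ; exact: schw_rint.
move=> t; rewrite normcM mulrC ler_wpM2r ?normc_ge0 //.
by have := schwartz_norm_ub (s := [::]) (lsubmx r + 2^-1 *: t) sf (leq0n 0); rewrite cpderiv_nil expr0 mul1r.
Qed.

Variable a : fn (n + n) -> C.
Hypothesis ta : tempered a.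

(** The matrix element of a^w between two packets. *)
Definition Kt (X Y : E) : C := a (fun r => ((2 * pi) ^- n)%:C * Wig (tens (wp G X) (wp G Y)) r).

Lemma schw_Wig_packets X Y : schwartz (Wig (tens (wp G X) (wp G Y))).
Proof. by apply: schw_Wig; apply: schw_tens; exact: wp_schw. Qed.

(** The matrix elements of a^w are, up to phase, the packet transform of the symbol at
    q(X, Y); this is where the map q of the statement comes from. *)
Lemma KtE X Y : Kt X Y = ((2 * pi) ^- n)%:C * (cis (pairphase X Y) * a (wp (wigwin G) (@qmap R n (row_mx X Y)))).
Proof.
rewrite /Kt tempZ //; last exact: schw_Wig_packets.
by rewrite Wig_packets // tempZ //; apply: wp_schw; exact: schw_wigwin.
Qed.

(** The kernel reproduces itself: its columns are packet transforms. Consequently so is any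
    superposition of the columns. *)
Lemma Kt_resolution Z Y :
  cintegral (fun X => ip (wp G Z) (wp G X) * Kt X Y) = kap R n * ip G G * Kt Z Y.
Proof.
have sZ := wp_schw Z sG; have sW := schw_Wig_packets Z Y.
set c := kap R n * ip G G.
have H r : c * Wig (tens (wp G Z) (wp G Y)) r = cintegral (fun X => ip (wp G Z) (wp G X) *
    (fun z : 'rV[R]_((n + n) + (n + n)) => Wig (tens (wp G (lsubmx z)) (wp G Y)) (rsubmx z)) (row_mx X r)).
  rewrite /c (temp_resolution sG (Wig_tempered r (wp_schw Y sG)) sZ).
  by apply: eq_cintegral => X; rewrite row_mxKl row_mxKr.
have sf : schwartz (fun r => c * Wig (tens (wp G Z) (wp G Y)) r) by exact: schw_scale.
pose v X := a (fun r => (fun z : 'rV[R]_((n + n) + (n + n)) => Wig (tens (wp G (lsubmx z)) (wp G Y)) (rsubmx z)) (row_mx X r)).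
have e : a (fun r => c * Wig (tens (wp G Z) (wp G Y)) r) = cintegral (fun X => ip (wp G Z) (wp G X) * v X).
  exact: (temp_exchange (ccont_ip_wp sG sZ) (Brd_ip_wp sG sZ) (sm_Wig_family Y) H ta sf).
have Ec X : Kt X Y = ((2 * pi) ^- n)%:C * a (Wig (tens (wp G X) (wp G Y))).
  exact: (tempZ ta _ (schw_Wig_packets X Y)).
have vE X : a (Wig (tens (wp G X) (wp G Y))) = v X.
  have e1 : Wig (tens (wp G X) (wp G Y)) =
      (fun r => (fun z : 'rV[R]_((n + n) + (n + n)) => Wig (tens (wp G (lsubmx z)) (wp G Y)) (rsubmx z)) (row_mx X r)).
    by apply/funext => r; rewrite row_mxKl row_mxKr.
  exact: (congr1 a e1).
rewrite (tempZ ta _ sW) in e.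
rewrite Ec mulrCA e -cintegralZ.
  by apply: eq_cintegral => X; rewrite Ec vE mulrCA.
have cv : ccont v.
  have [M [K [M0 HM]]] := temp_family_lip ta (sm_Wig_family Y).
  exact: (@lip_ccont _ _ _ M K HM).
have [M [K [M0 HM]]] := temp_family_bound ta (sm_Wig_family Y).
have [M1 M10 HM1] := Brd_dec ((n + n) + (n + n) + K) (Brd_ip_wp sG sZ).
apply: (@cintegrable_jbr _ _ _ (M1 * M)).
  by apply: ccont_cmeas; apply: ccont_mul; first exact: ccont_ip_wp.
move=> X; rewrite normcM; apply: (le_trans (ler_pM (normc_ge0 _) (normc_ge0 _) (HM1 X) (HM X))).
rewrite (exprD _ _ K) le_eqVlt; apply/orP; left; apply/eqP; field.
by rewrite !gt_eqF ?jbrX_gt0.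
Qed.
End PairKernel.

(** * The image of a distribution *)

Section ImageDistribution.
Variable R : realType.
Local Notation C := R[i].
Local Notation fn N := ('rV[R]_N -> C).
Variables (n : nat) (g : fn n) (a : fn (n + n) -> C) (u : fn n -> C).
Hypotheses (sg : schwartz g) (g0 : ip g g != 0) (ta : tempered a) (tu : tempered u).
Local Notation E := 'rV[R]_(n + n).
Variables (Mr b : 'M[R]_(n + n)).
Hypotheses (uM : Mr \in unitmx) (ub : b \in unitmx).
Let L := [set map_mx intr z *m b | z in [set: 'rV[int]_(n + n)]].
Variables (k1 : E -> E -> R) (k2 : E -> R) (M1 M2 : nat).
Hypotheses (k10 : forall x y, 0 <= k1 x y) (k20 : forall y, 0 <= k2 y).
Hypothesis HK : forall X Y al be, L al -> L be ->
  normc (Kt g a X Y) <= jbr (X - al) ^+ M1 * jbr (Y - be) ^+ M1 * k1 al be.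
Hypothesis Hu : forall Y be, L be -> normc (u (wp g Y)) <= jbr (Y - be) ^+ M2 * k2 be.
Hypothesis Hs : forall al, L al -> csummable L (fun be => (k1 al be * k2 be)%:C : C).

Let A := Mr *m invmx b.
Let uA : A \in unitmx. Proof. by rewrite unitmx_mul uM unitmx_inv. Qed.
Let phi al z := k1 al (fl b A z) * k2 (fl b A z).
Let igr X z := Kt g a X (z *m Mr) * u (wp g (z *m Mr)).

Let phi0 al z : 0 <= phi al z. Proof. exact: mulr_ge0. Qed.

Let phi_int al : L al -> rint (phi al) /\
  rI (phi al) <= cvol A * normc (csum L (fun be => (k1 al be * k2 be)%:C : C)).
Proof.
move=> Lal; have [ic Ic] := csum_cintegral ub uA (Hs Lal).
have [ir _] := (cintegrableP _).1 ic.
have e : (fun z => complex.Re ((k1 al (fl b A z) * k2 (fl b A z))%:C : C)) = phi al by [].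
split; first by rewrite -e.
have -> : rI (phi al) = complex.Re (cintegral (fun z => (k1 al (fl b A z) * k2 (fl b A z))%:C : C)) by [].
rewrite Ic; set s := csum _ _.
have -> : complex.Re ((cvol A)%:C * s) = cvol A * complex.Re s by rewrite ReM mul0r subr0.
by apply: ler_wpM2l; [exact: cvol_ge0|exact: (le_trans (ler_norm _) (Re_le_normc s))].
Qed.

Let igr_bound : exists2 K, 0 <= K & forall X al z, L al ->
  normc (igr X z) <= K * jbr (X - al) ^+ M1 * phi al z.
Proof.
have [K K0 HKf] := jbr_fl b A.
exists (K ^+ (M1 + M2)) => [|X al z Lal]; first by rewrite exprn_ge0 // ltW.
have Lf : L (fl b A z) by exact: lat_in.
have Y1 : jbr (z *m Mr - fl b A z) <= K.
  have [_] := HKf (z *m Mr) z; rewrite /A mulmxA mulmxKV // subrr.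
  by rewrite jbr0 mulr1.
rewrite /igr normcM; apply: (le_trans (ler_pM (normc_ge0 _) (normc_ge0 _) (HK X (z *m Mr) Lal Lf) (Hu (z *m Mr) Lf))).
set y := jbr (z *m Mr - _) in Y1 *; set x := jbr (X - al) ^+ M1.
have x0 : 0 <= x by exact: jbrX_ge0.
have y0 : 0 <= y by exact: jbr_ge0.
have -> : x * y ^+ M1 * k1 al (fl b A z) * (y ^+ M2 * k2 (fl b A z)) = y ^+ (M1 + M2) * x * phi al z.
  by rewrite exprD /phi; ring.
by rewrite ler_wpM2r // ler_wpM2r // lerXn2r ?nnegrE // ltW.
Qed.

Let L0 : L 0. Proof. exact: lat0. Qed.

Let Kt_cont : ccont (fun Z : 'rV[R]_((n + n) + (n + n)) => Kt g a (lsubmx Z) (rsubmx Z *m Mr)).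
Proof.
have [ca _] := temp_packets (schw_wigwin sg) ta.
pose Y (Z : 'rV[R]_((n + n) + (n + n))) := rsubmx Z *m Mr.
have cY : continuous Y.
  exact: (@cont_comp _ _ _ _ (fun z : E => z *m Mr) (@cont_rsubmx _ _ _) (@cont_mulmx _ _ _ Mr)).
have cX := @cont_lsubmx R (n + n) (n + n).
apply: (@eq_ccont _ _ (fun Z => ((2 * pi) ^- n)%:C * (cis (pairphase (lsubmx Z) (Y Z)) * a (wp (wigwin g) (@qmap R n (row_mx (lsubmx Z) (Y Z))))))).
  by move=> Z; rewrite KtE.
apply: ccont_mul; first exact: ccont_cst.
apply: ccont_mul.
  apply: ccont_cis; apply: cont_dotmx.
    apply: cont_addv; first exact: (@cont_comp _ _ _ _ (@lsubmx R 1 n n) cX (@cont_lsubmx _ _ _)).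
    by apply: cont_oppv; exact: (@cont_comp _ _ _ _ (@lsubmx R 1 n n) cY (@cont_lsubmx _ _ _)).
  apply: cont_scalev; apply: cont_addv.
    exact: (@cont_comp _ _ _ _ (@rsubmx R 1 n n) cX (@cont_rsubmx _ _ _)).
  exact: (@cont_comp _ _ _ _ (@rsubmx R 1 n n) cY (@cont_rsubmx _ _ _)).
apply: (ccont_comp (f := fun Z => @qmap R n (row_mx (lsubmx Z) (Y Z))) _ ca).
have qE Z : @qmap R n (row_mx (lsubmx Z) (Y Z)) = lsubmx Z *m row_mx (2^-1)%:M (- Jmx R n) + Y Z *m row_mx (2^-1)%:M (Jmx R n).
  rewrite qmap_aff; congr (_ + _); rewrite /qmap row_mxKl row_mxKr add0r subr0 mul_mx_row mul_mx_scalar.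
  by rewrite mul_Jmx.
rewrite (_ : (fun Z => _) = (fun Z => lsubmx Z *m row_mx (2^-1)%:M (- Jmx R n) + Y Z *m row_mx (2^-1)%:M (Jmx R n))); last exact/funext.
apply: cont_addv.
  exact: (@cont_comp _ _ _ _ (fun x : E => x *m row_mx (2^-1)%:M (- Jmx R n)) cX (@cont_mulmx _ _ _ _)).
exact: (@cont_comp _ _ _ _ (fun x : E => x *m row_mx (2^-1)%:M (Jmx R n)) cY (@cont_mulmx _ _ _ _)).
Qed.

Let igr_cont : ccont (fun Z : 'rV[R]_((n + n) + (n + n)) => igr (lsubmx Z) (rsubmx Z)).
Proof.
have [cu _] := temp_packets sg tu.
apply: ccont_mul; first exact: Kt_cont.
apply: (ccont_comp (f := fun Z : 'rV[R]_((n + n) + (n + n)) => rsubmx Z *m Mr) _ cu).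
exact: (@cont_comp _ _ _ _ (fun z : E => z *m Mr) (@cont_rsubmx _ _ _) (@cont_mulmx _ _ _ Mr)).
Qed.

Lemma image_integrable X : cintegrable (igr X).
Proof.
have [K K0 HKi] := igr_bound; have [ip0 _] := phi_int L0.
have ch : ccont (igr X).
  have c1 : continuous (fun z : E => row_mx X z) by apply: cont_row_mx; [exact: cont_cstv|exact: cont_id].
  apply: (@eq_ccont _ _ (fun z => igr (lsubmx (row_mx X z)) (rsubmx (row_mx X z)))).
    by move=> z; rewrite row_mxKl row_mxKr.
  exact: (ccont_comp c1 igr_cont).
apply: (cint_dom (ccont_cmeas ch) (rintZ (K * jbr (X - 0) ^+ M1) ip0)) => z.
exact: HKi.
Qed.

(** The packet transform of the distribution to be constructed; the variable of integration
    is the coordinate [z] of C^n. *)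
Definition image X : C := cintegral (igr X).

(** On each cell the two bounds are evaluated at the lattice point that labels the cell; the
    loss is a constant, and the integral becomes the lattice sum of the hypothesis. *)
Lemma image_bound : exists2 K, 0 <= K & forall X al, L al ->
  normc (image X) <= K * jbr (X - al) ^+ M1 * normc (csum L (fun be => (k1 al be * k2 be)%:C : C)).
Proof.
have [K K0 HKi] := igr_bound; exists (K * cvol A) => [|X al Lal]; first by rewrite mulr_ge0 // cvol_ge0.
have [ip0 Ip0] := phi_int Lal.
have ib := rintZ (K * jbr (X - al) ^+ M1) ip0.
apply: (le_trans (le_normc_cintegral (image_integrable X) ib (fun z => HKi X al z Lal))).
rewrite rIZ //; set s := normc _.
have -> : K * cvol A * jbr (X - al) ^+ M1 * s = K * jbr (X - al) ^+ M1 * (cvol A * s) by ring.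
by rewrite ler_wpM2l // mulr_ge0 // jbrX_ge0.
Qed.

Lemma image_cont : ccont image.
Proof.
have [K K0 HKi] := igr_bound; have [ip0 _] := phi_int L0.
apply: (@eq_ccont _ _ (fun X => cintegral (fun z => (fun Z : 'rV[R]_((n + n) + (n + n)) => igr (lsubmx Z) (rsubmx Z)) (row_mx X z)))).
  by move=> X; apply: eq_cintegral => z; rewrite row_mxKl row_mxKr.
apply: (ccont_cintegral igr_cont (w := fun X => K * jbr X ^+ M1) (h := phi 0)) => //.
  by apply: cont_mul; [exact: cont_cst|apply: cont_exp; exact: continuous_jbr].
by move=> X z; rewrite row_mxKl row_mxKr; have := HKi X 0 z L0; rewrite subr0.
Qed.

Let image_poly : exists2 K, 0 <= K & forall X, normc (image X) <= K * jbr X ^+ M1.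
Proof.
have [K K0 H] := image_bound; exists (K * normc (csum L (fun be => (k1 0 be * k2 be)%:C : C))).
  by rewrite mulr_ge0 // normc_ge0.
by move=> X; have := H X 0 L0; rewrite subr0 mulrAC.
Qed.

Let c0 := kap R n * ip g g.
Let c00 : c0 != 0. Proof. by apply: mulf_neq0; [exact: kap_neq0|exact: g0]. Qed.

(** The only candidate: the resolution of the identity forces this formula. *)
Definition imdist : fn n -> C := fun f => c0^-1 * cintegral (fun X => image X * ip f (wp g X)).

Let d := ((n + n) + (n + n))%N.

Let imdist_int f : schwartz f -> cintegrable (fun X => image X * ip f (wp g X)).
Proof.
move=> sf; have [K K0 H] := image_poly.
have [M M0 HM] := Brd_dec (M1 + d) (Brd_ip_wp sg sf).
apply: (@cintegrable_jbr _ _ _ (K * M)).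
  by apply: ccont_cmeas; apply: ccont_mul; [exact: image_cont|exact: ccont_ip_wp].
move=> X; rewrite normcM; apply: (le_trans (ler_pM (normc_ge0 _) (normc_ge0 _) (H X) (HM X))).
rewrite (exprD _ M1 d) le_eqVlt; apply/orP; left; apply/eqP; rewrite /d; field.
by rewrite !gt_eqF ?jbrX_gt0.
Qed.

Lemma imdist_tempered : tempered imdist.
Proof.
split.
  move=> k f1 f2 s1 s2; rewrite /imdist mulrCA -mulrDr; congr (_ * _).
  rewrite -cintegralZ; last exact: imdist_int.
  rewrite -cintegralD; [|apply: cintegrableZ; exact: imdist_int|exact: imdist_int].
  apply: eq_cintegral => X; rewrite /ip.
  have i1 f : schwartz f -> cintegrable (fun p => f p * conjc (wp g X p)).
    by move=> sf; apply: schw_cintegrable; apply: schw_mul => //; apply: schw_conj; exact: wp_schw.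
  have -> : cintegral (fun p => (k * f1 p + f2 p) * conjc (wp g X p)) =
     k * cintegral (fun p => f1 p * conjc (wp g X p)) + cintegral (fun p => f2 p * conjc (wp g X p)).
    rewrite -cintegralZ; last exact: i1.
    rewrite -cintegralD; [|apply: cintegrableZ; exact: i1|exact: i1].
    by apply: eq_cintegral => p; ring.
  by ring.
have [K K0 H] := image_poly.
have [Ks [M [M0 HM]]] := stft_decay sg (M1 + d).
pose W := rI (fun X : E => (jbr X ^+ d)^-1).
exists Ks, (normc c0^-1 * (K * M * W)) => f sf.
rewrite /imdist (normcM c0^-1); set s := schwartz_norm Ks f.
rewrite -[leRHS]mulrA; apply: ler_wpM2l; first exact: normc_ge0.
have -> : K * M * W * s = (K * M * s) * W by ring.
rewrite /W -rIZ; last exact: rint_jbr.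
apply: le_normc_cintegral; [exact: imdist_int|apply: rintZ; exact: rint_jbr|].
move=> X; rewrite normcM.
have h : normc (ip f (wp g X)) <= M * s * (jbr X ^+ (M1 + d))^-1.
  by rewrite ler_pdivlMr ?jbrX_gt0 //; exact: HM.
apply: (le_trans (ler_pM (normc_ge0 _) (normc_ge0 _) (H X) h)).
rewrite (exprD _ M1 d) le_eqVlt; apply/orP; left; apply/eqP; rewrite /d; field.
by rewrite !gt_eqF ?jbrX_gt0.
Qed.

(** The reproducing property [Kt_resolution] under the integral that defines [image]. *)
Lemma imdist_wp Z : imdist (wp g Z) = image Z.
Proof.
have sZ := wp_schw Z sg; rewrite /imdist.
have [K K0 HKi] := igr_bound; have [ip0 _] := phi_int L0.
have [M M0 HM] := Brd_dec (M1 + d) (Brd_ip_wp sg sZ).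
suff -> : cintegral (fun X => image X * ip (wp g Z) (wp g X)) = cintegral (fun z => c0 * igr Z z).
  by rewrite cintegralZ ?mulKf //; exact: image_integrable.
apply: (@fubini_eq _ _ _ (fun X z => igr X z * ip (wp g Z) (wp g X)) (fun X => K * M * (jbr X ^+ d)^-1) (phi 0)).
- by apply: rintZ; exact: rint_jbr.
- exact: ip0.
- apply: ccont_mul; first exact: igr_cont.
  exact: (ccont_comp (@cont_lsubmx _ _ _) (ccont_ip_wp sg sZ)).
- move=> X z; rewrite normcM.
  have h1 := HKi X 0 z L0; rewrite subr0 in h1.
  apply: (le_trans (ler_pM (normc_ge0 _) (normc_ge0 _) h1 (HM X))).
  rewrite (exprD _ M1 d) le_eqVlt; apply/orP; left; apply/eqP; rewrite /d; field.
  by rewrite !gt_eqF ?jbrX_gt0.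
- by move=> X; rewrite cintegralZr //; exact: image_integrable.
move=> z; rewrite /igr mulrA -(Kt_resolution sg ta) -cintegralZr; last first.
  apply: (@cintegrable_jbr _ _ _ (M * (jbr (z *m Mr) ^+ M1 * k1 0 0))).
    apply: ccont_cmeas; apply: ccont_mul; first exact: ccont_ip_wp.
    have c1 : continuous (fun X : E => row_mx X z) by apply: cont_row_mx; [exact: cont_id|exact: cont_cstv].
    apply: (@eq_ccont _ _ (fun X => Kt g a (lsubmx (row_mx X z)) (rsubmx (row_mx X z) *m Mr))).
      by move=> X; rewrite row_mxKl row_mxKr.
    exact: (ccont_comp c1 Kt_cont).
  move=> X; rewrite normcM.
  have h := HK X (z *m Mr) L0 L0; rewrite !subr0 in h.
  apply: (le_trans (ler_pM (normc_ge0 _) (normc_ge0 _) (HM X) h)).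
  rewrite (exprD _ M1 d) le_eqVlt; apply/orP; left; apply/eqP; rewrite /d; field.
  by rewrite !gt_eqF ?jbrX_gt0.
by apply: eq_cintegral => X; ring.
Qed.
End ImageDistribution.

(** * The effective kernel *)

Section EffectiveKernel.
Variables (R : realType) (n : nat).
Local Notation C := R[i].
Local Notation fn N := ('rV[R]_N -> C).
Local Notation E := 'rV[R]_(n + n).

(** The trace formula [cintegral_Wig] shows that the Wigner transform of a nonzero packet
    does not vanish identically. *)
Lemma ip_wigwin (g : fn n) : schwartz g -> ip g g != 0 -> ip (wigwin g) (wigwin g) != 0.
Proof.
move=> sg; apply: contra => /eqP h; have z := ip_eq0 (schw_wigwin sg) h.
have e := cintegral_Wig (schw_tens sg sg).
have ip_tens : cintegral (fun p => tens g g (row_mx p p)) = ip g g.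
  by apply: eq_cintegral => p; rewrite /tens row_mxKl row_mxKr.
rewrite (_ : Wig _ = fun=> 0) ?cintegral0 ?ip_tens in e; last exact/funext.
by move/esym/eqP: e; rewrite mulf_eq0 (negbTE (kap_neq0 R n)).
Qed.

(** q is linear, and its two arguments are displaced separately. *)
Lemma jbr_qmap : exists2 K : R, 0 <= K & forall X Y al be : E,
  jbr (qmap (row_mx X Y) - qmap (row_mx al be)) <= K * (jbr (X - al) * jbr (Y - be)).
Proof.
have qE (X Y : E) : qmap (row_mx X Y) = X *m row_mx (2^-1)%:M (- Jmx R n) + Y *m row_mx (2^-1)%:M (Jmx R n).
  rewrite qmap_aff; congr (_ + _); rewrite /qmap row_mxKl row_mxKr add0r subr0 mul_mx_row mul_mx_scalar.
  by rewrite mul_Jmx.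
have [K1 K10 H1] := jbr_mulmx (row_mx (2^-1)%:M (- Jmx R n)).
have [K2 K20 H2] := jbr_mulmx (row_mx (2^-1)%:M (Jmx R n)).
exists (2 * (K1 * K2)) => [|X Y al be]; first by rewrite !mulr_ge0 // ltW.
rewrite !qE opprD addrACA -!mulmxBl; apply: (le_trans (jbrD _ _)).
rewrite -[leRHS]mulrA ler_wpM2l //.
apply: (le_trans (ler_pM (jbr_ge0 _) (jbr_ge0 _) (H1 _) (H2 _))).
by rewrite mulrACA.
Qed.

Variable P : quad_form R n.
Hypothesis bP : bargmann_phase P.
Local Notation bg := (bgauss P).
Let sg : schwartz bg. Proof. exact: schw_bgauss. Qed.

Lemma ccont_pi i : ccont (fun r : E => (pi_kappaT P r) 0 i).
Proof.
have e r : (pi_kappaT P r) 0 i = (r *m kapmx P) 0 (lshift n i) +i* (r *m kapmx P) 0 (rshift n i).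
  by rewrite -[pi_kappaT P r]of_CnK -mul_kapmx mxE.
have h j : continuous (fun r : E => (r *m kapmx P) 0 j).
  exact: (@cont_comp _ _ _ (fun r : E => r *m kapmx P) (fun z : E => z 0 j) (@cont_mulmx _ _ _ _) (@continuous_coord _ _ j)).
by apply: (eq_ccont (fun r => esym (e r))); split; exact: h.
Qed.

Lemma ccont_dotmx (T : topologicalType) (f g : T -> 'rV[C]_n) :
  (forall i, ccont (fun t => f t 0 i)) -> (forall i, ccont (fun t => g t 0 i)) ->
  ccont (fun t => dotmx (f t) (g t)).
Proof. by move=> cf cg; apply: ccont_sum => i; apply: ccont_mul. Qed.

Lemma ccont_mxC (T : topologicalType) (f : T -> 'rV[C]_n) (A : 'M[C]_n) :
  (forall i, ccont (fun t => f t 0 i)) -> forall i, ccont (fun t => (f t *m A) 0 i).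
Proof.
move=> cf i; apply: (@eq_ccont _ _ (fun t => \sum_j f t 0 j * A j i)).
  by move=> t; rewrite [RHS]mxE.
by apply: ccont_sum => j; apply: ccont_mul => //; exact: ccont_cst.
Qed.

Lemma ccont_bphase : ccont (fun r : E => cis (bphase P r)).
Proof.
have cx : forall i, ccont (fun r : E => (pi_kappaT P r) 0 i) by exact: ccont_pi.
have cy i : ccont (fun r : E => cplx_vec (lsubmx r) 0 i).
  apply: (@eq_ccont _ _ (fun r : E => (r 0 (lshift n i))%:C)); first by move=> r; rewrite !mxE.
  by apply: ccont_real; exact: continuous_coord.
apply: ccont_cis; rewrite /bphase /phase.
suff [] : ccont (fun r : E => phase P (pi_kappaT P r) (cplx_vec (lsubmx r))) by [].
apply: ccont_add; last first.
  by apply: ccont_mul; [exact: ccont_cst|apply: ccont_dotmx => //; exact: ccont_mxC].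
apply: ccont_add; last by apply: ccont_dotmx => //; exact: ccont_mxC.
by apply: ccont_mul; [exact: ccont_cst|apply: ccont_dotmx => //; exact: ccont_mxC].
Qed.

(** The weight exp(- Phi) cancels exactly the size of the Bargmann kernel. *)
Lemma wbargmannE (c : R) (u : fn n -> C) r : tempered u ->
  wbargmann P c u (pi_kappaT P r) = c%:C * cis (bphase P r) * u (wp bg r).
Proof.
move=> tu; have sr := wp_schw r sg.
rewrite /wbargmann /bargmann barg_kernelE // (tempZ tu) //.
have e : (expR (- Phi P (pi_kappaT P r)))%:C * (expR (Phi P (pi_kappaT P r)))%:C = 1 :> C.
  by rewrite -rmorphM -expRD addNr expR0.
set p := (expR (- _))%:C in e *; set q := (expR _)%:C in e *.
by rewrite -[RHS]mul1r -e; ring.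
Qed.

Lemma cexp_pair (A B : C) :
  cexp ('i%C * (A - conjc B)) = cexp ('i%C * A) * conjc (cexp ('i%C * B)).
Proof.
have -> : 'i%C * (A - conjc B) = 'i%C * A + conjc ('i%C * B).
  by rewrite rmorphM /=; apply: ReIm_eq; rewrite ?ReD ?ImD ?ReM ?ImM /=; ring.
by rewrite cexpD conj_cexp.
Qed.

Lemma conj_mulr (r : R) (z w : C) : conjc (z * r%:C * w) = conjc z * r%:C * conjc w.
Proof. by rewrite !rmorphM /= oppr0. Qed.

Let regroup (z1 z2 z3 z4 z5 w1 w2 : C) :
  z5 * (z1 * z2 * w1 * (z3 * z4 * w2)) = z1 * z2 * (z3 * z4) * (z5 * (w1 * w2)).
Proof. by ring. Qed.

Let kernel_at X y : barg_kernel P (pi_kappaT P X) y =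
  cis (bphase P X) * (expR (Phi P (pi_kappaT P X)))%:C * wp bg X y.
Proof. by rewrite barg_kernelE. Qed.

Lemma weyl_dist_packets (a : fn (n + n) -> C) X Y : tempered a ->
  weyl_dist_kernel a (fun p => cexp ('i%C * (phase P (pi_kappaT P X) (cplx_vec (lsubmx p)) -
    conjc (phase P (pi_kappaT P Y) (cplx_vec (rsubmx p)))))) =
  cis (bphase P X) * (expR (Phi P (pi_kappaT P X)))%:C *
    (conjc (cis (bphase P Y)) * (expR (Phi P (pi_kappaT P Y)))%:C) * Kt bg a X Y.
Proof.
move=> ta; have sX := wp_schw X sg; have sY := wp_schw Y sg.
rewrite /weyl_dist_kernel /Kt -(tempZ ta); last first.
  by apply: schw_scale; exact: schw_Wig_packets.
congr a; apply/funext => r; rewrite [RHS]mulrCA; congr (_ * _).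
rewrite -[r in RHS]hsubmxK WigE -cintegralZ; last first.
  exact: (schw_cintegrable (schw_Wig_integrand _ _ (schw_tens sX sY))).
apply: eq_cintegral => t; rewrite row_mxKl row_mxKr cexp_pair /tens row_mxKl row_mxKr.
rewrite -/(barg_kernel P (pi_kappaT P X) _).
rewrite -/(barg_kernel P (pi_kappaT P Y) _).
rewrite [X in _ * (X * conjc _) = _]kernel_at [X in _ * (_ * conjc X) = _]kernel_at.
rewrite (conj_mulr (expR (Phi P (pi_kappaT P Y))) (cis (bphase P Y))).
exact: regroup.
Qed.

Let cancel_weights (p q eX eY k1 k2 k3 k : C) : p * eX = 1 -> q * eY = 1 ->
  p * (k * (k1 * eX * (k2 * eY) * k3)) * q = k * (k1 * k2) * k3.
Proof.
move=> h1 h2; rewrite -[RHS]mul1r -[1]mulr1 -{1}h1 -h2; ring.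
Qed.

(** The effective kernel is the matrix element between packets, up to unimodular factors. *)
Lemma KeffE (c : R) (a : fn (n + n) -> C) X Y : tempered a ->
  Keff P c a (pi_kappaT P X) (pi_kappaT P Y) =
  (c ^+ 2)%:C * (cis (bphase P X) * conjc (cis (bphase P Y))) * Kt bg a X Y.
Proof.
move=> ta; rewrite /Keff /Kbar weyl_dist_packets //.
by apply: cancel_weights; rewrite -rmorphM -expRD addNr expR0.
Qed.

Let unit_cancel (k c k1 k2 k3 K U : C) : k3 * k2 = 1 ->
  k * (k1 * k3) * K * (c * k2 * U) = c * k * k1 * (K * U).
Proof. by move=> h; rewrite -[RHS]mulr1 -[X in _ = _ * X]h; ring. Qed.

Lemma Keff_wbargmann (c : R) (a : fn (n + n) -> C) (u : fn n -> C) X Y : tempered a -> tempered u ->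
  Keff P c a (pi_kappaT P X) (pi_kappaT P Y) * wbargmann P c u (pi_kappaT P Y) =
  (c ^+ 3)%:C * cis (bphase P X) * (Kt bg a X Y * u (wp bg Y)).
Proof.
move=> ta tu; rewrite KeffE // wbargmannE //.
have e : conjc (cis (bphase P Y)) * cis (bphase P Y) = 1 by rewrite conj_cis -cisD addNr cis0.
rewrite (_ : (c ^+ 3)%:C = c%:C * (c ^+ 2)%:C); first exact: unit_cancel e.
by rewrite -rmorphM exprS.
Qed.

(** The bound at one lattice point of the doubled phase space separates into bounds at
    [al] and [be], because the bracket of q(X, Y) is controlled by a product. *)
Lemma Kt_bound (a : fn (n + n) -> C) M (k : 'rV[R]_((n + n) + (n + n)) -> R) (Lh : set 'rV[R]_((n + n) + (n + n))) :
  tempered a ->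
  (forall Z g, Lh g -> normc (a (wp (wigwin bg) Z)) <= jbr (Z - g) ^+ M * k g) ->
  (forall g, 0 <= k g) ->
  exists2 K : R, 0 <= K & forall X Y al be, Lh (qmap (row_mx al be)) ->
    normc (Kt bg a X Y) <= jbr (X - al) ^+ M * jbr (Y - be) ^+ M * (K * k (qmap (row_mx al be))).
Proof.
move=> ta H k0; have [Kq Kq0 Hq] := jbr_qmap.
have p0 : 0 <= (2 * pi : R) ^- n by rewrite invr_ge0 exprn_ge0 // mulr_ge0 // pi_ge0.
exists ((2 * pi) ^- n * Kq ^+ M) => [|X Y al be Lq]; first by rewrite mulr_ge0 // exprn_ge0.
rewrite (KtE sg ta) 2!normcM normc_cis mul1r normcR ger0_norm //.
have h := H (qmap (row_mx X Y)) _ Lq.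
have hj : jbr (qmap (row_mx X Y) - qmap (row_mx al be)) ^+ M <= Kq ^+ M * (jbr (X - al) ^+ M * jbr (Y - be) ^+ M).
  rewrite -!exprMn lerXn2r ?nnegrE ?jbr_ge0 //.
  by apply: mulr_ge0 => //; apply: mulr_ge0; exact: jbr_ge0.
set kq := k _ in h *; set A := jbr (X - al) ^+ M in hj *; set B := jbr (Y - be) ^+ M in hj *.
have -> : A * B * ((2 * pi) ^- n * Kq ^+ M * kq) = (2 * pi) ^- n * (Kq ^+ M * (A * B) * kq) by ring.
rewrite ler_wpM2l //; apply: (le_trans h).
by rewrite ler_wpM2r // k0.
Qed.

(** The hypothesis on kernels is applied to nonnegative ones, for which absolute convergence
    and the value of the sum carry the information. *)
Lemma bfs_abs N (L : set 'rV[R]_N) (B : banach_fun_space R 'rV[R]_N) (K : R) (w : B) : admissible L B -> 0 <= K ->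
  exists w' : B, bfs_fun w' = fun g => (K * normc (bfs_fun w g))%:C.
Proof.
move=> adm K0; have [_ _ _ [S HS]] := adm.
have [|w' w'E _] := HS (K%:C *: w) (fun g => (K * normc (bfs_fun w g))%:C); last by exists w'.
move=> g; rewrite bfsZ normcM normcR normcR (ger0_norm K0) ger0_norm // mulr_ge0 //; exact: normc_ge0.
Qed.

Lemma temp_scale N (k : C) (v : fn N -> C) : tempered v -> tempered (fun f => k * v f).
Proof.
move=> [vl [d [M Hv]]]; split; first by move=> a f g sf sg'; rewrite vl //; ring.
exists d, (normc k * M) => f sf; rewrite normcM -mulrA ler_wpM2l ?normc_ge0 //; exact: Hv.
Qed.

Lemma tempered_wp_inj (v v' : fn n -> C) : tempered v -> tempered v' ->
  (forall X, v (wp bg X) = v' (wp bg X)) -> forall f, schwartz f -> v f = v' f.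
Proof.
move=> tv tv' h f sf; have c0 : kap R n * ip bg bg != 0.
  by apply: mulf_neq0; [exact: kap_neq0|exact: ip_bgauss].
apply: (mulfI c0); rewrite !(temp_resolution sg) //.
by apply: eq_cintegral => X; rewrite h.
Qed.
End EffectiveKernel.

Theorem theorem7p11 (R : realType) (n : nat)
  (P : quad_form R n) (c : R)
  (m1 : 'rV[R]_((n + n) + (n + n)) -> R) (m2 m3 : 'rV[R]_(n + n) -> R)
  (Ghat : set 'rV[R]_((n + n) + (n + n))) (G : set 'rV[R]_(n + n))
  (B1 : banach_fun_space R 'rV[R]_((n + n) + (n + n)))
  (B2 B3 : banach_fun_space R 'rV[R]_(n + n))
  (chi1 : 'rV[R]_((n + n) + (n + n)) -> R[i])
  (chi2 chi3 : 'rV[R]_(n + n) -> R[i]) (chi : 'rV[R]_(n + n) -> R) :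
  (* the Bargmann transform *)
  bargmann_phase P -> 0 < c -> bargmann_unitary P c ->
  (* order functions, lattices, admissible spaces *)
  order_function m1 -> order_function m2 -> order_function m3 ->
  lattice Ghat -> lattice G -> @qmap R n @^-1` Ghat = setX_row G G ->
  admissible Ghat B1 -> admissible G B2 -> admissible G B3 ->
  (* auxiliary functions in the definitions of the spaces *)
  partition_unity Ghat chi1 -> partition_unity G chi2 -> partition_unity G chi3 ->
  cutoff G chi ->
  (* the hypothesis on m_j, B_j *)
  (exists K : R, forall (k1 : 'rV[R]_((n + n) + (n + n)) -> R[i])
      (k2 : 'rV[R]_(n + n) -> R[i])
      (w1 : bfs_comp B1 (@qmapinvK R n)) (w2 : B2),
    weighted (m1 \o @qmap R n) k1 w1 -> weighted m2 k2 w2 ->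
    (forall alpha, G alpha ->
       csummable G (fun beta => k1 (row_mx alpha beta) * k2 beta)) /\
    exists2 w3 : B3,
      weighted m3
        (fun alpha => csum G (fun beta => k1 (row_mx alpha beta) * k2 beta)) w3 &
      `|w3| <= K%:C * `|w1| * `|w2|) ->
  forall (a1 : ('rV[R]_(n + n) -> R[i]) -> R[i]) (u : ('rV[R]_n -> R[i]) -> R[i]),
  Stilde Ghat chi1 m1 B1 a1 -> Stilde G chi2 m2 B2 u ->
  (forall x : 'rV[R[i]]_n, cintegrable (fun z : 'rV[R]_(n + n) =>
     Keff P c a1 x (to_Cn z) * wbargmann P c u (to_Cn z))) /\
  exists v : ('rV[R]_n -> R[i]) -> R[i],
    let Fv := fun r : 'rV[R]_(n + n) =>
      wbargmann P c v (pi_kappaT P r) / (m3 r)%:C in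
    [/\ Stilde G chi3 m3 B3 v,
        weyl_image P c a1 u v,
        bracket_bound G chi B3 Fv,
        (rmeasurable m3 -> bracket G chi B3 Fv) &
        forall v', tempered v' -> weyl_image P c a1 u v' ->
          forall f, schwartz f -> v' f = v f].

Proof.
move=> bP c0 _ om1 om2 om3 [bh ubh ->] [b ub ->] qG adm1 adm2 adm3 pu1 pu2 pu3 cut [K HK] a1 u Sa Su.
have [ta _] := Sa; have [tu _] := Su.
have sg := schw_bgauss bP; have ip0 := ip_bgauss bP.
have uM : invmx (kapmx P) \in unitmx by rewrite unitmx_inv; exact: kapmx_unit.
set Lh := [set _ | z in _] in qG adm1 pu1 Sa *.
set L := [set _ | z in _] in qG adm2 adm3 pu2 pu3 cut HK Su *.
have [M1 [w1 H1]] := Stilde_packets (schw_wigwin sg) (ip_wigwin sg ip0) ubh pu1 ta om1 adm1 Sa.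
have [M2 [w2 H2]] := Stilde_packets sg ip0 ub pu2 tu om2 adm2 Su.
have m10 x : 0 < m1 x by case: om1. have m20 x : 0 < m2 x by case: om2.
have m30 x : 0 < m3 x by case: om3.
have [K1 K10 HKt] := Kt_bound bP ta H1 (fun g => mulr_ge0 (ltW (m10 g)) (normc_ge0 _)).
(* the nonnegative kernels that dominate the packet bounds of a1 and u *)
have [w1' E1] := bfs_abs w1 adm1 K10.
have [w2' E2] := bfs_abs w2 adm2 ler01.
pose k1 (al be : 'rV[R]_(n + n)) := K1 * (m1 (qmap (row_mx al be)) * normc (bfs_fun w1 (qmap (row_mx al be)))).
pose k2 be := m2 be * normc (bfs_fun w2 be).
pose k1f p : R[i] := (m1 (qmap p))%:C * bfs_fun w1' (qmap p).
pose k2f be : R[i] := (m2 be)%:C * bfs_fun w2' be.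
have k12 al be : k1f (row_mx al be) * k2f be = (k1 al be * k2 be)%:C.
  rewrite /k1f /k2f E1 E2 /k1 /k2 -!rmorphM; congr (_%:C); ring.
have W1 : weighted (m1 \o @qmap R n) k1f (w1' : bfs_comp B1 (@qmapinvK R n)).
  apply/funext => p; rewrite /k1f /= mulrC mulKf // fmorph_eq0 gt_eqF //.
have W2 : weighted m2 k2f w2'.
  by apply/funext => p; rewrite /k2f mulrC mulKf // fmorph_eq0 gt_eqF.
have [Hs [w3 W3 _]] := HK _ _ _ _ W1 W2.
have kfE al : (fun be => k1f (row_mx al be) * k2f be) = (fun be => (k1 al be * k2 be)%:C).
  exact/funext.
have k10 x y : 0 <= k1 x y by rewrite /k1; apply: mulr_ge0 => //; apply: mulr_ge0; [exact: ltW|exact: normc_ge0].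
have k20 y : 0 <= k2 y by rewrite /k2; apply: mulr_ge0; [exact: ltW|exact: normc_ge0].
have Hq al be : L al -> L be -> Lh (qmap (row_mx al be)).
  move=> La Lb; have h : setX_row L L (row_mx al be) by rewrite /setX_row /= row_mxKl row_mxKr.
  by rewrite -qG in h.
have HKb X Y al be : L al -> L be ->
    normc (Kt (bgauss P) a1 X Y) <= jbr (X - al) ^+ M1 * jbr (Y - be) ^+ M1 * k1 al be.
  by move=> La Lb; apply: HKt; exact: Hq.
have Hub Y be : L be -> normc (u (wp (bgauss P) Y)) <= jbr (Y - be) ^+ M2 * k2 be by exact: H2.
have Hsb al : L al -> csummable L (fun be => (k1 al be * k2 be)%:C : R[i]).
  by move=> La; rewrite -kfE; exact: Hs.
have iI := image_integrable sg ta tu uM ub k10 k20 HKb Hub Hsb.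
have [K3 K30 HI] := image_bound sg ta tu uM ub k10 k20 HKb Hub Hsb.
have tI := imdist_tempered sg ta tu uM ub k10 k20 HKb Hub Hsb.
have wI := imdist_wp sg ip0 ta tu uM ub k10 k20 HKb Hub Hsb.
have cI := image_cont sg ta tu uM ub k10 k20 HKb Hub Hsb.
set F := image _ _ _ _ in HI wI cI.
have F3 X al : L al -> normc (F X) <= K3 * jbr (X - al) ^+ M1 * (m3 al * normc (bfs_fun w3 al)).
  move=> La; apply: (le_trans (HI X al La)); rewrite -kfE -W3 normcM normcV normcR (ger0_norm (ltW (m30 al))).
  by rewrite [m3 al * _]mulrCA mulfV ?gt_eqF // mulr1.
have Fk k : 0 <= k -> exists w : B3, forall X al, L al ->
    k * normc (F X) <= jbr (X - al) ^+ M1 * (m3 al * normc (bfs_fun w al)).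
  move=> k0; have kK0 : 0 <= k * K3 by exact: mulr_ge0.
  have [w wE] := bfs_abs w3 adm3 kK0; exists w => X al La.
  have -> : normc (bfs_fun w al) = k * K3 * normc (bfs_fun w3 al).
    by rewrite wE normcR ger0_norm // mulr_ge0 // normc_ge0.
  apply: (le_trans (ler_wpM2l k0 (F3 X al La))).
  by rewrite le_eqVlt; apply/orP; left; apply/eqP; ring.
have igrE X z : Keff P c a1 (pi_kappaT P X) (to_Cn z) * wbargmann P c u (to_Cn z) =
    (c ^+ 3)%:C * cis (bphase P X) *
    (Kt (bgauss P) a1 X (z *m invmx (kapmx P)) * u (wp (bgauss P) (z *m invmx (kapmx P)))).
  by rewrite -(pi_realpt bP z) (Keff_wbargmann bP).
have c20 : 0 <= c ^+ 2 by rewrite exprn_ge0 // ltW.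
have c30 : 0 <= c ^+ 3 by rewrite exprn_ge0 // ltW.
split.
  move=> x; have [X ->] := pi_surj bP x.
  rewrite (_ : (fun z => _) = (fun z => (c ^+ 3)%:C * cis (bphase P X) *
    (Kt (bgauss P) a1 X (z *m invmx (kapmx P)) * u (wp (bgauss P) (z *m invmx (kapmx P)))))).
    exact: cintegrableZ (iI X).
  by apply/funext => z; exact: igrE.
pose v f := (c ^+ 2)%:C * imdist (bgauss P) a1 u (invmx (kapmx P)) f.
have tv : tempered v by exact: temp_scale.
have vE X : v (wp (bgauss P) X) = (c ^+ 2)%:C * F X by rewrite /v wI.
have TvE X : wbargmann P c v (pi_kappaT P X) = (c ^+ 3)%:C * cis (bphase P X) * F X.
  rewrite (wbargmannE bP) // vE (_ : (c ^+ 3)%:C = c%:C * (c ^+ 2)%:C); last by rewrite -rmorphM -exprS.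
  by ring.
have imv : weyl_image P c a1 u v.
  move=> x; have [X ->] := pi_surj bP x; rewrite TvE -cintegralZ; last exact: iI.
  by apply: eq_cintegral => z; rewrite igrE.
exists v => Fv.
have bv : bracket_bound L chi B3 Fv.
  have [w Hw] := Fk _ c30.
  apply: (packets_bracket ub adm3 cut om3 (F := fun r => wbargmann P c v (pi_kappaT P r)) (M := M1) (w := w)).
  move=> X al La; rewrite TvE 2!normcM normc_cis mulr1 normcR (ger0_norm c30).
  exact: Hw.
split; [ |exact: imv|exact: bv| | ].
- have [w Hw] := Fk _ c20.
  apply: (packets_Stilde sg ip0 _ m30 adm3 (M := M1) (w := w) tv); first by case: pu3.
  by move=> X al La; rewrite vE normcM normcR (ger0_norm c20); exact: Hw.
- move=> rm; split; last exact: bv.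
  have cm : cmeasurable (fun r => wbargmann P c v (pi_kappaT P r)).
    apply: ccont_cmeas; apply: (eq_ccont (fun r => esym (TvE r))).
    by apply: ccont_mul => //; apply: ccont_mul; [exact: ccont_cst|exact: ccont_bphase].
  have rmV : rmeasurable (fun r => (m3 r)^-1).
    have := measurableT_comp (@measurable_powR R (-1)) rm; congr (measurable_fun _ _).
    by apply/funext => t /=; rewrite powR_inv1 // ltW.
  rewrite (_ : Fv = fun r => wbargmann P c v (pi_kappaT P r) * ((m3 r)^-1)%:C); first exact: cmeas_mulr.
  by apply/funext => r; rewrite /Fv fmorphV.
- move=> v' tv' im' f sf; apply: (tempered_wp_inj bP) => // X.
  have cc : c%:C * cis (bphase P X) != 0.
    by rewrite -normc_eq0 normcM normc_cis mulr1 normcR normr_eq0 gt_eqF.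
  by apply: (mulfI cc); rewrite -!(wbargmannE bP) // im' imv.
Qed.
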